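(* Let $W:\mathbb{R}^d\to\mathbb{R}$ be of class $C^2$, symmetric ($W(z)=W(-z)$), with $\sup_{z,v\in\mathbb{R}^d,|v|=1}v\cdot\nabla^2W(z)\cdot v<+\infty$, and let $\mu^{\mathrm{in}},\mu^{\mathrm{fin}}\in\mathcal{P}_2(\mathbb{R}^d)$ satisfy $\tilde{\mathcal F}(\mu^{\mathrm{in}})<+\infty$ and $\tilde{\mathcal F}(\mu^{\mathrm{fin}})<+\infty$. Consider the mean field Schrödinger problem $$\text{(MFSP)}\qquad \inf\left\{\mathcal H(P|\Gamma(P)):\ P\in\mathcal P_1(\Omega),\ P_0=\mu^{\mathrm{in}},\ P_T=\mu^{\mathrm{fin}}\right\}.$$ 1. Let $P$ be admissible for (MFSP), i.e. $P\in\mathcal P_1(\Omega)$, $P_0=\mu^{\mathrm{in}}$, $P_T=\mu^{\mathrm{fin}}$ and $\mathcal H(P|\Gamma(P))<\infty$. Then there exists a predictable process $(\alpha^P_t)_{t\in[0,T]}$ such that $$\mathbb E_P\left[\int_0^T|\alpha^P_t|^2dt\right]<+\infty$$ and so that $$X_t-\int_0^t\left(-\nabla W*P_s(X_s)+\alpha^P_s\right)ds\qquad (\ast)$$ has law $R^{\mu^{\mathrm{in}}}$ under $P$. 2. The problem (MFSP) is equivalent to $$\inf\left\{\tfrac12\mathbb E_P\left[\int_0^T|\alpha^P_t|^2dt\right]:\ P\in\mathcal P_1(\Omega),\ P_0=\mu^{\mathrm{in}},\ P_T=\mu^{\mathrm{fin}},\ \alpha^P\text{ as in }(\ast)\right\},$$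 as well as to $$\inf\ \tfrac12\mathbb E_P\left[\int_0^T|\Phi_t+\nabla W*P_t(X_t)|^2dt\right]$$ $$\text{s.t. }\ P\in\mathcal P_1(\Omega),\ P_0=\mu^{\mathrm{in}},\ P_T=\mu^{\mathrm{fin}},\ P\circ\left(X_\cdot-\int_0^\cdot\Phi_s\,ds\right)^{-1}=R^{\mu^{\mathrm{in}}}.$$
   Context: Fix $d\ge1$, $T>0$. $\Omega=C([0,T];\mathbb{R}^d)$ with the uniform topology; $X=(X_t)_{t\in[0,T]}$ is the canonical process, and predictability refers to the canonical (coordinate) filtration. $P_t$ is the law of $X_t$ under $P$; $\mathcal P_1(\Omega)$ is the set of Borel probability measures $P$ on $\Omega$ with $\mathbb E_P[\sup_{t\le T}|X_t|]<\infty$; $\mathcal P_2(\mathbb R^d)$ is the set of Borel probability measures on $\mathbb R^d$ with finite second moment. $R^\mu$ is the Wiener measure with starting distribution $\mu$. A measure and its Lebesgue density are denoted by the same symbol. $\mathcal H(P|Q)=\mathbb E_P[\log\frac{dP}{dQ}]$ if $P\ll Q$ and $+\infty$ otherwise. $\nabla W*\mu(x)=\int\nabla W(x-y)\,\mu(dy)$, similarly $W*\mu$. $\tilde{\mathcal F}(\mu)=\int\log\mu(x)\,\mu(dx)+\int W*\mu(x)\,\mu(dx)$ if $\mu$ is absolutely continuous with respect to Lebesgue measure, and $+\infty$ otherwise. For $P\in\mathcal P_1(\Omega)$, $\Gamma(P)$ is the law of the unique strong solution of $dZ_t=-\nabla W*P_t(Z_t)\,dt+dB_t$, $Z_0\sim\mu^{\mathrm{in}}$,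 with $B$ a Brownian motion. In the last problem the minimization is over $P$ and the drift process $\Phi$.
   Formalization: ''Has law R^{μ^in} under P'', in (∗) and in the constraint of the last problem, is strengthened: the process must also be Brownian relative to the canonical filtration (increments independent of the canonical past); with equality of laws alone the equivalences in item 2 fail. *)

(* Defs.v *)
From HB Require Import structures.
From mathcomp Require Import all_boot all_order all_algebra.
From mathcomp Require Import all_classical all_reals all_analysis.
Import Order.TTheory GRing.Theory Num.Theory.
Import numFieldNormedType.Exports.

Set Implicit Arguments.
Unset Strict Implicit.
Unset Printing Implicit Defensive.

Local Open Scope classical_set_scope.
Local Open Scope ring_scope.

(* R^d is 'rV[R]_d with its Borel sigma-algebra. *)
HB.instance Definition _ (R : realType) (m n : nat) :=
  Measurable.copy 'M[R]_(m, n) (g_sigma_algebraType (@open 'M[R]_(m, n))).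

Section euclidean.
Context (R : realType) (d : nat).
Implicit Types (x : 'rV[R]_d) (f W : 'rV[R]_d -> R).

(* The norm `|x| of the library on 'rV[R]_d is the sup norm. *)
Definition enorm x : R := Num.sqrt (\sum_i x 0 i ^+ 2).

Definition partial (i : 'I_d) f x : R := 'D_(delta_mx 0 i) f x.

Definition is_C1 f : Prop :=
  (forall x i, derivable f x (delta_mx 0 i)) /\
  (forall i, continuous (partial i f)).

Definition is_C2 f : Prop := is_C1 f /\ forall i, is_C1 (partial i f).

Definition grad f x : 'rV[R]_d := \row_i partial i f x.

Definition hessian f x : 'M[R]_d := \matrix_(i, j) partial j (partial i f) x.

Definition quad_form (A : 'M[R]_d) x : R := (x *m A *m x^T) 0 0.

Definition second_moment_finite (mu : probability 'rV[R]_d R) : Prop :=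
  (\int[mu]_x (enorm x ^+ 2)%:E < +oo)%E.

Definition conv W (mu : probability 'rV[R]_d R) x : \bar R :=
  (\int[mu]_y (W (x - y))%:E)%E.

Definition grad_conv W (mu : probability 'rV[R]_d R) x : 'rV[R]_d :=
  \row_i \int[mu]_y (grad W (x - y) 0 i).

(* d-dimensional Lebesgue outer measure, by countable coverings with boxes;
   it is only evaluated on Borel sets below. *)
Definition box (a b : 'rV[R]_d) : set 'rV[R]_d :=
  [set x | forall i, a 0 i < x 0 i <= b 0 i].

Definition lebesgue_rV (A : set 'rV[R]_d) : \bar R :=
  ereal_inf [set (\sum_(0 <= k <oo) (\prod_i ((p k).2 0 i - (p k).1 0 i))%:E)%E
    | p in [set p : nat -> 'rV[R]_d * 'rV[R]_d |
        (forall k i, (p k).1 0 i <= (p k).2 0 i) /\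
        A `<=` \bigcup_k box (p k).1 (p k).2]].

Definition is_density (mu : probability 'rV[R]_d R) f : Prop :=
  [/\ measurable_fun [set: 'rV[R]_d] (f : 'rV[R]_d -> measurableTypeR R),
      forall x, 0 <= f x &
      forall A, measurable A -> mu A = (\int[lebesgue_rV]_(x in A) (f x)%:E)%E].

Definition density (mu : probability 'rV[R]_d R) : 'rV[R]_d -> R :=
  xget (cst 0) [set f | is_density mu f].

Definition free_energy W (mu : probability 'rV[R]_d R) : \bar R :=
  (if `[< mu `<< lebesgue_rV >]
   then \int[mu]_x (ln (density mu x))%:E + \int[mu]_x conv W mu x
   else +oo)%E.

End euclidean.

Section optimization.
Context (R : realType).

Definition minimizer (A : Type) (S : set A) (c : A -> \bar R) (a : A) : Prop :=
  [/\ S a, (c a < +oo)%E & forall b, S b -> (c a <= c b)%E].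

(* Same infimum, and the minimizers of the first problem are the images under
   pr of the minimizers of the second one. *)
Definition equivalent_problems (A B : Type) (pr : B -> A)
    (S : set A) (c : A -> \bar R) (S' : set B) (c' : B -> \bar R) : Prop :=
  ereal_inf (c @` S) = ereal_inf (c' @` S') /\
  forall a, minimizer S c a <-> exists b, pr b = a /\ minimizer S' c' b.

End optimization.

Definition relative_entropy (dd : measure_display) (A : measurableType dd)
    (R : realType) (P Q : probability A R) : \bar R :=
  (if `[< P `<< Q >]
   then \int[P]_w lne (Radon_Nikodym (charge_of_finite_measure P) Q w)
   else +oo)%E.

(* Measures of type probability are functions on all sets, so equality of laws
   is required on measurable sets only. *)
Definition same_law (dd : measure_display) (A : measurableType dd)
    (R : realType) (P Q : probability A R) : Prop :=
  forall E, measurable E -> P E = Q E.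

(* C([0,T];R^d) with the topology of uniform convergence and the corresponding
   Borel sigma-algebra. *)
Definition path_space (R : realType) (T : R) (d : nat) : Type :=
  continuousType (set_type `[0, T]%classic) 'rV[R]_d.

Section canonical_space.
Context (R : realType) (T : R) (d : nat).

Definition path_fun (w : path_space T d) :
    {uniform (set_type `[0, T]%classic) -> 'rV[R]_d} :=
  (w : continuousType _ _).

HB.instance Definition _ := gen_eqMixin (path_space T d).
HB.instance Definition _ := gen_choiceMixin (path_space T d).
HB.instance Definition _ := isPointed.Build (path_space T d)
  (cst 0 : continuousType (set_type `[0, T]%classic) 'rV[R]_d).
HB.instance Definition _ :=
  Topological.copy (path_space T d) (initial_topology path_fun).
HB.instance Definition _ :=
  Measurable.copy (path_space T d) (g_sigma_algebraType (@open (path_space T d))).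

(* Canonical process; the value for t outside [0,T] is a dummy. *)
Definition X (t : R) (w : path_space T d) : 'rV[R]_d := oapp (path_fun w) 0 (insub t).

Lemma continuous_X t : continuous (X t).
Proof.
rewrite /X; case: insubP => [u _ _|_] /=; last exact: cst_continuous.
move=> w; apply: (@continuous_comp _ _ _ path_fun (fun f => f u)).
  exact: initial_continuous.
move=> A /=; rewrite -nbhs_entourageE => -[E entE EA].
apply/uniform_nbhs; exists E; split => // h hE.
by apply/EA/xsectionP; exact: hE.
Qed.

Lemma measurable_X t : measurable_fun [set: path_space T d] (X t).
Proof.
apply: (measurability (@open 'rV[R]_d)) => // _ [B oB <-].
rewrite setTI; apply: sub_sigma_algebra.
by apply: open_comp => // w _; exact: continuous_X.
Qed.

HB.instance Definition _ t :=
  isMeasurableFun.Build _ _ _ _ (X t) (measurable_X t).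

Definition marginal (P : probability (path_space T d) R) (t : R) :
    probability 'rV[R]_d R := distribution P (X t).

Definition in_P1 (P : probability (path_space T d) R) : Prop :=
  (\int[P]_w ereal_sup [set (enorm (X t w))%:E | t in `[0%R, T]] < +oo)%E.

Definition canonical_filtration (s : R) : set (set (path_space T d)) :=
  <<s [set E | exists r C, [/\ 0 <= r <= s, measurable C & E = X r @^-1` C]] >>.

End canonical_space.

Section processes.
Context (R : realType) (T : R) (d : nat).

Section on_probability_space.
Context (dd : measure_display) (A : measurableType dd).
Implicit Types (F : R -> set (set A)) (M b : R -> A -> 'rV[R]_d).

Definition predictable_rectangles F : set (set (R * A)) :=
  [set G | (exists E, F 0 E /\ G = [set 0] `*` E) \/
           (exists s t E, [/\ 0 <= s, s < t, t <= T, F s E &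
                              G = `]s, t] `*` E])].

Definition predictable F b : Prop :=
  measurable_fun
    (`[0, T] `*` setT : set (g_sigma_algebraType (predictable_rectangles F)))
    (fun p => b p.1 p.2).

Definition time_integrable (f : R -> 'rV[R]_d) : Prop :=
  forall i, lebesgue_measure.-integrable `[0, T] (fun s => (f s 0 i)%:E).

Definition time_integral (f : R -> 'rV[R]_d) (t : R) : 'rV[R]_d :=
  \row_i \int[lebesgue_measure]_(s in `[0, t]) (f s 0 i).

(* M t - M s is N(0, (t - s) I_d)-distributed and independent of F s; F is
   meant to be a filtration to which M is (almost surely) adapted. *)
Definition brownian_increments (P : probability A R) F M : Prop :=
  forall (s t : R) (E : set A) (C : 'I_d -> set (measurableTypeR R)),
    0 <= s -> s < t -> t <= T -> F s E -> (forall i, measurable (C i)) ->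
    P (E `&` [set w | forall i, C i ((M t w - M s w) 0 i)]) =
    (P E * \prod_i normal_prob 0 (Num.sqrt (t - s)) (C i))%E.

Section sde.
Context (P : probability A R) (xi : {mfun A >-> 'rV[R]_d})
        (B : {mfun A >-> path_space T d}).

Definition augmented_filtration (s : R) : set (set A) :=
  <<s [set E | [\/ exists C, measurable C /\ E = xi @^-1` C,
                   exists r C, [/\ 0 <= r <= s, measurable C &
                                   E = (fun w => X r (B w)) @^-1` C] |
                   measurable E /\ P E = 0%E]] >>.

(* xi has law mu and B is a standard Brownian motion independent of xi. *)
Definition brownian_setup (mu : probability 'rV[R]_d R) : Prop :=
  [/\ same_law (distribution P xi) mu,
      {ae P, forall w, X 0 (B w) = 0} &
      brownian_increments P augmented_filtration (fun t w => X t (B w))].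

(* Strong solution of dZ_t = b(t, Z_t) dt + dB_t, Z_0 = xi. *)
Definition strong_solution (b : R -> 'rV[R]_d -> 'rV[R]_d)
    (Z : {mfun A >-> path_space T d}) : Prop :=
  (forall t C, 0 <= t <= T -> measurable C ->
     augmented_filtration t ((fun w => X t (Z w)) @^-1` C)) /\
  {ae P, forall w, time_integrable (fun s => b s (X s (Z w))) /\
     forall t, 0 <= t <= T ->
       X t (Z w) = xi w + time_integral (fun s => b s (X s (Z w))) t
                        + X t (B w)}.

Definition unique_strong_solution (b : R -> 'rV[R]_d -> 'rV[R]_d)
    (Z : {mfun A >-> path_space T d}) : Prop :=
  strong_solution b Z /\
  forall Z' : {mfun A >-> path_space T d}, strong_solution b Z' ->
    {ae P, forall w, Z' w = Z w}.

End sde.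
End on_probability_space.

Definition law_of_unique_strong_solution (mu : probability 'rV[R]_d R)
    (b : R -> 'rV[R]_d -> 'rV[R]_d) (Q : probability (path_space T d) R) : Prop :=
  exists (dd : measure_display) (A : measurableType dd) (P : probability A R)
         (xi : {mfun A >-> 'rV[R]_d}) (B Z : {mfun A >-> path_space T d}),
    [/\ brownian_setup P xi B mu, unique_strong_solution P xi B b Z &
        same_law (distribution P Z) Q].

(* Q = Gamma(P); the first conjunct says that grad W * P_t is well defined. *)
Definition is_Gamma (W : 'rV[R]_d -> R) (mu : probability 'rV[R]_d R)
    (P Q : probability (path_space T d) R) : Prop :=
  (forall t x i, 0 <= t <= T ->
     (marginal P t).-integrable setT (fun y => (grad W (x - y) 0 i)%:E)) /\
  law_of_unique_strong_solution mu
    (fun t x => - grad_conv W (marginal P t) x) Q.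

(* Q is the Wiener measure with starting distribution mu. *)
Definition is_wiener (mu : probability 'rV[R]_d R)
    (Q : probability (path_space T d) R) : Prop :=
  same_law (marginal Q 0) mu /\
  brownian_increments Q (@canonical_filtration R T d) (@X R T d).

(* The process Y = X - \int_0^. b_s ds has law R^mu under P, i.e. it is under P
   a Wiener process with starting distribution mu.  The last conjunct makes it
   one relative to the canonical filtration: as b is predictable for that
   filtration but need not be a functional of Y, this does not follow from the
   law of Y alone. *)
Definition wiener_residual (mu : probability 'rV[R]_d R)
    (P : probability (path_space T d) R) (b : R -> path_space T d -> 'rV[R]_d) : Prop :=
  exists Y : {mfun path_space T d >-> path_space T d},
    [/\ {ae P, forall w, time_integrable (b ^~ w) /\
           forall t, 0 <= t <= T -> X t (Y w) = X t w - time_integral (b ^~ w) t},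
        is_wiener mu (distribution P Y) &
        brownian_increments P (@canonical_filtration R T d)
          (fun t w => X t (Y w))].

Definition energy (P : probability (path_space T d) R)
    (b : R -> path_space T d -> 'rV[R]_d) : \bar R :=
  (\int[P]_w \int[lebesgue_measure]_(t in `[0%R, T]) (enorm (b t w) ^+ 2)%:E)%E.

Definition admissible_marginals (muin mufin : probability 'rV[R]_d R)
    (P : probability (path_space T d) R) : Prop :=
  [/\ in_P1 P, same_law (marginal P 0) muin & same_law (marginal P T) mufin].

Definition is_drift (W : 'rV[R]_d -> R) (muin : probability 'rV[R]_d R)
    (P : probability (path_space T d) R) (alpha : R -> path_space T d -> 'rV[R]_d) : Prop :=
  [/\ predictable (@canonical_filtration R T d) alpha,
      (energy P alpha < +oo)%E &
      wiener_residual muin P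
        (fun s w => - grad_conv W (marginal P s) (X s w) + alpha s w)].

End processes.

(* Main.v *)
(* H(P|Q) is used only through entropy duality: H(P|Q) <= K iff
   E_P f <= K + log E_Q exp f for all bounded f.

   Upper bound.  Let P be the law of a process X = M + int beta with M a Brownian
   motion, and R the Wiener measure.  When beta is piecewise constant on a dyadic
   grid, Girsanov's theorem is the shift invariance of Gaussian measures applied
   increment by increment, and Jensen's inequality turns it into
   E_P f <= 1/2 E_P int |beta|^2 + log E_R exp f.  Approximating beta in L^2 by
   such processes handles Lipschitz f, hence all bounded f, so
   H(P|R) <= 1/2 E_P int |beta|^2.  Applied to f + int c.dX - 1/2 int |c|^2 with c
   a simple approximation of the drift b of Q = Gamma(P), this gives
   H(P|Q) <= 1/2 E_P int |beta - b|^2.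

   Lower bound.  Let M be the driving noise of Gamma(P).  Duality bounds
   E_P[int c.dM] - 1/2 E_P int |c|^2 by H = H(P|Q) for every simple c.  The
   maximizing sequences of this concave functional converge in L^2(dt x P) to
   some alpha with 1/2 E_P int |alpha|^2 <= H which represents E_P[int c.dM].  That
   M - int alpha is a Brownian motion under P replaces Levy's characterization: for
   a C^{1,1} function v of an increment, the exponential moments of
   lambda (v - E v) corrected by its discrete Clark-Ocone sum are 1 + O(mesh) under
   Q tilted by c, so duality bounds lambda E_P[1_E (v - E v)] uniformly in lambda,
   and the expectation vanishes.

   Linear growth of grad W, needed for the square integrability of b, follows from
   Gamma being defined on all of P_1: otherwise a discrete measure on constant paths
   would make grad W * P_t diverge. *)
Require Import Defs.
From HB Require Import structures.
From mathcomp Require Import all_boot all_order all_algebra.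
From mathcomp Require Import all_classical all_reals all_analysis.
Import Order.TTheory GRing.Theory Num.Theory.
Import numFieldNormedType.Exports.
Set Implicit Arguments.
Unset Strict Implicit.
Unset Printing Implicit Defensive.
Local Open Scope classical_set_scope.
Local Open Scope ring_scope.
From mathcomp Require Import measurable_realfun.
From mathcomp Require Import zify ring lra.

(** * Borel sets and expectations *)

Section rV_borel.
Context (R : realType) (d : nat).

(** A law [P] of finite entropy is compared with [Gamma P] only through exponential moments under
    [Gamma P], so whatever is claimed about the noise under [P] has to be cast as such a moment.
    After the Clark-Ocone correction the error of one grid cell is centred and of the order of the
    mesh. Its exponential moment is [1 + O(mesh ^ 2)], hence the product over [2 ^ n] cells still
    tends to one, for any fixed multiplier. A second obstacle is that membership in [P_1] provides
    only first moments, while Girsanov's bound compares drifts in L^2. The missing second moment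
    comes from a pathwise Gronwall estimate: the noise has the moments of a Wiener path started in
    [muin], and the part of the drift that does not grow with the path has finite energy. For a
    fixed [P], the equivalence of the problems reduces to two inequalities: the entropy is at most
    half the energy of every admissible drift, and some drift has half energy at most the entropy.
    All stochastic integrals are finite sums over the dyadic grids [T k / 2 ^ n]; these are nested,
    so two integrands always have a common grid. *)

Lemma measurable_coord (i : 'I_d) :
  measurable_fun [set: 'rV[R]_d] (fun x : 'rV[R]_d => x 0 i).
Proof.
apply: (measurability _ (RGenOInfty.measurableE R)).
move=> _ [_ [a ->] <-].
rewrite setTI; apply: sub_sigma_algebra.
apply: open_comp => [w _|]; [exact: coord_continuous|exact: interval_open].
Qed.

Definition rbox (ab : 'rV[rat]_d * 'rV[rat]_d) : set 'rV[R]_d :=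
  [set x | forall i, ratr (ab.1 0 i) < x 0 i < ratr (ab.2 0 i)].

Lemma open_rboxE (U : set 'rV[R]_d) : open U ->
  U = \bigcup_(ab in [set ab | rbox ab `<=` U]) rbox ab.
Proof.
move=> oU; apply/seteqP; split=> [x Ux|x [ab abU abx]]; last exact: abU.
move: oU; rewrite openE => /(_ x Ux); rewrite /interior => /nbhs_ballP[e /= e0 eU].
have ra (y : R) : exists q : rat, y - e < ratr q < y.
  have h : y - e < y by lra.
  by have [q] := rat_in_itvoo h; rewrite in_itv; exists q.
have rb (y : R) : exists q : rat, y < ratr q < y + e.
  have h : y < y + e by lra.
  by have [q] := rat_in_itvoo h; rewrite in_itv; exists q.
pose a : 'rV[rat]_d := \row_i sval (cid (ra (x 0 i))).
pose b : 'rV[rat]_d := \row_i sval (cid (rb (x 0 i))).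
have abx i : x 0 i - e < ratr (a 0 i) < x 0 i /\ x 0 i < ratr (b 0 i) < x 0 i + e.
  rewrite !mxE; split; [by case: cid|by case: cid].
exists (a, b) => /= [y yab|i]; last by case: (abx i) => /andP[_ ->] /andP[->].
apply: eU; split=> // i j; rewrite ord1 /ball/= ltr_distlC.
by case: (abx j) => /andP[? ?] /andP[? ?]; have := yab j; case/andP => /= *; apply/andP; split; lra.
Qed.

(** Every open set is a union of rational boxes, and these are countably many, so the coordinates
    determine measurability. *)
Lemma measurable_fun_rV (dd : measure_display) (A : measurableType dd)
  (D : set A) (f : A -> 'rV[R]_d) : measurable D ->
  (forall i, measurable_fun D (fun x => f x 0 i)) -> measurable_fun D f.
Proof.
move=> mD mf; apply: (measurability (@open 'rV[R]_d)) => // _ [B oB <-].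
rewrite (open_rboxE oB) preimage_bigcup setI_bigcupr.
(* The union is reindexed by the whole countable type, with the empty set in place of the boxes not
   contained in [B]. *)
rewrite (_ : \bigcup_(i in _) _ =
  \bigcup_ab (if `[< rbox ab `<=` B >] then D `&` f @^-1` rbox ab else set0)); last first.
  apply/seteqP; split=> [x [ab abB abx]|x [ab _]].
    by exists ab => //; rewrite asboolT.
  by case: asboolP => // abB ?; exists ab.
apply: countable_bigcupT_measurable => [|ab]; first exact: countableP.
case: asboolP => // _.
rewrite (_ : _ `&` _ = \bigcap_i (D `&` ((fun x => f x 0 i) @^-1`
    `]ratr (ab.1 0 i), ratr (ab.2 0 i)[)) `&` D); last first.
  apply/seteqP; split=> [x [Dx fx]|x [fx Dx]].
    by split=> // i _; split=> //=; rewrite in_itv; exact: fx.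
  by split=> // i; have /= [_] := fx i I; rewrite in_itv.
apply: measurableI => //.
by apply: fin_bigcap_measurable => [|i _]; [exact: finite_finset|apply: mf].
Qed.

Definition boxes : set (set 'rV[R]_d) :=
  [set B | exists2 C : 'I_d -> set R, (forall i, measurable (C i)) &
     B = [set y : 'rV[R]_d | forall i, C i (y 0 i)]].

Lemma measurable_box (C : 'I_d -> set R) : (forall i, measurable (C i)) ->
  measurable [set y : 'rV[R]_d | forall i, C i (y 0 i)].
Proof.
move=> mC; rewrite (_ : mkset _ = \bigcap_(i in setT) ((fun y : 'rV[R]_d => y 0 i) @^-1` C i)).
  apply: fin_bigcap_measurable => [|i _]; first exact: finite_finset.
  by rewrite -[X in measurable X]setTI; exact: measurable_coord.
by apply/seteqP; split=> y yC i => [_|]; apply: yC.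
Qed.

Lemma measurable_rVE : @measurable _ 'rV[R]_d = <<s boxes >>.
Proof.
apply/seteqP; split=> [A mA|].
  have : measurable_fun setT (id : g_sigma_algebraType boxes -> 'rV[R]_d).
    apply: measurable_fun_rV => // i _ B mB; rewrite setTI.
    apply: sub_sigma_algebra; exists (fun j => if j == i then B else setT).
      by move=> j; case: ifP.
    apply/seteqP; split=> [y By j|y /(_ i)]; last by rewrite eqxx.
    by case: eqP => // ->.
  by move=> /(_ measurableT _ mA); rewrite setTI.
apply: smallest_sub; first exact: sigma_algebra_measurable.
by move=> _ [C mC ->]; exact: measurable_box.
Qed.

(** Boxes are stable under intersection and generate the Borel sets. Brownian increments and
    Gaussian laws are specified on boxes only; this lemma extends such identities to all Borel
    sets. *)
Lemma measure_rV_unique (m1 m2 : {measure set 'rV[R]_d -> \bar R}) :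
  (m1 setT < +oo)%E ->
  (forall C : 'I_d -> set R, (forall i, measurable (C i)) ->
     m1 [set y : 'rV[R]_d | forall i, C i (y 0 i)] = m2 [set y : 'rV[R]_d | forall i, C i (y 0 i)]) ->
  forall A, measurable A -> m1 A = m2 A.
Proof.
move=> m1oo m12 A mA; apply: (measure_unique boxes (fun _ => setT)) => //.
- exact: measurable_rVE.
- move=> _ _ [C mC ->] [C' mC' ->]; exists (fun i => C i `&` C' i).
    by move=> i; exact: measurableI.
  by apply/seteqP; split=> [y [h h'] i|y h]; [split|split=> i; case: (h i)].
- by move=> _; exists (fun _ => setT) => //; apply/seteqP; split.
- by rewrite bigcup_const.
- by move=> _ [C mC ->]; exact: m12.
Qed.

End rV_borel.

Section expectation.
Context (R : realType) (dd : measure_display) (A : measurableType dd).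
Variable mu : {measure set A -> \bar R}.
Implicit Types f g : A -> R.

(** Real-valued counterparts of integrability and integral: once integrability is recorded,
    expectations are real numbers and their inequalities are accessible to linear arithmetic. *)
Definition ing f := mu.-integrable setT (EFin \o f).
Definition Ex f : R := \int[mu]_x f x.

Lemma ing_meas f : ing f -> measurable_fun setT f.
Proof. by move=> /measurable_int /measurable_EFinP. Qed.

Lemma ExE f : ing f -> (\int[mu]_x (f x)%:E)%E = (Ex f)%:E.
Proof. by move=> h; rewrite /Ex /Rintegral fineK//; exact: integrable_fin_num. Qed.

Lemma ing_dom f g : measurable_fun setT f -> ing g -> (forall x, `|f x| <= g x) -> ing f.
Proof.
move=> mf ig fg; apply: (le_integrable measurableT _ _ ig); first exact/measurable_EFinP.
by move=> x _ /=; rewrite lee_fin (le_trans (fg x))// ler_norm.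
Qed.

Lemma ing_ge0 f : measurable_fun setT f -> (forall x, 0 <= f x) ->
  (\int[mu]_x (f x)%:E < +oo)%E -> ing f.
Proof.
move=> mf f0 foo; apply/integrableP; split; first exact/measurable_EFinP.
by under eq_integral do rewrite /= ger0_norm//.
Qed.

Lemma ingD f g : ing f -> ing g -> ing (fun x => f x + g x).
Proof. by move=> hf hg; apply: eq_integrable (integrableD measurableT hf hg). Qed.

Lemma ingZ k f : ing f -> ing (fun x => k * f x).
Proof. by move=> hf; apply: eq_integrable (integrableZl measurableT k hf). Qed.

Lemma ingN f : ing f -> ing (fun x => - f x).
Proof. by move=> hf; apply: eq_integrable (ingZ (-1) hf) => // x _; rewrite /= mulN1r. Qed.

Lemma ingB f g : ing f -> ing g -> ing (fun x => f x - g x).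
Proof. by move=> hf hg; apply: ingD => //; exact: ingN. Qed.

Lemma ing_norm f : ing f -> ing (fun x => `|f x|).
Proof. by move=> hf; apply: eq_integrable (integrable_abse hf). Qed.

Lemma ing0 : ing (fun=> 0).
Proof. exact: integrable0. Qed.

Lemma ing_sum (I : Type) (s : seq I) (F : I -> A -> R) :
  (forall i, ing (F i)) -> ing (fun x => \sum_(i <- s) F i x).
Proof.
move=> hF; elim: s => [|i s ih].
  by under eq_fun do rewrite big_nil; exact: ing0.
by under eq_fun do rewrite big_cons; exact: ingD.
Qed.

Lemma ExD f g : ing f -> ing g -> Ex (fun x => f x + g x) = Ex f + Ex g.
Proof. by move=> hf hg; rewrite /Ex RintegralD. Qed.

Lemma ExZ k f : ing f -> Ex (fun x => k * f x) = k * Ex f.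
Proof. by move=> hf; rewrite /Ex RintegralZl. Qed.

Lemma ExN f : ing f -> Ex (fun x => - f x) = - Ex f.
Proof.
by move=> hf; rewrite -mulN1r -ExZ//; congr Ex; apply/funext => x; rewrite mulN1r.
Qed.

Lemma ExB f g : ing f -> ing g -> Ex (fun x => f x - g x) = Ex f - Ex g.
Proof. by move=> hf hg; rewrite /Ex RintegralB. Qed.

Lemma Ex0 : Ex (fun=> 0) = 0.
Proof. by rewrite /Ex /Rintegral integral0. Qed.

Lemma Ex_sum (I : Type) (s : seq I) (F : I -> A -> R) :
  (forall i, ing (F i)) -> Ex (fun x => \sum_(i <- s) F i x) = \sum_(i <- s) Ex (F i).
Proof.
move=> hF; elim: s => [|i s ih].
  by rewrite big_nil; under [X in Ex X]eq_fun do rewrite big_nil; exact: Ex0.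
rewrite big_cons -ih -ExD//; first by congr Ex; apply/funext => x; rewrite big_cons.
exact: ing_sum.
Qed.

Lemma le_Ex f g : ing f -> ing g -> (forall x, f x <= g x) -> Ex f <= Ex g.
Proof. by move=> hf hg fg; rewrite /Ex le_Rintegral. Qed.

Lemma Ex_ge0 f : (forall x, 0 <= f x) -> 0 <= Ex f.
Proof. by move=> f0; rewrite /Ex Rintegral_ge0. Qed.

Lemma ler_norm_Ex f g : ing f -> ing g -> (forall x, `|f x| <= g x) -> `|Ex f| <= Ex g.
Proof.
move=> hf hg fg; apply: le_trans (le_normr_Rintegral measurableT hf) _.
by apply: le_Ex => //; exact: ing_norm.
Qed.

Lemma ing_mulb K f g : measurable_fun setT f -> (forall x, `|f x| <= K) -> ing g ->
  ing (fun x => f x * g x).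
Proof.
move=> mf fK ig; apply: (ing_dom _ (ingZ K (ing_norm ig))).
  by apply: measurable_funM => //; exact: ing_meas.
by move=> x; rewrite normrM ler_wpM2r.
Qed.

Lemma ing_ae_eq f g : measurable_fun setT g -> {ae mu, forall x, f x = g x} ->
  ing f -> ing g.
Proof.
move=> mg fg hf; have mf := ing_meas hf.
apply/integrableP; split; first exact/measurable_EFinP.
case/integrableP : hf => _; rewrite (@ae_eq_integral _ _ _ mu setT (fun x => `|(EFin \o g) x|%E) (fun x => `|(EFin \o f) x|%E))//.
- by apply: (measurableT_comp (@abse_measurable _ _)); exact/measurable_EFinP.
- by apply: (measurableT_comp (@abse_measurable _ _)); exact/measurable_EFinP.
- by apply: filterS fg => x /= ->.
Qed.

Lemma eq_ae_Ex f g : measurable_fun setT f -> measurable_fun setT g ->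
  {ae mu, forall x, f x = g x} -> Ex f = Ex g.
Proof.
move=> mf mg fg; rewrite /Ex /Rintegral; congr fine; apply: ae_eq_integral => //.
- exact/measurable_EFinP.
- exact/measurable_EFinP.
- by apply: filterS fg => x /= ->.
Qed.

(** The pointwise comparison is applied to the minimum of [f] and [g], which agrees with [f] almost
    everywhere. *)
Lemma ae_le_Ex f g : ing f -> ing g -> {ae mu, forall x, f x <= g x} -> Ex f <= Ex g.
Proof.
move=> hf hg fg; have mf := ing_meas hf; have mg := ing_meas hg.
have mm : measurable_fun setT (fun x => Num.min (f x) (g x)) by exact: measurable_minr.
have hmin : {ae mu, forall x, Num.min (f x) (g x) = f x} by apply: filterS fg => x /min_idPl.
rewrite -(eq_ae_Ex mm mf hmin); apply: le_Ex => //.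
  by apply: ing_ae_eq hf => //; apply: filterS hmin => x ->.
by move=> x; rewrite ge_min lexx orbT.
Qed.

End expectation.

Section finite_expectation.
Context (R : realType) (dd : measure_display) (A : measurableType dd).
Implicit Types f g : A -> R.

Lemma ing_bounded (mu : {measure set A -> \bar R}) (K : R) f : (mu setT < +oo)%E ->
  measurable_fun setT f -> (forall x, `|f x| <= K) -> ing mu f.
Proof.
move=> muoo mf fK; apply: (@ing_dom _ _ _ mu f (fun=> K) mf _ fK).
apply/integrableP; split; first by apply/measurable_EFinP; exact: measurable_cst.
by rewrite (integral_cst mu measurableT (`|K|%:E)) lte_mul_pinfty.
Qed.

(* Rewriting with [probability_setT] fails when [P] is coerced to a measure. *)
Lemma prob_mass (P : probability A R) : (P : {measure set A -> \bar R}) setT = 1%E.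
Proof. exact: probability_setT. Qed.

Lemma Ex_cst (P : probability A R) k : Ex P (fun=> k) = k.
Proof. rewrite /Ex /Rintegral (integral_cst P measurableT k%:E). by rewrite prob_mass mule1. Qed.

Lemma ingP_bounded (P : probability A R) (K : R) f :
  measurable_fun setT f -> (forall x, `|f x| <= K) -> ing P f.
Proof. by apply: ing_bounded; rewrite prob_mass ltry. Qed.

End finite_expectation.

(** * Entropy duality *)

Section relative_entropy_duality.
Context (R : realType) (dd : measure_display) (A : measurableType dd).
Implicit Types P Q : probability A R.

Lemma ing_dom_ae (mu : {measure set A -> \bar R}) (f g : A -> R) :
  measurable_fun setT f -> ing mu g -> {ae mu, forall x, `|f x| <= g x} -> ing mu f.
Proof.
move=> mf ig fg; have mg := ing_meas ig.
apply/integrableP; split; first exact/measurable_EFinP.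
case/integrableP : (ig) => _; apply: le_lt_trans.
apply: ae_ge0_le_integral => //.
- by apply: (measurableT_comp (@abse_measurable _ _)); exact/measurable_EFinP.
- by apply: (measurableT_comp (@abse_measurable _ _)); exact/measurable_EFinP.
- by apply: filterS fg => x h _; rewrite lee_fin (le_trans h)// ler_norm.
Qed.

(** Fatou's lemma with a prescribed limit and an asymptotic bound on the integrals. It serves as
    lower semicontinuity for truncated log-densities in [entropy_le] and for the L^2 limit in
    [riesz]. *)
Lemma fatou_ub (mu : {measure set A -> \bar R}) (f : nat -> A -> R) (g : A -> R) (K : R) :
  (forall n, measurable_fun setT (f n)) -> (forall n x, 0 <= f n x) ->
  measurable_fun setT g -> (forall x, 0 <= g x) ->
  {ae mu, forall x, f ^~ x @ \oo --> g x} ->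
  (forall e, 0 < e -> \forall n \near \oo, (\int[mu]_x (f n x)%:E <= (K + e)%:E)%E) ->
  (\int[mu]_x (g x)%:E <= K%:E)%E.
Proof.
move=> mf f0 mg g0 fg fK.
have mfE n : measurable_fun setT (fun x => (f n x)%:E) by exact/measurable_EFinP.
have aeq : ae_eq mu setT (fun x => limn_einf (fun n => (f n x)%:E)) (fun x => (g x)%:E).
  apply: filterS fg => x fgx _; apply: (fun h => (cvg_limn_einf_sup h).1).
  by apply/fine_cvgP; split; [exact: nearW|exact: fgx].
rewrite -(@ge0_ae_eq_integral _ _ _ mu setT (fun x => limn_einf (fun n => (f n x)%:E)))//; first last.
- by move=> x _; rewrite lee_fin.
- move=> x _; rewrite limn_einf_lim; apply: lime_ge; first exact: is_cvg_einfs.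
  by near=> n; apply: le_ereal_inf_tmp => _ [k _ <-]; rewrite lee_fin.
- exact/measurable_EFinP.
- rewrite (_ : (fun _ => _) = (fun x => - limn_esup (fun n => - (f n x)%:E))%E).
    by apply: measurableT_comp => //; apply: measurable_fun_limn_esup => n; exact: measurableT_comp.
  by apply/funext => x; rewrite limn_esupN oppeK.
apply: le_trans (fatou mu measurableT mfE _) _ => [n x _|]; first by rewrite lee_fin.
apply/lee_addgt0Pr => e e0; have [N _ hN] := fK e e0.
rewrite limn_einf_lim; apply: lime_le; first exact: is_cvg_einfs.
(* The infimum over the indices beyond [n] is at most the value at [maxn n N], where the asymptotic
   bound already holds. *)
near=> n; apply: le_trans (ereal_inf_lbound (x := \int[mu]_x (f (maxn n N) x)%:E)%E _) _.
  by exists (maxn n N) => //=; exact: leq_maxl.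
by rewrite -EFinD; apply: hN => /=; exact: leq_maxr.
Unshelve. all: by end_near. Qed.

(** A version of dP/dQ that is real and nonnegative everywhere. Its zero set is [P]-null by the
    change of variables, and any two versions agree [Q]-almost everywhere, hence [P]-almost
    everywhere; this identifies the entropy with the integral of [ln rho]. *)
Lemma density_of P Q : P `<< Q -> exists rho : A -> R,
  [/\ measurable_fun setT rho, (forall x, 0 <= rho x),
      (forall f : A -> \bar R, measurable_fun setT f -> (forall x, 0 <= f x)%E ->
        (\int[Q]_x (f x * (rho x)%:E) = \int[P]_x f x)%E),
      {ae P, forall x, 0 < rho x} &
      relative_entropy P Q = (\int[P]_x (ln (rho x))%:E)%E].
Proof.
move=> PQ; pose F := Radon_Nikodym_SigmaFinite.f P Q.
have F0 x : (0 <= F x)%E by exact: Radon_Nikodym_SigmaFinite.f_ge0.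
have Ffin x : F x \is a fin_num by exact: Radon_Nikodym_SigmaFinite.f_fin_num.
have mF : measurable_fun setT F.
  exact: measurable_int (Radon_Nikodym_SigmaFinite.f_integrable PQ).
pose rho x := fine (F x).
have rhoE x : (rho x)%:E = F x by rewrite fineK.
have mrho : measurable_fun setT rho.
  by apply/measurable_EFinP; apply: eq_measurable_fun mF => x _ /=; rewrite rhoE.
have rho0 x : 0 <= rho x by rewrite fine_ge0.
have cv (f : A -> \bar R) : measurable_fun setT f -> (forall x, 0 <= f x)%E ->
    (\int[Q]_x (f x * (rho x)%:E) = \int[P]_x f x)%E.
  move=> mf f0; rewrite -(Radon_Nikodym_SigmaFinite.change_of_variables PQ f0 measurableT mf).
  by apply: eq_integral => x _; rewrite rhoE.
have rhopos : {ae P, forall x, 0 < rho x}.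
  have mZ : measurable (rho @^-1` [set 0]) by rewrite -[X in measurable X]setTI; exact: mrho.
  exists (rho @^-1` [set 0]); split=> //.
    have m1 : measurable_fun setT (fun x => (\1_(rho @^-1` [set 0]) x)%:E : \bar R).
      by apply/measurable_EFinP; exact: measurable_indic.
    transitivity (\int[P]_x (\1_(rho @^-1` [set 0]) x)%:E)%E.
      by rewrite integral_indic// setIT.
    rewrite -cv//.
    rewrite integral0_eq// => x _; rewrite indicE; case: (boolP (x \in _)) => [|_]; last by rewrite mul0e.
    by rewrite inE /= => ->; rewrite mule0.
  by move=> x /= /negP; rewrite -leNgt => h; apply/eqP; rewrite eq_le h rho0.
exists rho; split => //.
rewrite /relative_entropy asboolT//.
have ml : measurable_fun setT (fun x => (ln (rho x))%:E).
  by apply/measurable_EFinP; apply: measurableT_comp => //; exact: measurable_ln.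
have aeRN := null_dominates_ae_eq measurableT PQ
  (ae_eq_Radon_Nikodym_SigmaFinite PQ measurableT).
have aeq : ae_eq P setT (fun x => (ln (rho x))%:E)
    (fun x => lne (Radon_Nikodym (charge_of_finite_measure P) Q x)).
  apply: filterS2 aeRN rhopos => x hx rx _; rewrite -hx//.
  by rewrite -[Radon_Nikodym_SigmaFinite.f P Q x]rhoE lne_EFin.
apply/esym/ae_eq_integral => //.
(* At nonpositive arguments [lne] is minus infinity; making the case distinction explicit yields
   measurability. *)
rewrite (_ : (fun x => lne _) = (fun x =>
    if 0 < fine (Radon_Nikodym (charge_of_finite_measure P) Q x)
    then (ln (fine (Radon_Nikodym (charge_of_finite_measure P) Q x)))%:E else -oo%E)).
  have mR : measurable_fun setT (fun x => fine (Radon_Nikodym (charge_of_finite_measure P) Q x)).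
    apply: measurableT_comp => //.
  apply: measurable_fun_ifT => //; first exact: measurable_fun_ltr.
  by apply/measurable_EFinP; apply: measurableT_comp mR; exact: measurable_ln.
apply/funext => x; have := @Radon_Nikodym_fin_num _ _ _ (charge_of_finite_measure P) Q x PQ.
by case: (Radon_Nikodym _ _ x) => // r _ /=; rewrite ltNge; case: ifP.
Qed.

Lemma ln_le_subr1 (x : R) : 0 < x -> ln x <= x - 1.
Proof. move=> x0; have h : -1 < x - 1 by lra.
by have := le_ln1Dx h; rewrite (_ : 1 + (x - 1) = x)//; lra. Qed.

Lemma measurable_inv_ge0 (f : A -> R) : measurable_fun setT f -> (forall x, 0 <= f x) ->
  measurable_fun setT (fun x => (f x)^-1).
Proof.
move=> mf f0; rewrite (_ : (fun _ => _) = (fun x => if 0 < f x then expR (- ln (f x)) else 0)).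
  apply: measurable_fun_ifT => //; first exact: measurable_fun_ltr.
  apply: measurableT_comp; first exact: measurable_expR.
  apply: measurableT_comp => //.
  by apply: measurableT_comp mf; exact: measurable_ln.
apply/funext => x; case: ifPn => [r0|]; first by rewrite expRN lnK ?posrE.
by rewrite lt_neqAle f0 andbT negbK => /eqP <-; rewrite invr0.
Qed.

(** The [P]-integral of [h / rho] is the [Q]-integral of [h] over the set where [rho] is positive;
    the set where [rho] vanishes accounts for the inequality. *)
Lemma ing_invr_density P Q (rho : A -> R) : measurable_fun setT rho ->
  (forall x, 0 <= rho x) ->
  (forall f : A -> \bar R, measurable_fun setT f -> (forall x, 0 <= f x)%E ->
        (\int[Q]_x (f x * (rho x)%:E) = \int[P]_x f x)%E) ->
  forall (h : A -> R) (kappa : R), measurable_fun setT h -> (forall x, 0 <= h x) ->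
  (\int[Q]_x (h x)%:E <= kappa%:E)%E ->
  ing P (fun x => h x / rho x) /\ Ex P (fun x => h x / rho x) <= kappa.
Proof.
move=> mrho rho0 cv h kappa mh h0 hk.
have mhr : measurable_fun setT (fun x => h x / rho x).
  by apply: measurable_funM => //; exact: measurable_inv_ge0.
have hr0 x : 0 <= h x / rho x by rewrite divr_ge0.
have le : (\int[P]_x (h x / rho x)%:E <= kappa%:E)%E.
  have mhr' : measurable_fun setT (fun x => (h x / rho x)%:E) by exact/measurable_EFinP.
  rewrite -cv//.
  apply: le_trans hk; apply: ge0_le_integral => //.
  - by move=> x _; rewrite -EFinM lee_fin mulr_ge0.
  - by apply: emeasurable_funM; exact/measurable_EFinP.
  - exact/measurable_EFinP.
  move=> x _; rewrite -EFinM lee_fin.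
  have [->|r0] := eqVneq (rho x) 0; first by rewrite mulr0.
  by rewrite mulfVK.
have i : ing P (fun x => h x / rho x) by apply: ing_ge0 => //; exact: le_lt_trans le (ltry _).
by split => //; rewrite -lee_fin -ExE.
Qed.

(* Gibbs' variational inequality, from [ln x <= x - 1] at
   [x = expR g / (kappa * rho)]. *)
Lemma entropy_ge P Q (H : R) : (relative_entropy P Q <= H%:E)%E ->
  (forall (g : A -> R) (kappa : R), measurable_fun setT g -> (forall x, 0 <= g x) -> 0 < kappa ->
     (\int[Q]_x (expR (g x))%:E <= kappa%:E)%E -> ing P g) /\
  (forall (g : A -> R) (kappa : R), ing P g -> 0 < kappa ->
     (\int[Q]_x (expR (g x))%:E <= kappa%:E)%E -> Ex P g <= H + ln kappa).
Proof.
move=> PQH.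
have PQ : P `<< Q.
  by move: PQH; rewrite /relative_entropy; case: asboolP.
have [rho [mrho rho0 cv rpos HE]] := density_of PQ.
have ml : measurable_fun setT (fun x => ln (rho x)).
  by apply: measurableT_comp mrho; exact: measurable_ln.
have i1 : ing P (fun x => 1 / rho x).
  have [] // := @ing_invr_density P Q rho mrho rho0 cv (fun=> 1) 1.
  by rewrite (integral_cst Q measurableT 1%:E) mul1e prob_mass.
have lr (x : A) : 0 < rho x -> - ln (rho x) <= 1 / rho x.
  move=> r0; rewrite -lnV// div1r.
  have := @ln_le_subr1 (rho x)^-1; rewrite invr_gt0 => /(_ r0); lra.
(* The negative part is dominated by [1 / rho], whose [P]-integral is at most one; the positive part
   is then finite because the entropy is bounded above. *)
have il : ing P (fun x => ln (rho x)).
  have neg : (\int[P]_x ((fun x => (ln (rho x))%:E)^\- x) < +oo)%E.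
    case/integrableP : (i1) => m1; apply: le_lt_trans; apply: ae_ge0_le_integral => //.
    - by apply: measurable_funeneg; exact/measurable_EFinP.
    - by apply: (measurableT_comp (@abse_measurable _ _)).
    apply: filterS rpos => x rx _; rewrite funenegE -EFinN -EFin_max lee_fin.
    by rewrite ge_max normr_ge0 andbT (le_trans (lr _ rx))// ler_norm.
  have pos : (\int[P]_x ((fun x => (ln (rho x))%:E)^\+ x) < +oo)%E.
    have := le_lt_trans PQH (ltry H); rewrite HE integralE.
    have := @integral_ge0 _ _ _ P setT _ (fun x _ => funeneg_ge0 (fun x => (ln (rho x))%:E) x).
    move: neg; case: (integral P setT _^\-)%E => // r _ _.
    by case: (\int[P]_x (fun x => (ln (rho x))%:E)^\+ x)%E => // ? _; exact: ltry.
  apply/integrableP; split; first exact/measurable_EFinP.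
  rewrite (_ : (fun x => `|_|%E) = (fun x => (ln (rho x))%:E)^\+ \+ (fun x => (ln (rho x))%:E)^\-)%E; last by rewrite -fune_abse.
  rewrite ge0_integralD//; first by rewrite lte_add_pinfty.
  - by apply: measurable_funepos; exact/measurable_EFinP.
  - by apply: measurable_funeneg; exact/measurable_EFinP.
have HE' : Ex P (fun x => ln (rho x)) <= H by rewrite -lee_fin -ExE// -HE.
have key g kappa : measurable_fun setT g -> 0 < kappa ->
   (\int[Q]_x (expR (g x))%:E <= kappa%:E)%E ->
   [/\ ing P (fun x => expR (g x) / rho x), Ex P (fun x => expR (g x) / rho x) <= kappa &
     {ae P, forall x, g x <= ln (rho x) + ln kappa + (kappa^-1 * (expR (g x) / rho x) - 1)}].
  move=> mg k0 gk.
  have [|||ig Eg] := @ing_invr_density P Q rho mrho rho0 cv (fun x => expR (g x)) kappa.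
  - by apply: measurableT_comp mg; exact: measurable_expR.
  - by move=> x; exact: expR_ge0.
  - exact: gk.
  split => //; apply: filterS rpos => x rx.
  have e0 : 0 < kappa^-1 * (expR (g x) / rho x).
    by rewrite mulr_gt0 ?invr_gt0// divr_gt0// expR_gt0.
  have := ln_le_subr1 e0; rewrite lnM ?posrE ?invr_gt0 ?divr_gt0 ?expR_gt0//.
  by rewrite ln_div ?posrE ?expR_gt0// expRK lnV ?posrE//; lra.
split=> [g kappa mg g0 k0 gk|g kappa ig k0 gk].
  have [ie _ ge] := key g kappa mg k0 gk.
  apply: (@ing_dom_ae _ _ (fun x => ln (rho x) + ln kappa + (kappa^-1 * (expR (g x) / rho x) - 1))) => //.
    have icst k : ing P (fun=> k) by apply: (@ingP_bounded _ _ _ P `|k|).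
    by apply: ingD; [exact: ingD|apply: ingB => //; exact: ingZ].
  by apply: filterS ge => x; rewrite ger0_norm.
have [ie Ee ge] := key g kappa (ing_meas ig) k0 gk.
have icst k : ing P (fun=> k) by apply: (@ingP_bounded _ _ _ P `|k|).
have := ae_le_Ex ig (ingD (ingD il (icst (ln kappa))) (ingB (ingZ kappa^-1 ie) (icst 1))) ge.
rewrite ExD; [|exact: ingD|by apply: ingB => //; exact: ingZ].
rewrite ExD// ExB//; last exact: ingZ.
rewrite ExZ// !Ex_cst => h; apply: (le_trans h).
have : kappa^-1 * Ex P (fun x => expR (g x) / rho x) <= 1 by rewrite mulrC ler_pdivrMr// mul1r.
by move: HE'; lra.
Qed.

(* Converse of [entropy_ge]: [f] runs through truncations of the log-density. *)
Lemma entropy_le P Q (K : R) :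
  (forall (f : A -> R) (M : R), measurable_fun setT f -> (forall x, `|f x| <= M) ->
     Ex P f <= K + ln (Ex Q (fun x => expR (f x)))) ->
  (relative_entropy P Q <= K%:E)%E.
Proof.
move=> hK.
have PQ : P `<< Q.
  (* On a [Q]-null set [B] the test function [n * \1_B] gives [n P(B) <= K] for every [n]. *)
  apply/null_content_dominatesP => B mB QB0.
  have mi (n : nat) : measurable_fun setT (fun x => n%:R * (\1_B x : R)).
    by apply: measurable_funM => //; exact: measurable_indic.
  have iB (P' : probability A R) : ing P' (fun x => \1_B x : R).
    apply: (@ingP_bounded _ _ _ P' 1); first exact: measurable_indic.
    by move=> x; rewrite indicE; case: (_ \in _); rewrite ?normr1 ?normr0.
  have EB (P' : probability A R) : (Ex P' (fun x => \1_B x : R))%:E = P' B.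
    by rewrite -ExE// integral_indic// setIT.
  have h (n : nat) : n%:R * Ex P (fun x => \1_B x : R) <= K.
    have := hK (fun x => n%:R * (\1_B x : R)) n%:R (mi n).
    rewrite (_ : Ex Q _ = 1); last first.
      rewrite -[RHS](Ex_cst Q); apply: eq_ae_Ex => //.
        by apply: measurableT_comp (mi n); exact: measurable_expR.
      exists B; split => // x /= h; apply: contrapT => nB; apply: h.
      by rewrite indicE memNset// mulr0 expR0.
    rewrite ln1 addr0 ExZ//; apply => x.
    by rewrite indicE; case: (_ \in _); rewrite ?mulr1 ?mulr0 ?normr0 ?ger0_norm.
  rewrite -EB; congr EFin; apply/eqP; rewrite eq_le Ex_ge0 ?andbT; last first.
    by move=> x; rewrite indicE.
  rewrite leNgt; apply/negP => E0.
  have := h (Num.truncn (K / Ex P (fun x => \1_B x : R))).+1.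
  apply/negP; rewrite -ltNge -ltr_pdivrMr//.
  by rewrite truncnS_gt.
have [rho [mrho rho0 cv rpos HE]] := density_of PQ.
have i1 : ing P (fun x => 1 / rho x).
  have [] // := @ing_invr_density P Q rho mrho rho0 cv (fun=> 1) 1.
  by rewrite (integral_cst Q measurableT 1%:E) mul1e prob_mass.
have ml : measurable_fun setT (fun x => ln (rho x)).
  by apply: measurableT_comp mrho; exact: measurable_ln.
pose c (n : nat) x := Num.min (Num.max (rho x) (expR (- n%:R))) (expR n%:R).
have c0 n x : 0 < c n x by rewrite lt_min lt_max !expR_gt0 orbT.
have mc n : measurable_fun setT (c n) by apply: measurable_minr => //; exact: measurable_maxr.
pose f n x := ln (c n x).
have mf n : measurable_fun setT (f n) by apply: measurableT_comp (mc n); exact: measurable_ln.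
have fn n x : `|f n x| <= n%:R.
  rewrite ler_norml -[X in X <= _ <= _]expRK -[X in _ <= _ <= X](expRK) !ler_ln ?posrE ?expR_gt0//.
  rewrite le_min le_max lexx orbT ge_min lexx orbT ler_expR ?andbT.
  by rewrite (@le_trans _ _ 0) ?ler0n// oppr_le0 ler0n.
have ifn n : ing P (f n) by exact: (ingP_bounded P (mf n) (fn n)).
(* The truncation [c n] is at most [rho + expR (- n)], so its [Q]-integral exceeds one by at most
   [expR (- n)]. *)
have Efn n : Ex P (f n) <= K + expR (- n%:R).
  apply: (le_trans (hK _ _ (mf n) (fn n))); rewrite lerD2l.
  have irho : ing Q rho.
    apply: ing_ge0 => //; under eq_integral do rewrite -[(rho _)%:E]mul1e.
    by rewrite (cv (cst 1%E))// (integral_cst P measurableT 1%E) mul1e prob_mass ltry.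
  have Erho : Ex Q rho = 1.
    apply/EFin_inj; rewrite -ExE//; under eq_integral do rewrite -[(rho _)%:E]mul1e.
    by rewrite (cv (cst 1%E))// (integral_cst P measurableT 1%E) mul1e prob_mass.
  have icst : ing Q (fun=> expR (- n%:R)) by apply: (@ingP_bounded _ _ _ Q `|expR (- n%:R)|).
  have ief : ing Q (fun x => expR (f n x)).
    apply: (@ingP_bounded _ _ _ Q (expR n%:R)).
      by apply: measurableT_comp (mf n); exact: measurable_expR.
    by move=> x; rewrite ger0_norm ?expR_ge0// ler_expR; have := fn n x; rewrite ler_norml => /andP[].
  have e0 : 0 < Ex Q (fun x => expR (f n x)).
    apply: (lt_le_trans (expR_gt0 (- n%:R))); rewrite -[leLHS](Ex_cst Q).
    apply: le_Ex => // x; rewrite ler_expR.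
    by have := fn n x; rewrite ler_norml => /andP[].
  apply: (le_trans (ln_le_subr1 e0)); rewrite lerBlDr.
  have -> : expR (- n%:R) + 1 = Ex Q (fun x => rho x + expR (- n%:R)).
    by rewrite ExD// Erho Ex_cst addrC.
  apply: le_Ex => //; first exact: ingD.
  move=> x; rewrite lnK ?posrE//.
  rewrite ge_min; apply/orP; left; rewrite ge_max.
  by rewrite lerDl expR_ge0 lerDr rho0.
have frho n x : 0 < rho x -> 0 <= f n x + 1 / rho x.
  move=> r0; have [c1|c1] := leP 1 (c n x).
    by rewrite addr_ge0// ?ln_ge0// divr_ge0.
  have rc : rho x <= c n x.
    rewrite /c le_min le_max lexx/=.
    have : rho x <= Num.max (rho x) (expR (- n%:R)) by rewrite le_max lexx.
    move/le_trans; apply; move: c1; rewrite /c minEle; case: ifP => // _ h1.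
    by move: h1; rewrite ltNge -[X in X <= _]expR0 ler_expR ler0n.
  have := @ln_le_subr1 (c n x)^-1; rewrite invr_gt0 lnV ?posrE// => /(_ (c0 n x)).
  have : (c n x)^-1 <= (rho x)^-1 by rewrite lef_pV2 ?posrE.
  by rewrite /f div1r; lra.
(* Fatou's lemma needs nonnegative functions: adding the integrable function [1 / rho] makes the
   truncated logarithms nonnegative where [rho] is positive, and the maximum with 0 covers the
   remaining null set. *)
pose g n x := Num.max 0 (f n x + 1 / rho x).
have mg n : measurable_fun setT (g n).
  by apply: measurable_maxr => //; apply: measurable_funD => //; exact: ing_meas i1.
pose h x := Num.max 0 (ln (rho x) + 1 / rho x).
have mh : measurable_fun setT h.
  by apply: measurable_maxr => //; apply: measurable_funD => //; exact: ing_meas i1.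
have h0 x : 0 <= h x by rewrite le_max lexx.
have hE x : 0 < rho x -> h x = ln (rho x) + 1 / rho x.
  move=> r0; apply/max_idPr.
  have := @ln_le_subr1 (rho x)^-1; rewrite invr_gt0 lnV ?posrE// => /(_ r0).
  by rewrite div1r; lra.
have hle : (\int[P]_x (h x)%:E <= (K + Ex P (fun x => 1 / rho x))%:E)%E.
  apply: (@fatou_ub P g) => //.
  - by move=> n x; rewrite le_max lexx.
  - apply: filterS rpos => x r0; apply: cvg_near_cst.
    near=> n; rewrite hE// /g; have /max_idPr -> := frho n x r0.
    congr (ln _ + _).
    have hn : Num.max (rho x) (rho x)^-1 <= expR n%:R.
      apply: (le_trans (y := n%:R)); first by near: n; exact: nbhs_infty_ger.
      by have := @expR_ge1Dx R n%:R; lra.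
    move: hn; rewrite ge_max => /andP[h1 h2].
    rewrite /c; have /max_idPl -> : expR (- n%:R) <= rho x.
      by rewrite expRN -[leRHS]invrK lef_pV2// ?posrE ?invr_gt0 ?expR_gt0.
    exact/min_idPl.
  - move=> e e0; near=> n.
    have -> : (\int[P]_x (g n x)%:E = (Ex P (f n) + Ex P (fun x => 1 / rho x))%:E)%E.
      have gf : {ae P, forall x, f n x + 1 / rho x = g n x}.
        by apply: filterS rpos => x r0; rewrite /g; have /max_idPr -> := frho n x r0.
      have ig := ing_ae_eq (mg n) gf (ingD (ifn n) i1).
      rewrite ExE// -ExD//; congr EFin; apply/esym/eq_ae_Ex => //.
      by apply: measurable_funD => //; exact: ing_meas i1.
    rewrite lee_fin -addrA [_ + e]addrC addrA lerD2r; apply: (le_trans (Efn n)); rewrite lerD2l.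
    have hn : e^-1 <= expR n%:R.
      apply: (le_trans (y := n%:R)); first by near: n; exact: nbhs_infty_ger.
      by have := @expR_ge1Dx R n%:R; lra.
    by rewrite expRN -[leRHS]invrK lef_pV2// ?posrE ?invr_gt0 ?expR_gt0.
have ih : ing P h by apply: ing_ge0 => //; exact: le_lt_trans hle (ltry _).
have ihl : ing P (fun x => ln (rho x)).
  apply: (ing_ae_eq ml _ (ingB ih i1)); apply: filterS rpos => x r0.
  by rewrite hE// addrK.
rewrite HE ExE// lee_fin.
have hEx : Ex P h = Ex P (fun x => ln (rho x)) + Ex P (fun x => 1 / rho x).
  rewrite -ExD//; apply: eq_ae_Ex => //; first by apply: measurable_funD => //; exact: ing_meas i1.
  by apply: filterS rpos => x r0; rewrite hE.
by move: hle; rewrite ExE// lee_fin hEx lerD2r.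
Unshelve. all: by end_near. Qed.

End relative_entropy_duality.

(** * Paths, filtration and predictable processes *)

Section paths.
Context (R : realType) (T : R) (d : nat) (T_gt0 : 0 < T).
Local Notation Om := (path_space T d).

(** Projection of the line onto [[0, T]]. Composing with it extends a path continuously to all
    times, whereas [X t] takes a dummy value outside [[0, T]]. *)
Definition clamp (t : R) : R := Num.max 0 (Num.min t T).

Lemma clamp_itv t : 0 <= clamp t <= T.
Proof.
rewrite /clamp le_max lexx/= ge_max ge_min lexx orbT andbT.
exact: ltW.
Qed.

Lemma clamp_id t : 0 <= t <= T -> clamp t = t.
Proof. by move=> /andP[t0 tT]; rewrite /clamp (min_idPl tT); exact/max_idPr. Qed.

Lemma clamp_lip t s : `|clamp t - clamp s| <= `|t - s|.
Proof.
rewrite /clamp /Num.max /Num.min; do !case: ifPn; rewrite -?leNgt => *;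
  rewrite ler_norml; apply/andP; split; (have := ler_norm (t - s); have := ler_norm (s - t); rewrite distrC; lra).
Qed.

Lemma continuous_clamp : continuous clamp.
Proof.
move=> t; apply/cvgrPdist_lt => e e0; near=> s.
by apply: (le_lt_trans (clamp_lip t s)); near: s; apply: cvgr_dist_lt.
Unshelve. all: by end_near. Qed.

Lemma clamp_set t : clamp t \in `[0, T]%classic.
Proof. by rewrite inE/= in_itv/=; exact: clamp_itv. Qed.

Definition sub_clamp (t : R) : set_type `[0, T]%classic :=
  exist _ (clamp t) (clamp_set t).

Lemma X_sub (w : Om) (u : set_type `[0, T]%classic) : X (set_val u) w = path_fun w u.
Proof.
rewrite /X; case: insubP => [v _ vu|]; last by rewrite (valP u).
by congr (path_fun w _); exact: val_inj.
Qed.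

Lemma continuous_path (w : Om) : continuous (fun t => X (clamp t) w).
Proof.
have c1 : continuous sub_clamp.
  by apply: continuous_comp_initial => t; exact: continuous_clamp.
rewrite (_ : (fun _ => _) = path_fun w \o sub_clamp); last first.
  by apply/funext => t /=; rewrite -X_sub.
move=> t; apply: continuous_comp; first exact: c1.
exact: (@cts_fun _ _ (w : continuousType _ _)).
Qed.

Definition mkpath (f : R -> 'rV[R]_d) (fc : continuous f) : Om :=
  mkcts (fun u => continuous_comp (@initial_continuous _ _ set_val u) (fc (set_val u))) : continuousType _ _.

Lemma X_mkpath f fc t : 0 <= t <= T -> X t (@mkpath f fc) = f t.
Proof.
move=> h; have hu : t \in `[0, T]%classic by rewrite inE/= in_itv.
by rewrite (X_sub _ (exist _ t hu)).
Qed.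

Definition grid (n k : nat) : R := T * k%:R / (2 ^+ n).

Lemma grid0 n : grid n 0 = 0.
Proof. by rewrite /grid mulr0 mul0r. Qed.

Lemma pow2_gt0 n : 0 < (2 : R) ^+ n.
Proof. by rewrite exprn_gt0. Qed.

Lemma gridT n : grid n (2 ^ n) = T.
Proof. by rewrite /grid natrX mulfK// gt_eqF// pow2_gt0. Qed.

Lemma grid_le n k l : (k <= l)%N -> grid n k <= grid n l.
Proof. by move=> kl; rewrite ler_wpM2r ?invr_ge0 ?(ltW (pow2_gt0 n))// ler_pM2l// ler_nat. Qed.

Lemma grid_lt n k l : (k < l)%N -> grid n k < grid n l.
Proof. by move=> kl; rewrite ltr_pM2r ?invr_gt0 ?pow2_gt0// ltr_pM2l// ltr_nat. Qed.

Lemma grid_itv n k : (k <= 2 ^ n)%N -> 0 <= grid n k <= T.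
Proof. move=> h; apply/andP; split; first by rewrite -(grid0 n) grid_le.
by rewrite -[leRHS](gridT n) grid_le. Qed.

Definition mesh n : R := T / 2 ^+ n.

Lemma mesh_gt0 n : 0 < mesh n. Proof. by rewrite divr_gt0// pow2_gt0. Qed.

Lemma gridS n k : grid n k.+1 = grid n k + mesh n.
Proof. by rewrite /grid /mesh -natr1 mulrDr mulr1 mulrDl. Qed.

Lemma grid_double n k : grid n.+1 k.*2 = grid n k.
Proof.
rewrite /grid -mul2n natrM exprS.
have /negbT h := gt_eqF (pow2_gt0 n); field.
by rewrite h.
Qed.

Lemma grid_refine n m k : grid (n + m) (k * 2 ^ m) = grid n k.
Proof.
rewrite /grid natrM natrX exprD.
have /negbT h := gt_eqF (pow2_gt0 n); have /negbT h' := gt_eqF (pow2_gt0 m).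
by field; rewrite h h'.
Qed.

Lemma mesh_cvg : mesh n @[n --> \oo] --> (0 : R).
Proof.
rewrite -[X in _ --> X](mulr0 T); apply: cvgM; first exact: cvg_cst.
by under eq_fun do rewrite -exprVn; apply: cvg_expr; rewrite ger0_norm ?invr_ge0// invf_lt1// ltr1n.
Qed.

Lemma grid_ex n t : 0 < t <= T -> exists2 k, (k < 2 ^ n)%N & grid n k < t <= grid n k.+1.
Proof.
move=> /andP[t0 tT].
have ex : exists j, t <= grid n j by exists (2 ^ n)%N; rewrite gridT.
case: (ex_minnP ex) => -[|k] tk kmin; first by move: tk; rewrite grid0 leNgt t0.
exists k; first by rewrite ltnNge; apply/negP => h; have := kmin (2 ^ n)%N; rewrite gridT tT => /(_ isT); rewrite leqNgt ltnS h.
by rewrite tk andbT ltNge; apply/negP => /kmin; rewrite ltnn.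
Qed.

Lemma path_modulus (w : Om) (e : R) : 0 < e -> exists n, forall t s, 0 <= t <= T -> 0 <= s <= T ->
  `|t - s| <= mesh n -> ball (X t w) e (X s w).
Proof.
move=> e0; pose g t := X (clamp t) w.
have /compact_near_coveringP nc := @segment_compact R 0 T.
have [t _|N _ hN] := nc nat \oo (fun n t => forall s, `|t - s| <= mesh n -> ball (g t) e (g s)) eventually_filter.
  have e20 : 0 < e / 2 by rewrite divr_gt0.
  have /cvg_ballP/(_ _ e20)/nbhs_ballP := @continuous_path w t.
  move=> [del /= del0 hdel].
  exists (ball t (del / 2), [set n | mesh n < del / 2]) => /=.
    split; first by apply: nbhsx_ballx; rewrite divr_gt0.
    by apply: (cvgr_lt 0 mesh_cvg); rewrite divr_gt0.
  move=> [s n] /= [ts nd] s' ss'.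
  apply: (@ball_splitr _ _ (g t)); apply: hdel; rewrite /ball/=.
    by move: ts; rewrite /ball/=; lra.
  have := ler_distD s t s'; move: ts; rewrite /ball/=; lra.
exists N => t s t01 s01 h.
have := hN N (leqnn N) t; rewrite /= in_itv /= => /(_ t01 s h).
by rewrite /g !clamp_id.
Qed.

Lemma mesh_le n m : (n <= m)%N -> mesh m <= mesh n.
Proof.
by move=> nm; rewrite ler_pM2l// lef_pV2 ?posrE ?pow2_gt0// ler_eXn2l// ltr1n.
Qed.

Lemma gridE n k : grid n k = k%:R * mesh n.
Proof. by rewrite /grid /mesh mulrA [T * _]mulrC. Qed.

(** The cells here are closed on the left, in contrast to those of [grid_ex], which follow the
    predictable rectangles. At [t = T] the index is [2 ^ n], one past the last cell. *)
Definition cell n t : nat := Num.truncn (t / mesh n).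

Lemma cell_le n t : 0 <= t -> t <= T -> (cell n t <= 2 ^ n)%N.
Proof.
move=> t_ge0 tT; have t0 : 0 <= t / mesh n by rewrite divr_ge0// ltW// mesh_gt0.
rewrite -(@ler_nat R); have /andP[h _] := truncn_itv t0; apply: (le_trans h).
by rewrite ler_pdivrMr ?mesh_gt0// natrX /mesh mulrCA mulfV ?mulr1// gt_eqF// pow2_gt0.
Qed.

Lemma cell_dist n t : 0 <= t -> `|t - grid n (cell n t)| <= mesh n.
Proof.
move=> t0; have m0 := mesh_gt0 n.
have /truncn_itv : 0 <= t / mesh n by rewrite divr_ge0// ltW.
rewrite -/(cell n t) => /andP[h1 h2].
move: h1 h2; rewrite ler_pdivlMr// ltr_pdivrMr// -natr1 mulrDl mul1r -gridE => h1 h2.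
by rewrite ger0_norm; lra.
Qed.

Lemma path_open_ball (U : set Om) (w : Om) : open U -> U w -> exists e, 0 < e /\
  forall w', (forall t, 0 <= t <= T -> ball (X t w) e (X t w')) -> U w'.
Proof.
move=> [V oV <-] Vw.
have /uniform_nbhs[E [entE EV]] := open_nbhs_nbhs (conj oV Vw).
move: entE; rewrite -entourage_ballE => -[e /= e0 eE].
exists e; split => // w' h; apply: EV => u _; apply: eE => /=.
have := h (set_val u); rewrite !X_sub; apply.
by have := set_valP u; rewrite /= in_itv.
Qed.

Lemma countable_bigcapT_measurable (dd : measure_display) (A : measurableType dd)
  (U : countType) (F : U -> set A) :
  (forall i, measurable (F i)) -> measurable (\bigcap_i F i).
Proof.
move=> mF; rewrite -[X in measurable X]setCK setC_bigcap; apply: measurableC.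
by apply: countable_bigcupT_measurable => [|i]; [exact: countableP|exact: measurableC].
Qed.

(** A closed tube around a step function with rational values: [p] lists the level of the grid, the
    precision and the values. It restrains the path at dyadic times only, but at those of every
    level, so that there are countably many tubes, each given by countably many conditions. *)
Definition tube (p : nat * nat * seq 'rV[rat]_d) : set Om :=
  [set w | forall q : nat * nat * 'I_d, (q.1.2 <= 2 ^ q.1.1)%N ->
    `|X (grid q.1.1 q.1.2) w 0 q.2 -
      ratr (nth 0 p.2 (cell p.1.1 (grid q.1.1 q.1.2)) 0 q.2)| <= p.1.2.+1%:R^-1].

Lemma open_tubeE (U : set Om) : open U ->
  U = \bigcup_(p in [set p | tube p `<=` U]) tube p.
Proof.
move=> oU; apply/seteqP; split=> [w Uw|w [p pU pw]]; last exact: pU.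
have [e [e0 eU]] := path_open_ball oU Uw.
(* Two paths in one tube differ by less than [e / 4] at dyadic times, and each of them moves by less
   than [e / 4] between a time and a close enough dyadic time. The radius of the tube is split into
   the modulus of continuity of [w] and the rounding of its values. *)
pose m := Num.truncn (8 / e).
have m1 : m.+1%:R^-1 < e / 8.
  rewrite -[ltRHS]invf_div ltf_pV2 ?posrE ?divr_gt0//.
  by rewrite truncnS_gt.
pose e' := m.+1%:R^-1 / 2 : R.
have e'0 : 0 < e' by rewrite divr_gt0// invr_gt0.
have [n hn] := path_modulus w e'0.
have ra k i : exists q : rat, `|X (grid n k) w 0 i - ratr q| < e'.
  have /rat_in_itvoo[q] : X (grid n k) w 0 i - e' < X (grid n k) w 0 i by lra.
  by rewrite in_itv/= => /andP[h1 h2]; exists q; rewrite ltr_norml; apply/andP; split; lra.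
pose s := mkseq (fun k => \row_i sval (cid (ra k i))) (2 ^ n).+1.
have hw : tube (n, m, s) w.
  move=> [[N j] i] /= jN.
  have /andP[g0 gT] := grid_itv jN.
  have cl := cell_le n g0 gT.
  rewrite nth_mkseq ?ltnS// mxE; case: cid => q /= hq.
  have := hn (grid N j) (grid n (cell n (grid N j))) (grid_itv jN) (grid_itv cl) (cell_dist n g0).
  move=> [_ /(_ 0 i)]; rewrite /ball/=.
  move: hq; rewrite /e'; move: (m.+1%:R^-1) => z.
  by rewrite !ltr_norml ler_norml => /andP[? ?] /andP[? ?]; apply/andP; split; lra.
exists (n, m, s) => //= w' hw'; apply: eU => t t01; split => // a i; rewrite ord1 {a}.
have e40 : 0 < e / 4 by rewrite divr_gt0.
have [n1 h1] := path_modulus w e40.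
have [n2 h2] := path_modulus w' e40.
pose N := maxn n1 n2.
have [t0 tT] := andP t01.
have cl := cell_le N t0 tT.
have cd := cell_dist N t0.
have := h1 t _ t01 (grid_itv cl) (le_trans cd (mesh_le (leq_maxl _ _))).
have := h2 t _ t01 (grid_itv cl) (le_trans cd (mesh_le (leq_maxr _ _))).
move=> [_ /(_ 0 i)] + [_ /(_ 0 i)].
have := hw (N, cell N t, i) cl; have := hw' (N, cell N t, i) cl => /=.
move: m1; move: (m.+1%:R^-1) => z m1.
move: (ratr _) => q; rewrite /ball/= !ler_norml !ltr_norml.
by do 4 move=> /andP[? ?]; apply/andP; split; lra.
Qed.

(** An open set of paths is a countable union of tubes and a tube is a countable intersection of
    events at dyadic times. This gives measurability of every path-valued map built below. *)
Lemma measurable_path_grid (dd : measure_display) (A : measurableType dd) (D : set A)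
  (f : A -> Om) : measurable D ->
  (forall n k, (k <= 2 ^ n)%N -> measurable_fun D (fun a => X (grid n k) (f a))) -> measurable_fun D f.
Proof.
move=> mD mf; apply: (measurability (@open Om)) => // _ [B oB <-].
rewrite (open_tubeE oB) preimage_bigcup setI_bigcupr.
rewrite (_ : \bigcup_(i in _) _ =
  \bigcup_p (if `[< tube p `<=` B >] then D `&` f @^-1` tube p else set0)); last first.
  apply/seteqP; split=> [x [ab abB abx]|x [ab _]].
    by exists ab => //; rewrite asboolT.
  by case: asboolP => // abB ?; exists ab.
apply: countable_bigcupT_measurable => [|p]; first exact: countableP.
case: asboolP => // _.
pose F (q : nat * nat * 'I_d) : set A := if (q.1.2 <= 2 ^ q.1.1)%N then
  D `&` (fun a => `|X (grid q.1.1 q.1.2) (f a) 0 q.2 -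
      ratr (nth 0 p.2 (cell p.1.1 (grid q.1.1 q.1.2)) 0 q.2)|) @^-1` `]-oo, p.1.2.+1%:R^-1] else D.
rewrite (_ : _ `&` _ = (\bigcap_q F q) `&` D); last first.
  apply/seteqP; split=> [x [Dx fx]|x [fx Dx]].
    split=> // q _; rewrite /F; case: ifPn => // h; split=> //=.
    by rewrite in_itv/=; exact: fx.
  split=> // q h; have /= := fx q I; rewrite /F h => -[_ /=].
  by rewrite in_itv.
apply: measurableI => //; apply: countable_bigcapT_measurable => q; rewrite /F; case: ifPn => // h.
apply: measurableT_comp => //; apply: measurable_funB => //.
exact: (measurableT_comp (measurable_coord q.2) (mf _ _ h)).
Qed.

Lemma measurable_path (dd : measure_display) (A : measurableType dd) (D : set A)
  (f : A -> Om) : measurable D ->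
  (forall t, 0 <= t <= T -> measurable_fun D (fun a => X t (f a))) -> measurable_fun D f.
Proof. by move=> mD mf; apply: measurable_path_grid => // n k /grid_itv; exact: mf. Qed.

End paths.

Section time_integrals.
Context (R : realType) (dd : measure_display) (A : measurableType dd).
Local Notation leb := (@lebesgue_measure R).

Lemma measurable_time_integral_ge0 (D : set (measurableTypeR R))
  (f : measurableTypeR R * A -> \bar R) : measurable D ->
  measurable_fun (D `*` setT) f -> (forall p, 0 <= f p)%E ->
  measurable_fun setT (fun w => \int[leb]_(s in D) f (s, w))%E.
Proof.
move=> mD mf f0.
have mDT : measurable (D `*` [set: A]) by exact: measurableX.
have mg : measurable_fun setT (f \_ (D `*` setT)) by apply/(measurable_restrictT f mDT).
have g0 p : (0 <= (f \_ (D `*` setT)) p)%E by rewrite patchE; case: ifP.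
have := @measurable_fun_fubini_tonelli_G _ _ _ _ R leb _ mg g0.
apply: eq_measurable_fun => w _; rewrite /fubini_G [RHS]integral_mkcond.
apply: eq_integral => s _; rewrite !patchE; congr (if _ then _ else _).
by apply/idP/idP => [/set_mem[h _]|/set_mem h]; exact/mem_set.
Qed.

Lemma measurable_time_integral (D : set (measurableTypeR R))
  (f : measurableTypeR R * A -> R) : measurable D ->
  measurable_fun (D `*` setT) f ->
  measurable_fun setT (fun w => \int[leb]_(s in D) f (s, w)).
Proof.
move=> mD mf; apply: measurableT_comp => //.
have mfE : measurable_fun (D `*` [set: A]) (EFin \o f) by exact/measurable_EFinP.
rewrite (_ : (fun _ => _) = (fun w => \int[leb]_(s in D) ((EFin \o f)^\+ (s, w)) -
   \int[leb]_(s in D) ((EFin \o f)^\- (s, w)))%E); last first.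
  apply/funext => w; rewrite integralE; congr (_ - _)%E; apply: eq_integral => s _.
    by rewrite !funeposE.
  by rewrite !funenegE.
apply: emeasurable_funB; apply: measurable_time_integral_ge0 => //.
- exact: measurable_funepos.
- exact: measurable_funeneg.
Qed.

End time_integrals.

Section filtration.
Context (R : realType) (T : R) (d : nat) (T_gt0 : 0 < T).
Local Notation Om := (path_space T d).

(** The generators of [canonical_filtration s], named so that path space with this sigma-algebra
    becomes a type [FT s]; being adapted is then ordinary measurability, and likewise being
    predictable for the type [PT]. *)
Definition coord_events (s : R) : set (set Om) :=
  [set E | exists r C, [/\ 0 <= r <= s, measurable C & E = X r @^-1` C]].
Local Notation FT s := (g_sigma_algebraType (coord_events s)).
Local Notation PT :=
  (g_sigma_algebraType (predictable_rectangles T (@canonical_filtration R T d))).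
Local Notation DT := (`[0, T]%classic `*` [set: Om]).

Lemma filtration_le (s t : R) (E : set Om) : s <= t ->
  canonical_filtration s E -> canonical_filtration t E.
Proof.
move=> st; apply: sub_sigma_algebra2 => {}E [r [C [/andP[r0 rs] mC ->]]].
by exists r, C; split=> //; rewrite r0 (le_trans rs).
Qed.

Lemma filtration_measurable (s : R) (E : set Om) : canonical_filtration s E -> measurable E.
Proof.
apply: smallest_sub; first exact: sigma_algebra_measurable.
by move=> _ [r [C [_ mC ->]]]; rewrite -[X in measurable X]setTI; exact: measurable_X.
Qed.

Definition fmeas (dd : measure_display) (B : measurableType dd) (s : R) (f : Om -> B) : Prop :=
  measurable_fun (setT : set (FT s)) f.

Lemma fmeas_le (dd : measure_display) (B : measurableType dd) (s t : R) (f : Om -> B) :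
  s <= t -> fmeas s f -> fmeas t f.
Proof. by move=> st mf mT C mC; apply: (filtration_le st); exact: mf. Qed.

Lemma fmeas_meas (dd : measure_display) (B : measurableType dd) (s : R) (f : Om -> B) :
  fmeas s f -> measurable_fun setT f.
Proof. by move=> mf mT C mC; apply: (@filtration_measurable s); exact: mf. Qed.

Lemma fmeas_X (r s : R) : 0 <= r <= s -> fmeas s (@X R T d r).
Proof.
move=> rs mT C mC; rewrite setTI; apply: sub_sigma_algebra.
by exists r, C.
Qed.

Lemma fmeas_indic (s : R) (E : set Om) : canonical_filtration s E -> fmeas s (\1_E : Om -> R).
Proof. by move=> FE; exact: (measurable_indic (T := FT s)). Qed.

Lemma measurable_PT_rect (s t : R) (E : set Om) : 0 <= s -> s < t -> t <= T ->
  canonical_filtration s E -> measurable (`]s, t]%classic `*` E : set PT).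
Proof. by move=> *; apply: sub_sigma_algebra; right; exists s, t, E. Qed.

Lemma measurable_PT_zero (E : set Om) :
  canonical_filtration 0 E -> measurable ([set 0] `*` E : set PT).
Proof. by move=> *; apply: sub_sigma_algebra; left; exists E. Qed.

Lemma filtrationT (s : R) : @canonical_filtration R T d s setT.
Proof. exact: (@measurableT _ (FT s)). Qed.

Lemma measurable_DT : measurable (DT : set PT).
Proof.
rewrite (_ : DT = ([set 0] `*` setT) `|` (`]0, T]%classic `*` setT)).
  apply: measurableU; first by apply: measurable_PT_zero; exact: filtrationT.
  by apply: measurable_PT_rect => //; exact: filtrationT.
apply/seteqP; split=> [[t w] /= [/[!in_itv]/= /andP[t0 tT] _]|[t w] /= [[-> _]|[/[!in_itv]/= /andP[t0 tT] _]]].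
- move: t0; rewrite le_eqVlt => /predU1P[<-|t0]; [by left|right].
  by rewrite t0.
- by rewrite in_itv/= lexx ltW.
- by rewrite (ltW t0).
Qed.

Lemma measurable_PT_indicM (I : set R) (h : Om -> R) :
  (forall B : set R, measurable B -> measurable (I `*` (h @^-1` B) : set PT)) ->
  measurable_fun (setT : set PT) (fun p => \1_I p.1 * h p.2 : R).
Proof.
move=> mI _ B mB; rewrite setTI.
have mIT : measurable (I `*` setT : set PT) by have := mI setT measurableT; rewrite preimage_setT.
rewrite (_ : _ @^-1` B = (I `*` (h @^-1` B)) `|`
   (~` (I `*` setT) `&` (if 0 \in B then setT else set0))).
  apply: measurableU; first exact: mI.
  by apply: measurableI; [exact: measurableC|case: ifP].
apply/seteqP; split=> [[t w] /=|[t w] /=].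
  rewrite indicE; case: (boolP (t \in I)) => [|tI].
    by rewrite inE mul1r => tI hB; left.
  rewrite mul0r => B0; right; split; first by case=> + _; move: tI; rewrite notin_setE.
  by rewrite mem_set.
rewrite indicE => -[[tI hB]|[/not_andP tI]]; first by rewrite mem_set// mul1r.
case: ifP => //; rewrite inE => B0 _; rewrite memNset ?mul0r//.
by case: tI => // + tI; apply.
Qed.

Lemma measurable_PT_step (s t : R) (h : Om -> R) : 0 <= s -> s < t -> t <= T ->
  fmeas s h -> measurable_fun (setT : set PT) (fun p => \1_(`]s, t]%classic) p.1 * h p.2 : R).
Proof.
move=> s0 st tT mh; apply: measurable_PT_indicM => B mB.
by apply: measurable_PT_rect => //; rewrite -[X in canonical_filtration _ X]setTI; exact: mh.
Qed.

Lemma sum_grid_indic (V : nzRingType) n (t : R) (a : nat -> V) k : (k < 2 ^ n)%N ->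
  grid T n k < t <= grid T n k.+1 ->
  \sum_(j < 2 ^ n) \1_(`]grid T n j, grid T n j.+1]%classic) t * a j = a k.
Proof.
move=> kn tk; rewrite (bigD1 (Ordinal kn))//= indicE mem_set ?mul1r; last by rewrite /= in_itv.
rewrite big1 ?addr0// => j jk.
rewrite indicE memNset ?mul0r//= in_itv/= => /andP[h1 h2]; case/andP : tk => h3 h4.
move: jk; rewrite -val_eqE/= neq_ltn => /orP[jk|kj].
  have := lt_le_trans h3 (le_trans h2 (grid_le T_gt0 n jk)); by rewrite ltxx.
have := lt_le_trans h1 (le_trans h4 (grid_le T_gt0 n kj)); by rewrite ltxx.
Qed.

(** Step processes frozen at the left end of each cell converge pointwise by continuity. Time 0 lies
    in no cell, as cells are open on the left, and receives a term of its own. *)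
Lemma predictable_continuous (Y : R -> Om -> R) :
  (forall t, 0 <= t <= T -> fmeas t (Y t)) ->
  (forall w, continuous (fun t => Y (clamp T t) w)) ->
  measurable_fun (DT : set PT) (fun p => Y p.1 p.2).
Proof.
move=> mY cY.
pose G n (p : PT) : R := \sum_(j < 2 ^ n) \1_(`]grid T n j, grid T n j.+1]%classic) p.1 * Y (grid T n j) p.2
  + \1_([set 0]) p.1 * Y 0 p.2.
apply: (@measurable_fun_cvg _ _ _ _ G) => [n|[t w] /= [/[!in_itv]/= /andP[t0 tT] _]].
  apply: measurable_funTS; apply: measurable_funD.
    apply: measurable_sum => j; apply: measurable_PT_step.
    - by rewrite -(grid0 T n) grid_le.
    - by rewrite grid_lt.
    - by rewrite -[leRHS](gridT T n) grid_le//.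
    - apply: mY; apply: grid_itv => //; exact: ltnW.
  apply: measurable_PT_indicM => B mB; apply: measurable_PT_zero.
  by rewrite -[X in canonical_filtration _ X]setTI; apply: mY => //; rewrite lexx ltW.
move: t0; rewrite le_eqVlt => /predU1P[<-|t0].
  apply: cvg_near_cst; near=> n; rewrite /G/= big1 ?add0r => [|j _].
    by rewrite indicE mem_set// mul1r.
  rewrite indicE memNset ?mul0r//= in_itv/= => /andP[h _].
  have : 0 <= grid T n j by rewrite -(grid0 T n) grid_le.
  by rewrite leNgt h.
apply/cvgrPdist_lt => e e0.
have /cvgrPdist_lt/(_ e e0)/nbhs_ballP[del /= del0 hdel] := cY w t.
near=> n.
have [k kn /andP[k1 k2]] := grid_ex n (introT andP (conj t0 tT)).
rewrite /G/=; have -> := sum_grid_indic (fun j => Y (grid T n j) w) kn (introT andP (conj k1 k2)).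
rewrite indicE memNset ?mul0r ?addr0//=; last by move=> te; rewrite te ltxx in t0.
have kT : 0 <= grid T n k <= T by apply: grid_itv => //; exact: ltnW.
have ct : clamp T t = t by rewrite clamp_id// (ltW t0).
have cg : clamp T (grid T n k) = grid T n k by rewrite clamp_id.
have := hdel (grid T n k); rewrite /= ct cg; apply.
rewrite /ball/= ger0_norm ?subr_ge0 ?ltW//.
have : t - grid T n k <= mesh T n by rewrite gridS in k2; lra.
move=> /le_lt_trans; apply; near: n.
exact: (cvgr_lt 0 (mesh_cvg T)).
Unshelve. all: by end_near. Qed.

(** Predictable sets are progressive: cut off at time [t], a rectangle starting after [t] becomes
    empty, and any other one has its base in the sigma-algebra at time [t]. *)
Lemma PT_progressive (t : R) : 0 <= t <= T ->
  measurable_fun (`[0, t]%classic `*` setT : set (measurableTypeR R * FT t)%type)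
    (fun p : measurableTypeR R * FT t => (p : PT)).
Proof.
move=> /andP[t0 tT].
have mD : measurable (`[0, t]%classic `*` setT : set (measurableTypeR R * FT t)%type).
  by apply: measurableX => //; exact: measurable_itv.
apply: (@measurability _ _ _ PT _ _ (predictable_rectangles T (@canonical_filtration R T d))) => // _ [B hB <-].
rewrite /preimage/=.
have [[E [FE ->]]|[s [r [E [s0 sr rT FE ->]]]]] := hB.
  apply: measurableI => //; apply: measurableX; first exact: measurable_set1.
  exact: (filtration_le t0).
have [st|st] := leP s t.
  apply: measurableI => //; apply: measurableX; first exact: measurable_itv.
  exact: (filtration_le st).
rewrite (_ : _ `&` _ = set0) //; apply/seteqP; split => // -[u w] /= [[+ _] [+ _]].
by rewrite !in_itv/= => /andP[_ ut] /andP[su _]; have := lt_trans st (lt_le_trans su ut); rewrite ltxx.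
Qed.

Lemma PT_prod : measurable_fun (DT : set (measurableTypeR R * Om)%type) (fun p : measurableTypeR R * Om => (p : PT)).
Proof.
have mD : measurable (DT : set (measurableTypeR R * Om)%type).
  by apply: measurableX => //; exact: measurable_itv.
apply: (@measurability _ _ _ PT _ _ (predictable_rectangles T (@canonical_filtration R T d))) => // _ [B hB <-].
have [[E [FE ->]]|[s [r [E [s0 sr rT FE ->]]]]] := hB.
  apply: measurableI => //; apply: measurableX; first exact: measurable_set1.
  exact: filtration_measurable FE.
apply: measurableI => //; apply: measurableX; first exact: measurable_itv.
exact: filtration_measurable FE.
Qed.

Lemma predictable_prod (dd : measure_display) (B : measurableType dd) (f : R * Om -> B) :
  measurable_fun (DT : set PT) f -> measurable_fun (DT : set (measurableTypeR R * Om)%type) f.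
Proof.
move=> mf _ C mC.
have := mf measurable_DT C mC => /(PT_prod (measurableX _ measurableT)) /=.
rewrite setIA setIid; apply; exact: measurable_itv.
Qed.

Lemma predictable_prog (dd : measure_display) (B : measurableType dd) (f : R * Om -> B) (t : R) :
  0 <= t <= T ->
  measurable_fun (DT : set PT) f ->
  measurable_fun (`[0, t]%classic `*` setT : set (measurableTypeR R * FT t)%type) f.
Proof.
move=> t01 mf mD C mC.
have := mf measurable_DT C mC => /(PT_progressive t01 mD) /=.
rewrite setIA (_ : _ `&` _ `&` _ = (`[0, t]%classic `*` setT) `&` f @^-1` C)//.
congr (_ `&` _); apply/seteqP; split=> [[u w] []//|[u w] /= [+ _]].
rewrite !in_itv/= => /andP[u0 ut]; rewrite u0 ut; split => //; split => //=.
by case/andP : t01 => _; exact: le_trans.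
Qed.

(** Tonelli's theorem applied on [[0, t]] with the sigma-algebra at time [t], which progressive
    measurability permits. *)
Lemma fmeas_integral (f : R * Om -> R) (s t : R) : 0 <= s -> s <= t -> t <= T ->
  measurable_fun (DT : set PT) f ->
  fmeas t (fun w => \int[lebesgue_measure]_(u in `]s, t]) f (u, w)) /\
  fmeas t (fun w => \int[lebesgue_measure]_(u in `[s, t]) f (u, w)).
Proof.
move=> s0 st tT mf.
have t01 : 0 <= t <= T by rewrite tT (le_trans s0).
have mg := predictable_prog t01 mf.
have mD : measurable (`[0, t]%classic `*` setT : set (measurableTypeR R * FT t)%type).
  by apply: measurableX => //; exact: measurable_itv.
split; apply: (measurable_time_integral (A := FT t)); try exact: measurable_itv;
  apply: measurable_funS mg => // -[u w] /= [+ _]; rewrite !in_itv/= => /andP[h1 ->]; rewrite andbT;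
  split => //; apply: (le_trans s0) => //; exact: ltW.
Qed.

End filtration.

(** * Gaussian vectors *)

Section normal_calculus.
Context (R : realType).
Local Notation leb := (@lebesgue_measure R).
Local Open Scope ereal_scope.

Lemma normal_integral (sigma : R) (f : measurableTypeR R -> \bar R) :
  measurable_fun setT f -> (forall x, 0 <= f x) ->
  \int[normal_prob 0 sigma]_x f x = \int[leb]_x (f x * (normal_pdf 0 sigma x)%:E).
Proof.
move=> mf f0.
have dom := normal_prob_dominates (0 : R) sigma.
rewrite -(Radon_Nikodym_SigmaFinite.change_of_variables dom f0 measurableT mf).
have RNi := Radon_Nikodym_SigmaFinite.f_integrable dom.
have mRN := measurable_int _ RNi.
have mpdf : measurable_fun setT (fun x : measurableTypeR R => (normal_pdf 0 sigma x)%:E).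
  by apply/measurable_EFinP; exact: measurable_normal_pdf.
apply: ge0_ae_eq_integral => //.
- exact: emeasurable_funM.
- exact: emeasurable_funM.
- by move=> x _; rewrite mule_ge0// Radon_Nikodym_SigmaFinite.f_ge0.
- by move=> x _; rewrite mule_ge0// lee_fin normal_pdf_ge0.
have : ae_eq leb setT (Radon_Nikodym_SigmaFinite.f (normal_prob 0 sigma) leb)
    (fun x => (normal_pdf 0 sigma x)%:E).
  apply: integral_ae_eq => // [A _ mA].
  by rewrite -Radon_Nikodym_SigmaFinite.f_integral.
by apply: filterS => x /= h _; rewrite h.
Qed.

Lemma lebesgue_translate (b : R) (f : measurableTypeR R -> \bar R) :
  measurable_fun setT f -> (forall x, 0 <= f x) ->
  \int[leb]_x f (x - b)%R = \int[leb]_x f x.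
Proof.
move=> mf f0; pose phi (x : measurableTypeR R) : measurableTypeR R := (x - b)%R.
have mphi : measurable_fun setT phi by exact: measurable_funB.
transitivity (\int[pushforward leb phi]_x f x).
  by rewrite ge0_integral_pushforward// preimage_setT.
apply: eq_measure_integral => /= A mA _.
apply/esym/(@lebesgue_measure_unique R (pushforward leb phi)) => // _ [[x y] _ <-].
transitivity (leb `](x + b)%R, (y + b)%R]%classic); last first.
  congr (leb _); apply/seteqP; split=> z /=; rewrite /phi !in_itv/= => /andP[? ?]; apply/andP; split; lra.
rewrite !lebesgue_measure_itv/= !lte_fin ltrD2r; case: ifP => // _.
by rewrite -!EFinD; congr EFin; ring.
Qed.

(** One-dimensional Cameron-Martin formula: the exponential weight completes the square in the
    density, and Lebesgue measure is invariant under translation. *)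
Lemma normal_shift (s c : R) (f : measurableTypeR R -> \bar R) : (0 < s)%R ->
  measurable_fun setT f -> (forall x, 0 <= f x) ->
  \int[normal_prob 0 (Num.sqrt s)]_x ((expR (c * x - c ^+ 2 * s / 2))%:E * f (x - c * s)%R) =
  \int[normal_prob 0 (Num.sqrt s)]_x f x.
Proof.
move=> s0 mf f0.
have mphi : measurable_fun setT (fun x : measurableTypeR R => x - c * s : measurableTypeR R)%R.
  exact: measurable_funB.
have mfphi := measurableT_comp mf mphi.
rewrite !normal_integral//; first last.
- by move=> x; rewrite mule_ge0// lee_fin expR_ge0.
- apply: emeasurable_funM => //; apply/measurable_EFinP.
  apply: measurableT_comp; first exact: measurable_expR.
  by apply: measurable_funB => //; exact: measurable_funM.
have mpdf : measurable_fun setT (fun x : measurableTypeR R => (normal_pdf 0 (Num.sqrt s) x)%:E).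
  by apply/measurable_EFinP; exact: measurable_normal_pdf.
rewrite -[RHS](@lebesgue_translate (c * s)%R); last 2 first.
- exact: emeasurable_funM.
- by move=> x; rewrite mule_ge0// lee_fin normal_pdf_ge0.
apply: eq_integral => x _; rewrite muleAC muleC; congr (_ * _).
have sq0 : (Num.sqrt s != 0)%R by rewrite gt_eqF// sqrtr_gt0.
rewrite -EFinM !normal_pdfE// /normal_fun sqr_sqrtr ?(ltW s0)//; congr EFin.
rewrite mulrCA -expRD; congr (_ * expR _)%R.
by field; rewrite gt_eqF.
Qed.

Lemma normal_sym (s : R) (C : set (measurableTypeR R)) : (0 < s)%R -> measurable C ->
  normal_prob 0 (Num.sqrt s) (-%R @^-1` C) = normal_prob 0 (Num.sqrt s) C.
Proof.
move=> s0 mC.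
have mN : measurable_fun setT (-%R : measurableTypeR R -> measurableTypeR R) by exact: oppr_measurable.
have mNC : measurable ((-%R : measurableTypeR R -> measurableTypeR R) @^-1` C).
  by rewrite -[X in measurable X]setTI; exact: mN.
have mpdf : measurable_fun setT (fun x : measurableTypeR R => (normal_pdf 0 (Num.sqrt s) x)%:E).
  by apply/measurable_EFinP; exact: measurable_normal_pdf.
transitivity (\int[pushforward leb (-%R : _ -> measurableTypeR R)]_(x in C) (normal_pdf 0 (Num.sqrt s) x)%:E).
  rewrite (ge0_integral_pushforward mN leb mC (measurable_funTS mpdf)); last first.
    by move=> x _; rewrite lee_fin normal_pdf_ge0.
  rewrite /normal_prob; apply: eq_integral => x _ /=.
  have sq0 : (Num.sqrt s != 0)%R by rewrite gt_eqF// sqrtr_gt0.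
  by rewrite !normal_pdfE// /normal_fun !subr0 sqrrN.
by apply: eq_measure_integral => /= A mA _; exact: lebesgue_measureN.
Qed.

End normal_calculus.

Section image_measure.
Context (R : realType) (d1 d2 : measure_display) (A : measurableType d1) (B : measurableType d2).

(* [pushforward] bundled with the measurability of the map, which canonical
   structure inference cannot find by itself. *)
Definition image_measure (mu : {measure set A -> \bar R}) (f : A -> B)
  (mf : measurable_fun setT f) : {measure set B -> \bar R} :=
  measure_function_pushforward__canonical__measure_function_Measure mu mf.

End image_measure.

Section joint_law.
Context (R : realType) (d1 d2 d3 : measure_display) (A : measurableType d1)
  (B : measurableType d2) (C : measurableType d3).

(** Independence on rectangles identifies the joint law of [(g, f)] with a product measure, to which
    Tonelli's theorem applies. *)
Lemma indep_joint (P : probability A R) (nu : probability C R) (g : A -> B) (f : A -> C)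
  (h : B * C -> \bar R) : measurable_fun setT g -> measurable_fun setT f ->
  (forall E F, measurable E -> measurable F -> P (g @^-1` E `&` f @^-1` F) = (P (g @^-1` E) * nu F)%E) ->
  measurable_fun setT h -> (forall x, 0 <= h x)%E ->
  (\int[P]_a h (g a, f a) = \int[P]_a \int[nu]_y h (g a, y))%E.
Proof.
move=> mg mf ind mh h0.
pose gm : {mfun A >-> B} := HB.pack g (isMeasurableFun.Build _ _ _ _ g mg).
have mgf : measurable_fun setT (fun a => (g a, f a)) by exact: measurable_fun_pair.
pose gf : {mfun A >-> (B * C)%type} := HB.pack (fun a => (g a, f a)) (isMeasurableFun.Build _ _ _ _ _ mgf).
transitivity (\int[distribution P gf]_z h z)%E.
  by rewrite ge0_integral_distribution.
transitivity (\int[distribution P gm \x nu]_z h z)%E.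
  apply: eq_measure_integral => D mD _; apply/esym.
  apply: (@product_measure_unique _ _ _ _ _ (distribution P gm) nu (distribution P gf)) => // E F mE mF.
rewrite fubini_tonelli1// ge0_integral_distribution//.
  exact: measurable_fun_fubini_tonelli_F.
by move=> y; exact: integral_ge0.
Qed.

End joint_law.

Section gaussian_vectors.
Context (R : realType) (d : nat).
Implicit Types (s : R) (y c : 'rV[R]_d) (g : probability 'rV[R]_d R).

(** The law N(0, s I_d), given on boxes so as to match [brownian_increments]. *)
Definition gaussian_law g s : Prop := forall C : 'I_d -> set (measurableTypeR R),
  (forall i, measurable (C i)) ->
  g [set y : 'rV[R]_d | forall i, C i (y 0 i)] = (\prod_i normal_prob 0 (Num.sqrt s) (C i))%E.

Definition upd y (i : 'I_d) (t : R) : 'rV[R]_d := \row_j (if j == i then t else y 0 j).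

Lemma updE y i : upd y i (y 0 i) = y.
Proof. by apply/rowP => j; rewrite mxE; case: eqP => [->|]. Qed.

Lemma upd_upd y i t t' : upd (upd y i t) i t' = upd y i t'.
Proof. by apply/rowP => j; rewrite !mxE; case: eqP. Qed.

Lemma measurable_upd i :
  measurable_fun setT (fun p : 'rV[R]_d * measurableTypeR R => upd p.1 i p.2).
Proof.
apply: measurable_fun_rV => // j.
apply: (@eq_measurable_fun _ _ _ _ _ (fun p : 'rV[R]_d * measurableTypeR R => if j == i then p.2 else p.1 0 j)).
  by move=> p _; rewrite mxE.
case: (j == i); first exact: measurable_snd.
exact: (measurableT_comp (@measurable_coord R d j) (@measurable_fst _ _ 'rV[R]_d (measurableTypeR R))).
Qed.

(** The coordinate [i] is independent of the others. The others are represented by the vector whose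
    coordinate [i] is reset to 0, which avoids splitting the vector space. *)
Lemma gaussian_split g s i (F : 'rV[R]_d -> \bar R) : gaussian_law g s ->
  measurable_fun setT F -> (forall y, 0 <= F y)%E ->
  (\int[g]_y F y = \int[g]_y \int[normal_prob 0 (Num.sqrt s)]_t F (upd y i t))%E.
Proof.
move=> hg mF F0.
have mu0 : measurable_fun setT (fun y : 'rV[R]_d => upd y i 0).
  apply: measurable_fun_rV => // j.
  apply: (@eq_measurable_fun _ _ _ _ _ (fun y : 'rV[R]_d => if j == i then 0 else y 0 j)).
    by move=> p _; rewrite mxE.
  by case: (j == i) => //; exact: measurable_coord.
have mci : measurable_fun setT (fun y : 'rV[R]_d => y 0 i : measurableTypeR R) by exact: measurable_coord.
transitivity (\int[g]_y F (upd (upd y i 0) i (y ord0 i)))%E.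
  by apply: eq_integral => y _; rewrite upd_upd updE.
have mh : measurable_fun setT (fun p : 'rV[R]_d * measurableTypeR R => F (upd p.1 i p.2)).
  by apply: (measurableT_comp mF); exact: measurable_upd.
apply: (etrans (@indep_joint _ _ _ _ _ _ _ g (normal_prob 0 (Num.sqrt s)) (fun y => upd y i 0)
    (fun y => y 0 i) (fun p => F (upd p.1 i p.2)) mu0 mci _ mh (fun p => F0 _))); last first.
  by apply: eq_integral => y _; apply: eq_integral => t _ /=; rewrite upd_upd.
- move=> E C mE mC.
  have mCi : measurable ((fun y : 'rV[R]_d => y 0 i) @^-1` C).
    by rewrite -[X in measurable X]setTI; exact: mci.
  pose N : probability _ R := normal_prob 0 (Num.sqrt s).
  have NC0 : (0 <= fine (N C)) by exact: fine_ge0.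
  have NCE : ((fine (N C))%:E = N C) by rewrite fineK// fin_num_measure.
  (* As functions of [E] both sides are finite measures, so boxes suffice; the preimage of a box is
     empty when its side number [i] misses 0. *)
  pose m1 := image_measure (mrestr g mCi) mu0.
  pose m2 : {measure set _ -> \bar R} := mscale (NngNum NC0) (image_measure g mu0).
  have m12 : forall A, measurable A -> m1 A = m2 A.
    apply: measure_rV_unique.
      by rewrite /m1 /= /pushforward /mrestr preimage_setT setTI; apply: le_lt_trans (probability_le1 g mCi) (ltry _).
    move=> D mD; rewrite /m1 /m2 /= /mscale /image_measure/= /pushforward /mrestr/= NCE.
    have prodE (C' : set (measurableTypeR R)) : measurable C' ->
        g [set y : 'rV[R]_d | forall j, (if j == i then C' else D j) (y 0 j)] =
        (N C' * \prod_(j | j != i) normal_prob 0 (Num.sqrt s) (D j))%E.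
      move=> mC'; rewrite (hg (fun j => if j == i then C' else D j)); last by move=> j; case: (j == i) => //; exact: mD.
      rewrite (bigD1 i)//= eqxx; congr (_ * _)%E.
      by apply: eq_bigr => j /negPf ->.
    have [Di|Di] := pselect (D i 0).
      rewrite (_ : (fun y => upd y i 0) @^-1` _ = [set y : 'rV[R]_d | forall j, (if j == i then setT else D j) (y 0 j)]); last first.
        apply/seteqP; split=> [y h j|y h j /=].
          by have := h j; rewrite /= mxE; case: eqP.
        by have := h j; rewrite mxE; case: eqP => // ->.
      rewrite (_ : _ `&` _ = [set y : 'rV[R]_d | forall j, (if j == i then C else D j) (y 0 j)]); last first.
        apply/seteqP; split=> [y [h hC] j|y h].
          by have := h j; case: eqP => // ->.
        split=> [j|]; last by have := h i; rewrite eqxx.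
        by have := h j; case: eqP.
      by rewrite !prodE// [N setT]probability_setT mul1e.
    rewrite (_ : (fun y => upd y i 0) @^-1` _ = set0); first by rewrite set0I !measure0 mule0.
    by apply/seteqP; split=> // y /= /(_ i); rewrite mxE eqxx.
  have := m12 E mE; rewrite /m1 /m2 /= /mscale /image_measure/= /pushforward /mrestr/= NCE => ->.
  by rewrite muleC.
Qed.

Definition dot c y : R := \sum_i c 0 i * y 0 i.
Definition sqn c : R := \sum_i c 0 i ^+ 2.
Definition nrm1 y : R := \sum_i `|y 0 i|.

Lemma measurable_rVD (f g : 'rV[R]_d -> 'rV[R]_d) : measurable_fun setT f -> measurable_fun setT g ->
  measurable_fun setT (fun y => f y + g y).
Proof.
move=> mf mg; apply: measurable_fun_rV => // i.
apply: (@eq_measurable_fun _ _ _ _ _ (fun y => f y 0 i + g y 0 i)); first by move=> y _; rewrite mxE.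
by apply: measurable_funD; [exact: (measurableT_comp (measurable_coord i) mf)|
  exact: (measurableT_comp (measurable_coord i) mg)].
Qed.

Lemma measurable_dot c : measurable_fun setT (dot c).
Proof.
apply: measurable_sum => i; apply: measurable_funM => //; exact: measurable_coord.
Qed.

Lemma measurable_nrm1 : measurable_fun setT nrm1.
Proof.
by apply: measurable_sum => i; apply: measurableT_comp => //; exact: measurable_coord.
Qed.

Lemma gaussian_shift1 g s i (c : R) (F : 'rV[R]_d -> \bar R) : 0 < s -> gaussian_law g s ->
  measurable_fun setT F -> (forall y, 0 <= F y)%E ->
  (\int[g]_y ((expR (c * y ord0 i - c ^+ 2 * s / 2))%:E * F (y - (c * s) *: delta_mx 0 i)%R) = \int[g]_y F y)%E.
Proof.
move=> s0 hg mF F0.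
have mFs (k : 'rV[R]_d) : measurable_fun setT (fun y : 'rV[R]_d => F (y - k)).
  by apply: measurableT_comp => //; apply: measurable_rVD => //; exact: measurable_cst.
apply: (etrans _ (esym (gaussian_split i hg mF F0))).
apply: (etrans (gaussian_split i hg _ _)).
- apply: emeasurable_funM => //; apply/measurable_EFinP.
  apply: measurableT_comp; first exact: measurable_expR.
  apply: measurable_funB => //; apply: measurable_funM => //; exact: measurable_coord.
- by move=> y; rewrite mule_ge0// lee_fin expR_ge0.
apply: eq_integral => y _.
have mFu : measurable_fun setT (fun t : measurableTypeR R => F (upd y i t)).
  apply: (measurableT_comp mF); apply: measurable_fun_rV => // j.
  apply: (@eq_measurable_fun _ _ _ _ _ (fun t : measurableTypeR R => if j == i then t else y 0 j)).
    by move=> p _; rewrite mxE.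
  by case: (j == i).
transitivity (\int[normal_prob 0 (Num.sqrt s)]_t ((expR (c * t - c ^+ 2 * s / 2))%:E * F (upd y i (t - c * s)%R)))%E;
  last exact: (normal_shift c s0 mFu (fun t => F0 _)).
apply: eq_integral => t _; rewrite mxE eqxx; congr (_ * F _)%E.
apply/rowP => j; rewrite /upd !mxE eqxx/=; case: (j == i); first by rewrite mulr1.
by rewrite mulr0 subr0.
Qed.

(** The Cameron-Martin formula in one coordinate is applied successively; distinctness of the
    coordinates keeps the remaining weights untouched by the translation. *)
Lemma gaussian_shift g s c (F : 'rV[R]_d -> \bar R) : 0 < s -> gaussian_law g s ->
  measurable_fun setT F -> (forall y, 0 <= F y)%E ->
  (\int[g]_y ((expR (dot c y - sqn c * s / 2))%:E * F (y - s *: c)%R) = \int[g]_y F y)%E.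
Proof.
move=> s0 hg mF F0.
have mFs (k : 'rV[R]_d) : measurable_fun setT (fun y : 'rV[R]_d => F (y - k)).
  by apply: measurableT_comp => //; apply: measurable_rVD => //; exact: measurable_cst.
suff H (r : seq 'I_d) : uniq r ->
    (\int[g]_y ((expR (\sum_(i <- r) (c ord0 i * y ord0 i - c ord0 i ^+ 2 * s / 2)))%:E *
      F (y - \sum_(i <- r) (c ord0 i * s) *: delta_mx 0 i)%R) = \int[g]_y F y)%E.
  apply: (etrans _ (H (index_enum 'I_d) (index_enum_uniq _))); apply: eq_integral => y _.
  rewrite sumrB -!mulr_suml; congr (_ * F (_ - _)%R)%E.
  by apply/rowP => j; rewrite !mxE summxE (bigD1 j)//= big1 ?addr0 ?mxE ?eqxx ?mulr1 1?mulrC// => k kj; rewrite !mxE eqxx/= eq_sym (negPf kj) mulr0.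
elim: r => [_|i r ih /= /andP[ir ur]].
  by apply: eq_integral => y _; rewrite !big_nil expR0 mul1e subr0.
apply: (etrans _ (ih ur)); apply: (etrans _ (gaussian_shift1 i (c ord0 i) s0 hg _ _)); last 2 first.
- apply: emeasurable_funM => //; apply/measurable_EFinP.
  apply: measurableT_comp; first exact: measurable_expR.
  apply: measurable_sum => j; apply: measurable_funB => //; apply: measurable_funM => //; exact: measurable_coord.
- by move=> y; rewrite mule_ge0// lee_fin expR_ge0.
apply: eq_integral => y _; rewrite !big_cons expRD EFinM -muleA; congr (_ * (_ * F _))%E.
  congr (expR _)%:E; apply: eq_big_seq => j jr; rewrite !mxE eqxx/=.
  have /negPf -> : j != i by apply: contra ir => /eqP <-.
  by rewrite mulr0 subr0.
by rewrite opprD addrA.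
Qed.

Lemma gaussian_exp g s c : 0 < s -> gaussian_law g s ->
  (\int[g]_y (expR (dot c y))%:E = (expR (sqn c * s / 2))%:E)%E.
Proof.
move=> s0 hg.
have := gaussian_shift c s0 hg (@measurable_cst _ _ _ _ setT 1%E) (fun=> lee01).
rewrite [RHS](integral_cst g measurableT 1%E) mul1e prob_mass => h.
rewrite -[RHS]mule1 -h -ge0_integralZl//; last 2 first.
- apply: emeasurable_funM => //; apply/measurable_EFinP.
  apply: measurableT_comp; first exact: measurable_expR.
  by apply: measurable_funB => //; exact: measurable_dot.
- by move=> y _; rewrite mule1 lee_fin expR_ge0.
apply: eq_integral => y _; rewrite /cst mule1 -EFinM -expRD; congr (expR _)%:E; ring.
Qed.

(** Each factor [exp (a |y_i|)] is at most [exp (a y_i) + exp (- a y_i)]. Expanding the product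
    gives [2 ^ d] exponentials of linear forms, one per choice of signs, all with the same
    expectation. *)
Lemma gaussian_exp_nrm1 g s a : 0 < s -> gaussian_law g s ->
  (\int[g]_y (expR (a * nrm1 y))%:E <= (2 ^+ d * expR (a ^+ 2 * s * d%:R / 2))%:E)%E.
Proof.
move=> s0 hg.
pose c (e : {ffun 'I_d -> bool}) : 'rV[R]_d := \row_i (if e i then a else - a).
have le y : expR (a * nrm1 y) <= \sum_(e : {ffun 'I_d -> bool}) expR (dot (c e) y).
  rewrite /nrm1 mulr_sumr expR_sum.
  apply: (le_trans (y := \prod_i \sum_(b : bool) expR ((if b then a else - a) * y 0 i))).
    apply: ler_prod => i _; rewrite expR_ge0/= big_bool/=.
    have [y0|y0] := ger0P (y 0 i); first by rewrite lerDl expR_ge0.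
    by rewrite mulrN mulNr lerDr expR_ge0.
  rewrite bigA_distr_bigA/=; apply: ler_sum => e _; rewrite -expR_sum ler_expR.
  by rewrite /dot; apply: ler_sum => i _; rewrite mxE.
apply: (le_trans (y := \int[g]_y (\sum_(e : {ffun 'I_d -> bool}) (expR (dot (c e) y))%:E))%E).
  apply: ge0_le_integral => //.
  - apply/measurable_EFinP; apply: measurableT_comp; first exact: measurable_expR.
    by apply: measurable_funM => //; exact: measurable_nrm1.
  - apply: emeasurable_sum => e; apply/measurable_EFinP.
    by apply: measurableT_comp; [exact: measurable_expR|exact: measurable_dot].
  - by move=> y _; rewrite sumEFin lee_fin.
rewrite ge0_integral_sum//; last first.
  move=> e; apply/measurable_EFinP.
  by apply: measurableT_comp; [exact: measurable_expR|exact: measurable_dot].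
under eq_bigr => e _ do rewrite (gaussian_exp _ s0 hg).
rewrite sumEFin lee_fin (eq_bigr (fun=> expR (a ^+ 2 * s * d%:R / 2))) => [|e _].
  by rewrite sumr_const card_ffun card_bool card_ord -[X in X <= _]mulr_natl natrX.
congr expR; rewrite /sqn (eq_bigr (fun=> a ^+ 2)) => [|i _].
  by rewrite sumr_const card_ord -mulr_natl; ring.
by rewrite mxE; case: ifP => //; rewrite sqrrN.
Qed.

Lemma gaussian_sym g s : 0 < s -> gaussian_law g s ->
  forall A, measurable A -> g ((-%R : 'rV[R]_d -> 'rV[R]_d) @^-1` A) = g A.
Proof.
move=> s0 hg A mA.
have mN : measurable_fun setT (-%R : 'rV[R]_d -> 'rV[R]_d).
  apply: measurable_fun_rV => // i.
  apply: (@eq_measurable_fun _ _ _ _ _ (fun y : 'rV[R]_d => - y 0 i)); first by move=> y _; rewrite mxE.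
  by apply: measurableT_comp => //; exact: measurable_coord.
apply: (@measure_rV_unique _ _ (image_measure g mN) g) => //.
  by rewrite /= /pushforward preimage_setT prob_mass ltry.
move=> C mC; rewrite [RHS](hg C mC).
transitivity (g [set y : 'rV[R]_d | forall i, (-%R @^-1` C i) (y 0 i)]).
  by congr (g _); apply/seteqP; split=> y h i; have := h i; rewrite /= mxE.
rewrite (hg (fun i => -%R @^-1` C i)) => [|i]; first by apply: eq_bigr => i _; exact: (normal_sym s0 (mC i)).
by rewrite -[X in measurable X]setTI; exact: oppr_measurable.
Qed.

Lemma gaussian_odd g s (F : 'rV[R]_d -> R) : 0 < s -> gaussian_law g s -> ing g F ->
  (forall y, F (- y) = - F y) -> Ex g F = 0.
Proof.
move=> s0 hg iF oF.
have mN : measurable_fun setT (-%R : 'rV[R]_d -> 'rV[R]_d).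
  apply: measurable_fun_rV => // i.
  apply: (@eq_measurable_fun _ _ _ _ _ (fun y : 'rV[R]_d => - y 0 i)); first by move=> y _; rewrite mxE.
  by apply: measurableT_comp => //; exact: measurable_coord.
have E : Ex g F = Ex g (fun y => F (- y)).
  rewrite /Ex /Rintegral; congr fine.
  transitivity (\int[image_measure g mN]_y (F y)%:E)%E.
    by apply: eq_measure_integral => A mA _; rewrite [RHS](gaussian_sym s0 hg).
  have mF : measurable_fun setT (EFin \o F) by apply/measurable_EFinP; exact: ing_meas iF.
  have hint : g.-integrable ((-%R : 'rV[R]_d -> 'rV[R]_d) @^-1` setT) ((EFin \o F) \o -%R).
    by apply: eq_integrable (ingN iF) => // y _ /=; rewrite oF.
  exact: (integral_pushforward mN mF hint measurableT).
have : Ex g F = - Ex g F.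
  rewrite {1}E -ExN//; congr Ex; apply/funext => y; exact: oF.
lra.
Qed.

End gaussian_vectors.

Import HBNNSimple.

(** * Measures given by a density *)

Section weighted_measure.
Context (R : realType) (dd : measure_display) (A : measurableType dd).
Variables (mu : {measure set A -> \bar R}) (f : A -> R).
Hypotheses (mf : measurable_fun setT f) (f0 : forall x, 0 <= f x).
Local Open Scope ereal_scope.

(** The proofs of measurability and nonnegativity are arguments, so that the measure structure can
    be attached to the term itself. *)
Definition weighted (_ : measurable_fun setT f) (_ : forall x, (0 <= f x)%R) :
  set A -> \bar R := fun B => \int[mu]_(x in B) (f x)%:E.
Local Notation nu := (weighted mf f0).

Let mfE : measurable_fun setT (EFin \o f). Proof. exact/measurable_EFinP. Qed.

Let weighted0 : nu set0 = 0. Proof. exact: integral_set0. Qed.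

Let weighted_ge0 B : 0 <= nu B.
Proof. by apply: integral_ge0 => x _; rewrite lee_fin. Qed.

Let weighted_sigma_additive : semi_sigma_additive nu.
Proof.
move=> F mF tF mUF; rewrite /weighted ge0_integral_bigcup//; last 2 first.
- exact: measurable_funTS.
- by move=> x _; rewrite lee_fin.
by apply: is_cvg_ereal_nneg_natsum_cond => n _ _; exact: weighted_ge0.
Qed.

HB.instance Definition _ := isMeasure.Build _ _ _ nu
  weighted0 weighted_ge0 weighted_sigma_additive.

Lemma integral_weighted (g : A -> \bar R) : measurable_fun setT g -> (forall x, 0 <= g x) ->
  \int[nu]_x g x = \int[mu]_x (g x * (f x)%:E).
Proof.
move=> mg g0; pose h := nnsfun_approx measurableT mg.
have cvg_h (x : A) : ((h n : A -> R) x)%:E @[n --> \oo] --> g x by exact: cvg_nnsfun_approx.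
have nd_h (x : A) : {homo (fun n => ((h n : A -> R) x)%:E) : n m / (n <= m)%N >-> n <= m}.
  by move=> n m nm; rewrite lee_fin; exact/lefP/nd_nnsfun_approx.
have gE : g = (fun x => limn (fun n => (h n x)%:E)).
  by apply/funext => x; apply/esym/cvg_lim => //; exact: cvg_h.
have -> : \int[nu]_x g x = limn (fun n => \int[nu]_x (h n x)%:E).
  rewrite {1}gE; apply: monotone_convergence => //.
  - by move=> n; exact/measurable_EFinP.
  - by move=> n x _; rewrite lee_fin.
have mhf n : measurable_fun setT (fun x => (h n x)%:E * (f x)%:E).
  by apply: emeasurable_funM => //; exact/measurable_EFinP.
have gfE : (fun x => g x * (f x)%:E) = (fun x => limn (fun n => (h n x)%:E * (f x)%:E)).
  by apply/funext => x; apply/esym/cvg_lim => //; apply: cvgeZr => //; exact: cvg_h.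
have -> : \int[mu]_x (g x * (f x)%:E) = limn (fun n => \int[mu]_x ((h n x)%:E * (f x)%:E)).
  rewrite gfE; apply: monotone_convergence => //.
  - by move=> n x _; rewrite mule_ge0// lee_fin.
  - by move=> x _ n m nm; rewrite lee_wpmul2r ?lee_fin//; exact: nd_h.
congr (limn _); apply/funext => n.
have mi r : measurable_fun setT (fun x => (r * \1_(h n @^-1` [set r]) x)%:E : \bar R).
  by apply/measurable_EFinP; apply: measurable_funM => //; exact: measurable_indic.
transitivity (\int[nu]_x (\sum_(y \in range (h n)) (y * \1_(h n @^-1` [set y]) x)%:E)).
  by apply: eq_integral => x _; rewrite fimfunE -fsumEFin.
rewrite ge0_integral_fsum//; last by move=> r x _; exact: nnfun_muleindic_ge0.
transitivity (\int[mu]_x (\sum_(y \in range (h n)) (y * \1_(h n @^-1` [set y]) x)%:E * (f x)%:E)); last first.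
  apply: eq_integral => x _; rewrite -ge0_mule_fsuml => [|y]; last exact: nnfun_muleindic_ge0.
  by rewrite fsumEFin// -fimfunE.
rewrite ge0_integral_fsum//; last 2 first.
- by move=> r; apply: emeasurable_funM.
- by move=> r x _; rewrite mule_ge0 ?lee_fin// -lee_fin; exact: nnfun_muleindic_ge0.
apply: eq_fsbigr => r /set_mem[x0 _ rE].
have r0 : (0 <= r)%R by rewrite -rE.
have mr : measurable (h n @^-1` [set r]) by exact: measurable_sfunP.
under eq_integral do rewrite EFinM.
rewrite ge0_integralZl//; last by apply/measurable_EFinP; exact: measurable_indic.
under [RHS]eq_integral do rewrite EFinM -muleA.
rewrite ge0_integralZl//; last 2 first.
- by apply: emeasurable_funM => //; apply/measurable_EFinP; exact: measurable_indic.
- by move=> x _; rewrite mule_ge0 ?lee_fin.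
rewrite integral_indic// setIT; congr (_ * _).
rewrite /weighted [LHS]integral_mkcond; apply: eq_integral => x _.
rewrite patchE indicE; case: (x \in _); rewrite ?mul1e ?mul0e//.
Qed.

End weighted_measure.

(** * Approximation in L^2 *)

Section L2_density.
Context (R : realType) (dd : measure_display) (A : measurableType dd).
Variable mu : {measure set A -> \bar R}.
Hypothesis mu_fin : (mu setT < +oo)%E.
Implicit Types f g : A -> R.

Definition L2dist2 f g : \bar R := (\int[mu]_x ((f x - g x) ^+ 2)%:E)%E.

Variable V : set (A -> R).
Hypothesis V_meas : forall v, V v -> measurable_fun setT v.
Hypothesis V_lin : forall (a : R) u v, V u -> V v -> V (fun x => a * u x + v x).
Hypothesis V0 : V (fun=> 0).

(** Membership in the L^2 closure of [V]. The squared distance is an extended real, so no square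
    integrability has to be known beforehand. *)
Definition approximable f : Prop := measurable_fun setT f /\
  forall e : R, 0 < e -> exists2 v, V v & (L2dist2 f v < e%:E)%E.

Lemma measurable_L2dist2 f g : measurable_fun setT f -> measurable_fun setT g ->
  measurable_fun setT (fun x => ((f x - g x) ^+ 2)%:E).
Proof.
by move=> mf mg; apply/measurable_EFinP; apply: measurable_funX; exact: measurable_funB.
Qed.

Lemma sqr_split_le (x y z : R) : (x - z) ^+ 2 <= 2 * (x - y) ^+ 2 + 2 * (y - z) ^+ 2.
Proof. by have := sqr_ge0 (x - 2 * y + z); nra. Qed.

Lemma approximable_lim f : measurable_fun setT f ->
  (forall e, 0 < e -> exists2 g, approximable g & (L2dist2 f g < e%:E)%E) -> approximable f.
Proof.
move=> mf fg; split=> // e e0.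
have e4 : 0 < e / 4 by rewrite divr_gt0.
have [g [mg ag] dg] := fg _ e4; have [v Vv dv] := ag _ e4.
have mv := V_meas Vv.
exists v => //.
apply: (@le_lt_trans _ _ (2%:E * L2dist2 f g + 2%:E * L2dist2 g v)%E); last first.
  have -> : e%:E = (2%:E * (e / 4)%:E + 2%:E * (e / 4)%:E)%E by rewrite -!EFinM -EFinD; congr EFin; lra.
  by apply: lteD; rewrite lte_pmul2l.
rewrite -!ge0_integralZl//; try (exact: measurable_L2dist2); try by move=> x _; rewrite lee_fin sqr_ge0.
rewrite -ge0_integralD//; first last.
- by apply: measurable_funeM; exact: measurable_L2dist2.
- by move=> x _; rewrite mule_ge0// lee_fin sqr_ge0.
- by apply: measurable_funeM; exact: measurable_L2dist2.
- by move=> x _; rewrite mule_ge0// lee_fin sqr_ge0.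
apply: ge0_le_integral => //.
- by move=> x _; rewrite lee_fin sqr_ge0.
- exact: measurable_L2dist2.
- by apply: emeasurable_funD; apply: measurable_funeM; exact: measurable_L2dist2.
- by move=> x _; rewrite -!EFinM -EFinD lee_fin; exact: sqr_split_le.
Qed.

Lemma approximableV v : V v -> approximable v.
Proof.
move=> Vv; split; first exact: V_meas.
move=> e e0; exists v => //; rewrite /L2dist2 integral0_eq//.
by move=> x _; rewrite subrr expr0n.
Qed.

Lemma approximable_lin (a : R) f g : approximable f -> approximable g ->
  approximable (fun x => a * f x + g x).
Proof.
move=> [mf af] [mg ag].
have maf : measurable_fun setT (fun x => a * f x + g x).
  by apply: measurable_funD => //; exact: measurable_funM.
split=> // e e0.
have e1 : 0 < e / (4 * (a ^+ 2 + 1)) by rewrite divr_gt0// mulr_gt0// ltr_wpDl// sqr_ge0.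
have e4 : 0 < e / 4 by rewrite divr_gt0.
have [u Vu du] := af _ e1; have [v Vv dv] := ag _ e4.
have mv := V_meas Vv; have mu' := V_meas Vu.
exists (fun x => a * u x + v x); first exact: V_lin.
have c1 : 0 < 2 * (a ^+ 2 + 1) by rewrite mulr_gt0// ltr_wpDl// sqr_ge0.
have le_e : ((2 * (a ^+ 2 + 1))%:E * L2dist2 f u + 2%:E * L2dist2 g v < e%:E)%E.
  have -> : e%:E = ((2 * (a ^+ 2 + 1))%:E * (e / (4 * (a ^+ 2 + 1)))%:E + 2%:E * (e / 4)%:E)%E.
    by rewrite -!EFinM -EFinD; congr EFin; field; rewrite gt_eqF// ltr_wpDl// sqr_ge0.
  by apply: lteD; rewrite lte_pmul2l.
apply: le_lt_trans le_e.
have c0 : 0 <= 2 * (a ^+ 2 + 1) by rewrite mulr_ge0// addr_ge0// sqr_ge0.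
rewrite -!ge0_integralZl//; try (exact: measurable_L2dist2); try by move=> x _; rewrite lee_fin sqr_ge0.
rewrite -ge0_integralD//; first last.
- by apply: measurable_funeM; exact: measurable_L2dist2.
- by move=> x _; rewrite mule_ge0// lee_fin sqr_ge0.
- by apply: measurable_funeM; exact: measurable_L2dist2.
- by move=> x _; rewrite mule_ge0// lee_fin ?sqr_ge0.
apply: ge0_le_integral => //.
- by move=> x _; rewrite lee_fin sqr_ge0.
- by apply: measurable_L2dist2 => //; apply: measurable_funD => //; exact: measurable_funM.
- by apply: emeasurable_funD; apply: measurable_funeM; exact: measurable_L2dist2.
- move=> x _; rewrite -!EFinM -EFinD lee_fin.
  have h1 := sqr_ge0 (a * (f x - u x) - (g x - v x)); have h2 := sqr_ge0 (f x - u x).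
  nra.
Qed.

Lemma approximable_sum (I : Type) (s : seq I) (a : I -> R) (F : I -> A -> R) :
  (forall i, approximable (F i)) -> approximable (fun x => \sum_(i <- s) a i * F i x).
Proof.
move=> aF; elim: s => [|i s ih].
  by under eq_fun do rewrite big_nil; exact: approximableV.
by under eq_fun do rewrite big_cons; exact: approximable_lin.
Qed.

Lemma approximable_cvg f (g : A -> R) (F : nat -> A -> R) : measurable_fun setT f ->
  (forall n, approximable (F n)) -> (forall x, F ^~ x @ \oo --> f x) ->
  ing mu g -> (forall n x, (f x - F n x) ^+ 2 <= g x) -> approximable f.
Proof.
move=> mf aF Ff ig Fg; apply: approximable_lim => // e e0.
have mF n : measurable_fun setT (F n) by case: (aF n).
have h : (L2dist2 f (F n) @[n --> \oo] --> 0)%E.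
  have cv : {ae mu, forall x, setT x -> (((f x - F n x) ^+ 2)%:E @[n --> \oo] --> 0)%E}.
    apply: aeW => x _; apply/fine_cvgP; split; first exact: nearW.
    rewrite (_ : _ \o _ = (fun n => (f x - F n x) ^+ 2)); last exact/funext.
    rewrite -[X in _ --> X](_ : (f x - f x) ^+ 2 = 0); last by rewrite subrr expr0n.
    by apply: (@cvg_comp _ _ _ (fun n => f x - F n x) (fun y => y ^+ 2) _ (nbhs (f x - f x)));
      [apply: cvgB; [exact: cvg_cst|exact: Ff]|exact: exprn_continuous].
  have dm : {ae mu, forall x n, setT x -> (`|((f x - F n x) ^+ 2)%:E| <= (g x)%:E)%E}.
    by apply: aeW => x n _; rewrite /= lee_fin ger0_norm ?sqr_ge0.
  have [_ _] := @dominated_convergence _ _ _ mu setT measurableT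
    (fun n x => ((f x - F n x) ^+ 2)%:E) (fun=> 0%E) (EFin \o g)
    (fun n => measurable_L2dist2 mf (mF n)) (measurable_cst _) cv ig dm.
  by rewrite integral0.
have /fine_cvgP[h1 /cvgrPdist_lt/(_ e e0) h2] := h.
near \oo => n.
exists (F n) => //.
have h1n : L2dist2 f (F n) \is a fin_num by near: n.
rewrite -(fineK h1n) lte_fin.
have : `|0 - fine (L2dist2 f (F n))| < e by near: n.
by rewrite sub0r normrN => /(le_lt_trans (ler_norm _)).
Unshelve. all: by end_near. Qed.

Variable G : set (set A).
Hypothesis G_gen : @measurable _ A = <<s G >>.
Hypothesis G_setI : setI_closed G.
Hypothesis G_app : forall B, G B -> approximable (\1_B).
Hypothesis T_app : approximable (fun=> 1).

(** Dynkin's argument: the sets with approximable indicator form a lambda-system containing the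
    pi-system [G]. *)
Lemma approximable_indic B : measurable B -> approximable (\1_B).
Proof.
move=> mB; pose H := [set B | measurable B /\ approximable (\1_B)].
suff : <<s setT, G >> `<=` H by rewrite -G_gen => /(_ B mB)[].
apply: lambda_system_subset => //; last first.
  by move=> C GC; split; [rewrite G_gen; exact: sub_sigma_algebra|exact: G_app].
split => //.
- by split => //; rewrite indicT.
- move=> C D CD [mC aC] [mD aD]; split; first exact: measurableD.
  have := approximable_lin (-1) aD aC; congr approximable; apply/funext => x.
  rewrite !indicE in_setD; have [xD|xD] := boolP (x \in D).
    by rewrite (mem_set (CD _ (set_mem xD))) mulr1 addNr.
  by rewrite mulr0 add0r andbT.
- move=> F ndF HF; have mF n : measurable (F n) by case: (HF n).
  have mU : measurable (\bigcup_n F n) by exact: bigcup_measurable.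
  split=> //; apply: (@approximable_cvg _ (fun=> 1) (fun n => \1_(F n))).
  - exact: measurable_indic.
  - by move=> n; case: (HF n).
  - move=> x; have [[n _ Fnx]|nU] := pselect ((\bigcup_n F n) x).
      apply: cvg_near_cst; near=> m; rewrite !indicE !mem_set//; first by exists n.
      by apply: (subsetPset _ _ (ndF n m _)) => //; near: m; exact: nbhs_infty_ge.
    apply: cvg_near_cst; apply: nearW => m; rewrite !indicE !memNset//.
    by move=> Fmx; apply: nU; exists m.
  - by apply: (@ing_bounded _ _ _ mu 1) => // x; rewrite normr1.
  - move=> n x; rewrite !indicE; case: (_ \in _); case: (_ \in _);
    by rewrite ?subrr ?subr0 ?sub0r ?sqrrN ?expr0n ?expr1n//= ?ler01.
Unshelve. all: by end_near. Qed.

(** Simple functions increasing to a nonnegative function, then positive and negative parts. It is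
    applied to step processes on predictable rectangles and to Lipschitz functionals on path
    space. *)
Lemma approximable_L2 f : measurable_fun setT f -> ing mu (fun x => f x ^+ 2) -> approximable f.
Proof.
have pos g : measurable_fun setT g -> (forall x, 0 <= g x) -> ing mu (fun x => g x ^+ 2) -> approximable g.
  move=> mg g0 ig.
  have mgE : measurable_fun setT (EFin \o g) by exact/measurable_EFinP.
  pose h := nnsfun_approx measurableT mgE.
  have cvg_h x : h ^~ x @ \oo --> g x.
    have : (h n x)%:E @[n --> \oo] --> (g x)%:E by apply: (cvg_nnsfun_approx _ mgE) => // y _; rewrite lee_fin.
    by move=> /fine_cvgP[].
  have h_le n x : h n x <= g x.
    have nd : {homo (fun n => h n x) : n m / (n <= m)%N >-> n <= m}.
      by move=> k m km; exact/lefP/nd_nnsfun_approx.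
    rewrite -(cvg_lim _ (cvg_h x))//.
    by apply: nondecreasing_cvgn_le => //; apply/cvg_ex; exists (g x); exact: cvg_h.
  apply: (@approximable_cvg _ (fun x => g x ^+ 2) h) => //.
    move=> n; have -> : (h n : A -> R) = (fun x => \sum_(y \in range (h n)) y * \1_(h n @^-1` [set y]) x).
      by apply/funext => x; exact: fimfunE.
    under eq_fun do rewrite fsbig_finite//.
    by apply: approximable_sum => y; apply: approximable_indic; exact: measurable_sfunP.
  move=> n x; have hx0 : 0 <= h n x by []. 
  have := h_le n x; nra.
move=> mf if2.
have mp : measurable_fun setT (fun x => Num.max (f x) 0) by exact: measurable_maxr.
have mn : measurable_fun setT (fun x => Num.max (- f x) 0) by apply: measurable_maxr => //; exact: measurableT_comp.
have ap : approximable (fun x => Num.max (f x) 0).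
  apply: pos => // [x|]; first by rewrite le_max lexx orbT.
  apply: (ing_dom _ if2); first exact: measurable_funX.
  move=> x; rewrite ger0_norm ?sqr_ge0// /Num.max; case: ifP => // _.
  by rewrite expr0n sqr_ge0.
have an : approximable (fun x => Num.max (- f x) 0).
  apply: pos => // [x|]; first by rewrite le_max lexx orbT.
  apply: (ing_dom _ if2); first exact: measurable_funX.
  move=> x; rewrite ger0_norm ?sqr_ge0// /Num.max; case: ifP => // _; rewrite ?sqrrN//.
  by rewrite expr0n sqr_ge0.
have := approximable_lin (-1) an ap; congr approximable; apply/funext => x.
by rewrite /Num.max; do 2 case: ifPn; rewrite -?leNgt; lra.
Qed.

End L2_density.

Section vector_measurability.
Context (R : realType) (d : nat) (dd : measure_display) (A : measurableType dd).
Implicit Types f g : A -> 'rV[R]_d.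

Lemma measurable_coordT f i : measurable_fun setT f -> measurable_fun setT (fun a => f a 0 i : R).
Proof. by move=> mf; apply: (measurableT_comp (measurable_coord i) mf). Qed.

Lemma measurable_addv f g : measurable_fun setT f -> measurable_fun setT g ->
  measurable_fun setT (fun a => f a + g a).
Proof.
move=> mf mg; apply: measurable_fun_rV => // i.
apply: (@eq_measurable_fun _ _ _ _ _ (fun a => f a 0 i + g a 0 i)); first by move=> a _; rewrite mxE.
by apply: measurable_funD; exact: measurable_coordT.
Qed.

Lemma measurable_scalev (k : A -> R) f : measurable_fun setT k -> measurable_fun setT f ->
  measurable_fun setT (fun a => k a *: f a).
Proof.
move=> mk mf; apply: measurable_fun_rV => // i.
apply: (@eq_measurable_fun _ _ _ _ _ (fun a => k a * f a 0 i)); first by move=> a _; rewrite mxE.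
by apply: measurable_funM => //; exact: measurable_coordT.
Qed.

Lemma measurable_oppv f : measurable_fun setT f -> measurable_fun setT (fun a => - f a).
Proof.
move=> mf; apply: (@eq_measurable_fun _ _ _ _ _ (fun a => (-1) *: f a)); first by move=> a _; rewrite scaleN1r.
by apply: measurable_scalev => //; exact: measurable_cst.
Qed.

Lemma measurable_subv f g : measurable_fun setT f -> measurable_fun setT g ->
  measurable_fun setT (fun a => f a - g a).
Proof. by move=> mf mg; apply: measurable_addv => //; exact: measurable_oppv. Qed.

Lemma measurable_sumv (I : Type) (s : seq I) (F : I -> A -> 'rV[R]_d) :
  (forall i, measurable_fun setT (F i)) -> measurable_fun setT (fun a => \sum_(i <- s) F i a).
Proof.
move=> mF; elim: s => [|i s ih].
  by under eq_fun do rewrite big_nil; exact: measurable_cst.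
by under eq_fun do rewrite big_cons; exact: measurable_addv.
Qed.

Lemma measurable_sumr (I : Type) (s : seq I) (F : I -> A -> R) :
  (forall i, measurable_fun setT (F i)) -> measurable_fun setT (fun a => \sum_(i <- s) F i a).
Proof.
move=> mF; elim: s => [|i s ih].
  by under eq_fun do rewrite big_nil; exact: measurable_cst.
by under eq_fun do rewrite big_cons; exact: measurable_funD.
Qed.

Lemma measurable_prodr (I : Type) (s : seq I) (F : I -> A -> R) :
  (forall i, measurable_fun setT (F i)) -> measurable_fun setT (fun a => \prod_(i <- s) F i a).
Proof.
move=> mF; elim: s => [|i s ih].
  by under eq_fun do rewrite big_nil; exact: measurable_cst.
by under eq_fun do rewrite big_cons; exact: measurable_funM.
Qed.

Lemma measurable_dotv f g : measurable_fun setT f -> measurable_fun setT g ->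
  measurable_fun setT (fun a => dot (f a) (g a)).
Proof.
move=> mf mg; apply: measurable_sumr => i.
by apply: measurable_funM; exact: measurable_coordT.
Qed.

Lemma measurable_sqnv f : measurable_fun setT f -> measurable_fun setT (fun a => sqn (f a)).
Proof.
move=> mf; apply: measurable_sumr => i.
by apply: measurable_funX; exact: measurable_coordT.
Qed.

Lemma measurable_indic_comp (d' : measure_display) (B : measurableType d') (C : set B) (f : A -> B) :
  measurable C -> measurable_fun setT f -> measurable_fun setT (fun a => \1_C (f a) : R).
Proof. by move=> mC mf; exact: (measurableT_comp (f := \1_C : B -> R) (measurable_indic mC) mf). Qed.

End vector_measurability.

(** * Brownian motion on dyadic grids *)

Section brownian_grid.
Context (R : realType) (T : R) (d : nat) (T_gt0 : 0 < T).
Local Notation Om := (path_space T d).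
Local Notation FT s := (g_sigma_algebraType (@coord_events R T d s)).
Local Notation fm s := (@fmeas R T d _ _ s).

Lemma grid_itvS n k : (k < 2 ^ n)%N ->
  [/\ 0 <= grid T n k, grid T n k < grid T n k.+1 & grid T n k.+1 <= T].
Proof.
move=> kn; split.
- by have /andP[] := grid_itv T_gt0 (ltnW kn).
- exact: grid_lt.
- by have /andP[] := grid_itv T_gt0 kn.
Qed.

(** A Brownian motion for the canonical filtration with arbitrary initial law, as a functional of
    the path; continuity of its paths is supplied separately where it is used. *)
Definition gbm (P : probability Om R) (M : R -> Om -> 'rV[R]_d) : Prop :=
  (forall t, 0 <= t <= T -> fm t (M t)) /\
  brownian_increments T P (@canonical_filtration R T d) M.

Section fixed_process.
Variables (P : probability Om R) (M : R -> Om -> 'rV[R]_d).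
Hypothesis PM : gbm P M.

Lemma fmeas_diff s t : 0 <= s -> s <= t -> t <= T -> fm t (fun w => M t w - M s w).
Proof.
case: PM => aM _ s0 st tT; apply: (measurable_subv (A := FT t)).
  by apply: aM; rewrite tT (le_trans s0).
by apply: (fmeas_le st); apply: aM; rewrite s0 (le_trans st).
Qed.

(** The Gaussian law is read off as the law of the increment itself. *)
Lemma gauss_ex s t : 0 <= s -> s < t -> t <= T ->
  exists g : probability 'rV[R]_d R, gaussian_law g (t - s).
Proof.
move=> s0 st tT; have md := fmeas_meas (fmeas_diff s0 (ltW st) tT).
pose D : {mfun Om >-> 'rV[R]_d} := HB.pack (fun w => M t w - M s w) (isMeasurableFun.Build _ _ _ _ _ md).
exists (distribution P D) => C mC.
have [_ /(_ s t setT C s0 st tT (@filtrationT R T d s) mC)] := PM.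
by rewrite setTI prob_mass mul1e.
Qed.

Lemma brownian_indep s t (g : probability 'rV[R]_d R) (E : set Om) (B : set 'rV[R]_d) :
  0 <= s -> s < t -> t <= T -> gaussian_law g (t - s) ->
  canonical_filtration s E -> measurable B ->
  P (E `&` (fun w => M t w - M s w) @^-1` B) = (P E * g B)%E.
Proof.
move=> s0 st tT hg FE mB; have md := fmeas_meas (fmeas_diff s0 (ltW st) tT).
have mE := filtration_measurable FE.
pose r : {nonneg R} := NngNum (fine_ge0 (measure_ge0 P E)).
pose m1 := image_measure (mrestr P mE) md.
pose m2 := mscale r g.
have PEf : (fine (P E))%:E = P E by rewrite fineK// fin_num_measure.
have : m1 B = m2 B.
  apply: measure_rV_unique => //.
    change (P (setT `&` E) < +oo)%E; rewrite setTI.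
    by rewrite (le_lt_trans (probability_le1 P mE))// ltry.
  move=> C mC; change (P ([set w | forall i, C i ((M t w - M s w)%R 0 i)] `&` E) =
    ((fine (P E))%:E * g [set y : 'rV[R]_d | forall i, C i (y 0%R i)])%E).
  have [_ /(_ s t E C s0 st tT FE mC)] := PM.
  by rewrite (hg C mC) PEf setIC => <-.
change (P (((fun w => M t w - M s w)%R @^-1` B) `&` E) = ((fine (P E))%:E * g B)%E -> P (E `&` (fun w => M t w - M s w)%R @^-1` B) = (P E * g B)%E).
by rewrite PEf setIC.
Qed.

(** The freezing lemma: the past is held fixed while the increment is integrated out. That [h]
    depends on the past only up to time [s] is encoded in the type [FT s] of its first argument. *)
Lemma brownian_step s t (g : probability 'rV[R]_d R) (h : (FT s * 'rV[R]_d)%type -> \bar R) :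
  0 <= s -> s < t -> t <= T -> gaussian_law g (t - s) ->
  measurable_fun setT h -> (forall x, 0 <= h x)%E ->
  (\int[P]_w h (w, (M t w - M s w)%R) = \int[P]_w \int[g]_y h (w, y))%E.
Proof.
move=> s0 st tT hg mh h0.
apply: (@indep_joint _ _ _ _ Om (FT s) 'rV[R]_d P g id (fun w => M t w - M s w) h) => //.
- by move=> _ C mC; rewrite setTI; exact: (filtration_measurable mC).
- exact: fmeas_meas (fmeas_diff s0 (ltW st) tT).
- by move=> E F FE mF; exact: brownian_indep.
Qed.

Lemma fmeas_step s t (dd : measure_display) (B : measurableType dd) (h : (FT s * 'rV[R]_d)%type -> B) :
  0 <= s -> s <= t -> t <= T -> measurable_fun setT h ->
  fm t (fun w => h (w, M t w - M s w)).
Proof.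
move=> s0 st tT mh; apply: (measurableT_comp (T1 := FT t) mh).
apply: measurable_fun_pair; first by apply: (@fmeas_le _ _ _ _ (FT s) s t id st); exact: measurable_id.
exact: fmeas_diff.
Qed.

Definition incr n k w := M (grid T n k.+1) w - M (grid T n k) w.

Variables (n : nat) (g : probability 'rV[R]_d R).
Hypothesis hg : gaussian_law g (mesh T n).

Lemma incr_law k : gaussian_law g (grid T n k.+1 - grid T n k).
Proof. by rewrite gridS addrAC subrr add0r. Qed.

Lemma fmeas_incr k : (k < 2 ^ n)%N -> fm (grid T n k.+1) (incr n k).
Proof. by move=> /grid_itvS[g0 gl gT]; apply: fmeas_diff => //; exact: ltW. Qed.

Lemma incr_step k (h : (FT (grid T n k) * 'rV[R]_d)%type -> \bar R) : (k < 2 ^ n)%N ->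
  measurable_fun setT h -> (forall x, 0 <= h x)%E ->
  (\int[P]_w h (w, incr n k w) = \int[P]_w \int[g]_y h (w, y))%E.
Proof. by move=> /grid_itvS[g0 gl gT] mh h0; exact: (brownian_step g0 gl gT (incr_law k) mh h0). Qed.

Lemma fmeas_incr_step k (dd : measure_display) (B : measurableType dd)
  (h : (FT (grid T n k) * 'rV[R]_d)%type -> B) : (k < 2 ^ n)%N ->
  measurable_fun setT h -> fm (grid T n k.+1) (fun w => h (w, incr n k w)).
Proof. by move=> /grid_itvS[g0 gl gT] mh; apply: fmeas_step => //; exact: ltW. Qed.

(** Conditioning on the past removes the last factor at the price of [kap], whatever the past is,
    and the induction continues towards the first increment. *)
Lemma prod_bound (G : nat -> Om * 'rV[R]_d -> R) (kap : R) m : (m <= 2 ^ n)%N -> 0 <= kap ->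
  (forall k, (k < m)%N -> measurable_fun setT (G k : (FT (grid T n k) * 'rV[R]_d)%type -> R)) ->
  (forall k x, 0 <= G k x) ->
  (forall k w, (k < m)%N -> (\int[g]_y (G k (w, y))%:E <= kap%:E)%E) ->
  (\int[P]_w (\prod_(k < m) G k (w, incr n k w))%:E <= (kap ^+ m)%:E)%E.
Proof.
elim: m => [|m ih] mn k0 mG G0 kG.
  rewrite (eq_integral (cst 1%E)) ?integral_cst// ?mul1e ?prob_mass//.
  by move=> w _; rewrite big_ord0.
pose H w := \prod_(k < m) G k (w, incr n k w).
have H0 w : 0 <= H w by exact: prodr_ge0.
have mH : fm (grid T n m) H.
  apply: (measurable_prodr (A := FT (grid T n m)) (index_enum _) (F := fun (k : 'I_m) w => G k (w, incr n k w))) => k.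
  apply: (fmeas_le (grid_le T_gt0 n (ltn_ord k))).
  apply: fmeas_incr_step; first exact: (ltn_trans (ltn_ord k)).
  by apply: mG; exact: ltnW (ltn_ord k).
have mGm := mG m (ltnSn m).
pose h (x : (FT (grid T n m) * 'rV[R]_d)%type) := (H x.1 * G m x)%:E.
have mh : measurable_fun setT h.
  apply/measurable_EFinP; apply: measurable_funM => //.
  exact: (measurableT_comp (f := H : FT (grid T n m) -> R) mH measurable_fst).
have h0 x : (0 <= h x)%E by rewrite lee_fin mulr_ge0.
have -> : (\int[P]_w (\prod_(k < m.+1) G k (w, incr n k w))%:E = \int[P]_w h (w, incr n m w))%E.
  by apply: eq_integral => w _; rewrite big_ord_recr.
rewrite incr_step//.
have mg w : measurable_fun setT (fun y => (G m (w, y))%:E).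
  apply/measurable_EFinP.
  exact: (measurableT_comp (f := G m : (FT (grid T n m) * 'rV[R]_d)%type -> R) mGm (measurable_pair1 _)).
have mH' : measurable_fun setT (EFin \o H) by apply/measurable_EFinP; exact: fmeas_meas mH.
apply: (@le_trans _ _ (\int[P]_w (kap%:E * (H w)%:E))%E).
  apply: ge0_le_integral => //.
  - by move=> w _; apply: integral_ge0.
  - apply: (@fmeas_meas _ _ _ _ _ (grid T n m)).
    rewrite /fmeas; exact: (@measurable_fun_fubini_tonelli_F _ _ (FT (grid T n m)) 'rV[R]_d R g h mh).
  - exact: measurable_funeM.
  - move=> w _; rewrite /h; under eq_integral do rewrite EFinM.
    rewrite /= ge0_integralZl ?lee_fin//; last by move=> y _; rewrite lee_fin.
    by rewrite muleC lee_wpmul2r ?lee_fin// kG.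
rewrite ge0_integralZl//; last by move=> w _; rewrite lee_fin.
rewrite exprS EFinM lee_wpmul2l ?lee_fin//; apply: ih => //; first exact: ltnW.
- by move=> k km; apply: mG; exact: ltnW.
- by move=> k w km; apply: kG; exact: ltnW.
Qed.

(** Here [c k] is the value on the cell that begins at the grid point [k], hence is known there; [K]
    bounds every coordinate. *)
Definition simple K (c : nat -> Om -> 'rV[R]_d) := forall k, (k < 2 ^ n)%N ->
  fm (grid T n k) (c k) /\ forall w i, `|c k w 0 i| <= K.

Variables (K : R) (c : nat -> Om -> 'rV[R]_d).
Hypothesis sc : simple K c.

(** The Girsanov weight under which [shifted], that is [M] with the additional drift [c], has the
    law of a Brownian motion at the grid points. *)
Definition sexp m w := expR (\sum_(j < m) (- dot (c j w) (incr n j w) - sqn (c j w) * mesh T n / 2)).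
Definition shifted m w := M (grid T n m) w + mesh T n *: \sum_(j < m) c j w.

Variable A : nat -> set 'rV[R]_d.
Hypothesis mA : forall k, measurable (A k).

(* The law of [M] at the grid points, integrating out the last increment first. *)
Fixpoint val (mu : probability 'rV[R]_d R) m (F : 'rV[R]_d -> \bar R) : \bar R :=
  if m is m'.+1 then val mu m' (fun x => (\1_(A m') x)%:E * \int[g]_y F (x + y)%R)%E
  else (\int[mu]_x F x)%E.

Lemma fmeas_c k m : (k <= m)%N -> (k < 2 ^ n)%N -> fm (grid T n m) (c k).
Proof. by move=> km kn; apply: (fmeas_le (grid_le T_gt0 n km)); case: (sc kn). Qed.

Lemma fmeas_sexp m : (m <= 2 ^ n)%N -> fm (grid T n m) (sexp m).
Proof.
move=> mn; apply: (measurableT_comp (T1 := FT (grid T n m))); first exact: measurable_expR.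
apply: (measurable_sumr (A := FT (grid T n m)) (index_enum _)) => k.
have kn : (k < 2 ^ n)%N by rewrite (leq_trans _ mn).
have mck : fm (grid T n m) (c k) by apply: fmeas_c => //; exact: ltnW.
apply: (measurable_funB (T := FT (grid T n m))).
  apply: (measurableT_comp (T1 := FT (grid T n m))); first exact: oppr_measurable.
  apply: (measurable_dotv (A := FT (grid T n m))) => //.
  exact: (fmeas_le (grid_le T_gt0 n (ltn_ord k)) (fmeas_incr kn)).
apply: (measurable_funM (T := FT (grid T n m))); last exact: measurable_cst.
apply: (measurable_funM (T := FT (grid T n m))); last exact: measurable_cst.
exact: (measurable_sqnv (A := FT (grid T n m))).
Qed.

Lemma fmeas_shifted k m : (k <= m)%N -> (m <= 2 ^ n)%N -> fm (grid T n m) (shifted k).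
Proof.
move=> km mn; apply: (measurable_addv (A := FT (grid T n m))).
  apply: (fmeas_le (grid_le T_gt0 n km)); apply: PM.1; apply: (grid_itv T_gt0).
  exact: leq_trans mn.
apply: (measurable_scalev (A := FT (grid T n m))); first exact: measurable_cst.
apply: (measurable_sumv (A := FT (grid T n m)) (index_enum _)) => j.
have jm : (j < m)%N by rewrite (leq_trans (ltn_ord j)).
by apply: fmeas_c; [exact: ltnW|exact: leq_trans jm mn].
Qed.

(* Each drifted increment is absorbed, together with its exponential weight, by
   a translation of the Gaussian law. *)
Lemma grid_law (mu : probability 'rV[R]_d R) m (F : 'rV[R]_d -> \bar R) :
  (forall F : 'rV[R]_d -> \bar R, measurable_fun setT F -> (forall x, 0 <= F x)%E ->
    \int[P]_w F (M 0 w) = \int[mu]_x F x)%E ->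
  (m <= 2 ^ n)%N -> measurable_fun setT F -> (forall x, 0 <= F x)%E ->
  (\int[P]_w ((sexp m w * \prod_(k < m) \1_(A k) (shifted k w))%:E * F (shifted m w)) = val mu m F)%E.
Proof.
move=> hmu; elim: m F => [|m ih] F mn mF F0.
  rewrite /= -hmu//; apply: eq_integral => w _.
  by rewrite /sexp /shifted !big_ord0 expR0 scaler0 addr0 mul1r grid0 mul1e.
have mD := mesh_gt0 T_gt0 n.
have mFxy : measurable_fun setT (fun z : ('rV[R]_d * 'rV[R]_d)%type => F (z.1 + z.2)).
  by apply: measurableT_comp => //; apply: measurable_addv; [exact: measurable_fst|exact: measurable_snd].
have mFg : measurable_fun setT (fun x : 'rV[R]_d => \int[g]_y F (x + y)%R)%E.
  exact: (@measurable_fun_fubini_tonelli_F _ _ 'rV[R]_d 'rV[R]_d R g (fun z => F (z.1 + z.2)) mFxy).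
have Fg0 x : (0 <= \int[g]_y F (x + y)%R)%E by apply: integral_ge0.
rewrite /= -ih//; last 3 first.
- exact: ltnW.
- apply: emeasurable_funM => //; apply/measurable_EFinP; exact: measurable_indic.
- by move=> x; rewrite mule_ge0// lee_fin.
set H := fun w => sexp m w * \prod_(k < m) \1_(A k) (shifted k w).
have mH : fm (grid T n m) H.
  apply: (measurable_funM (T := FT (grid T n m))); first by apply: fmeas_sexp; exact: ltnW.
  apply: (measurable_prodr (A := FT (grid T n m)) (index_enum _) (F := fun k : 'I_m => fun w => \1_(A k) (shifted k w))) => k.
  apply: (measurable_indic_comp (A := FT (grid T n m)) (mA k)).
  by apply: fmeas_shifted; [exact: ltnW (ltn_ord k)|exact: ltnW].
have H0 w : 0 <= H w by rewrite mulr_ge0 ?expR_ge0// prodr_ge0.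
have mS : fm (grid T n m) (shifted m) by apply: fmeas_shifted => //; exact: ltnW.
have mc : fm (grid T n m) (c m) by case: (sc mn).
pose e (x : (FT (grid T n m) * 'rV[R]_d)%type) := expR (- dot (c m x.1) x.2 - sqn (c m x.1) * mesh T n / 2).
pose h (x : (FT (grid T n m) * 'rV[R]_d)%type) :=
  ((H x.1 * \1_(A m) (shifted m x.1))%:E * ((e x)%:E * F (shifted m x.1 + (x.2 + mesh T n *: c m x.1))%R))%E.
have f1 (dd : measure_display) (B : measurableType dd) (f : Om -> B) : fm (grid T n m) f ->
    measurable_fun setT (fun x : (FT (grid T n m) * 'rV[R]_d)%type => f x.1).
  by move=> mf; exact: (measurableT_comp (f := f : FT (grid T n m) -> B) mf measurable_fst).
have m2 : measurable_fun setT (fun x : (FT (grid T n m) * 'rV[R]_d)%type => x.2) by exact: measurable_snd.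
have mdot : measurable_fun setT (fun x : (FT (grid T n m) * 'rV[R]_d)%type => - dot (c m x.1) x.2).
  apply: measurableT_comp; first exact: oppr_measurable.
  by apply: measurable_dotv => //; exact: (f1 _ _ (c m)).
have me : measurable_fun setT e.
  apply: measurableT_comp; first exact: measurable_expR.
  apply: measurable_funB => //.
  apply: measurable_funM; last exact: measurable_cst.
  apply: measurable_funM; last exact: measurable_cst.
  by apply: measurable_sqnv; exact: (f1 _ _ (c m)).
have mshift : measurable_fun setT (fun x : (FT (grid T n m) * 'rV[R]_d)%type => shifted m x.1 + (x.2 + mesh T n *: c m x.1)).
  apply: measurable_addv; first exact: (f1 _ _ (shifted m)).
  apply: measurable_addv => //; apply: measurable_scalev; first exact: measurable_cst.
  exact: (f1 _ _ (c m)).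
have mi : fm (grid T n m) (fun w => \1_(A m) (shifted m w) : R).
  exact: (measurable_indic_comp (A := FT (grid T n m)) (mA m) mS).
have mh : measurable_fun setT h.
  apply: emeasurable_funM.
    by apply/measurable_EFinP; apply: measurable_funM; [exact: (f1 _ _ H mH)|exact: (f1 _ _ _ mi)].
  apply: emeasurable_funM; first exact/measurable_EFinP.
  exact: (measurableT_comp mF mshift).
have h0 x : (0 <= h x)%E.
  apply: mule_ge0; first by rewrite lee_fin mulr_ge0.
  by apply: mule_ge0 => //; rewrite lee_fin expR_ge0.
transitivity (\int[P]_w h (w, incr n m w))%E.
  apply: eq_integral => w _; rewrite /h /= muleA -EFinM; congr (_%:E * F _)%E.
    rewrite /H /sexp /e /= !big_ord_recr/= expRD; ring.
  rewrite /shifted big_ord_recr/= scalerDr gridS /incr gridS.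
  by apply/rowP => i; rewrite !mxE; ring.
rewrite incr_step//; apply: eq_integral => w _; rewrite /h /=.
have mey : measurable_fun setT (fun y => (e (w, y))%:E * F (shifted m w + (y + mesh T n *: c m w))%R)%E.
  apply: emeasurable_funM.
    by apply/measurable_EFinP; exact: (measurableT_comp (f := e) me (measurable_pair1 _)).
  apply: measurableT_comp => //; apply: measurable_addv; first exact: measurable_cst.
  by apply: measurable_addv; [exact: measurable_id|exact: measurable_cst].
rewrite ge0_integralZl//; last 2 first.
- by move=> y _; rewrite mule_ge0// lee_fin expR_ge0.
- by rewrite lee_fin mulr_ge0.
rewrite EFinM -muleA; congr (_ * (_ * _))%E.
have mFw : measurable_fun setT (fun y => F (shifted m w + y)).
  apply: measurableT_comp => //; apply: measurable_addv; [exact: measurable_cst|exact: measurable_id].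
(* Given the past, [c m w] is a constant vector, and the last factor of the weight is the
   Cameron-Martin density for [- c m w]. *)
have := gaussian_shift (- c m w) mD hg mFw (fun=> F0 _).
move=> <-; apply: eq_integral => y _; rewrite /e /=; congr (_%:E * F _)%E.
  congr expR; rewrite /dot /sqn; congr (_ - _ * _ / _).
    by rewrite -sumrN; apply: eq_bigr => i _; rewrite mxE mulNr.
  by apply: eq_bigr => i _; rewrite mxE sqrrN.
by rewrite scalerN opprK.
Qed.

End fixed_process.
End brownian_grid.

(** * Time integration over predictable processes *)

Section predictable_measure.
Context (R : realType) (T : R) (d : nat) (T_gt0 : 0 < T).
Local Notation Om := (path_space T d).
Local Notation FT s := (g_sigma_algebraType (@coord_events R T d s)).
Local Notation fm s := (@fmeas R T d _ _ s).
Local Notation PT :=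
  (g_sigma_algebraType (predictable_rectangles T (@canonical_filtration R T d))).
Local Notation DT := (`[0, T]%classic `*` [set: Om]).
Local Notation leb := (@lebesgue_measure R).

(** Makes the inclusion of [[0, T] x Omega] into the predictable space a total measurable map;
    [timeind] removes the times outside [[0, T]] again. *)
Definition clampt (p : (measurableTypeR R * Om)%type) : PT := (clamp T p.1, p.2).

Lemma measurable_clampt : measurable_fun setT clampt.
Proof.
apply: (@measurable_comp _ _ _ (measurableTypeR R * Om)%type (measurableTypeR R * Om)%type PT DT
   (fun p => (p : PT)) setT (fun p => (clamp T p.1, p.2))).
- by apply: measurableX => //; exact: measurable_itv.
- by move=> _ [p _ <-]; split => //=; rewrite in_itv/=; exact: clamp_itv.
- exact: PT_prod.
- apply: measurable_fun_pair; last exact: measurable_snd.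
  by apply: measurableT_comp; [apply: continuous_measurable_fun; exact: continuous_clamp|exact: measurable_fst].
Qed.

Definition timeind (p : (measurableTypeR R * Om)%type) : R := \1_(`[0, T]%classic) p.1.

Lemma measurable_timeind : measurable_fun setT timeind.
Proof.
by apply: (measurable_indic_comp (B := measurableTypeR R)); [exact: measurable_itv|exact: measurable_fst].
Qed.

Lemma timeind_ge0 p : 0 <= timeind p.
Proof. by []. Qed.

Section one_measure.
Variable P : probability Om R.

(* dt (x) P restricted to [0,T], seen on the predictable sigma-algebra. *)
Definition PTm : {measure set PT -> \bar R} :=
  image_measure (weighted (leb \x P)%E measurable_timeind timeind_ge0) measurable_clampt.

Lemma PTm_prod (f : PT -> \bar R) : measurable_fun setT f -> (forall p, 0 <= f p)%E ->
  (\int[PTm]_p f p = \int[leb \x P]_z (f (clampt z) * (timeind z)%:E))%E.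
Proof.
move=> mf f0; rewrite /PTm /image_measure ge0_integral_pushforward//; last exact: measurable_clampt.
rewrite preimage_setT integral_weighted//; last by move=> z; exact: f0.
by apply: measurableT_comp => //; exact: measurable_clampt.
Qed.

Let mF (f : PT -> \bar R) : measurable_fun setT f ->
  measurable_fun setT (fun z => f (clampt z) * (timeind z)%:E)%E.
Proof.
move=> mf; apply: emeasurable_funM.
  by apply: measurableT_comp => //; exact: measurable_clampt.
by apply/measurable_EFinP; exact: measurable_timeind.
Qed.

Lemma time_restrict (f : PT -> \bar R) w :
  (fun t => f (clampt (t, w)) * (timeind (t, w))%:E)%E = (fun t => f (t, w)) \_ `[0, T].
Proof.
apply/funext => t; rewrite patchE /timeind/= indicE; case: ifPn => [tT|_]; last by rewrite mule0.
by rewrite mule1 /clampt/= clamp_id//; move: tT; rewrite inE/= in_itv.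
Qed.

Lemma PTmE (f : PT -> \bar R) : measurable_fun setT f -> (forall p, 0 <= f p)%E ->
  (\int[PTm]_p f p = \int[P]_w \int[leb]_(t in `[0%R, T]) f (t, w))%E.
Proof.
move=> mf f0; rewrite PTm_prod//.
have F0 z : (0 <= f (clampt z) * (timeind z)%:E)%E by rewrite mule_ge0// lee_fin.
apply: (etrans (fubini_tonelli2 _ (mF mf) F0)).
apply: eq_integral => w _; rewrite [RHS]integral_mkcond -time_restrict.
exact: eq_integral.
Qed.

Lemma PTm_mass : PTm setT = T%:E.
Proof.
rewrite -[LHS]mul1e -[LHS](integral_cst PTm measurableT 1%E) PTmE//.
under eq_integral do rewrite integral_cst//= mul1e lebesgue_measure_itv/= lte_fin T_gt0 -EFinB subr0.
by rewrite integral_cst// prob_mass mule1.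
Qed.

Lemma PTm_fin : (PTm setT < +oo)%E. Proof. by rewrite PTm_mass ltry. Qed.

(** Time 0 is Lebesgue-null. Step processes vanish there, so approximations need to be checked on
    []0, T]] only. *)
Lemma PTm_null (f : PT -> \bar R) : measurable_fun setT f -> (forall p, 0 <= f p)%E ->
  (forall t w, 0 < t <= T -> f (t, w) = 0%E) -> (\int[PTm]_p f p = 0)%E.
Proof.
move=> mf f0 fn; rewrite PTmE// integral0_eq// => w _.
have mfw : measurable_fun (setT : set (measurableTypeR R)) (fun t => f (clampt (t, w)) * (timeind (t, w))%:E)%E.
  exact: (measurableT_comp (mF mf) (measurable_pair2 _)).
have mfd : measurable_fun (`[0, T] : set (measurableTypeR R)) (fun t => f (t, w)).
  by rewrite time_restrict in mfw; apply/(measurable_restrictT (fun t => f (t, w))).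
rewrite (@ge0_negligible_integral _ _ _ leb _ [set 0])//; last exact: lebesgue_measure_set1.
rewrite integral0_eq// => t [/= /[!in_itv]/= /andP[t0 tT] tn].
by apply: fn; rewrite tT lt0r t0 !andbT; apply/eqP => te; exact: tn.
Qed.

Lemma PT_meas_prod (f : PT -> R) : measurable_fun setT f ->
  measurable_fun (DT : set (measurableTypeR R * Om)%type) f.
Proof. by move=> mf; apply: predictable_prod => //; exact: measurable_funTS. Qed.

Lemma PTm_fubini (f : PT -> R) : ing PTm f ->
  [/\ ing P (fun w => \int[leb]_(t in `[0, T]) f (t, w)),
      Ex P (fun w => \int[leb]_(t in `[0, T]) f (t, w)) = Ex PTm f &
      {ae P, forall w, leb.-integrable `[0, T] (fun t => (f (t, w))%:E)}].
Proof.
move=> fi; have mf := ing_meas fi.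
have mfE : measurable_fun setT (EFin \o f) by exact/measurable_EFinP.
pose F (z : (measurableTypeR R * Om)%type) : \bar R := ((f (clampt z))%:E * (timeind z)%:E)%E.
have mFF : measurable_fun setT F by exact: (mF mfE).
have Fabs z : `|F z|%E = (`|(f (clampt z))%:E| * (timeind z)%:E)%E.
  by rewrite /F abseM [X in (_ * X)%E]gee0_abs// lee_fin.
have iF : (leb \x P)%E.-integrable setT F.
  apply/integrableP; split => //; under eq_integral do rewrite Fabs.
  rewrite -(@PTm_prod (abse \o (EFin \o f))); first by case/integrableP : fi.
    by apply: measurableT_comp => //; exact: abse_measurable.
  by move=> p; exact: abse_ge0.
have Fw w : (fun t => F (t, w)) = (fun t => (f (t, w))%:E) \_ `[0, T] by exact: (time_restrict (EFin \o f)).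
have innerE w : fubini_G leb F w = (\int[leb]_(t in `[0%R, T]) (f (t, w))%:E)%E.
  by rewrite [RHS]integral_mkcond -Fw.
have ai : {ae P, forall w, leb.-integrable `[0, T] (fun t => (f (t, w))%:E)}.
  apply: filterS (ae_integrable2 iF) => w; rewrite Fw => iw.
  by apply/(integrable_mkcond _ _).2 => //; exact: measurable_itv.
have mI : measurable_fun setT (fun w => \int[leb]_(t in `[0, T]) f (t, w)).
  apply: (measurable_time_integral (measurable_itv _)); exact: PT_meas_prod.
have aeE : {ae P, forall w, fubini_G leb F w = (\int[leb]_(t in `[0%R, T]) f (t, w))%:E}.
  apply: filterS ai => w iw; rewrite innerE /Rintegral fineK//.
  exact: integrable_fin_num.
have mIE : measurable_fun setT (fun w => (\int[leb]_(t in `[0, T]) f (t, w))%:E) by exact/measurable_EFinP.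
have eqI : (\int[P]_w (\int[leb]_(t in `[0, T]) f (t, w))%:E = \int[PTm]_p (f p)%:E)%E.
  transitivity (\int[P]_w fubini_G leb F w)%E.
    apply: ae_eq_integral => //; first exact: (measurable_fubini_G iF).
    by apply: filterS aeE => w /= e _; exact/esym.
  rewrite integral21_prod_meas1// integralE [RHS]integralE; congr (_ - _)%E.
    rewrite PTm_prod//; last exact: measurable_funepos.
    apply: eq_integral => z _; rewrite !funeposE /F.
    by rewrite /timeind indicE; case: (_ \in _); rewrite ?mule1// !mule0 maxxx.
  rewrite PTm_prod//; last exact: measurable_funeneg.
  apply: eq_integral => z _; rewrite !funenegE /F.
  by rewrite /timeind indicE; case: (_ \in _); rewrite ?mule1// !mule0 oppe0 maxxx.
split => //; last by rewrite /Ex /Rintegral eqI.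
apply/integrableP; split => //.
apply: (@le_lt_trans _ _ (\int[PTm]_p `|(f p)%:E|)%E); last by case/integrableP : fi.
have mfa : measurable_fun setT (fun p => `|(f p)%:E|%E) by exact: (measurableT_comp (@abse_measurable _ _) mfE).
have fa0 p : (0 <= `|(f p)%:E|)%E by exact: abse_ge0.
rewrite PTmE//; apply: ge0_le_integral => //.
- by apply: measurableT_comp mIE; exact: abse_measurable.
- apply: (@measurable_time_integral_ge0 _ _ _ _ (fun p => `|(f p)%:E|%E) (measurable_itv _)) => //.
  by apply: measurableT_comp; [exact: abse_measurable|apply/measurable_EFinP; exact: PT_meas_prod].
- move=> w _; apply: (@le_trans _ _ `|\int[leb]_(t in `[0%R, T]) (f (t, w))%:E|%E).
    by rewrite /= /Rintegral; case: (integral _ _ _) => [r| |] //=; rewrite normr0 leey.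
  apply: le_abse_integral => //.
  have : measurable_fun (setT : set (measurableTypeR R)) (fun t => F (t, w)).
    exact: (measurableT_comp mFF (measurable_pair2 _)).
  by rewrite Fw => /(measurable_restrictT _ (measurable_itv _)).2.
Qed.

End one_measure.

Section steps.

(** A left-continuous step function with value [a j] on the cell number [j], equal to 0 at time 0
    and outside []0, T]]. The values lie in any module, so that scalar and vector processes share
    the lemmas. *)
Definition steps (V : lmodType R) n (a : nat -> V) (t : R) : V :=
  \sum_(j < 2 ^ n) (\1_(`]grid T n j, grid T n j.+1]%classic) t : R) *: a j.

Lemma steps_cell (V : lmodType R) n (a : nat -> V) t k : (k < 2 ^ n)%N ->
  grid T n k < t <= grid T n k.+1 -> steps n a t = a k.
Proof.
move=> kn tk; rewrite /steps (bigD1 (Ordinal kn))//= indicE mem_set ?scale1r; last by rewrite /= in_itv.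
rewrite big1 ?addr0// => j jk.
rewrite indicE memNset ?scale0r//= in_itv/= => /andP[h1 h2]; case/andP : tk => h3 h4.
move: jk; rewrite -val_eqE/= neq_ltn => /orP[jk|kj].
  have := lt_le_trans h3 (le_trans h2 (grid_le T_gt0 n jk)); by rewrite ltxx.
have := lt_le_trans h1 (le_trans h4 (grid_le T_gt0 n kj)); by rewrite ltxx.
Qed.

Lemma steps_out (V : lmodType R) n (a : nat -> V) t : ~~ (0 < t <= T) -> steps n a t = 0.
Proof.
move=> tn; rewrite /steps big1// => j _; rewrite indicE memNset ?scale0r//= in_itv/= => /andP[h1 h2].
move/negP : tn; apply; rewrite (le_lt_trans _ h1)/=.
  by rewrite (le_trans h2)// -[leRHS](gridT T n) grid_le.
by rewrite -(grid0 T n) grid_le.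
Qed.

Lemma stepsP (V : lmodType R) n t (Q : V -> Prop) (a : nat -> V) : Q 0 ->
  (forall k, (k < 2 ^ n)%N -> Q (a k)) -> Q (steps n a t).
Proof.
move=> Q0 Qa; have [t0|t0] := boolP (0 < t <= T); last by rewrite steps_out.
by have [k kn kt] := grid_ex n t0; rewrite (steps_cell a kn kt); exact: Qa.
Qed.

Lemma steps_map (V W : lmodType R) n (a : nat -> V) (h : V -> W) t : h 0 = 0 ->
  h (steps n a t) = steps n (fun j => h (a j)) t.
Proof.
move=> h0; have [t0|t0] := boolP (0 < t <= T); last by rewrite !steps_out.
by have [k kn kt] := grid_ex n t0; rewrite !(steps_cell _ kn kt).
Qed.

Lemma steps_map2 (V W U : lmodType R) n (a : nat -> V) (b : nat -> W) (h : V -> W -> U) t :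
  h 0 0 = 0 -> h (steps n a t) (steps n b t) = steps n (fun j => h (a j) (b j)) t.
Proof.
move=> h0; have [t0|t0] := boolP (0 < t <= T); last by rewrite !steps_out.
by have [k kn kt] := grid_ex n t0; rewrite !(steps_cell _ kn kt).
Qed.

Lemma steps_half (V : lmodType R) n (a : nat -> V) t :
  steps n.+1 (fun j => a j./2) t = steps n a t.
Proof.
have [t0|t0] := boolP (0 < t <= T); last by rewrite !steps_out.
have [k kn kt] := grid_ex n.+1 t0; rewrite (steps_cell _ kn kt).
have k2 : (k./2 < 2 ^ n)%N by rewrite ltn_half_double -mul2n -expnS.
rewrite (@steps_cell V n a t k./2 k2)//; case/andP : kt => h1 h2.
rewrite -!(grid_double T n) (le_lt_trans _ h1)/=.
  by rewrite (le_trans h2)// grid_le//; lia.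
by rewrite grid_le//; lia.
Qed.

(** The length of the part of the cell number [j] before time [t], for a nonnegative [t]. *)
Definition tincr n j t : R := Num.min t (grid T n j.+1) - Num.min t (grid T n j).

Lemma integral_steps n (a : nat -> R) t : 0 <= t ->
  leb.-integrable `[0, t] (fun s => (steps n (a : nat -> R^o) s)%:E) /\
  \int[leb]_(s in `[0, t]) steps n (a : nat -> R^o) s = \sum_(j < 2 ^ n) tincr n j t * a j.
Proof.
move=> t0.
have mI j : measurable (`]grid T n j, grid T n j.+1]%classic : set (measurableTypeR R)) by exact: measurable_itv.
have m0 : measurable (`[0, t]%classic : set (measurableTypeR R)) by exact: measurable_itv.
have t_fin : (leb `[0%R, t]%classic < +oo)%E by rewrite /= lebesgue_measure_itv/=; case: ifP => _; rewrite -?EFinB ltry.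
have ij j : leb.-integrable `[0, t] (EFin \o (\1_(`]grid T n j, grid T n j.+1]%classic) : R -> R)).
  apply: measurable_bounded_integrable => //.
  exists 1; split => // M M1 x _ /=; rewrite indicE; case: (_ \in _) => /=.
    by rewrite normr1 ltW.
  by rewrite normr0 ltW// (lt_trans ltr01).
have ija j : leb.-integrable `[0, t] (EFin \o (fun s => \1_(`]grid T n j, grid T n j.+1]%classic) s * a j)).
  have := integrableZr m0 (a j) (ij j).
  by apply: eq_integrable => // s _.
have E1 j : \int[leb]_(s in `[0, t]) (\1_(`]grid T n j, grid T n j.+1]%classic) s * a j) = tincr n j t * a j.
  rewrite RintegralZr// /Rintegral integral_indic//; congr (_ * _).
  have g0 : 0 <= grid T n j by rewrite -(grid0 T n) grid_le.
  have gl : grid T n j <= grid T n j.+1 by rewrite grid_le.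
  rewrite (_ : _ `&` _ = `]grid T n j, Num.min t (grid T n j.+1)]%classic); last first.
    apply/seteqP; split => s /=; rewrite !in_itv/= le_min.
      by case=> /andP[-> ->] /andP[_ ->].
    move=> /and3P[h1 h2 h3]; rewrite h1 h2 h3; split => //.
    by rewrite andbT ltW// (le_lt_trans g0).
  rewrite /= lebesgue_measure_itv/= lte_fin lt_min /tincr.
  case: (ltP (grid T n j) t) => gt /=.
    by rewrite grid_lt.
  by rewrite min_l ?subrr// (le_trans _ gl).
rewrite /steps; split.
  have := @integrable_sum _ _ _ leb _ m0 _ (index_enum _) xpredT _ (fun (j : 'I_(2 ^ n)) _ => ija j).
  by apply: eq_integrable => // s _; rewrite /= sumEFin.
rewrite [LHS]/Rintegral.
under eq_integral do rewrite -sumEFin.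
rewrite (@integral_sum _ _ _ leb _ m0 _ _ (fun (j : 'I_(2 ^ n)) => ija j)).
rewrite (eq_bigr (fun j : 'I_(2 ^ n) => (tincr n j t * a j)%:E)) ?sumEFin// => j _.
rewrite -E1 /Rintegral fineK//; apply: integrable_fin_num => //; exact: ija.
Qed.

End steps.
End predictable_measure.

(** * Simple predictable processes *)

Section simple_processes.
Context (R : realType) (T : R) (d : nat) (T_gt0 : 0 < T).
Local Notation Om := (path_space T d).
Local Notation FT s := (g_sigma_algebraType (@coord_events R T d s)).
Local Notation fm s := (@fmeas R T d _ _ s).
Local Notation PT :=
  (g_sigma_algebraType (predictable_rectangles T (@canonical_filtration R T d))).
Local Notation DT := (`[0, T]%classic `*` [set: Om]).
Local Notation leb := (@lebesgue_measure R).
Local Notation rV := 'rV[R]_d.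

Lemma coord_steps n (a : nat -> rV) t i :
  steps T n a t 0 i = steps T n (fun j => a j 0 i : R^o) t.
Proof. by rewrite /steps summxE; apply: eq_bigr => j _; rewrite mxE. Qed.

Definition proc n (c : nat -> Om -> rV) (p : R * Om) : rV := steps T n (fun j => c j p.2) p.1.

Lemma measurable_steps n (a : nat -> Om -> R) :
  (forall k, (k < 2 ^ n)%N -> fm (grid T n k) (a k)) ->
  measurable_fun (setT : set PT) (fun p => steps T n (fun j => a j p.2 : R^o) p.1 : R).
Proof.
move=> ma; apply: (measurable_sumr (A := PT)) => j.
have [g0 gl gT] := grid_itvS T_gt0 (ltn_ord j).
by apply: (measurable_PT_step g0 gl gT); exact: ma.
Qed.

Section one_process.
Variables (n : nat) (K : R) (c : nat -> Om -> rV).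
Hypothesis sc : simple n K c.

Lemma measurable_proc : measurable_fun (setT : set PT) (proc n c).
Proof.
apply: measurable_fun_rV => // i.
apply: (@eq_measurable_fun _ _ _ _ _ (fun p : PT => steps T n (fun j => c j p.2 0 i : R^o) p.1)).
  by move=> p _; rewrite /proc coord_steps.
apply: (measurable_steps (a := fun j w => c j w 0 i)) => k kn.
by apply: (measurable_coordT (A := FT (grid T n k))); case: (sc kn).
Qed.

Lemma proc_bound p i : `|proc n c p 0 i| <= K.
Proof.
apply: (@stepsP _ _ T_gt0 rV n p.1 (fun v : rV => `|v 0 i| <= K)); last by move=> k /sc[].
rewrite mxE normr0; have := (sc (expn_gt0 2 n)).2 p.2 i.
exact: le_trans.
Qed.

Lemma sqn_proc_bound p : sqn (proc n c p) <= d%:R * K ^+ 2.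
Proof.
rewrite /sqn (le_trans (ler_sum (G := fun=> K ^+ 2) _ _))//.
  move=> i _; rewrite -real_normK ?num_real// ler_sqr ?nnegrE//; first exact: proc_bound.
  exact: le_trans (normr_ge0 _) (proc_bound p i).
by rewrite sumr_const card_ord mulr_natl.
Qed.

(** The primitive of the process [proc n c], in a closed form whose continuity in [t] is
    immediate. *)
Definition cumul t w : rV := \sum_(j < 2 ^ n) tincr T n j t *: c j w.

Lemma cumulE t w : 0 <= t -> time_integral (fun s => proc n c (s, w)) t = cumul t w.
Proof.
move=> t0; apply/rowP => i; rewrite mxE.
under eq_Rintegral do rewrite /proc coord_steps.
rewrite (integral_steps T_gt0 n (fun j => c j w 0 i) t0).2 /cumul summxE.
by apply: eq_bigr => j _; rewrite mxE.
Qed.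

Lemma time_integrable_proc w : time_integrable T (fun s => proc n c (s, w)).
Proof.
move=> i; have := (integral_steps T_gt0 n (fun j => c j w 0 i) (ltW T_gt0)).1.
by apply: eq_integrable => // s _; rewrite /proc coord_steps.
Qed.

Lemma tincr_grid j m : (m <= 2 ^ n)%N -> tincr T n j (grid T n m) = (if (j < m)%N then mesh T n else 0).
Proof.
move=> mn; rewrite /tincr; case: ltnP => jm.
  by rewrite !min_r ?grid_le//; [rewrite gridS addrAC subrr add0r|exact: ltnW].
by rewrite !min_l ?subrr ?grid_le// ltnW.
Qed.

Lemma cumul_grid m w : (m <= 2 ^ n)%N -> cumul (grid T n m) w = mesh T n *: \sum_(j < m) c j w.
Proof.
move=> mn; rewrite /cumul scaler_sumr.
rewrite -(big_mkord xpredT (fun j => tincr T n j (grid T n m) *: c j w)).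
rewrite (big_cat_nat (n := m))//= [X in _ + X]big_nat_cond [X in _ + X]big1 ?addr0.
  rewrite big_mkord; apply: eq_bigr => j _; by rewrite tincr_grid// ltn_ord.
by move=> j /andP[/andP[mj jn] _]; rewrite tincr_grid// ltnNge mj scale0r.
Qed.

Lemma tincrT j : (j < 2 ^ n)%N -> tincr T n j T = mesh T n.
Proof. by move=> jn; rewrite -{2}(gridT T n) tincr_grid// jn. Qed.

Lemma qv_proc w :
  \int[leb]_(t in `[0, T]) sqn (proc n c (t, w)) = \sum_(j < 2 ^ n) mesh T n * sqn (c j w).
Proof.
have sqn0 : sqn (0 : rV) = 0 :> R^o by rewrite /sqn big1// => i _; rewrite mxE expr0n.
under eq_Rintegral => t _ do rewrite /proc (steps_map T_gt0 n (fun j => c j w) (h := @sqn R d : rV -> R^o) t sqn0).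
rewrite (integral_steps T_gt0 n (fun j => sqn (c j w)) (ltW T_gt0)).2.
by apply: eq_bigr => j _; rewrite tincrT.
Qed.

End one_process.

(** The stochastic integral of the simple process over [[0, T]]. *)
Definition stoch (M : R -> Om -> rV) n (c : nat -> Om -> rV) w : R :=
  \sum_(j < 2 ^ n) dot (c j w) (incr M n j w).

Lemma big_double (V : nmodType) (F : nat -> V) m :
  \sum_(j < m.*2) F j = \sum_(j < m) (F j.*2 + F j.*2.+1).
Proof.
elim: m => [|m ih]; first by rewrite !big_ord0.
by rewrite doubleS !big_ord_recr/= ih addrA.
Qed.

(** On a finer grid every value is repeated; process and stochastic integral do not change because
    increments add up. This puts two simple processes on a common grid. *)
Lemma refine_simple n m (K : R) (c : nat -> Om -> rV) : simple n K c -> (n <= m)%N -> exists c', [/\ simple m K c',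
  forall p, proc m c' p = proc n c p & forall M w, stoch M m c' w = stoch M n c w].
Proof.
move=> sc; elim: m => [|m ih]; first by rewrite leqn0 => /eqP n0; rewrite n0 in sc *; exists c.
rewrite leq_eqVlt => /predU1P[<-|]; first by exists c.
rewrite ltnS => /ih[c' [sc' pc' mc']]; exists (fun j => c' j./2); split.
- move=> k km; have k2 : (k./2 < 2 ^ m)%N by rewrite ltn_half_double -mul2n -expnS.
  have [h1 h2] := sc' _ k2; split => //.
  by apply: (fmeas_le _ h1); rewrite -(grid_double T m) grid_le//; lia.
- by move=> p; rewrite -pc'; exact: steps_half.
- move=> M w; rewrite -mc' /stoch expnS mul2n.
  rewrite (big_double (fun j => dot (c' j./2 w) (incr M m.+1 j w))); apply: eq_bigr => j _.
  rewrite (_ : j.*2.+1./2 = j) ?doubleK; last exact: uphalf_double.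
  rewrite /dot -big_split/=; apply: eq_bigr => i _.
  by rewrite -mulrDr /incr !mxE -doubleS !grid_double; congr (_ * _); ring.
Qed.

Lemma simple_lin n (K K' : R) (c c' : nat -> Om -> rV) (a : R) : simple n K c -> simple n K' c' ->
  simple n (`|a| * K + K') (fun j w => a *: c j w + c' j w).
Proof.
move=> sc sc' k kn; have [h1 h2] := sc k kn; have [h1' h2'] := sc' k kn; split.
  apply: (measurable_addv (A := FT (grid T n k))) => //.
  by apply: (measurable_scalev (A := FT (grid T n k))) => //; exact: measurable_cst.
move=> w i; rewrite !mxE (le_trans (ler_normD _ _))// lerD// normrM ler_wpM2l//.
Qed.

Lemma proc_lin n (c c' : nat -> Om -> rV) (a : R) p :
  proc n (fun j w => a *: c j w + c' j w) p = a *: proc n c p + proc n c' p.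
Proof.
rewrite /proc /steps scaler_sumr -big_split/=; apply: eq_bigr => j _.
by rewrite scalerDr !scalerA mulrC.
Qed.

Lemma stoch_lin M n (c c' : nat -> Om -> rV) (a : R) w :
  stoch M n (fun j w => a *: c j w + c' j w) w = a * stoch M n c w + stoch M n c' w.
Proof.
rewrite /stoch mulr_sumr -big_split/=; apply: eq_bigr => j _.
rewrite /dot mulr_sumr -big_split/=; apply: eq_bigr => i _.
by rewrite !mxE; ring.
Qed.

Section density.
Variable mu : {measure set PT -> \bar R}.
Hypothesis mu_fin : (mu setT < +oo)%E.
Hypothesis mu_null : forall f : PT -> \bar R, measurable_fun setT f -> (forall p, 0 <= f p)%E ->
  (forall t w, 0 < t <= T -> f (t, w) = 0%E) -> (\int[mu]_p f p = 0)%E.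

(** The scalar form of [proc]. The reference measure is any finite measure that does not charge time
    0, since one approximation will have to be accurate under two laws at once. *)
Definition simple_fun (f : PT -> R) : Prop := exists n K (a : nat -> Om -> R),
  (forall k, (k < 2 ^ n)%N -> fm (grid T n k) (a k) /\ forall w, `|a k w| <= K) /\
  f = (fun p => steps T n (fun j => a j p.2 : R^o) p.1 : R).

Lemma simple_fun_up f : simple_fun f -> exists n0, forall m, (n0 <= m)%N -> exists K (a : nat -> Om -> R),
  (forall k, (k < 2 ^ m)%N -> fm (grid T m k) (a k) /\ forall w, `|a k w| <= K) /\
  f = (fun p => steps T m (fun j => a j p.2 : R^o) p.1 : R).
Proof.
move=> [n [K [a [ha fE]]]]; exists n => {}m; elim: m => [|m ih].
  by rewrite leqn0 => /eqP n0; rewrite n0 in ha fE; exists K, a.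
rewrite leq_eqVlt => /predU1P[<-|]; first by exists K, a.
rewrite ltnS => /ih[K' [a' [ha' fE']]]; exists K', (fun j => a' j./2); split.
  move=> k km; have k2 : (k./2 < 2 ^ m)%N by rewrite ltn_half_double -mul2n -expnS.
  have [h1 h2] := ha' _ k2; split => //.
  by apply: (fmeas_le _ h1); rewrite -(grid_double T m) grid_le//; lia.
by rewrite fE'; apply/funext => p; rewrite (steps_half T_gt0 m (fun j => a' j p.2 : R^o)).
Qed.

Lemma simple_fun_meas f : simple_fun f -> measurable_fun setT f.
Proof. by move=> [n [K [a [ha ->]]]]; apply: measurable_steps => k /ha[]. Qed.

Lemma simple_fun_lin (k : R) f g : simple_fun f -> simple_fun g ->
  simple_fun (fun p => k * f p + g p).
Proof.
move=> /simple_fun_up[n hf] /simple_fun_up[m hg].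
have [K [a [ha ->]]] := hf (maxn n m) (leq_maxl _ _).
have [L [b [hb ->]]] := hg (maxn n m) (leq_maxr _ _).
exists (maxn n m), (`|k| * K + L), (fun j w => k * a j w + b j w); split.
  move=> j jn; have [a1 a2] := ha j jn; have [b1 b2] := hb j jn; split.
    apply: (measurable_funD (T := FT (grid T (maxn n m) j))) => //.
    by apply: (measurable_funM (T := FT (grid T (maxn n m) j))) => //; exact: measurable_cst.
  by move=> w; rewrite (le_trans (ler_normD _ _))// lerD// normrM ler_wpM2l.
apply/funext => p; rewrite /steps mulr_sumr -big_split/=; apply: eq_bigr => j _.
by rewrite /GRing.scale/=; ring.
Qed.

Lemma simple_fun0 : simple_fun (fun=> 0).
Proof.
exists 0%N, 0, (fun _ _ => 0); split.
  by move=> k _; split; [exact: measurable_cst|move=> w; rewrite normr0].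
by apply/funext => p; rewrite /steps big1// => j _; rewrite scaler0.
Qed.

Local Notation app := (approximable mu simple_fun).

Lemma simple_fun_null (f g : PT -> R) : measurable_fun setT f -> simple_fun g ->
  (forall t w, 0 < t <= T -> f (t, w) = g (t, w)) -> app f.
Proof.
move=> mf Vg fg; split => // e e0; exists g => //.
rewrite /L2dist2 mu_null ?lte_fin//.
- by apply: measurable_L2dist2 => //; exact: simple_fun_meas.
- by move=> p; rewrite lee_fin sqr_ge0.
- by move=> t w t0; rewrite fg// subrr expr0n.
Qed.

Lemma rect_closed : setI_closed (predictable_rectangles T (@canonical_filtration R T d)).
Proof.
have z0 : predictable_rectangles T (@canonical_filtration R T d) set0.
  left; exists set0; split; first exact: (@measurable0 _ (FT 0)).
  by rewrite setX0.
move=> A B [[E [FE ->]]|[s [t [E [s0 st tT FE ->]]]]] [[E' [FE' ->]]|[s' [t' [E' [s0' st' tT' FE' ->]]]]].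
- left; exists (E `&` E'); split; first exact: (@measurableI _ (FT 0)).
  by rewrite -setXI setIid.
- rewrite (_ : _ `&` _ = set0)//; apply/seteqP; split => // -[r w] /= [[-> _] [+ _]].
  by rewrite in_itv/= ltNge s0'.
- rewrite (_ : _ `&` _ = set0)//; apply/seteqP; split => // -[r w] /= [[+ _] [re _]].
  by rewrite re in_itv/= ltNge s0.
- have [lt|ge] := ltP (Num.max s s') (Num.min t t').
    right; exists (Num.max s s'), (Num.min t t'), (E `&` E'); split => //.
    + by rewrite le_max s0.
    + by rewrite ge_min tT.
    + apply: (@measurableI _ (FT (Num.max s s'))).
        by apply: filtration_le FE; rewrite le_max lexx.
      by apply: filtration_le FE'; rewrite le_max lexx orbT.
    rewrite -setXI; congr (_ `*` _); apply/seteqP; split => r /=; rewrite !in_itv/= gt_max le_min.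
      by move=> [/andP[-> ->] /andP[-> ->]].
    by move=> /andP[/andP[-> ->] /andP[-> ->]].
  rewrite (_ : _ `&` _ = set0)//; apply/seteqP; split => // -[r w] /= [[+ _] [+ _]].
  rewrite !in_itv/= => /andP[h1 h2] /andP[h3 h4].
  have : Num.max s s' < Num.min t t' by rewrite gt_max !lt_min; apply/andP; split; apply/andP; split; lra.
  by rewrite ltNge ge.
Qed.

Lemma rect_app (G : set PT) : predictable_rectangles T (@canonical_filtration R T d) G -> app (\1_G).
Proof.
move=> rG; have mG : measurable (G : set PT) by exact: sub_sigma_algebra.
have m1 : measurable_fun setT (\1_G : PT -> R) by exact: measurable_indic.
case: rG => [[E [FE GE]]|[s [t [E [s0 st tT FE GE]]]]].
  apply: (simple_fun_null m1 simple_fun0) => r w /andP[r0 _]; rewrite indicE memNset// GE/= => -[re _].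
  by rewrite re ltxx in r0.
(* The cells whose left end lies in [[s, t[] approximate []s, t]]. The condition on the left end
   makes [E] known at that time, which keeps the approximation adapted. *)
pose a n k w : R := (((s <= grid T n k) && (grid T n k < t))%R : bool)%:R * \1_E w.
pose F n (p : PT) : R := steps T n (fun j => a n j p.2 : R^o) p.1.
apply: (@approximable_cvg _ _ _ mu _ simple_fun_meas _ (fun=> 1) F) => //.
- move=> n; apply: approximableV; first exact: simple_fun_meas.
  exists n, 1, (a n); split => // k kn; split.
    rewrite /a; case: (boolP (s <= grid T n k < t)) => [/andP[sk _]|_].
      apply: (measurable_funM (T := FT (grid T n k))); first exact: measurable_cst.
      by apply: fmeas_indic; exact: (filtration_le sk).
    by under eq_fun do rewrite mul0r; exact: measurable_cst.
  move=> w; rewrite /a indicE normrM; case: (_ && _); case: (_ \in _); rewrite ?normr1 ?normr0 ?mulr1 ?mulr0//.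
- move=> [r w]; have [rT|rT] := boolP (0 < r <= T); last first.
    apply: cvg_near_cst; apply: nearW => n; rewrite /F/= steps_out// indicE memNset// GE/= in_itv/=.
    move=> [/andP[h1 h2] _]; move/negP : rT; apply.
    by rewrite (le_lt_trans s0 h1) (le_trans h2 tT).
  case/andP : (rT) => r0 rT'.
  have [Ew|Ew] := boolP (w \in E); last first.
    apply: cvg_near_cst; apply: nearW => n; rewrite /F/=.
    rewrite indicE memNset ?GE/=; last by case=> _ /mem_set; apply/negP.
    by rewrite /steps big1// => j _; rewrite /a (_ : \1_E w = 0) ?mulr0 ?scaler0// indicE (negbTE Ew).
  (* At a fixed time [r] the approximation is eventually constant: once the mesh is below the
     distance from [r] to an end point smaller than [r], the left end of the cell of [r] lies on the
     same side as [r]. *)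
  have ev x : \forall n \near \oo, x < r -> mesh T n <= r - x.
    have [xr|xr] := ltP x r; last by apply: nearW => n.
    by near=> n => _; near: n; apply: (cvgr_le 0 (mesh_cvg T)); rewrite subr_gt0.
  apply: cvg_near_cst; near=> n.
  have evs : s < r -> mesh T n <= r - s by near: n; exact: ev.
  have evt : t < r -> mesh T n <= r - t by near: n; exact: ev.
  have [k kn kr] := grid_ex n rT; rewrite /F/= (steps_cell T_gt0 (fun j => a n j w : R^o) kn kr).
  rewrite /a !indicE Ew mulr1; congr (_%:R); rewrite GE; case/andP : kr => k1 k2.
  have mn : r - mesh T n <= grid T n k by rewrite gridS in k2; lra.
  have [sr|rs] := ltP s r.
    have sk : s <= grid T n k.
      by apply: le_trans mn; have := evs sr; lra.
    rewrite sk/=; have [rt|tr] := leP r t.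
      rewrite (lt_le_trans k1 rt); congr (nat_of_bool _); apply/esym/mem_set => /=; split; last exact: set_mem.
      by rewrite in_itv/= sr rt.
    have tk : t <= grid T n k.
      by apply: le_trans mn; have := evt tr; lra.
    rewrite ltNge tk/= memNset//= in_itv/= => -[/andP[_ rt] _].
    by have := lt_le_trans tr rt; rewrite ltxx.
  rewrite leNgt (lt_le_trans k1 rs)/= memNset//= in_itv/= => -[/andP[sr _] _].
  by have := lt_le_trans sr rs; rewrite ltxx.
- by apply: (@ing_bounded _ _ _ mu 1) => // x; rewrite normr1.
- move=> n [r w]; have /orP[/eqP->|/eqP->] : (F n (r, w) == 0) || (F n (r, w) == 1).
    apply: (@stepsP _ _ T_gt0 R^o n r (fun v => is_true ((v == 0) || (v == 1)))); first by rewrite eqxx.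
    move=> k _; rewrite /a indicE; case: (_ && _); case: (_ \in _); rewrite ?mulr1 ?mulr0 ?mul1r ?eqxx ?orbT//.
  all: rewrite indicE; case: (_ \in _); rewrite ?subrr ?subr0 ?sub0r ?sqrrN ?expr0n ?expr1n//= ?ler01//.
Unshelve. all: by end_near. Qed.

Lemma one_app : app (fun=> 1).
Proof.
apply: (@simple_fun_null _ (fun p => steps T 0 (fun=> 1 : R^o) p.1)); first exact: measurable_cst.
  by exists 0%N, 1, (fun _ _ => 1); split => // k _; split; [exact: measurable_cst|move=> w; rewrite normr1].
by move=> t w t0; have [k kn kt] := grid_ex 0 t0; rewrite (steps_cell T_gt0 (fun=> 1 : R^o) kn kt).
Qed.

Lemma simple_fun_dense (f : PT -> R) : measurable_fun setT f -> ing mu (fun p => f p ^+ 2) -> app f.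
Proof.
apply: (approximable_L2 mu_fin simple_fun_meas simple_fun_lin simple_fun0 _ rect_closed rect_app one_app).
by [].
Qed.

Lemma simple_dense (b : PT -> rV) (e : R) : 0 < e -> measurable_fun setT b ->
  ing mu (fun p => sqn (b p)) -> exists n K c, simple n K c /\
    (\int[mu]_p (sqn (b p - proc n c p)%R)%:E < e%:E)%E.
Proof.
move=> e0 mb ib.
have mbi i : measurable_fun setT (fun p => b p 0 i : R) by exact: measurable_coordT.
(* The squared errors of the [d] coordinates add up; dividing by [d.+1] keeps the total strictly
   below [e], for [d = 0] as well. *)
have e1 : 0 < e / d.+1%:R by rewrite divr_gt0.
have ai i : exists v, simple_fun v /\ (L2dist2 mu (fun p => b p ord0 i) v < (e / d.+1%:R)%:E)%E.
  have [|_ /(_ _ e1)[v Vv dv]] := @simple_fun_dense (fun p => b p 0 i) (mbi i); last by exists v.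
  apply: (ing_dom _ ib); first exact: measurable_funX.
  by move=> p; rewrite ger0_norm ?sqr_ge0// /sqn (bigD1 i)//= lerDl sumr_ge0// => j _; exact: sqr_ge0.
have [v /all_and2[Vv dv]] := boolp.choice ai.
have [n0 hn0] := boolp.choice (fun i => simple_fun_up (Vv i)).
pose N := \max_i n0 i.
have [K hK] := boolp.choice (fun i => hn0 i N (leq_bigmax i)).
have [a ha] := boolp.choice hK.
pose c j w : rV := \row_i a i j w.
exists N, (\sum_i `|K i|), c; split.
  move=> k kn; split.
    apply: (measurable_fun_rV (A := FT (grid T N k))) => // i.
    apply: (@eq_measurable_fun _ _ (FT (grid T N k)) _ _ (a i k)); first by move=> w _; rewrite mxE.
    by case: ((ha i).1 k kn).
  move=> w i; rewrite mxE (le_trans (((ha i).1 k kn).2 w))// (le_trans (ler_norm _))//.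
  by rewrite (bigD1 i)//= lerDl sumr_ge0.
have vE p i : proc N c p 0 i = v i p.
  by rewrite /proc coord_steps (ha i).2; congr (steps _ _ _ _); apply/funext => j; rewrite mxE.
have -> : (\int[mu]_p (sqn (b p - proc N c p)%R)%:E = \sum_i L2dist2 mu (fun p => b p ord0 i) (v i))%E.
  rewrite /L2dist2 -ge0_integral_sum//.
  - apply: eq_integral => p _; rewrite sumEFin; congr EFin; apply: eq_bigr => i _.
    by rewrite !mxE vE.
  - by move=> i; apply: measurable_L2dist2 => //; exact: simple_fun_meas.
  - by move=> i p _; rewrite lee_fin sqr_ge0.
apply: (@le_lt_trans _ _ (\sum_(i < d) (e / d.+1%:R)%:E)%E).
  by apply: lee_sum => i _; exact: ltW.
rewrite sumEFin sumr_const card_ord lte_fin -[_ *+ _]mulr_natr -mulrA gtr_pMr// mulrC.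
by rewrite ltr_pdivrMr// mul1r ltr_nat.
Qed.

End density.
End simple_processes.

(** * Moments of increments and of stochastic sums *)

Section gaussian_moments.
Context (R : realType) (T : R) (d : nat) (T_gt0 : 0 < T).
Local Notation Om := (path_space T d).
Local Notation FT s := (g_sigma_algebraType (@coord_events R T d s)).
Local Notation fm s := (@fmeas R T d _ _ s).
Local Notation rV := 'rV[R]_d.

Lemma nrm1_ge0 (y : rV) : 0 <= nrm1 y. Proof. exact: sumr_ge0. Qed.

Lemma sqn_ge0 (y : rV) : 0 <= sqn y. Proof. by apply: sumr_ge0 => i _; exact: sqr_ge0. Qed.

Lemma nrm1N (y : rV) : nrm1 (- y) = nrm1 y.
Proof. by apply: eq_bigr => i _; rewrite mxE normrN. Qed.

Lemma dot_le_nrm1 (c y : rV) K : (forall i, `|c 0 i| <= K) -> `|dot c y| <= K * nrm1 y.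
Proof.
move=> cK; rewrite /dot (le_trans (ler_norm_sum _ _ _))// mulr_sumr.
by apply: ler_sum => i _; rewrite normrM ler_wpM2r.
Qed.

Lemma dotNr (c y : rV) : dot c (- y) = - dot c y.
Proof. by rewrite /dot -sumrN; apply: eq_bigr => i _; rewrite mxE mulrN. Qed.

Lemma gaussian_sym_int (g : probability rV R) s (F : rV -> \bar R) : 0 < s -> gaussian_law g s ->
  measurable_fun setT F -> (forall y, 0 <= F y)%E ->
  (\int[g]_y F (- y)%R = \int[g]_y F y)%E.
Proof.
move=> s0 hg mF F0.
have mN : measurable_fun setT (fun y : rV => - y) by apply: measurable_oppv; exact: measurable_id.
transitivity (\int[image_measure g mN]_y F y)%E.
  by rewrite /image_measure ge0_integral_pushforward// preimage_setT.
by apply: eq_measure_integral => A mA _; exact: (gaussian_sym s0 hg).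
Qed.

Section process.
Variables (P : probability Om R) (M : R -> Om -> rV).
Hypothesis PM : gbm P M.

Lemma mesh_law n : exists g : probability rV R, gaussian_law g (mesh T n).
Proof.
have [g0 gl gT] := grid_itvS T_gt0 (expn_gt0 2 n : (0 < 2 ^ n)%N).
have [g hg] := gauss_ex PM g0 gl gT.
by exists g; move: hg; rewrite gridS addrAC subrr add0r.
Qed.

Lemma ing_exp_incr n k a : (k < 2 ^ n)%N -> ing P (fun w => expR (a * nrm1 (incr M n k w))).
Proof.
move=> kn; have [g hg] := mesh_law n.
pose h (x : (FT (grid T n k) * rV)%type) := (expR (a * nrm1 x.2))%:E.
have mn : measurable_fun setT (fun y : rV => expR (a * nrm1 y)).
  apply: measurableT_comp; first exact: measurable_expR.
  by apply: measurable_funM; [exact: measurable_cst|exact: measurable_nrm1].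
have mh : measurable_fun setT h by apply/measurable_EFinP; exact: (measurableT_comp mn measurable_snd).
have h0 x : (0 <= h x)%E by rewrite lee_fin expR_ge0.
apply: ing_ge0; [|by move=> w; exact: expR_ge0|].
  exact: (measurableT_comp mn (fmeas_meas (fmeas_incr T_gt0 PM kn))).
rewrite (incr_step T_gt0 PM hg kn mh h0).
apply: (@le_lt_trans _ _ (\int[P]_w (2 ^+ d * expR (a ^+ 2 * mesh T n * d%:R / 2))%:E)%E).
  apply: ge0_le_integral => //.
  - by move=> w _; apply: integral_ge0 => y _; rewrite lee_fin expR_ge0.
  - apply: (@fmeas_meas _ _ _ _ _ (grid T n k)).
    by rewrite /fmeas; exact: (@measurable_fun_fubini_tonelli_F _ _ (FT (grid T n k)) rV R g h mh).
  - by move=> w _; apply: gaussian_exp_nrm1 => //; exact: mesh_gt0.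
by rewrite integral_cst// prob_mass mule1 ltry.
Qed.

Lemma ing_nrm1_incr n k : (k < 2 ^ n)%N -> ing P (fun w => nrm1 (incr M n k w)).
Proof.
move=> kn; apply: (ing_dom _ (ing_exp_incr 1 kn)).
  exact: (measurableT_comp (measurable_nrm1 (d := d)) (fmeas_meas (fmeas_incr T_gt0 PM kn))).
move=> w; rewrite mul1r ger0_norm ?nrm1_ge0//.
by apply: le_trans (expR_ge1Dx _); rewrite lerDr.
Qed.

(** Once the past is frozen the increment has a symmetric law, so the positive and negative parts
    have the same integral. This replaces the martingale property of stochastic sums. *)
Lemma incr_odd n k (H : (FT (grid T n k) * rV)%type -> R) : (k < 2 ^ n)%N ->
  measurable_fun setT H -> (forall w y, H (w, - y) = - H (w, y)) ->
  ing P (fun w => H (w, incr M n k w)) -> Ex P (fun w => H (w, incr M n k w)) = 0.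
Proof.
move=> kn mH oH iH; have [g hg] := mesh_law n.
pose hp x := (Num.max (H x) 0)%:E; pose hn x := (Num.max (- H x) 0)%:E.
have mhp : measurable_fun setT hp by apply/measurable_EFinP; apply: measurable_maxr => //; exact: measurable_cst.
have mhn : measurable_fun setT hn.
  apply/measurable_EFinP; apply: measurable_maxr; last exact: measurable_cst.
  by apply: measurableT_comp => //; exact: oppr_measurable.
have hp0 x : (0 <= hp x)%E by rewrite lee_fin le_max lexx orbT.
have hn0 x : (0 <= hn x)%E by rewrite lee_fin le_max lexx orbT.
have eqpn : (\int[P]_w hp (w, incr M n k w) = \int[P]_w hn (w, incr M n k w))%E.
  rewrite (incr_step T_gt0 PM hg kn mhp hp0) (incr_step T_gt0 PM hg kn mhn hn0).
  apply: eq_integral => w _.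
  rewrite -(gaussian_sym_int (mesh_gt0 T_gt0 n) hg) //; last first.
    exact: (measurableT_comp mhp (measurable_pair1 _)).
  by apply: eq_integral => y _; rewrite /hp oH.
rewrite /Ex /Rintegral integralE.
have -> : (\int[P]_w ((fun w => (H (w, incr M n k w))%:E)^\+ w) = \int[P]_w hp (w, incr M n k w))%E.
  by apply: eq_integral => w _; rewrite funeposE /hp EFin_max.
have -> : (\int[P]_w ((fun w => (H (w, incr M n k w))%:E)^\- w) = \int[P]_w hn (w, incr M n k w))%E.
  by apply: eq_integral => w _; rewrite funenegE /hn EFin_max.
rewrite eqpn; case: (integral _ _ _) => [r| |] //=.
by rewrite subrr.
Qed.

Section stoch.
Variables (n : nat) (K : R) (c : nat -> Om -> rV).
Hypothesis sc : simple n K c.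

Lemma fmeas_dot k : (k < 2 ^ n)%N -> measurable_fun setT (fun w => dot (c k w) (incr M n k w)).
Proof.
move=> kn; apply: measurable_dotv; first exact: (fmeas_meas (sc kn).1).
exact: (fmeas_meas (fmeas_incr T_gt0 PM kn)).
Qed.

Lemma ing_dot k : (k < 2 ^ n)%N -> ing P (fun w => dot (c k w) (incr M n k w)).
Proof.
move=> kn; apply: (ing_dom (fmeas_dot kn) (ingZ K (ing_nrm1_incr kn))) => w.
by apply: dot_le_nrm1; exact: (sc kn).2.
Qed.

Lemma Ex_dot k : (k < 2 ^ n)%N -> Ex P (fun w => dot (c k w) (incr M n k w)) = 0.
Proof.
move=> kn; pose H (x : (FT (grid T n k) * rV)%type) := dot (c k x.1) x.2.
apply: (@incr_odd n k H kn) => //; last exact: ing_dot.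
  apply: measurable_dotv; last exact: measurable_snd.
  exact: (measurableT_comp (f := c k : FT (grid T n k) -> rV) (sc kn).1 measurable_fst).
by move=> w y; rewrite /H/= dotNr.
Qed.

Lemma ing_stoch : ing P (stoch M n c).
Proof. by apply: (@ing_sum _ _ _ P _ (index_enum _) (fun (j : 'I_(2 ^ n)) w => dot (c j w) (incr M n j w))) => j; exact: ing_dot. Qed.

Lemma Ex_stoch : Ex P (stoch M n c) = 0.
Proof.
rewrite /stoch (@Ex_sum _ _ _ P _ (index_enum _) (fun (j : 'I_(2 ^ n)) w => dot (c j w) (incr M n j w))).
  by rewrite big1// => j _; exact: Ex_dot.
by move=> j; exact: ing_dot.
Qed.

Definition qv w : R := \sum_(j < 2 ^ n) mesh T n * sqn (c j w).

(** The complete Girsanov weight, equal to [sexp] at the last grid point but expressed by quantities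
    that do not depend on the grid. *)
Definition wexp w : R := expR (- stoch M n c w - 2^-1 * qv w).

Lemma sexpE w : sexp M n c (2 ^ n) w = wexp w.
Proof.
rewrite /sexp /wexp; congr expR; rewrite /stoch /qv mulr_sumr -sumrN -sumrB.
by apply: eq_bigr => j _; rewrite [_ * mesh _ _]mulrC -[_ / 2]mulrC mulrA.
Qed.

Lemma measurable_stoch : measurable_fun setT (stoch M n c).
Proof. exact: ing_meas ing_stoch. Qed.

Lemma measurable_qv : measurable_fun setT qv.
Proof.
apply: measurable_sumr => j; apply: measurable_funM; first exact: measurable_cst.
by apply: measurable_sqnv; exact: (fmeas_meas (sc (ltn_ord j)).1).
Qed.

Lemma measurable_wexp : measurable_fun setT wexp.
Proof.
apply: measurableT_comp; first exact: measurable_expR.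
apply: measurable_funB; first by apply: measurableT_comp; [exact: oppr_measurable|exact: measurable_stoch].
by apply: measurable_funM; [exact: measurable_cst|exact: measurable_qv].
Qed.

Lemma qv_bound w : 0 <= qv w <= T * (d%:R * K ^+ 2).
Proof.
have m0 := mesh_gt0 T_gt0 n; apply/andP; split.
  by apply: sumr_ge0 => j _; rewrite mulr_ge0 ?sqn_ge0// ltW.
rewrite /qv (le_trans (ler_sum (G := fun=> mesh T n * (d%:R * K ^+ 2)) _ _))//.
  move=> j _; rewrite ler_pM2l// /sqn (le_trans (ler_sum (G := fun=> K ^+ 2) _ _))//.
    move=> i _; have h := (sc (ltn_ord j)).2 w i.
    by rewrite -real_normK ?num_real// ler_sqr ?nnegrE// (le_trans _ h).
  by rewrite sumr_const card_ord mulr_natl.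
have mT : mesh T n *+ 2 ^ n = T.
  by rewrite -mulr_natr /mesh natrX divfK// gt_eqF// pow2_gt0.
by rewrite sumr_const card_ord -mulrnAl mT.
Qed.

End stoch.
End process.
End gaussian_moments.

(** * Girsanov's theorem for simple drifts *)

Section shift_law.
Context (R : realType) (T : R) (d : nat) (T_gt0 : 0 < T).
Local Notation Om := (path_space T d).
Local Notation FT s := (g_sigma_algebraType (@coord_events R T d s)).
Local Notation fm s := (@fmeas R T d _ _ s).
Local Notation rV := 'rV[R]_d.

(* Tested against functions, as [M] is not bundled as a measurable map. *)
Definition start_law (muin : probability rV R) (P : probability Om R) (M : R -> Om -> rV) :=
  forall F : rV -> \bar R, measurable_fun setT F -> (forall x, 0 <= F x)%E ->
    (\int[P]_w F (M 0%R w) = \int[muin]_x F x)%E.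

Lemma start_law_marginal muin (P : probability Om R) : same_law (marginal P 0) muin ->
  start_law muin P (@X R T d).
Proof.
move=> h F mF F0; rewrite -(ge0_integral_distribution (P := P) (@X R T d 0 : {mfun Om >-> rV}) mF F0).
by apply: eq_measure_integral => A mA _; exact: h.
Qed.

Lemma wiener_gbm muin (Q : probability Om R) : is_wiener muin Q ->
  gbm Q (@X R T d) /\ start_law muin Q (@X R T d).
Proof.
move=> [h1 h2]; split; last exact: start_law_marginal.
by split => // t t0; apply: fmeas_X; case/andP: t0 => -> _; rewrite lexx.
Qed.

Definition cyl N (A : nat -> set rV) : set Om :=
  [set w | forall k, (k <= 2 ^ N)%N -> A k (X (grid T N k) w)].

Definition cyls : set (set Om) :=
  [set E | exists N A, (forall k, measurable (A k)) /\ E = cyl N A].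

(** Even points of the next grid are the old points; at the odd ones the condition is the whole
    space. *)
Lemma cyl_up N m A : (N <= m)%N -> (forall k, measurable (A k)) ->
  exists A', (forall k, measurable (A' k)) /\ cyl N A = cyl m A'.
Proof.
move=> Nm mA; elim: m Nm => [|m ih]; first by rewrite leqn0 => /eqP ->; exists A.
rewrite leq_eqVlt => /predU1P[<-|]; first by exists A.
rewrite ltnS => /ih[A' [mA' ->]]; exists (fun k => if odd k then setT else A' k./2).
split; first by move=> k; case: ifP.
apply/seteqP; split => w h k km.
  case: ifPn => // ok; have k2 : k = k./2.*2 by rewrite -[LHS]odd_double_half (negbTE ok).
  have -> : grid T m.+1 k = grid T m k./2 by rewrite {1}k2 grid_double.
  by apply: h; rewrite leq_half_double -mul2n -expnS (leq_trans km).
have := h k.*2; rewrite odd_double doubleK grid_double; apply.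
by rewrite expnS mul2n leq_double.
Qed.

Lemma cyls_setI : setI_closed cyls.
Proof.
move=> _ _ [N [A [mA ->]]] [N' [A' [mA' ->]]].
have [B [mB ->]] := cyl_up (leq_maxl N N') mA; have [B' [mB' ->]] := cyl_up (leq_maxr N N') mA'.
exists (maxn N N'), (fun k => B k `&` B' k); split; first by move=> k; exact: measurableI.
by apply/seteqP; split => w; [move=> [h h'] k km; split; [exact: h|exact: h']|
  move=> h; split => k km; case: (h k km)].
Qed.

Lemma cylT : cyls setT.
Proof. by exists 0%N, (fun=> setT); split => //; apply/seteqP; split. Qed.

Lemma measurable_cyl N A : (forall k, measurable (A k)) -> measurable (cyl N A).
Proof.
move=> mA; rewrite (_ : cyl N A = \bigcap_k (if (k <= 2 ^ N)%N then X (grid T N k) @^-1` A k else setT)).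
  apply: bigcapT_measurable => k; case: ifP => // _.
  by rewrite -[X in measurable X]setTI; exact: measurable_X.
apply/seteqP; split => w h k; first by move=> _; case: ifP => // km; exact: h.
by move=> km; have := h k I; rewrite km.
Qed.

Lemma cyls_gen : @measurable _ Om = <<s cyls >>.
Proof.
apply/seteqP; split=> [E mE|].
  have : measurable_fun setT (id : g_sigma_algebraType cyls -> Om).
    apply: (measurable_path_grid T_gt0) => // n k kn _ B mB; rewrite setTI.
    apply: sub_sigma_algebra; exists n, (fun j => if j == k then B else setT); split.
      by move=> j; case: ifP.
    apply/seteqP; split=> [w Bw j jn|w /(_ k kn)]; last by rewrite eqxx.
    by case: eqP => // ->.
  by move=> /(_ measurableT _ mE); rewrite setTI.
apply: smallest_sub; first exact: sigma_algebra_measurable.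
by move=> _ [N [A [mA ->]]]; exact: measurable_cyl.
Qed.

Section shift.
Variables (muin : probability rV R) (P Q : probability Om R) (M : R -> Om -> rV) (Y : {mfun Om >-> Om}).
Hypotheses (PM : gbm P M) (PM0 : start_law muin P M).
Hypothesis PY : {ae P, forall w, forall t, 0 <= t <= T -> X t (Y w) = M t w}.
Hypothesis Qw : is_wiener muin Q.
Variables (n : nat) (K : R) (c : nat -> Om -> rV).
Hypothesis sc : simple n K c.

Lemma continuous_sum (s : seq nat) (F : nat -> R -> rV) :
  (forall j, continuous (F j)) -> continuous (fun t => \sum_(j <- s) F j t).
Proof.
move=> cF; elim: s => [|j s ih].
  by rewrite (_ : (fun _ => _) = (fun=> 0)); [exact: cst_continuous|apply/funext => t; rewrite big_nil].
rewrite (_ : (fun _ => _) = (fun t => F j t + \sum_(j <- s) F j t)); last by apply/funext => t; rewrite big_cons.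
by move=> t; apply: cvgD; [exact: cF|exact: ih].
Qed.

Lemma continuous_cumul w : continuous (fun t => cumul n c t w).
Proof.
rewrite (_ : (fun _ => _) = (fun t => \sum_(j <- iota 0 (2 ^ n)) tincr T n j t *: c j w)); last first.
  by apply/funext => t; rewrite /cumul -(big_mkord xpredT (fun j => tincr T n j t *: c j w)) /index_iota subn0.
apply: continuous_sum => j t; apply: cvgZr_tmp.
by apply: cvgB; apply: (continuous_min (f := id)); try exact: cvg_id; exact: cvg_cst.
Qed.

Lemma continuous_shift w : continuous (fun t => X (clamp T t) (Y w) + cumul n c (clamp T t) w).
Proof.
move=> t; apply: cvgD; first exact: continuous_path.
by apply: (@continuous_comp _ _ _ (clamp T) (fun t => cumul n c t w)); [exact: continuous_clamp|exact: continuous_cumul].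
Qed.

(** The path with driving noise [M], represented by the path-valued version [Y], and drift [c]. *)
Definition shift w : Om := mkpath T (@continuous_shift w).

Lemma X_shift t w : 0 <= t <= T -> X t (shift w) = X t (Y w) + cumul n c t w.
Proof. by move=> t0; rewrite /shift X_mkpath// clamp_id. Qed.

Lemma measurable_cumul t : measurable_fun setT (cumul n c t).
Proof.
apply: measurable_sumv => j; apply: measurable_scalev; first exact: measurable_cst.
exact: (fmeas_meas (sc (ltn_ord j)).1).
Qed.

Lemma measurable_shift : measurable_fun setT shift.
Proof.
apply: (measurable_path T_gt0) => // t t0; under eq_fun do rewrite X_shift//.
apply: measurable_addv; last exact: measurable_cumul.
by apply: measurableT_comp; [exact: measurable_X|exact: measurable_funP].
Qed.

Let wexp0 w : 0 <= wexp M n c w. Proof. exact: expR_ge0. Qed.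

(* Girsanov for a simple drift: under the density [wexp], the shifted path is a
   Wiener process. *)
Lemma shift_measure E : measurable E ->
  image_measure (weighted P (measurable_wexp T_gt0 PM sc) wexp0) measurable_shift E = Q E.
Proof.
move=> mE; have [QX Q0] := wiener_gbm Qw.
set m1 := image_measure _ _.
have eqc E' : cyls E' -> m1 E' = Q E'.
  move=> [N0 [A0 [mA0 ->]]].
  have [A [mA ->]] := cyl_up (leq_maxl N0 n) mA0; set N := maxn N0 n.
  have [c' [sc' pc' mc']] := refine_simple T_gt0 sc (leq_maxr N0 n : (n <= N)%N).
  have [g hg] := mesh_law T_gt0 PM N.
  have wE w : wexp M n c w = sexp M N c' (2 ^ N) w.
    rewrite sexpE /wexp -mc'; congr (expR (_ - _ * _)).
    by rewrite /qv -(qv_proc T_gt0) -(qv_proc T_gt0); apply: eq_Rintegral => t _; rewrite pc'.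
  have cE k w : (k <= 2 ^ N)%N -> cumul n c (grid T N k) w = mesh T N *: \sum_(j < k) c' j w.
    move=> kN; rewrite -(cumul_grid T_gt0)// -!(cumulE T_gt0); last 2 first.
    - by have /andP[] := grid_itv T_gt0 kN.
    - by have /andP[] := grid_itv T_gt0 kN.
    by apply/rowP => i; rewrite !mxE; apply: eq_Rintegral => t _; rewrite pc'.
  (* Both laws are reduced to the same number [val], which involves only the starting law and the
     Gaussian transition: [P] with the drift [c'] and its weight, [Q] with zero drift. *)
  have lhs : (\int[P]_w ((sexp M N c' (2 ^ N) w * \prod_(k < 2 ^ N) \1_(A k) (shifted M N c' k w))%:E *
       (\1_(A (2 ^ N)%N) (shifted M N c' (2 ^ N) w))%:E) = val g A muin (2 ^ N) (EFin \o \1_(A (2 ^ N)%N)))%E.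
    apply: (grid_law T_gt0 PM hg sc' mA PM0) => //.
      by apply/measurable_EFinP; exact: measurable_indic.
    by move=> x; rewrite lee_fin.
  have s0 : simple N 0 (fun (_ : nat) (_ : Om) => 0 : rV).
    by move=> k _; split; [exact: measurable_cst|move=> w i; rewrite mxE normr0].
  have rhs : (\int[Q]_w ((sexp (@X R T d) N (fun _ _ => 0) (2 ^ N) w * \prod_(k < 2 ^ N) \1_(A k) (shifted (@X R T d) N (fun _ _ => 0) k w))%:E *
       (\1_(A (2 ^ N)%N) (shifted (@X R T d) N (fun _ _ => 0) (2 ^ N) w))%:E) = val g A muin (2 ^ N) (EFin \o \1_(A (2 ^ N)%N)))%E.
    apply: (grid_law T_gt0 QX hg s0 mA Q0) => //.
      by apply/measurable_EFinP; exact: measurable_indic.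
    by move=> x; rewrite lee_fin.
  have prodE (f : nat -> rV) : \prod_(k < 2 ^ N) (\1_(A k) (f k) : R) * \1_(A (2 ^ N)%N) (f (2 ^ N)%N) =
      if `[< forall k, (k <= 2 ^ N)%N -> A k (f k) >] then 1 else 0.
    rewrite -(big_ord_recr (2 ^ N) (fun k => \1_(A k) (f k) : R)); case: asboolP => h.
      by rewrite big1// => k _; rewrite indicE mem_set//; apply: h; rewrite -ltnS.
    move/existsNP : h => [k /not_implyP[kN Ak]].
    have kN' : (k < (2 ^ N).+1)%N by rewrite ltnS.
    by rewrite (bigD1 (Ordinal kN'))//= indicE memNset// mul0r.
  have mC := measurable_cyl N mA.
  have mSC : measurable (shift @^-1` cyl N A) by rewrite -[X in measurable X]setTI; exact: measurable_shift.
  transitivity (val g A muin (2 ^ N) (EFin \o \1_(A (2 ^ N)%N))).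
    rewrite -lhs; change (\int[P]_(w in shift @^-1` cyl N A) (wexp M n c w)%:E = 
      \int[P]_w ((sexp M N c' (2 ^ N) w * \prod_(k < 2 ^ N) \1_(A k) (shifted M N c' k w))%:E *
       (\1_(A (2 ^ N)%N) (shifted M N c' (2 ^ N) w))%:E))%E.
    rewrite integral_mkcond.
    have msx := fmeas_meas (fmeas_sexp T_gt0 PM sc' (leqnn _)).
    apply: ae_eq_integral => //.
    + apply/(measurable_restrictT _ mSC); apply: measurable_funTS; apply/measurable_EFinP.
      exact: (measurable_wexp T_gt0 PM sc).
    + apply/measurable_EFinP.
      have msh k : (k <= 2 ^ N)%N -> measurable_fun setT (fun w => \1_(A k) (shifted M N c' k w) : R).
        move=> kN; apply: (measurable_indic_comp (B := rV)) => //.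
        exact: (fmeas_meas (fmeas_shifted T_gt0 PM sc' kN (leqnn _))).
      apply: measurable_funM; last exact: msh.
      apply: measurable_funM => //; apply: (measurable_prodr _ (F := fun (k : 'I_(2 ^ N)) w => \1_(A k) (shifted M N c' k w))) => k.
      by apply: msh; exact: ltnW.
    + apply: filterS PY => w hw _; rewrite -EFinM -mulrA.
      have /= -> := prodE (fun k => shifted M N c' k w); rewrite patchE.
      have SE k : (k <= 2 ^ N)%N -> X (grid T N k) (shift w) = shifted M N c' k w.
        by move=> kN; have h := grid_itv T_gt0 kN; rewrite X_shift// hw// cE.
      case: asboolP => h.
        by rewrite mem_set ?mulr1 ?wE// => k kN; rewrite SE//; exact: h.
      rewrite memNset ?mulr0// => h'; apply: h => k kN; rewrite -SE//; exact: h'.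
  rewrite -rhs -[RHS]mul1e -[RHS]integral_cst// [RHS]integral_mkcond.
  apply: eq_integral => w _; rewrite -EFinM -mulrA.
  have /= -> := prodE (fun k => shifted (@X R T d) N (fun _ _ => 0) k w).
  have -> : sexp (@X R T d) N (fun (_ : nat) (_ : Om) => 0) (2 ^ N) w = 1.
    rewrite /sexp big1 ?expR0// => j _.
    by rewrite /dot /sqn !big1 ?mul0r ?oppr0 ?addr0// => i _; rewrite mxE ?mul0r ?expr0n.
  have SE k : shifted (@X R T d) N (fun (_ : nat) (_ : Om) => 0) k w = X (grid T N k) w.
    by rewrite /shifted big1// scaler0 addr0.
  rewrite mul1r patchE; case: asboolP => h.
    by rewrite mem_set// => k kN; rewrite -SE; exact: h.
  by rewrite memNset// => h'; apply: h => k kN; rewrite SE; exact: h'.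
apply: (measure_unique cyls (fun=> setT) cyls_gen cyls_setI) => //.
- by move=> _; exact: cylT.
- by rewrite bigcup_const.
- by move=> _; rewrite eqc ?prob_mass ?ltry//; exact: cylT.
Qed.

Lemma shift_integral (F : Om -> \bar R) : measurable_fun setT F -> (forall w, 0 <= F w)%E ->
  (\int[P]_w (F (shift w) * (wexp M n c w)%:E) = \int[Q]_w F w)%E.
Proof.
move=> mF F0; rewrite -(eq_measure_integral _ (fun E mE _ => shift_measure mE)).
rewrite /image_measure ge0_integral_pushforward//; last exact: measurable_shift.
rewrite preimage_setT integral_weighted//; last by move=> w; exact: F0.
by apply: measurableT_comp => //; exact: measurable_shift.
Qed.

End shift.
End shift_law.

(** * Bounded Lipschitz functionals of the path *)

Section lipschitz_functionals.
Context (R : realType) (T : R) (d : nat) (T_gt0 : 0 < T).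
Local Notation Om := (path_space T d).
Implicit Types f g : Om -> R.

(** The Lipschitz condition is tested against any uniform bound [r] on the distance of the
    coordinates. This matches the way the distance between a path and its approximation is
    estimated, by a time integral. *)
Definition pathlip : set (Om -> R) := [set f : Om -> R | [/\ measurable_fun setT f,
  exists K : R, forall w, `|f w| <= K &
  exists2 L : R, 0 <= L & forall (w w' : Om) (r : R), 0 <= r ->
    (forall t i, 0 <= t <= T -> `|X t w 0 i - X t w' 0 i| <= r) -> `|f w - f w'| <= L * r]].

Lemma pathlip_meas f : pathlip f -> measurable_fun setT f. Proof. by case. Qed.

Lemma pathlip_cst k : pathlip (fun=> k).
Proof.
split; [exact: measurable_cst|by exists (`|k|)|exists 0 => // w w' r _ _].
by rewrite subrr normr0 mul0r.
Qed.

Lemma pathlip_lin (a : R) f g : pathlip f -> pathlip g -> pathlip (fun w => a * f w + g w).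
Proof.
move=> [mf [K fK] [L L0 fL]] [mg [K' gK] [L' L0' gL]]; split.
- by apply: measurable_funD => //; apply: measurable_funM => //; exact: measurable_cst.
- by exists (`|a| * K + K') => w; rewrite (le_trans (ler_normD _ _))// lerD// normrM ler_wpM2l.
- exists (`|a| * L + L'); first by rewrite addr_ge0// mulr_ge0.
  move=> w w' r r0 h; rewrite (_ : _ - _ = a * (f w - f w') + (g w - g w')); last by ring.
  rewrite (le_trans (ler_normD _ _))// mulrDl lerD//; last exact: gL.
  by rewrite normrM -mulrA ler_wpM2l//; exact: fL.
Qed.

Lemma pathlip_mul f g : pathlip f -> pathlip g -> pathlip (fun w => f w * g w).
Proof.
move=> [mf [K fK] [L L0 fL]] [mg [K' gK] [L' L0' gL]]; split.
- exact: measurable_funM.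
- by exists (K * K') => w; rewrite normrM ler_pM.
have K0 : 0 <= K by apply: le_trans (fK point).
have K0' : 0 <= K' by apply: le_trans (gK point).
exists (L * K' + K * L'); first by rewrite addr_ge0// mulr_ge0.
move=> w w' r r0 h; rewrite (_ : _ - _ = (f w - f w') * g w + f w' * (g w - g w')); last by ring.
rewrite [leRHS]mulrDl (le_trans (ler_normD _ _))// !normrM lerD//.
  by rewrite [leRHS]mulrAC ler_pM//; exact: fL.
by rewrite -mulrA ler_pM//; exact: gL.
Qed.

Lemma clip_lip (a b x y : R) : `|Num.max a (Num.min b x) - Num.max a (Num.min b y)| <= `|x - y|.
Proof.
have h1 := ler_norm (x - y); have h2 := ler_norm (y - x); rewrite distrC in h2.
rewrite /Num.max /Num.min ler_norml.
by do !case: ifPn; rewrite -?leNgt => *; apply/andP; split; lra.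
Qed.

Lemma measurable_clip (a b : R) (dd : measure_display) (A : measurableType dd) (h : A -> R) :
  measurable_fun setT h -> measurable_fun setT (fun x => Num.max a (Num.min b (h x))).
Proof.
move=> mh; apply: measurable_maxr; first exact: measurable_cst.
by apply: measurable_minr => //; exact: measurable_cst.
Qed.

Lemma clip_bound (a b x : R) : a <= b -> a <= Num.max a (Num.min b x) <= b.
Proof. by move=> ab; rewrite le_max lexx/= ge_max ab ge_min lexx. Qed.

Lemma pathlip_clip (M : R) f : 0 <= M -> pathlip f -> pathlip (fun w => Num.max (- M) (Num.min M (f w))).
Proof.
move=> M0 [mf [K fK] [L L0 fL]]; split.
- exact: measurable_clip.
- by exists M => w; rewrite ler_norml clip_bound//; lra.
- by exists L => // w w' r r0 h; rewrite (le_trans (clip_lip _ _ _ _))// fL.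
Qed.

(** Piecewise linear approximations of the indicator of a half-space; products of them approximate
    finite intersections of half-spaces, which generate the Borel sets. *)
Lemma pathlip_ramp (n : nat) t i (a : R) : 0 <= t <= T ->
  pathlip (fun w => Num.max 0 (Num.min 1 (n%:R * (X t w 0 i - a)))).
Proof.
move=> t0; split.
- apply: measurable_clip; apply: measurable_funM; first exact: measurable_cst.
  by apply: measurable_funB; [apply: measurable_coordT; exact: measurable_X|exact: measurable_cst].
- by exists 1 => w; have := clip_bound (n%:R * (X t w 0 i - a)) ler01; rewrite ler_norml => /andP[h1 h2]; apply/andP; split; lra.
- exists n%:R => // w w' r r0 h; rewrite (le_trans (clip_lip _ _ _ _))//.
  rewrite (_ : _ - _ = n%:R * (X t w 0 i - X t w' 0 i)); last by ring.
  by rewrite normrM ger0_norm// ler_wpM2l// h.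
Qed.

Definition halfspaces : set (set Om) := [set E | exists s : seq (R * 'I_d * R),
  all (fun x => 0 <= x.1.1 <= T) s /\ E = [set w | forall x, x \in s -> x.2 < X x.1.1 w 0 x.1.2]].

Lemma halfspaces_setI : setI_closed halfspaces.
Proof.
move=> _ _ [s [hs ->]] [s' [hs' ->]]; exists (s ++ s'); split; first by rewrite all_cat hs.
apply/seteqP; split => w.
  by move=> [h h'] x; rewrite mem_cat => /orP[]; [exact: h|exact: h'].
by move=> h; split => x xs; apply: h; rewrite mem_cat xs ?orbT.
Qed.

Lemma halfspaceE (s : seq (R * 'I_d * R)) w :
  (\1_([set w : Om | forall x, x \in s -> x.2 < X x.1.1 w 0 x.1.2]) w : R) =
  \prod_(x <- s) (x.2 < X x.1.1 w 0 x.1.2)%R%:R.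
Proof.
rewrite indicE; have [h|] := boolP (all (fun x => x.2 < X x.1.1 w 0 x.1.2) s).
  rewrite mem_set; last by move=> x xs; exact: (allP h).
  by rewrite big_seq big1// => x xs; rewrite (allP h _ xs).
move=> /allPn[x xs hx]; rewrite memNset; last by move=> /(_ x xs); apply/negP.
by apply/esym/eqP; rewrite (big_rem x)//= (negbTE hx) mul0r.
Qed.

Lemma halfspaces_gen : @measurable _ Om = <<s halfspaces >>.
Proof.
apply/seteqP; split=> [E mE|].
  have : measurable_fun setT (id : g_sigma_algebraType halfspaces -> Om).
    apply: (measurable_path T_gt0) => // t t0; apply: measurable_fun_rV => // i.
    apply: (measurability (@RGenOInfty.G R)); first exact: RGenOInfty.measurableE.
    move=> _ [_ [a ->] <-]; rewrite setTI; apply: sub_sigma_algebra.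
    exists [:: (t, i, a)]; split; first by rewrite /= t0.
    apply/seteqP; split => w /=; rewrite in_itv/= andbT.
      by move=> aw x; rewrite mem_seq1 => /eqP ->.
    by move=> /(_ (t, i, a)); apply; rewrite mem_seq1.
  by move=> /(_ measurableT _ mE); rewrite setTI.
apply: smallest_sub; first exact: sigma_algebra_measurable.
move=> _ [s [hs ->]].
rewrite (_ : mkset _ = \big[setI/setT]_(x <- s) ((fun w => X x.1.1 w 0 x.1.2) @^-1` `]x.2, +oo[)).
  apply: big_ind => //; first by move=> *; exact: measurableI.
  move=> x _; rewrite -[X in measurable X]setTI.
  by apply: (measurable_coordT (A := Om)) => //; exact: measurable_X.
rewrite -bigcap_seq; apply/seteqP; split => w h x /= xs; have := h x xs.
  by rewrite in_itv/= andbT.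
by rewrite /= in_itv/= andbT.
Qed.

Variable mu : {measure set Om -> \bar R}.
Hypothesis mu_fin : (mu setT < +oo)%E.

Lemma halfspaces_app E : halfspaces E -> approximable mu pathlip (\1_E).
Proof.
move=> hE; have mE : measurable E by rewrite halfspaces_gen; exact: sub_sigma_algebra.
case: hE => s [hs EE].
pose F (n : nat) (w : Om) : R := \prod_(x <- s) Num.max 0 (Num.min 1 (n%:R * (X x.1.1 w 0 x.1.2 - x.2))).
have F01 n w : 0 <= F n w <= 1.
  rewrite /F; elim: (s) => [|x s' ih]; first by rewrite big_nil ler01 lexx.
  rewrite big_cons; have := clip_bound (n%:R * (X x.1.1 w 0 x.1.2 - x.2)) ler01.
  by case/andP : ih => h1 h2 /andP[h3 h4]; rewrite mulr_ge0//= mulr_ile1.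
apply: (@approximable_cvg _ _ _ mu _ pathlip_meas _ (fun=> 1) F).
- exact: measurable_indic.
- move=> n; apply: approximableV; first exact: pathlip_meas.
  rewrite /F; elim: s hs {EE F01 F} => [_|x s ih /= /andP[hx hs]].
    by under eq_fun do rewrite big_nil; exact: pathlip_cst.
  under eq_fun do rewrite big_cons; apply: pathlip_mul; last exact: ih.
  exact: pathlip_ramp.
- move=> w; rewrite EE halfspaceE /F; elim: (s) => [|x s' ih].
    by under eq_fun do rewrite big_nil; rewrite big_nil; exact: cvg_cst.
  under eq_fun do rewrite big_cons; rewrite big_cons; apply: cvgM => //.
  have [h|h] := ltP x.2 (X x.1.1 w 0 x.1.2); last first.
    apply: cvg_near_cst; apply: nearW => n /=.
    by apply/max_idPl; rewrite ge_min; apply/orP; right; rewrite mulr_ge0_le0// subr_le0.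
  apply: cvg_near_cst; near=> n.
  have n1 : 1 <= n%:R * (X x.1.1 w 0 x.1.2 - x.2).
    rewrite -ler_pdivrMr ?subr_gt0// div1r.
    near: n; exact: nbhs_infty_ger.
  by rewrite min_l//; apply/max_idPr; exact: ler01.
- by apply: (@ing_bounded _ _ _ mu 1) => // x; rewrite normr1.
- move=> n w; have /andP[h1 h2] := F01 n w; rewrite indicE; case: (_ \in _) => /=; nra.
Unshelve. all: by end_near. Qed.

Lemma pathlip_dense f : measurable_fun setT f -> ing mu (fun x => f x ^+ 2) ->
  approximable mu pathlip f.
Proof.
apply: (approximable_L2 mu_fin pathlip_meas pathlip_lin (pathlip_cst 0) halfspaces_gen
  halfspaces_setI halfspaces_app).
by apply: approximableV; [exact: pathlip_meas|exact: pathlip_cst].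
Qed.

End lipschitz_functionals.

(** * Girsanov's entropy bound *)

Section girsanov.
Context (R : realType) (T : R) (d : nat) (T_gt0 : 0 < T).
Local Notation Om := (path_space T d).
Local Notation rV := 'rV[R]_d.
Local Notation leb := (@lebesgue_measure R).
Local Notation PT :=
  (g_sigma_algebraType (predictable_rectangles T (@canonical_filtration R T d))).
Local Notation PTm P := (@PTm R T d T_gt0 P).

(** Removes an error proportional to [e] whatever the sign of [C]. The range is limited to [e < 1],
    so that powers of [e] may be bounded by [e] beforehand. *)
Lemma le_vanish (x y C : R) : (forall e, 0 < e < 1 -> x <= y + C * e) -> x <= y.
Proof.
move=> h; rewrite leNgt; apply/negP => yx.
pose D := `|C| + 1; have D0 : 0 < D by rewrite ltr_wpDl.
pose e := Num.min (2^-1) ((x - y) / (2 * D)).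
have e0 : 0 < e by rewrite lt_min invr_gt0 ltr0n/= divr_gt0// ?subr_gt0// mulr_gt0.
have e1 : e < 1 by rewrite gt_min invf_lt1// ltr1n.
have := h e; rewrite e0 e1 => /(_ isT) hx.
have e2 : e <= (x - y) / (2 * D) by rewrite ge_min lexx orbT.
have : C * e <= D * e.
  by apply: ler_wpM2r; [exact: ltW|rewrite /D; have := ler_norm C; lra].
have : D * e <= (x - y) / 2.
  have -> : (x - y) / 2 = D * ((x - y) / (2 * D)) by field; rewrite gt_eqF.
  by rewrite ler_wpM2l// ltW.
move: hx; lra.
Qed.

Lemma nrm1_le_sqn (e : R) (v : rV) : 0 < e -> nrm1 v <= d%:R * e + sqn v / e.
Proof.
move=> e0; rewrite /nrm1 /sqn mulr_suml.
have -> : d%:R * e = \sum_(i < d) e by rewrite sumr_const card_ord mulr_natl.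
rewrite -big_split/=; apply: ler_sum => i _.
have -> : v 0 i ^+ 2 = `|v 0 i| ^+ 2 by rewrite real_normK ?num_real.
have : 0 <= `|v 0 i| by exact: normr_ge0.
set x := `|_| => x0.
have : x * e <= e ^+ 2 + x ^+ 2 by nra.
rewrite -ler_pdivlMr// mulrDl expr2 mulfK ?gt_eqF// => /le_trans; apply; lra.
Qed.

Lemma sqn_le_eps (e : R) (u v : rV) : 0 < e ->
  sqn v <= (1 + e) * sqn u + (1 + e^-1) * sqn (u - v).
Proof.
move=> e0; rewrite /sqn !mulr_sumr -big_split/=; apply: ler_sum => i _; rewrite !mxE.
set a := u 0 i; set b := v 0 i.
have h : 0 <= (e * a + (a - b)) ^+ 2 / e by rewrite divr_ge0 ?sqr_ge0// ltW.
suff -> : (1 + e) * a ^+ 2 + (1 + e^-1) * (a - b) ^+ 2 = b ^+ 2 + (e * a + (a - b)) ^+ 2 / e.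
  by rewrite lerDl.
by field; rewrite gt_eqF.
Qed.

Variables (muin : probability rV R) (P Q : probability Om R) (M : R -> Om -> rV) (Y : {mfun Om >-> Om}).
Hypotheses (PM : gbm P M) (PM0 : start_law muin P M).
Hypothesis PY : {ae P, forall w, forall t, 0 <= t <= T -> X t (Y w) = M t w}.
Hypothesis Qw : is_wiener muin Q.

(** Jensen's inequality for the exponential of [f] at the shifted path minus the stochastic integral
    and half the quadratic variation: by Girsanov its mean is [E_Q exp f], and the stochastic
    integral has mean zero. *)
Lemma girsanov_simple n (K : R) (c : nat -> Om -> rV) (f : Om -> R) (Mf : R) : simple n K c -> measurable_fun setT f -> (forall w, `|f w| <= Mf) ->
  Ex P (fun w => f (shift T_gt0 Y n c w)) <=
  2^-1 * Ex (PTm P) (fun p => sqn (proc n c p)) + ln (Ex Q (fun w => expR (f w))).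
Proof.
move=> sc mf fM; have mS := measurable_shift T_gt0 Y sc.
have mfS : measurable_fun setT (fun w => f (shift T_gt0 Y n c w)) by exact: measurableT_comp.
have ifS : ing P (fun w => f (shift T_gt0 Y n c w)) by apply: (@ingP_bounded _ _ _ _ Mf _ mfS) => w; exact: fM.
have iqv : ing P (qv n c).
  apply: (@ingP_bounded _ _ _ P (T * (d%:R * K ^+ 2))); first exact: (measurable_qv sc).
  by move=> w; have /andP[h1 h2] := qv_bound T_gt0 sc w; rewrite ger0_norm.
have ist := ing_stoch T_gt0 PM sc.
pose L w := f (shift T_gt0 Y n c w) - stoch M n c w - 2^-1 * qv n c w.
have iL : ing P L by apply: ingB; [exact: ingB|exact: ingZ].
have mexpf : measurable_fun setT (fun w => expR (f w)) by exact: measurableT_comp (@measurable_expR R) mf.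
have expfM w : `|expR (f w)| <= expR Mf.
  by rewrite ger0_norm ?expR_ge0// ler_expR (le_trans (ler_norm _)).
have iexpf : ing Q (fun w => expR (f w)) by exact: (@ingP_bounded _ _ _ _ (expR Mf) _ mexpf).
have expL : (\int[P]_w (expR (L w))%:E = (Ex Q (fun w => expR (f w)))%:E)%E.
  rewrite -(ExE iexpf) -(shift_integral T_gt0 PM PM0 PY Qw sc) //; last exact/measurable_EFinP.
  apply: eq_integral => w _; rewrite -EFinM; congr EFin; rewrite /wexp -expRD; congr expR.
  by rewrite /L; ring.
have mexpL : measurable_fun setT (fun w => expR (L w)) by exact: measurableT_comp (@measurable_expR R) (ing_meas iL).
have iexpL : ing P (fun w => expR (L w)).
  by apply: ing_ge0 => //; rewrite expL ltry.
have ExpL : Ex P (fun w => expR (L w)) = Ex Q (fun w => expR (f w)).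
  by apply: EFin_inj; rewrite -ExE.
pose a := Ex P L.
(* The tangent of the exponential at [a] lies below its graph. *)
have jensen : expR a <= Ex P (fun w => expR (L w)).
  have i1 : ing P (fun=> 1 - a) by apply: (@ingP_bounded _ _ _ P `|1 - a|); [exact: measurable_cst|].
  have : Ex P (fun w => expR a * (L w + (1 - a))) <= Ex P (fun w => expR (L w)).
    apply: le_Ex => //; first by apply: ingZ; exact: ingD.
    move=> w; rewrite -{2}[L w](subrK a) expRD mulrC ler_wpM2r ?expR_ge0//.
    by rewrite (le_trans _ (expR_ge1Dx _))//; lra.
  rewrite ExZ; last exact: ingD.
  by rewrite ExD// Ex_cst -/a addrCA subrr addr0 mulr1.
have -> : Ex P (fun w => f (shift T_gt0 Y n c w)) = a + 2^-1 * Ex (PTm P) (fun p => sqn (proc n c p)).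
  have isp : ing (PTm P) (fun p => sqn (proc n c p)).
    apply: (@ing_bounded _ _ _ (PTm P) (d%:R * K ^+ 2)); first exact: PTm_fin.
      by apply: measurable_sqnv; exact: (measurable_proc T_gt0 sc).
    by move=> p; rewrite ger0_norm ?sqn_ge0//; exact: (sqn_proc_bound T_gt0 sc).
  have [_ <- _] := PTm_fubini isp.
  have -> : Ex P (fun w => \int[leb]_(t in `[0, T]) sqn (proc n c (t, w))) = Ex P (qv n c).
    by rewrite /Ex; apply: eq_Rintegral => w _; rewrite (qv_proc T_gt0).
  rewrite /a /L ExB//; [|exact: ingB|exact: ingZ].
  by rewrite ExB// (Ex_stoch T_gt0 PM sc) ExZ// subr0 subrK.
rewrite addrC lerD2l -ExpL -{1}(expRK a) ler_ln ?posrE ?expR_gt0//.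
exact: lt_le_trans (expR_gt0 a) jensen.
Qed.

Variable beta : PT -> rV.
Hypothesis mbeta : measurable_fun setT beta.
Hypothesis ibeta : ing (PTm P) (fun p => sqn (beta p)).
Hypothesis PX : {ae P, forall w, time_integrable T (fun s => beta (s, w)) /\
  forall t, 0 <= t <= T -> X t w = M t w + time_integral (fun s => beta (s, w)) t}.
Let B := Ex (PTm P) (fun p => sqn (beta p)).

(** The path and its shifted version share the noise and differ by the time integral of [beta - c].
    The Lipschitz constant times the L^1 norm of that difference bounds the error, which is small
    since [c] is close to [beta] in L^2. *)
Lemma girsanov_lip f : pathlip f -> Ex P f <= 2^-1 * B + ln (Ex Q (fun w => expR (f w))).
Proof.
move=> [mf [Mf fM] [L L0 fL]].
apply: (@le_vanish _ _ (2^-1 * B + 1 + L * (d%:R * T + 1))) => e /andP[e0 e1].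
have e20 : 0 < e ^+ 2 by rewrite exprn_gt0.
have [n [K [c [sc dc]]]] := simple_dense T_gt0 (PTm_fin T_gt0 P) (@PTm_null _ _ _ T_gt0 P) e20 mbeta ibeta.
have mpc := measurable_proc T_gt0 sc.
have mdif : measurable_fun setT (fun p : PT => beta p - proc n c p) by exact: measurable_subv.
have msd : measurable_fun setT (fun p : PT => sqn (beta p - proc n c p)) by exact: measurable_sqnv.
have isd : ing (PTm P) (fun p => sqn (beta p - proc n c p)).
  by apply: ing_ge0 => //; [move=> p; exact: sqn_ge0|exact: lt_trans dc (ltry _)].
have Esd : Ex (PTm P) (fun p => sqn (beta p - proc n c p)) <= e ^+ 2.
  by rewrite -lee_fin -ExE// ltW.
have icst k : ing (PTm P) (fun=> k).
  by apply: (@ing_bounded _ _ _ (PTm P) `|k|); [exact: PTm_fin|exact: measurable_cst|].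
have Ecst k : Ex (PTm P) (fun=> k) = k * T.
  by rewrite /Ex /Rintegral (integral_cst (PTm P) measurableT k%:E) PTm_mass.
have mn1 : measurable_fun setT (fun p : PT => nrm1 (beta p - proc n c p)).
  exact: (measurableT_comp (measurable_nrm1 (d := d)) mdif).
have in1 : ing (PTm P) (fun p => nrm1 (beta p - proc n c p)).
  apply: (ing_dom mn1 (ingD (icst (d%:R * e)) (ingZ e^-1 isd))) => p.
  by rewrite ger0_norm ?nrm1_ge0// (le_trans (nrm1_le_sqn _ e0))// [e^-1 * _]mulrC.
have En1 : Ex (PTm P) (fun p => nrm1 (beta p - proc n c p)) <= (d%:R * T + 1) * e.
  apply: (@le_trans _ _ (Ex (PTm P) (fun p => d%:R * e + e^-1 * sqn (beta p - proc n c p)))).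
    apply: le_Ex => //; first by apply: ingD => //; exact: ingZ.
    by move=> p; rewrite (le_trans (nrm1_le_sqn _ e0))// [e^-1 * _]mulrC.
  rewrite ExD//; last exact: ingZ.
  rewrite Ecst ExZ// mulrDl mul1r mulrAC lerD2l mulrC ler_pdivrMr// -expr2//.
have [ir Er aer] := PTm_fubini in1.
pose r w := \int[leb]_(t in `[0, T]) nrm1 (beta (t, w) - proc n c (t, w)).
have mS := measurable_shift T_gt0 Y sc.
have mfS : measurable_fun setT (fun w => f (shift T_gt0 Y n c w)) by exact: measurableT_comp.
have ifS : ing P (fun w => f (shift T_gt0 Y n c w)) by apply: (@ingP_bounded _ _ _ _ Mf _ mfS) => w; exact: fM.
have jf : ing P f by exact: (@ingP_bounded _ _ _ _ Mf _ mf).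
have close : Ex P f <= Ex P (fun w => f (shift T_gt0 Y n c w)) + L * Ex P r.
  rewrite -ExZ// -ExD//; last exact: ingZ.
  apply: ae_le_Ex => //; first by apply: ingD => //; exact: ingZ.
  apply: filterS3 PX PY aer => w [bi hX] hY ni.
  suff : `|f w - f (shift T_gt0 Y n c w)| <= L * r w by have := ler_norm (f w - f (shift T_gt0 Y n c w)); lra.
  have r0 : 0 <= r w by apply: Rintegral_ge0 => t _; exact: nrm1_ge0.
  apply: fL => // t i t0; have t0' : 0 <= t by case/andP : t0.
  rewrite X_shift// hX// hY// -(cumulE T_gt0)// !mxE.
  have mT : measurable (`[0, t]%classic : set (measurableTypeR R)) by exact: measurable_itv.
  have mT' : measurable (`[0, T]%classic : set (measurableTypeR R)) by exact: measurable_itv.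
  have sub : `[0, t]%classic `<=` `[0, T]%classic.
    by move=> s; rewrite /= !in_itv/= => /andP[-> st]; case/andP : t0 => _ tT; exact: le_trans tT.
  have i1 : leb.-integrable `[0, t] (fun s => (beta (s, w) 0 i)%:E) by apply: (integrableS mT' mT sub); exact: bi.
  have i2 : leb.-integrable `[0, t] (fun s => (proc n c (s, w) 0 i)%:E).
    by apply: (integrableS mT' mT sub); exact: time_integrable_proc.
  rewrite opprD addrACA subrr add0r -RintegralB//.
  have i3 : leb.-integrable `[0, t] (EFin \o (fun s => beta (s, w) 0 i - proc n c (s, w) 0 i)).
    by have := integrableB mT i1 i2; apply: eq_integrable.
  have i4 : leb.-integrable `[0, t] (fun s => (nrm1 (beta (s, w) - proc n c (s, w)))%:E).
    exact: (integrableS mT' mT sub).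
  apply: (le_trans (le_normr_Rintegral _ i3)) => //.
  apply: (@le_trans _ _ (\int[leb]_(s in `[0, t]) nrm1 (beta (s, w) - proc n c (s, w)))).
    apply: le_Rintegral => //; first by have := integrable_abse i3; apply: eq_integrable.
    by move=> s _; rewrite /nrm1 (bigD1 i)//= !mxE lerDl sumr_ge0.
  rewrite /r -lee_fin /Rintegral !fineK; [|exact: integrable_fin_num..].
  apply: ge0_subset_integral => //.
    by case/integrableP : ni => + _; exact.
  by move=> s _; rewrite lee_fin nrm1_ge0.
have gs := girsanov_simple sc mf fM.
have isp : ing (PTm P) (fun p => sqn (proc n c p)).
  apply: (@ing_bounded _ _ _ (PTm P) (d%:R * K ^+ 2)); first exact: PTm_fin.
    by apply: measurable_sqnv; exact: (measurable_proc T_gt0 sc).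
  by move=> p; rewrite ger0_norm ?sqn_ge0//; exact: (sqn_proc_bound T_gt0 sc).
have Esp : Ex (PTm P) (fun p => sqn (proc n c p)) <= B + B * e + 2 * e.
  apply: (@le_trans _ _ (Ex (PTm P) (fun p => (1 + e) * sqn (beta p) + (1 + e^-1) * sqn (beta p - proc n c p)))).
    by apply: le_Ex => //; [apply: ingD; exact: ingZ|move=> p; exact: sqn_le_eps].
  rewrite ExD ?ExZ//; [|exact: ingZ..].
  rewrite -/B.
  have : (1 + e^-1) * Ex (PTm P) (fun p => sqn (beta p - proc n c p)) <= (1 + e^-1) * e ^+ 2.
    by rewrite ler_wpM2l// addr_ge0// invr_ge0 ltW.
  have -> : (1 + e^-1) * e ^+ 2 = e ^+ 2 + e by field; rewrite gt_eqF.
  nra.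
rewrite -/r in Er; rewrite Er in close.
have : L * Ex (PTm P) (fun p => nrm1 (beta p - proc n c p)) <= L * ((d%:R * T + 1) * e) by rewrite ler_wpM2l.
lra.
Qed.

Lemma chain4 (x y z u v w q r : R) : x <= y + q -> y <= z + u -> u <= v + w -> w <= r ->
  x <= z + v + (q + r).
Proof. by lra. Qed.

Lemma lin3 (x y z : R) : 0 <= y - 2 * x + z -> 0 <= x -> x <= z + y.
Proof. by lra. Qed.

(** Bounded functionals are replaced by Lipschitz ones clipped at the same bound [Mf]. Clipping
    keeps the exponentials bounded, so L^1 closeness carries over to the exponential moment. *)
Lemma girsanov_entropy : (relative_entropy P Q <= (2^-1 * B)%:E)%E.
Proof.
apply: entropy_le => f Mf mf fM.
have M0 : 0 <= Mf by exact: le_trans (normr_ge0 _) (fM point).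
have mexpf : measurable_fun setT (fun w => expR (f w)) by exact: measurableT_comp (@measurable_expR R) mf.
have iexpf : ing Q (fun w => expR (f w)).
  apply: (@ingP_bounded _ _ _ Q (expR Mf) _ mexpf) => w.
  by rewrite ger0_norm ?expR_ge0// ler_expR (le_trans (ler_norm _)).
set a := Ex Q _; have a0 : expR (- Mf) <= a.
  rewrite -(Ex_cst Q (expR (- Mf))); apply: le_Ex => //.
    by apply: (@ingP_bounded _ _ _ Q (expR (- Mf))); [exact: measurable_cst|move=> w; rewrite ger0_norm ?expR_ge0].
  by move=> w; rewrite ler_expR lerNl (le_trans (ler_norm _))// normrN.
have a_gt0 : 0 < a by exact: lt_le_trans (expR_gt0 _) a0.
apply: (@le_vanish _ _ (2 + 2 * expR Mf / a)) => e /andP[e0 e1].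
(* One approximation must serve the left side under [P] and the exponential moment under [Q], hence
   the sum of the two laws. *)
pose mu : {measure set Om -> \bar R} := measure_add P Q.
have mufin : (mu setT < +oo)%E.
  have -> : mu setT = ((P : {measure set Om -> \bar R}) setT + (Q : {measure set Om -> \bar R}) setT)%E.
    exact: measure_addE.
  by rewrite !prob_mass -EFinD ltry.
have if2 : ing mu (fun w => f w ^+ 2).
  apply: (@ing_bounded _ _ _ mu (Mf ^+ 2)) => //; first exact: measurable_funX.
  by move=> w; rewrite normrX ler_sqr ?nnegrE.
have [_ /(_ (e ^+ 2))] := pathlip_dense T_gt0 mufin mf if2.
rewrite exprn_gt0// => /(_ isT)[g0 lg0 dg0].
pose g w := Num.max (- Mf) (Num.min Mf (g0 w)).
have lg : pathlip g by exact: pathlip_clip.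
have fclip w : f w = Num.max (- Mf) (Num.min Mf (f w)).
  have /andP[h1 h2] : - Mf <= f w <= Mf by rewrite -ler_norml.
  by rewrite min_r// max_r.
have mg : measurable_fun setT g by case: lg.
have gM w : `|g w| <= Mf by rewrite ler_norml clip_bound//; lra.
have part (m : {measure set Om -> \bar R}) : (m setT = 1)%E ->
    (forall h : Om -> \bar R, measurable_fun setT h -> (forall w, 0 <= h w)%E -> \int[m]_w h w <= \int[mu]_w h w)%E ->
    ing m (fun w => `|f w - g w|) /\ Ex m (fun w => `|f w - g w|) <= 2 * e.
  move=> m1 mle; have m2 := measurable_L2dist2 mf (pathlip_meas lg0).
  have mfin : (m setT < +oo)%E by rewrite m1 ltry.
  have d2 : (\int[m]_w ((f w - g0 w) ^+ 2)%:E < (e ^+ 2)%:E)%E.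
    by apply: le_lt_trans dg0; apply: mle => // w; rewrite lee_fin sqr_ge0.
  have i2 : ing m (fun w => (f w - g0 w) ^+ 2).
    by apply: ing_ge0; [exact/measurable_EFinP|move=> w; exact: sqr_ge0|exact: lt_trans d2 (ltry _)].
  have ic : ing m (fun=> e).
    by apply: (@ing_bounded _ _ _ m e) => //; move=> w; rewrite ger0_norm// ltW.
  have i1 : ing m (fun w => `|f w - g w|).
    apply: ing_norm; apply: ingB; [exact: (@ing_bounded _ _ _ m Mf)|exact: (@ing_bounded _ _ _ m Mf)].
  split => //.
  apply: (@le_trans _ _ (Ex m (fun w => e + e^-1 * (f w - g0 w) ^+ 2))).
    apply: le_Ex => //; first by apply: ingD => //; exact: ingZ.
    move=> w; rewrite {1}fclip (le_trans (clip_lip _ _ _ _))//.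
    rewrite -[(f w - g0 w) ^+ 2]real_normK ?num_real//; set x := `|_|.
    have : 0 <= (x - e) ^+ 2 / e by rewrite divr_ge0 ?sqr_ge0// ltW.
    have -> : (x - e) ^+ 2 / e = e^-1 * x ^+ 2 - 2 * x + e by field; rewrite gt_eqF.
    have x0 : 0 <= x by exact: normr_ge0.
    by move=> h; exact: lin3 h x0.
  rewrite ExD//; last exact: ingZ.
  rewrite ExZ//; have -> : Ex m (fun=> e) = e.
    by rewrite /Ex /Rintegral (integral_cst m measurableT e%:E) m1 mule1.
  have : Ex m (fun w => (f w - g0 w) ^+ 2) <= e ^+ 2 by rewrite -lee_fin -ExE// ltW.
  rewrite -(ler_pM2l (x := e^-1)) ?invr_gt0// => h.
  have : e^-1 * e ^+ 2 = e by field; rewrite gt_eqF.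
  lra.
have muE (h : Om -> \bar R) : measurable_fun setT h -> (forall w, 0 <= h w)%E ->
    (\int[mu]_w h w = \int[P]_w h w + \int[Q]_w h w)%E.
  by move=> mh h0; apply: (ge0_integral_measure_add P Q) => //.
have mleP (h : Om -> \bar R) : measurable_fun setT h -> (forall w, 0 <= h w)%E ->
    (\int[P]_w h w <= \int[mu]_w h w)%E.
  by move=> mh h0; rewrite muE//; apply: leeDl; exact: integral_ge0.
have mleQ (h : Om -> \bar R) : measurable_fun setT h -> (forall w, 0 <= h w)%E ->
    (\int[Q]_w h w <= \int[mu]_w h w)%E.
  by move=> mh h0; rewrite muE//; apply: leeDr; exact: integral_ge0.
have [ip Ep] := part P (prob_mass P) mleP; have [iq Eq] := part Q (prob_mass Q) mleQ.
have ig : ing P g by exact: (@ingP_bounded _ _ _ _ Mf _ mg gM).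
have jf : ing P f by exact: (@ingP_bounded _ _ _ _ Mf _ mf fM).
have h1 : Ex P f <= Ex P g + 2 * e.
  apply: (@le_trans _ _ (Ex P (fun w => g w + `|f w - g w|))); last by rewrite ExD// lerD2l.
  apply: le_Ex => //; first exact: ingD.
  by move=> w; have := ler_norm (f w - g w); lra.
have mexpg : measurable_fun setT (fun w => expR (g w)) by exact: measurableT_comp (@measurable_expR R) mg.
have iexpg : ing Q (fun w => expR (g w)).
  apply: (@ingP_bounded _ _ _ Q (expR Mf) _ mexpg) => w.
  by rewrite ger0_norm ?expR_ge0// ler_expR (le_trans (ler_norm _)).
have h2 : Ex Q (fun w => expR (g w)) <= a + expR Mf * (2 * e).
  apply: (@le_trans _ _ (Ex Q (fun w => expR (f w) + expR Mf * `|f w - g w|))).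
    apply: le_Ex => //; first by apply: ingD => //; exact: ingZ.
    move=> w; have e1' := expR_ge1Dx (f w - g w); have p := expR_ge0 (g w).
    have gl : expR (g w) <= expR Mf by rewrite ler_expR (le_trans (ler_norm _)).
    have : expR (f w) = expR (g w) * expR (f w - g w) by rewrite -expRD addrC subrK.
    have n1 := ler_norm (- (f w - g w)); rewrite normrN in n1.
    have n0 : 0 <= `|f w - g w| by []. 
    have n2 : expR (g w) * `|f w - g w| <= expR Mf * `|f w - g w| by rewrite ler_wpM2r.
    have n3 : expR (g w) * (- (f w - g w)) <= expR (g w) * `|f w - g w| by rewrite ler_wpM2l.
    have n4 : expR (g w) * (1 + (f w - g w)) <= expR (g w) * expR (f w - g w) by rewrite ler_wpM2l.
    lra.
  by rewrite ExD//; [rewrite ExZ// lerD2l ler_wpM2l ?expR_ge0|exact: ingZ].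
have h3 := girsanov_lip lg.
set b := Ex Q (fun w => expR (g w)) in h2 h3.
have b0 : 0 < b.
  apply: (@lt_le_trans _ _ (expR (- Mf))); first exact: expR_gt0.
  rewrite -(Ex_cst Q (expR (- Mf))); apply: le_Ex => //.
    by apply: (@ingP_bounded _ _ _ Q (expR (- Mf))); [exact: measurable_cst|move=> w; rewrite ger0_norm ?expR_ge0].
  by move=> w; rewrite ler_expR lerNl (le_trans (ler_norm _))// normrN.
have ba0 : 0 < b / a by rewrite divr_gt0.
have h4 : ln b <= ln a + (b / a - 1).
  have {1}-> : b = a * (b / a) by field; rewrite gt_eqF.
  by rewrite lnM ?posrE// lerD2l; exact: ln_le_subr1.
have h5 : b / a - 1 <= expR Mf / a * (2 * e).
  rewrite lerBlDr ler_pdivrMr// (le_trans h2)// le_eqVlt; apply/orP; left; apply/eqP.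
  by field; rewrite gt_eqF.
have -> : (2 + 2 * expR Mf / a) * e = 2 * e + expR Mf / a * (2 * e) by ring.
exact: chain4 h1 h3 h4 h5.
Qed.

End girsanov.

(** * Girsanov's bound relative to a process with drift *)

Section relative_girsanov.
Context (R : realType) (T : R) (d : nat) (T_gt0 : 0 < T).
Local Notation Om := (path_space T d).
Local Notation FT s := (g_sigma_algebraType (@coord_events R T d s)).
Local Notation fm s := (@fmeas R T d _ _ s).
Local Notation rV := 'rV[R]_d.
Local Notation leb := (@lebesgue_measure R).
Local Notation PT :=
  (g_sigma_algebraType (predictable_rectangles T (@canonical_filtration R T d))).
Local Notation PTm P := (@PTm R T d T_gt0 P).
Local Notation mR := (measurableTypeR R).

Lemma integral_cells n (F : nat -> R -> R) :
  (forall j, (j < 2 ^ n)%N -> leb.-integrable `[0, T] (EFin \o F j)) ->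
  \int[leb]_(t in `[0, T]) (\sum_(j < 2 ^ n) \1_(`]grid T n j, grid T n j.+1]%classic) t * F j t) =
  \sum_(j < 2 ^ n) \int[leb]_(t in `]grid T n j, grid T n j.+1]) F j t.
Proof.
move=> iF; have mT : measurable (`[0, T]%classic : set mR) by exact: measurable_itv.
have mI j : measurable (`]grid T n j, grid T n j.+1]%classic : set mR) by exact: measurable_itv.
have sub (j : 'I_(2 ^ n)) : `]grid T n j, grid T n j.+1]%classic `<=` `[0, T]%classic.
  have [g0 gl gT] := grid_itvS T_gt0 (ltn_ord j).
  by move=> s /=; rewrite !in_itv/= => /andP[h1 h2]; rewrite (le_trans g0 (ltW h1)) (le_trans h2 gT).
have E (j : 'I_(2 ^ n)) : (fun t => (\1_(`]grid T n j, grid T n j.+1]%classic) t * F j t)%:E) =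
    (EFin \o F j) \_ `]grid T n j, grid T n j.+1].
  by apply/funext => t; rewrite patchE indicE; case: (_ \in _); rewrite ?mul1r ?mul0r.
have ii (j : 'I_(2 ^ n)) : leb.-integrable `[0, T] (fun t => (\1_(`]grid T n j, grid T n j.+1]%classic) t * F j t)%:E).
  rewrite E; apply/(integrable_mkcond _ mT); rewrite -patch_setI setIidr//.
  apply/(integrable_mkcond _ (mI j)); exact: (integrableS mT (mI j) (sub j) (iF _ (ltn_ord j))).
rewrite [LHS]/Rintegral; under eq_integral do rewrite -sumEFin.
rewrite (@integral_sum _ _ _ leb _ mT _ _ ii).
rewrite (eq_bigr (fun j : 'I_(2 ^ n) => (\int[leb]_(t in `]grid T n j, grid T n j.+1]) F j t)%:E)) ?sumEFin// => j _.
rewrite E -integral_mkcondr setIidr// /Rintegral fineK//.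
apply: integrable_fin_num => //.
exact: (integrableS mT (mI j) (sub j) (iF _ (ltn_ord j))).
Qed.

(** The exponential martingale of [c]; the stochastic integral has the sign opposite to that in
    [wexp]. *)
Definition gexp (M : R -> Om -> rV) n (c : nat -> Om -> rV) w := expR (stoch M n c w - 2^-1 * qv n c w).

Lemma measurable_gexp (P : probability Om R) (M : R -> Om -> rV) n (K : R) (c : nat -> Om -> rV) : gbm P M -> simple n K c ->
  measurable_fun setT (gexp M n c).
Proof.
move=> PM sc; apply: measurableT_comp; first exact: measurable_expR.
apply: measurable_funB; first exact: (measurable_stoch T_gt0 PM sc).
by apply: measurable_funM; [exact: measurable_cst|exact: (measurable_qv sc)].
Qed.

Lemma gexp_le1 (P : probability Om R) (M : R -> Om -> rV) n (K : R) (c : nat -> Om -> rV) : gbm P M -> simple n K c ->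
  (\int[P]_w (gexp M n c w)%:E <= 1%:E)%E.
Proof.
move=> PM sc; have [g hg] := mesh_law T_gt0 PM n.
pose G k (x : Om * rV) := expR (dot (c k x.1) x.2 - sqn (c k x.1) * mesh T n / 2).
have -> : (\int[P]_w (gexp M n c w)%:E = \int[P]_w (\prod_(k < 2 ^ n) G k (w, incr M n k w))%:E)%E.
  apply: eq_integral => w _; congr EFin; rewrite /gexp /G -expR_sum; congr expR.
  rewrite /stoch /qv mulr_sumr -sumrB; apply: eq_bigr => j _ /=.
  by rewrite [_ * mesh _ _]mulrC -[_ / 2]mulrC mulrA.
have := @prod_bound _ _ _ T_gt0 P M PM n g hg G 1 (2 ^ n) (leqnn _) ler01.
rewrite expr1n; apply.
- move=> k kn; apply: measurableT_comp; first exact: measurable_expR.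
  have mck : fm (grid T n k) (c k) by case: (sc _ kn).
  have mc : measurable_fun setT (fun x : (FT (grid T n k) * rV)%type => c k x.1).
    exact: (measurableT_comp (f := c k : FT (grid T n k) -> rV) mck measurable_fst).
  apply: measurable_funB; first by apply: measurable_dotv => //; exact: measurable_snd.
  apply: measurable_funM; last exact: measurable_cst.
  by apply: measurable_funM; [exact: measurable_sqnv|exact: measurable_cst].
- by move=> k x; exact: expR_ge0.
- move=> k w kn; rewrite /G/=.
  have := gaussian_shift (c k w) (mesh_gt0 T_gt0 n) hg (@measurable_cst _ _ _ _ setT 1%E) (fun=> lee01).
  rewrite [RHS](integral_cst g measurableT 1%E) mul1e prob_mass => <-.
  by rewrite le_eqVlt; apply/orP; left; apply/eqP; apply: eq_integral => y _; rewrite mule1.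
Qed.

Section stoch_X.
Variables (P : probability Om R) (M : R -> Om -> rV).
Hypotheses (PM : gbm P M).
Variable beta : PT -> rV.
Hypothesis mbeta : measurable_fun setT beta.
Hypothesis ibeta : ing (PTm P) (fun p => sqn (beta p)).
Hypothesis PX : {ae P, forall w, time_integrable T (fun s => beta (s, w)) /\
  forall t, 0 <= t <= T -> X t w = M t w + time_integral (fun s => beta (s, w)) t}.
Variables (n : nat) (K : R) (c : nat -> Om -> rV).
Hypothesis sc : simple n K c.

Lemma ing_dot_proc : ing (PTm P) (fun p => dot (proc n c p) (beta p)).
Proof.
have mp := measurable_proc T_gt0 sc.
apply: (@ing_sum _ _ _ (PTm P) _ (index_enum _) (fun i (p : PT) => proc n c p 0 i * beta p 0 i)) => i.
apply: (@ing_mulb _ _ _ (PTm P) K).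
- exact: measurable_coordT.
- by move=> p; exact: (proc_bound T_gt0 sc).
- have mi : measurable_fun setT (fun p : PT => beta p 0 i) by exact: measurable_coordT.
  apply: (ing_dom mi (ingD (@ing_bounded _ _ _ (PTm P) 1 (fun=> 1) (PTm_fin T_gt0 P) (measurable_cst _) _) ibeta)).
    by move=> p; rewrite normr1.
  move=> p; have h : beta p 0 i ^+ 2 <= sqn (beta p).
    by rewrite /sqn (bigD1 i)//= lerDl sumr_ge0// => j _; exact: sqr_ge0.
  by rewrite ler_norml; apply/andP; split; nra.
Qed.

Lemma dot_time_integral (f : R -> rV) (v : rV) (a b : R) : 0 <= a -> a <= b -> b <= T -> time_integrable T f ->
  \int[leb]_(t in `]a, b]) dot v (f t) = dot v (time_integral f b - time_integral f a).
Proof.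
move=> a0 ab bT fi; rewrite /dot.
have mab : measurable (`]a, b]%classic : set mR) by exact: measurable_itv.
have mT : measurable (`[0, T]%classic : set mR) by exact: measurable_itv.
have sub : `]a, b]%classic `<=` `[0, T]%classic.
  by move=> s /=; rewrite !in_itv/= => /andP[h1 h2]; rewrite (le_trans a0 (ltW h1)) (le_trans h2 bT).
have i1 i : leb.-integrable `]a, b] (fun t => (f t 0 i)%:E) by exact: (integrableS mT mab sub (fi i)).
have i2 i : leb.-integrable `]a, b] (fun t => (v 0 i * f t 0 i)%:E).
  by have := integrableZl mab (v 0 i) (i1 i); apply: eq_integrable.
rewrite [LHS]/Rintegral; under eq_integral do rewrite -sumEFin.
rewrite (@integral_sum _ _ _ leb _ mab _ (fun i t => (v 0 i * f t 0 i)%:E) i2).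
rewrite (eq_bigr (fun i => (v 0 i * (time_integral f b - time_integral f a) 0 i)%:E)) ?sumEFin// => i _.
rewrite -[LHS]fineK; last exact: integrable_fin_num.
have -> : fine (\int[leb]_(x in `]a, b]) (v 0 i * f x 0 i)%:E)%E = v 0 i * \int[leb]_(x in `]a, b]) f x 0 i.
  exact: (RintegralZl (v 0 i) mab (i1 i)).
congr (_ * _)%:E; rewrite !mxE; apply/esym.
have m0b : measurable (`[0, b]%classic : set mR) by exact: measurable_itv.
apply: (@Rintegral_itvB _ (fun t => f t 0 i) (BLeft 0) (BRight b) a).
- apply: (integrableS mT m0b) (fi i) => s /=; rewrite !in_itv/= => /andP[-> sb].
  exact: le_trans bT.
- by rewrite bnd_simp.
- by rewrite bnd_simp.
Qed.

Lemma stoch_X : {ae P, forall w, stoch (@X R T d) n c w = stoch M n c w +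
  \int[leb]_(t in `[0, T]) dot (proc n c (t, w)) (beta (t, w))}.
Proof.
apply: filterS PX => w [bi hX].
have dE t : dot (proc n c (t, w)) (beta (t, w)) =
    \sum_(j < 2 ^ n) \1_(`]grid T n j, grid T n j.+1]%classic) t * dot (c j w) (beta (t, w)).
  rewrite /proc; have dot0 : (fun v : rV => dot v (beta (t, w)) : R^o) 0 = 0.
    by rewrite /dot big1// => i _; rewrite mxE mul0r.
  exact: (@steps_map _ _ T_gt0 rV R^o n (fun j => c j w) (fun v => dot v (beta (t, w))) t dot0).
under eq_Rintegral do rewrite dE.
have idot j : leb.-integrable `[0, T] (EFin \o (fun t => dot (c j w) (beta (t, w)))).
  have mT : measurable (`[0, T]%classic : set mR) by exact: measurable_itv.
  have i2 i : leb.-integrable `[0, T] (fun t => (c j w 0 i * beta (t, w) 0 i)%:E).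
    by have := integrableZl mT (c j w 0 i) (bi i); apply: eq_integrable.
  have := @integrable_sum _ _ _ leb _ mT _ (index_enum _) xpredT _ (fun i _ => i2 i).
  by apply: eq_integrable => // t _; rewrite /= sumEFin.
rewrite (integral_cells (F := fun j t => dot (c j w) (beta (t, w)))); last by move=> j _; exact: idot.
rewrite /stoch -big_split/=; apply: eq_bigr => j _.
have [g0 gl gT] := grid_itvS T_gt0 (ltn_ord j).
rewrite dot_time_integral//; last exact: ltW.
rewrite /dot -big_split/=; apply: eq_bigr => i _; rewrite -mulrDr; congr (_ * _).
rewrite /incr !hX ?(ltW (le_lt_trans g0 gl)) ?gT ?g0 ?(le_trans (ltW gl) gT)// !mxE.
ring.
Qed.

Lemma ing_stoch_X : ing P (stoch (@X R T d) n c) /\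
  Ex P (stoch (@X R T d) n c) = Ex (PTm P) (fun p => dot (proc n c p) (beta p)).
Proof.
have [i1 E1 _] := PTm_fubini ing_dot_proc.
have ist := ing_stoch T_gt0 PM sc.
have i2 := ingD ist i1.
have mX : measurable_fun setT (stoch (@X R T d) n c).
  apply: measurable_sumr => j; apply: measurable_dotv; first exact: (fmeas_meas (sc (ltn_ord j)).1).
  by apply: measurable_subv; exact: measurable_X.
split; first by apply: (ing_ae_eq mX _ i2); apply: filterS stoch_X => w ->.
rewrite -E1 (eq_ae_Ex mX (ing_meas i2) stoch_X) ExD//.
by rewrite (Ex_stoch T_gt0 PM sc) add0r.
Qed.

End stoch_X.
Lemma sqn_sub_dot (u v : rV) : 2^-1 * sqn (u - v) = 2^-1 * sqn u - dot v u + 2^-1 * sqn v.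
Proof.
rewrite /sqn /dot !mulr_sumr -sumrB -big_split/=; by apply: eq_bigr => i _; rewrite !mxE; field.
Qed.

(** Follows from [exp (- x) <= 1 / (1 + x)]. It expands [exp (- e exp f)] to second order in
    [relative_girsanov]. *)
Lemma exp_neg_le (x : R) : 0 <= x -> expR (- x) <= 1 - x + x ^+ 2.
Proof.
move=> x0; have h := expR_ge1Dx x; have p : 0 < 1 + x by rewrite ltr_wpDr.
apply: (@le_trans _ _ (1 + x)^-1).
  by rewrite expRN lef_pV2 ?posrE ?expR_gt0.
rewrite -div1r ler_pdivrMr//.
have : (1 - x + x ^+ 2) * (1 + x) = 1 + x ^+ 3 by ring.
by move=> ->; rewrite lerDl exprn_ge0.
Qed.

(** This and the next lemmas carry out the closing linear arithmetic with variables in place of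
    large expectations. *)
Lemma arith5 (f s q u l : R) : f + (s - 2^-1 * q) <= 2^-1 * u + l ->
  f <= 2^-1 * u - s + 2^-1 * q + l.
Proof. by lra. Qed.

Lemma arith1 (x u y v : R) : x <= 1 -> v <= y * 1 -> x - u + v <= 1 + (- u + y).
Proof. by lra. Qed.

Lemma arith2 (e a E H x : R) : - (e * a) <= x + (- (e * E) + e ^+ 2 * H) -> x <= 2^-1 * e ^+ 2 ->
  e * E <= e * (a + (1 + H) * e).
Proof. by move=> h1 h2; have := sqr_ge0 e; lra. Qed.

Lemma arith3 (e B y : R) : e ^+ 2 <= e -> y <= e ^+ 2 + e -> (1 + e) * B + y <= B + B * e + 2 * e.
Proof. by lra. Qed.

Lemma arith4 (f u x y z e B : R) : f <= 2^-1 * u + x -> x <= y + z * e -> u <= B + B * e + 2 * e ->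
  f <= 2^-1 * B + y + (2^-1 * B + 1 + z) * e.
Proof. by lra. Qed.

Section with_wiener.
Variables (muin : probability rV R) (W : probability Om R).
Hypothesis Ww : is_wiener muin W.

(* The data of a weak solution of [dX = beta dt + dM], [M] a Brownian motion. *)
Record weak_solution (P : probability Om R) (beta : PT -> rV) : Prop := WeakSolution {
  weak_ex : exists (M : R -> Om -> rV) (Y : {mfun Om >-> Om}),
    [/\ gbm P M, start_law muin P M,
      {ae P, forall w, forall t, 0 <= t <= T -> X t (Y w) = M t w} &
      {ae P, forall w, time_integrable T (fun s => beta (s, w)) /\
        forall t, 0 <= t <= T -> X t w = M t w + time_integral (fun s => beta (s, w)) t}];
  weak_meas : measurable_fun setT beta;
  weak_ing : ing (PTm P) (fun p => sqn (beta p)) }.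

Let WX := (wiener_gbm Ww).1.

(* [girsanov_entropy] dualized against [f + int c.dX - 1/2 int |c|^2]. *)
Lemma weak_bound (P : probability Om R) beta n (K : R) (c : nat -> Om -> rV) (f : Om -> R) (Mf kap : R) :
  weak_solution P beta -> 0 < kap -> simple n K c -> measurable_fun setT f -> (forall w, `|f w| <= Mf) ->
  Ex W (fun w => gexp (@X R T d) n c w * expR (f w)) <= kap ->
  Ex P f <= Ex (PTm P) (fun p => 2^-1 * sqn (beta p - proc n c p)) + ln kap.
Proof.
move=> [[M [Y [PM PM0 PY PX]]] mb ib] kap0 sc mf fM lekap.
have ent := girsanov_entropy PM PM0 PY Ww mb ib PX.
have [_ dv] := entropy_ge ent.
have [isX EsX] := ing_stoch_X PM mb ib PX sc.
have mg := measurable_gexp WX sc.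
have g0 w : 0 <= gexp (@X R T d) n c w by exact: expR_ge0.
have iW : ing W (gexp (@X R T d) n c).
  by apply: ing_ge0 => //; exact: le_lt_trans (gexp_le1 WX sc) (ltry _).
have mexpf : measurable_fun setT (fun w => expR (f w)) by exact: measurableT_comp (@measurable_expR R) mf.
have eM w : `|expR (f w)| <= expR Mf.
  by rewrite ger0_norm ?expR_ge0// ler_expR (le_trans (ler_norm _)).
have iWf : ing W (fun w => gexp (@X R T d) n c w * expR (f w)).
  have := ing_mulb mexpf eM iW; by congr ing; apply/funext => w; rewrite mulrC.
have isp : ing (PTm P) (fun p => sqn (proc n c p)).
  apply: (@ing_bounded _ _ _ (PTm P) (d%:R * K ^+ 2)); first exact: PTm_fin.
    by apply: measurable_sqnv; exact: (measurable_proc T_gt0 sc).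
  by move=> p; rewrite ger0_norm ?sqn_ge0//; exact: (sqn_proc_bound T_gt0 sc).
have Eqv : Ex P (qv n c) = Ex (PTm P) (fun p => sqn (proc n c p)).
  have [_ <- _] := PTm_fubini isp.
  by rewrite /Ex; apply: eq_Rintegral => w _; rewrite (qv_proc T_gt0).
have id := ing_dot_proc mb ib sc.
(* Completing the square: the energy of [beta], the cross term from the stochastic integral against
   [X], and the quadratic variation of [c] combine into the distance from [beta] to [c]. *)
have -> : Ex (PTm P) (fun p => 2^-1 * sqn (beta p - proc n c p)) =
    2^-1 * Ex (PTm P) (fun p => sqn (beta p)) - Ex (PTm P) (fun p => dot (proc n c p) (beta p)) +
    2^-1 * Ex (PTm P) (fun p => sqn (proc n c p)).
  transitivity (Ex (PTm P) (fun p => 2^-1 * sqn (beta p) - dot (proc n c p) (beta p) + 2^-1 * sqn (proc n c p))).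
    by rewrite /Ex; apply: eq_Rintegral => p _; exact: sqn_sub_dot.
  rewrite ExD; [|exact: ingB (ingZ _ ib) id|exact: ingZ].
  by rewrite ExB ?ExZ//; exact: ingZ.
have iqv : ing P (qv n c).
  apply: (@ingP_bounded _ _ _ P (T * (d%:R * K ^+ 2))); first exact: (measurable_qv sc).
  by move=> w; have /andP[h1 h2] := qv_bound T_gt0 sc w; rewrite ger0_norm.
have jf : ing P f by exact: (@ingP_bounded _ _ _ _ Mf _ mf fM).
have ig : ing P (fun w => f w + (stoch (@X R T d) n c w - 2^-1 * qv n c w)).
  by apply: ingD => //; apply: ingB => //; exact: ingZ.
have := dv _ kap ig kap0.
have -> : (\int[W]_w (expR (f w + (stoch (@X R T d) n c w - 2^-1 * qv n c w)))%:E <= kap%:E)%E.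
  rewrite (le_trans _ (_ : (Ex W (fun w => gexp (@X R T d) n c w * expR (f w)))%:E <= _)%E) ?lee_fin//.
  by rewrite -(ExE iWf) le_eqVlt; apply/orP; left; apply/eqP/eq_integral => w _; rewrite expRD mulrC.
move=> /(_ isT).
rewrite ExD//; last by apply: ingB => //; exact: ingZ.
rewrite ExB ?ExZ//; last exact: ingZ.
rewrite EsX Eqv; exact: arith5.
Qed.

Variables (P Q : probability Om R) (beta b : PT -> rV).
Hypotheses (Pb : weak_solution P beta) (Qb : weak_solution Q b).
Hypothesis ibP : ing (PTm P) (fun p => sqn (b p)).

Lemma ing_sqnB (m : {measure set PT -> \bar R}) (u v : PT -> rV) : measurable_fun setT u -> measurable_fun setT v ->
  ing m (fun p => sqn (u p)) -> ing m (fun p => sqn (v p)) -> ing m (fun p => sqn (u p - v p)).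
Proof.
move=> mu mv iu iv; apply: (ing_dom _ (ingD (ingZ 2 iu) (ingZ 2 iv))).
  by apply: measurable_sqnv; exact: measurable_subv.
move=> p; rewrite ger0_norm ?sqn_ge0// /sqn !mulr_sumr -big_split/=; apply: ler_sum => i _; rewrite !mxE.
have := sqr_ge0 (u p 0 i + v p 0 i); nra.
Qed.

(** With [c] close to [b], the weight [D = exp(int c.dX - 1/2 int |c|^2)] imitates the density of
    [Q] with respect to Wiener measure. Convergence of densities is bypassed: [weak_bound] for [Q]
    itself, tested against [- e exp f], gives to first order in [e] that [E_W[D exp f]] exceeds
    [E_Q exp f] by O(e). With this bound as [kap], [weak_bound] for [P] concludes. *)
Lemma relative_girsanov :
  (relative_entropy P Q <= (2^-1 * Ex (PTm P) (fun p => sqn (beta p - b p)))%:E)%E.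
Proof.
apply: entropy_le => f Mf mf fM; set B := Ex (PTm P) _.
have [_ mbeta ibeta] := Pb; have [_ mb ibQ] := Qb.
have M0 : 0 <= Mf by exact: le_trans (normr_ge0 _) (fM point).
have mexpf : measurable_fun setT (fun w => expR (f w)) by exact: measurableT_comp (@measurable_expR R) mf.
have efM w : expR (f w) <= expR Mf by rewrite ler_expR (le_trans (ler_norm _)).
have iexpf : ing Q (fun w => expR (f w)).
  by apply: (@ingP_bounded _ _ _ Q (expR Mf) _ mexpf) => w; rewrite ger0_norm ?expR_ge0.
set a := Ex Q _; have a0 : expR (- Mf) <= a.
  rewrite -(Ex_cst Q (expR (- Mf))); apply: le_Ex => //.
    by apply: (@ingP_bounded _ _ _ Q (expR (- Mf))); [exact: measurable_cst|move=> w; rewrite ger0_norm ?expR_ge0].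
  by move=> w; rewrite ler_expR lerNl (le_trans (ler_norm _))// normrN.
have a_gt0 : 0 < a by exact: lt_le_trans (expR_gt0 _) a0.
pose H := expR Mf; have H0 : 0 < H by exact: expR_gt0.
(* The term [H ^+ 2] bounds the second-order part of [exp (- e exp f)], and 1 leaves room for the
   squared error of [c], which is at most [e ^+ 2] before division by [e]. *)
pose C := 1 + H ^+ 2.
have C0 : 0 < C by rewrite /C ltr_wpDr ?sqr_ge0.
apply: (@le_vanish _ _ _ (2^-1 * B + 1 + C / a)) => e /andP[e0 e1].
have e20 : 0 < e ^+ 2 by rewrite exprn_gt0.
(* The process [c] has to be close to [b] under both laws: under [Q] to imitate its density, under
   [P] to compare [beta - c] with [beta - b]. *)
pose mu : {measure set PT -> \bar R} := measure_add (PTm P) (PTm Q).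
have muE (h : PT -> \bar R) : measurable_fun setT h -> (forall w, 0 <= h w)%E ->
    (\int[mu]_w h w = \int[PTm P]_w h w + \int[PTm Q]_w h w)%E.
  by move=> mh h0; apply: (ge0_integral_measure_add (PTm P) (PTm Q)) => //.
have mufin : (mu setT < +oo)%E.
  have -> : mu setT = (PTm P setT + PTm Q setT)%E by exact: measure_addE.
  by rewrite !PTm_mass -EFinD ltry.
have munull (h : PT -> \bar R) : measurable_fun setT h -> (forall p, 0 <= h p)%E ->
    (forall t w, 0 < t <= T -> h (t, w) = 0%E) -> (\int[mu]_p h p = 0)%E.
  move=> mh h0 hn; have hP := PTm_null T_gt0 P mh h0 hn; have hQ := PTm_null T_gt0 Q mh h0 hn.
  by rewrite muE// hP hQ adde0.
have ib : ing mu (fun p => sqn (b p)).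
  have msb : measurable_fun setT (fun p => (sqn (b p))%:E) by apply/measurable_EFinP; exact: measurable_sqnv.
  apply: ing_ge0; [exact: measurable_sqnv|by move=> p; exact: sqn_ge0|].
  rewrite muE//; last by move=> p; rewrite lee_fin sqn_ge0.
  by rewrite (ExE ibP) (ExE ibQ) -EFinD ltry.
have [n [K [c [sc dc]]]] := simple_dense T_gt0 mufin munull e20 mb ib.
have mpc := measurable_proc T_gt0 sc.
have msd : measurable_fun setT (fun p : PT => (sqn (b p - proc n c p))%:E).
  by apply/measurable_EFinP; apply: measurable_sqnv; exact: measurable_subv.
have sd0 p : (0 <= (sqn (b p - proc n c p))%:E)%E by rewrite lee_fin sqn_ge0.
have small (m : {measure set PT -> \bar R}) : (\int[m]_p (sqn (b p - proc n c p))%:E < (e ^+ 2)%:E)%E ->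
    ing m (fun p => sqn (b p - proc n c p)) /\ Ex m (fun p => sqn (b p - proc n c p)) <= e ^+ 2.
  move=> h; have i : ing m (fun p => sqn (b p - proc n c p)).
    by apply: ing_ge0; [exact/measurable_EFinP|move=> p; exact: sqn_ge0|exact: lt_trans h (ltry _)].
  by split => //; rewrite -lee_fin -ExE// ltW.
rewrite muE// in dc.
have [iP EP] : ing (PTm P) (fun p => sqn (b p - proc n c p)) /\ Ex (PTm P) (fun p => sqn (b p - proc n c p)) <= e ^+ 2.
  by apply: small; apply: le_lt_trans dc; apply: leeDl; exact: integral_ge0.
have [iQ EQ] : ing (PTm Q) (fun p => sqn (b p - proc n c p)) /\ Ex (PTm Q) (fun p => sqn (b p - proc n c p)) <= e ^+ 2.
  by apply: small; apply: le_lt_trans dc; apply: leeDr; exact: integral_ge0.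
pose D := gexp (@X R T d) n c.
have mD : measurable_fun setT D by exact: (measurable_gexp WX sc).
have D0 w : 0 <= D w by exact: expR_ge0.
have iD : ing W D by apply: ing_ge0 => //; exact: le_lt_trans (gexp_le1 WX sc) (ltry _).
have D1 : Ex W D <= 1 by rewrite -lee_fin -ExE//; exact: gexp_le1 WX sc.
have iDh : ing W (fun w => D w * expR (f w)).
  have eM w : `|expR (f w)| <= H by rewrite ger0_norm ?expR_ge0.
  by have := ing_mulb mexpf eM iD; congr ing; apply/funext => w; rewrite mulrC.
set E := Ex W (fun w => D w * expR (f w)).
have EQle : E <= a + C * e.
  (* Written as an exponential, so that its logarithm is exactly the second-order expression;
     [1 + x <= exp x] shows that it dominates the expected value. *)
  pose k := expR (- (e * E) + e ^+ 2 * H ^+ 2).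
  have mneg : measurable_fun setT (fun w => - (e * expR (f w))).
    by apply: measurableT_comp; [exact: oppr_measurable|apply: measurable_funM => //; exact: measurable_cst].
  have negM w : `|- (e * expR (f w))| <= e * H.
    rewrite normrN ger0_norm; last by apply: mulr_ge0; [exact: ltW|exact: expR_ge0].
    by apply: ler_wpM2l; [exact: ltW|exact: efM].
  have i2 : ing W (fun w => D w * expR (- (e * expR (f w)))).
    apply: (ing_dom _ iD); first by apply: measurable_funM => //; exact: measurableT_comp (@measurable_expR R) mneg.
    move=> w; rewrite ger0_norm ?mulr_ge0 ?expR_ge0// ler_piMr// expR_le1 oppr_le0.
    by rewrite mulr_ge0 ?expR_ge0// ltW.
  have := @weak_bound Q b n K c (fun w => - (e * expR (f w))) (e * H) k Qb (expR_gt0 _) sc mneg negM.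
  have -> : Ex W (fun w => gexp (@X R T d) n c w * expR (- (e * expR (f w)))) <= k.
    apply: (@le_trans _ _ (Ex W (fun w => D w - e * (D w * expR (f w)) + e ^+ 2 * H ^+ 2 * D w))).
      apply: le_Ex => //; first by apply: ingD; [apply: ingB => //|]; exact: ingZ.
      move=> w; rewrite -/(D w).
      have h := exp_neg_le (mulr_ge0 (ltW e0) (expR_ge0 (f w))).
      have h2 : (e * expR (f w)) ^+ 2 <= e ^+ 2 * H ^+ 2.
        rewrite exprMn; apply: ler_wpM2l; first exact: sqr_ge0.
        by rewrite ler_sqr ?nnegrE ?expR_ge0//; exact: ltW.
      have : D w * expR (- (e * expR (f w))) <= D w * (1 - e * expR (f w) + e ^+ 2 * H ^+ 2).
        by rewrite ler_wpM2l// (le_trans h)// lerD2l.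
      move=> /le_trans; apply; rewrite le_eqVlt; apply/orP; left; apply/eqP; ring.
    rewrite ExD; [|by apply: ingB => //; exact: ingZ|exact: ingZ].
    rewrite ExB//; last exact: ingZ.
    rewrite !ExZ// -/E /k (le_trans _ (expR_ge1Dx _))//.
    have : e ^+ 2 * H ^+ 2 * Ex W D <= e ^+ 2 * H ^+ 2 * 1 by rewrite ler_wpM2l// mulr_ge0 ?sqr_ge0.
    exact: arith1.
  move=> /(_ isT); rewrite /k expRK ExN; last exact: ingZ.
  rewrite !ExZ// -/a => h.
  have : e * E <= e * (a + C * e).
    apply: (arith2 h); by rewrite ler_wpM2l.
  by rewrite ler_pM2l.
have k0 : 0 < a + C * e by rewrite addr_gt0// mulr_gt0.
have := weak_bound Pb k0 sc mf fM EQle.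
have isb : ing (PTm P) (fun p => sqn (beta p - proc n c p)).
  apply: ing_sqnB => //.
  apply: (@ing_bounded _ _ _ (PTm P) (d%:R * K ^+ 2)); first exact: PTm_fin.
    exact: measurable_sqnv.
  by move=> p; rewrite ger0_norm ?sqn_ge0//; exact: (sqn_proc_bound T_gt0 sc).
have iB : ing (PTm P) (fun p => sqn (beta p - b p)) by exact: ing_sqnB.
have Eb : Ex (PTm P) (fun p => sqn (beta p - proc n c p)) <= B + B * e + 2 * e.
  apply: (@le_trans _ _ (Ex (PTm P) (fun p => (1 + e) * sqn (beta p - b p) + (1 + e^-1) * sqn (b p - proc n c p)))).
    apply: le_Ex => //; first by apply: ingD; exact: ingZ.
    move=> p; have := sqn_le_eps (beta p - b p) (beta p - proc n c p) e0.
    have -> : beta p - b p - (beta p - proc n c p) = - (b p - proc n c p) by apply/rowP => i; rewrite !mxE; ring.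
    have -> : sqn (- (b p - proc n c p)) = sqn (b p - proc n c p).
      by apply: eq_bigr => i _; rewrite [in LHS]mxE sqrrN.
    by [].
  rewrite ExD ?ExZ//; [|exact: ingZ..].
  rewrite -/B.
  have : (1 + e^-1) * Ex (PTm P) (fun p => sqn (b p - proc n c p)) <= (1 + e^-1) * e ^+ 2.
    have ie : 0 <= 1 + e^-1 by apply: addr_ge0; [exact: ler01|rewrite invr_ge0; exact: ltW].
    exact: (ler_wpM2l ie EP).
  have -> : (1 + e^-1) * e ^+ 2 = e ^+ 2 + e by field; rewrite gt_eqF.
  have : e ^+ 2 <= e by rewrite expr2 ger_pMl// ltW.
  exact: arith3.
rewrite ExZ// => h.
have hl : ln (a + C * e) <= ln a + C / a * e.
  have -> : a + C * e = a * (1 + C / a * e) by field; rewrite gt_eqF.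
  have p : 0 < 1 + C / a * e by rewrite ltr_wpDr// mulr_ge0// ?ltW// divr_gt0.
  rewrite lnM ?posrE// lerD2l; apply: (le_trans (ln_le_subr1 p)).
  by rewrite addrAC subrr add0r.
exact: arith4 h hl Eb.
Qed.
End with_wiener.
End relative_girsanov.

(** * Representation of the drift *)

Section fast_convergence.
Context (R : realType) (dd : measure_display) (A : measurableType dd) (mu : {measure set A -> \bar R}).

(** The sum of the absolute increments has finite integral, hence is finite almost everywhere, and
    there the telescoping series converges. The upper limit provides a measurable candidate defined
    everywhere. *)
Lemma fast_cvg_ae (f : nat -> A -> R) (C : R) : 0 <= C -> (forall j, measurable_fun setT (f j)) ->
  (forall j, (\int[mu]_x `|f j.+1 x - f j x|%:E <= (C / (2 ^+ j.+1))%:E)%E) ->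
  exists2 g : A -> R, measurable_fun setT g & {ae mu, forall x, f ^~ x @ \oo --> g x}.
Proof.
move=> C0 mf fC.
pose G x : \bar R := (\sum_(0 <= j <oo) `|f j.+1 x - f j x|%:E)%E.
have md j : measurable_fun setT (fun x => `|f j.+1 x - f j x|%:E).
  by apply/measurable_EFinP; apply: measurableT_comp => //; exact: measurable_funB.
have mG : measurable_fun setT G by apply: ge0_emeasurable_sum => // j x _ _; rewrite lee_fin.
have G0 x : (0 <= G x)%E by apply: nneseries_ge0 => j _ _; rewrite lee_fin.
have iG : mu.-integrable setT G.
  apply/integrableP; split => //; under eq_integral do rewrite gee0_abs//.
  rewrite integral_nneseries//.
  apply: (@le_lt_trans _ _ (\sum_(0 <= j <oo) (C / (2 ^+ j.+1))%:E)%E).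
    by apply: lee_nneseries => j _; [move=> _; apply: integral_ge0 => x _; rewrite lee_fin|exact: fC].
  apply: (@le_lt_trans _ _ C%:E); last exact: ltry.
  apply: le_trans (@epsilon_trick0 R C xpredT C0).
  by apply: lee_nneseries => j _; rewrite ?lee_fin ?divr_ge0// natrX.
exists (fun x => fine (limn_esup (fun j => (f j x)%:E))).
  apply: measurableT_comp => //; apply: measurable_fun_limn_esup => n; exact/measurable_EFinP.
apply: filterS (integrable_ae measurableT iG) => x /(_ I) Gx.
have cs : cvgn [normed series (telescope (f ^~ x))].
  apply: nondecreasing_is_cvgn.
    apply/nondecreasing_seqP => n.
    have E : [normed series (telescope (f ^~ x))] n.+1 = [normed series (telescope (f ^~ x))] n + `|telescope (f ^~ x) n|.
      exact: (@big_nat_recr _ _ _ n 0%N (fun k => `|telescope (f ^~ x) k|) (leq0n n)).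
    by rewrite E lerDl.
  exists (fine (G x)) => _ [n _ <-].
  rewrite -lee_fin fineK// /series/= -sumEFin.
  exact: (nneseries_lim_ge (u_ := fun j => `|f j.+1 x - f j x|%:E) n (fun j _ _ => normr_ge0 _)).
have /normed_cvg/cvg_ex[l hl] := cs.
have cf : f ^~ x @ \oo --> f 0%N x + l.
  rewrite (_ : f ^~ x = (fun n => f 0%N x + series (telescope (f ^~ x)) n)); last first.
    by apply/funext => n; exact: (eq_sum_telescope (f ^~ x) n).
  by apply: cvgD => //; exact: cvg_cst.
have -> : limn_esup (fun j => (f j x)%:E) = (f 0%N x + l)%:E; last by [].
by apply: (cvg_limn_einf_sup _).2; apply/fine_cvgP; split; [exact: nearW|exact: cf].
Qed.

End fast_convergence.

Lemma cvg_sumr (R : realType) (I : Type) (s : seq I) (F : I -> nat -> R) (l : I -> R) :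
  (forall i, F i n @[n --> \oo] --> l i) ->
  \sum_(i <- s) F i n @[n --> \oo] --> \sum_(i <- s) l i.
Proof.
move=> hF; elim: s => [|i s ih].
  by rewrite big_nil; under eq_fun do rewrite big_nil; exact: cvg_cst.
by rewrite big_cons; under eq_fun do rewrite big_cons; apply: cvgD.
Qed.

Section riesz.
Context (R : realType) (d : nat) (dd : measure_display) (A : measurableType dd) (mu : {measure set A -> \bar R}).
Hypothesis mu_fin : (mu setT < +oo)%E.

Lemma riesz_arith (e ej s l lj a b n1 n2 y : R) : ej <= e ^+ 2 -> y <= 8 * e -> s - ej < lj - 2^-1 * n2 ->
  - (e * n1 + y) <= b ->
  e * l + lj - 2^-1 * (e ^+ 2 * n1 + 2 * e * a + n2) <= s ->
  0 < e ->
  e * l <= e * (a + b + (2^-1 * 3 * n1 + 9) * e).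
Proof.
move=> h1 h2 h3 h4 h5 e0.
have h6 : e * y <= e * (8 * e) by rewrite ler_pM2l.
have h7 : e * (- (e * n1 + y)) <= e * b by rewrite ler_pM2l.
lra.
Qed.

Local Notation rV := 'rV[R]_d.
Implicit Types u v : A -> rV.

Definition L2 u := measurable_fun setT u /\ ing mu (fun p => sqn (u p)).
Definition N u := Ex mu (fun p => sqn (u p)).

Lemma sqn_lin (a : R) (x y : rV) : sqn (a *: x + y) = a ^+ 2 * sqn x + 2 * a * dot x y + sqn y.
Proof. by rewrite /sqn /dot !mulr_sumr -!big_split/=; apply: eq_bigr => i _; rewrite !mxE; ring. Qed.

Lemma dot_le_sqn (e : R) (x y : rV) : 0 < e -> `|dot x y| <= e * sqn x + e^-1 * sqn y.
Proof.
move=> e0; rewrite /dot /sqn !mulr_sumr -big_split/= (le_trans (ler_norm_sum _ _ _))//.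
apply: ler_sum => i _; set a := x 0 i; set b := y 0 i.
have ie : 0 < e^-1 by rewrite invr_gt0.
have h1 : 0 <= (e * a + b) ^+ 2 / e by rewrite divr_ge0 ?sqr_ge0// ltW.
have h2 : 0 <= (e * a - b) ^+ 2 / e by rewrite divr_ge0 ?sqr_ge0// ltW.
have e1 : (e * a + b) ^+ 2 / e = e * a ^+ 2 + 2 * (a * b) + e^-1 * b ^+ 2 by field; rewrite gt_eqF.
have e2 : (e * a - b) ^+ 2 / e = e * a ^+ 2 - 2 * (a * b) + e^-1 * b ^+ 2 by field; rewrite gt_eqF.
have h3 : 0 <= e * a ^+ 2 by rewrite mulr_ge0 ?sqr_ge0// ltW.
have h4 : 0 <= e^-1 * b ^+ 2 by rewrite mulr_ge0 ?sqr_ge0// ltW.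
by rewrite ler_norml; apply/andP; split; lra.
Qed.

Lemma L2_dot u v : L2 u -> L2 v -> ing mu (fun p => dot (u p) (v p)).
Proof.
move=> [mu' iu] [mv iv]; apply: (ing_dom _ (ingD iu iv)); first exact: measurable_dotv.
by move=> p; have := dot_le_sqn (u p) (v p) ltr01; rewrite invr1 !mul1r.
Qed.

Lemma L2_lin (a : R) u v : L2 u -> L2 v -> L2 (fun p => a *: u p + v p).
Proof.
move=> Lu Lv; split.
  by apply: measurable_addv; [apply: measurable_scalev; [exact: measurable_cst|exact: Lu.1]|exact: Lv.1].
have := ingD (ingD (ingZ (a ^+ 2) Lu.2) (ingZ (2 * a) (L2_dot Lu Lv))) Lv.2.
by congr ing; apply/funext => p; rewrite sqn_lin.
Qed.

Lemma N_lin (a : R) u v : L2 u -> L2 v ->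
  N (fun p => a *: u p + v p) = a ^+ 2 * N u + 2 * a * Ex mu (fun p => dot (u p) (v p)) + N v.
Proof.
move=> Lu Lv; have iuv := L2_dot Lu Lv.
rewrite /N -!ExZ ?(proj2 Lu)// -ExD; [|by apply: ingZ; case: Lu|exact: ingZ].
rewrite -ExD; [|by apply: ingD; [apply: ingZ; case: Lu|exact: ingZ]|by case: Lv].
by rewrite /Ex; apply: eq_Rintegral => p _; exact: sqn_lin.
Qed.

Lemma N_ge0 u : 0 <= N u. Proof. by apply: Ex_ge0 => p; exact: sqn_ge0. Qed.

Variable S : set ((A -> rV) * R).
Hypothesis S_L2 : forall x, S x -> L2 x.1.
Hypothesis S0 : S (fun=> 0, 0).
Hypothesis S_lin : forall (a : R) x y, S x -> S y -> S (fun p => a *: x.1 p + y.1 p, a * x.2 + y.2).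
Variable H : R.
Hypothesis S_le : forall x, S x -> x.2 - 2^-1 * N x.1 <= H.

Let J (x : (A -> rV) * R) := x.2 - 2^-1 * N x.1.
Let s := sup [set J x | x in S].

Let hs : has_sup [set J x | x in S].
Proof. by split; [exists (J (fun=> 0, 0)), (fun=> 0, 0)|exists H => _ [x Sx <-]; exact: S_le]. Qed.

Let Jle x : S x -> J x <= s.
Proof. by move=> Sx; apply: (sup_upper_bound hs); exists x. Qed.

Let near_sup (e : R) : 0 < e -> exists x, S x /\ s - e < J x.
Proof. by move=> e0; have [_ [x Sx <-] h] := sup_adherent e0 hs; exists x. Qed.

(** Parallelogram identity: the midpoint of two near-maximizers has [J] at most [s], while [J] at
    the midpoint exceeds the mean of the two values by an eighth of their squared distance. *)
Let close x y (e e' : R) : S x -> S y -> s - e <= J x -> s - e' <= J y ->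
  N (fun p => (-1) *: x.1 p + y.1 p) <= 4 * (e + e').
Proof.
move=> Sx Sy hx hy; have Lx := S_L2 Sx; have Ly := S_L2 Sy.
have Sz := S_lin 2^-1 Sx (S_lin 2^-1 Sy S0); have := Jle Sz; rewrite /J/=.
have -> : (fun p => 2^-1 *: x.1 p + (2^-1 *: y.1 p + 0)) = (fun p => 2^-1 *: x.1 p + (2^-1 *: y.1 p + (fun=> 0) p)) by [].
have L0 := S_L2 S0.
have Ly' := L2_lin 2^-1 Ly L0.
rewrite (N_lin 2^-1 Lx Ly') (N_lin 2^-1 Ly L0) (N_lin (-1) Lx Ly).
have -> : N (fun=> 0) = 0 by rewrite /N -[RHS](Ex0 mu); congr Ex; apply/funext => p; rewrite /sqn big1// => i _; rewrite mxE expr0n.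
have -> : Ex mu (fun p => dot (y.1 p) 0) = 0.
  by rewrite -[RHS](Ex0 mu); congr Ex; apply/funext => p; rewrite /dot big1// => i _; rewrite mxE mulr0.
have -> : Ex mu (fun p => dot (x.1 p) (2^-1 *: y.1 p + 0)) = 2^-1 * Ex mu (fun p => dot (x.1 p) (y.1 p)).
  rewrite -ExZ; last exact: L2_dot.
  congr Ex; apply/funext => p; rewrite /dot mulr_sumr; apply: eq_bigr => i _; rewrite !mxE; ring.
move: hx hy; rewrite /J; move: (N _) (N _) (Ex _ _) x.2 y.2 => a b c l l'.
by lra.
Qed.

(* A pair [x] in [S] stands for a simple process and its stochastic integral;
   concavity of [J] makes maximizing sequences Cauchy. *)
Lemma riesz : exists alpha : A -> rV, [/\ L2 alpha, 2^-1 * N alpha <= H,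
  forall x, S x -> x.2 = Ex mu (fun p => dot (x.1 p) (alpha p)) &
  forall e : R, 0 < e -> exists x, S x /\ N (fun p => (-1) *: x.1 p + alpha p) <= e].
Proof.
(* The squared L^2 distance of consecutive terms is of order [16 ^ (- j)]. Young's inequality with
   weight [2 ^ j] turns this into an L^1 distance of order [2 ^ (- j)], as [fast_cvg_ae] demands. *)
pose e_ j : R := (16 ^+ j)^-1.
have e_gt0 j : 0 < e_ j by rewrite invr_gt0 exprn_gt0.
have [x_ /all_and2[Sx hx]] := boolp.choice (fun j => near_sup (e_gt0 j)).
have Lx j := S_L2 (Sx j).
have e_le j k : (j <= k)%N -> e_ k <= e_ j.
  by move=> jk; rewrite lef_pV2 ?posrE ?exprn_gt0// ler_eXn2l ?ltr1n.
have cl j k : (j <= k)%N -> N (fun p => (-1) *: (x_ j).1 p + (x_ k).1 p) <= 8 * e_ j.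
  move=> jk; apply: (le_trans (close (Sx j) (Sx k) (ltW (hx j)) (ltW (hx k)))).
  by have := e_le j k jk; lra.
pose m := fine (mu setT).
have mE : mu setT = m%:E by rewrite /m fineK// ge0_fin_numE.
have m0 : 0 <= m by rewrite /m fine_ge0.
have fast i : exists2 g : A -> R, measurable_fun setT g &
    {ae mu, forall p, (fun j => (x_ j).1 p 0 i) @ \oo --> g p}.
  apply: (@fast_cvg_ae _ _ _ mu (fun j p => (x_ j).1 p 0 i) (2 * (m + 8))) => //.
  - by rewrite mulr_ge0// addr_ge0.
  - by move=> j; apply: measurable_coordT; exact: (Lx j).1.
  move=> j; have [mD iD] := L2_lin (-1) (Lx j) (Lx j.+1).
  have t0 : 0 < (2 : R) ^+ j by rewrite exprn_gt0.
  pose h p := (2 ^+ j)^-1 + 2 ^+ j * sqn ((-1) *: (x_ j).1 p + (x_ j.+1).1 p).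
  have ic : ing mu (fun=> (2 ^+ j)^-1).
    by apply: (@ing_bounded _ _ _ mu (`|(2 ^+ j)^-1|)) => //; exact: measurable_cst.
  have ih : ing mu h by apply: ingD => //; exact: ingZ.
  apply: (@le_trans _ _ (\int[mu]_p (h p)%:E)%E).
    apply: ge0_le_integral => //.
    - apply/measurable_EFinP; apply: measurableT_comp => //; apply: measurable_funB.
        by apply: measurable_coordT; exact: (Lx j.+1).1.
      by apply: measurable_coordT; exact: (Lx j).1.
    - by apply/measurable_EFinP; exact: ing_meas ih.
    - move=> p _; rewrite lee_fin /h.
      set y := (x_ j.+1).1 p; set x := (x_ j).1 p.
      have le1 : (y 0 i - x 0 i) ^+ 2 <= sqn ((-1) *: x + y).
        have -> : y 0 i - x 0 i = ((-1) *: x + y) 0 i by rewrite !mxE; ring.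
        by rewrite /sqn (bigD1 i)//= lerDl sumr_ge0// => k _; exact: sqr_ge0.
      apply: (@le_trans _ _ ((2 ^+ j)^-1 + 2 ^+ j * (y 0 i - x 0 i) ^+ 2)); last first.
        by rewrite lerD2l ler_wpM2l// ltW.
      set z := y 0 i - x 0 i; have := sqr_ge0 (2 ^+ j * `|z| - 1).
      have z2 : z ^+ 2 = `|z| ^+ 2 by rewrite real_normK ?num_real.
      have z0 : 0 <= `|z| by exact: normr_ge0.
      rewrite z2; move: (`|z|) z0 => w w0 hw.
      have : 0 <= (2 ^+ j * w - 1) ^+ 2 / 2 ^+ j by rewrite divr_ge0 ?sqr_ge0// ltW.
      have -> : (2 ^+ j * w - 1) ^+ 2 / 2 ^+ j = 2 ^+ j * w ^+ 2 - 2 * w + (2 ^+ j)^-1.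
        by field; rewrite gt_eqF.
      by lra.
  rewrite (ExE ih) lee_fin /h ExD//; last exact: ingZ.
  have -> : Ex mu (fun=> (2 ^+ j)^-1) = (2 ^+ j)^-1 * m.
    by rewrite /Ex /Rintegral (integral_cst mu measurableT ((2 ^+ j)^-1)%:E) mE.
  rewrite ExZ//; have h1 := cl j j.+1 (leqnSn j); rewrite -/(N _).
  have h2 : 2 ^+ j * N (fun p => (-1) *: (x_ j).1 p + (x_ j.+1).1 p) <= 2 ^+ j * (8 * e_ j).
    by rewrite ler_pM2l.
  have h3 : 2 ^+ j * (8 * e_ j) <= 8 * (2 ^+ j)^-1.
    rewrite mulrCA ler_pM2l// -ler_pdivlMl//.
    rewrite -invfM lef_pV2 ?posrE ?mulr_gt0 ?exprn_gt0// -exprMn.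
    by rewrite lerXn2r// ?nnegrE// -natrM ler_nat.
  have -> : 2 * (m + 8) / 2 ^+ j.+1 = (2 ^+ j)^-1 * m + 8 * (2 ^+ j)^-1.
    by rewrite exprS; field; rewrite gt_eqF.
  lra.
have [g mg hg] : exists2 g : 'I_d -> A -> R, (forall i, measurable_fun setT (g i)) &
    forall i, {ae mu, forall p, (fun j => (x_ j).1 p 0 i) @ \oo --> g i p}.
  have fast' i : exists g : A -> R, measurable_fun setT g /\ {ae mu, forall p, (fun j => (x_ j).1 p 0 i) @ \oo --> g p}.
    by have [g h1 h2] := fast i; exists g.
  have [g hg] := boolp.choice fast'.
  by exists g => i; case: (hg i).
pose alpha p : rV := \row_i g i p.
have malpha : measurable_fun setT alpha.
  apply: measurable_fun_rV => // i.
  by apply: (@eq_measurable_fun _ _ _ _ _ (g i)) => // p _; rewrite mxE.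
have ae_all : {ae mu, forall p, forall i, (fun j => (x_ j).1 p 0 i) @ \oo --> g i p}.
  by apply: filter_forall => i; exact: hg.
have e_ex (e : R) : 0 < e -> exists j, e_ j <= e.
  move=> e0; exists (Num.truncn e^-1); rewrite /e_ -[leRHS]invrK lef_pV2 ?posrE ?exprn_gt0 ?invr_gt0//.
  apply/ltW/(lt_le_trans (truncnS_gt _)).
  by rewrite -natrX ler_nat ltn_expl.
have Na j : L2 (fun p => (-1) *: (x_ j).1 p + alpha p) /\ N (fun p => (-1) *: (x_ j).1 p + alpha p) <= 8 * e_ j.
  have mda : measurable_fun setT (fun p => (-1) *: (x_ j).1 p + alpha p).
    by apply: measurable_addv => //; apply: measurable_scalev; [exact: measurable_cst|exact: (Lx j).1].
  have bd : (\int[mu]_p (sqn ((-1) *: (x_ j).1 p + alpha p))%:E <= (8 * e_ j)%:E)%E.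
    apply: (@fatou_ub _ _ _ mu (fun k p => sqn ((-1) *: (x_ j).1 p + (x_ k).1 p))).
    - by move=> k; exact: (ing_meas (proj2 (L2_lin (-1) (Lx j) (Lx k)))).
    - by move=> k p; exact: sqn_ge0.
    - exact: measurable_sqnv.
    - by move=> p; exact: sqn_ge0.
    - apply: filterS ae_all => p hp; apply: cvg_sumr => i; rewrite !mxE.
      under eq_fun do rewrite !mxE.
      apply: (@cvg_comp _ _ _ (fun k => -1 * (x_ j).1 p 0 i + (x_ k).1 p 0 i) (fun y => y ^+ 2) _ (nbhs (-1 * (x_ j).1 p 0 i + g i p))); last exact: exprn_continuous.
      by apply: cvgD; [exact: cvg_cst|exact: hp].
    - move=> e e0; near=> k; rewrite (ExE (L2_lin (-1) (Lx j) (Lx k)).2) lee_fin.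
      rewrite (le_trans (cl j k _))//; last by rewrite lerDl ltW.
      by near: k; exact: nbhs_infty_ge.
  have La : L2 (fun p => (-1) *: (x_ j).1 p + alpha p).
    split => //; apply: ing_ge0; [exact: measurable_sqnv|by move=> p; exact: sqn_ge0|].
    exact: le_lt_trans bd (ltry _).
  by split => //; rewrite -lee_fin -(ExE La.2).
have La : L2 alpha.
  have := L2_lin 1 (Lx 0%N) (Na 0%N).1; congr L2; apply/funext => p; rewrite scale1r scaleN1r addrA subrr add0r//.
(* First variation: moving the near-maximizer [x_ j] by [e] in the direction [x] cannot raise [J] by
   more than [e_ j <= e ^+ 2]. Division by [e] leaves the inequality, and the direction [- x] yields
   the reverse one. *)
have half x : S x -> x.2 <= Ex mu (fun p => dot (x.1 p) (alpha p)).
  move=> Sx'; have Lu := S_L2 Sx'.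
  apply: (@le_vanish _ _ _ (2^-1 * 3 * N x.1 + 9)) => e /andP[e0 e1].
  have [j hj] := e_ex (e ^+ 2) (exprn_gt0 2 e0).
  have := Jle (S_lin e Sx' (Sx j)); rewrite /J/= (N_lin e Lu (Lx j)).
  have [Lj Nj] := Na j.
  have split_dot : Ex mu (fun p => dot (x.1 p) (alpha p)) = Ex mu (fun p => dot (x.1 p) ((x_ j).1 p)) +
      Ex mu (fun p => dot (x.1 p) ((-1) *: (x_ j).1 p + alpha p)).
    rewrite -ExD; [|exact: L2_dot|exact: L2_dot].
    congr Ex; apply/funext => p; rewrite /dot -big_split/=; apply: eq_bigr => i _; rewrite !mxE; ring.
  have bound : `|Ex mu (fun p => dot (x.1 p) ((-1) *: (x_ j).1 p + alpha p))| <= e * N x.1 + e^-1 * N (fun p => (-1) *: (x_ j).1 p + alpha p).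
    rewrite /N -!ExZ ?(proj2 Lu) ?(proj2 Lj)// -ExD; [|by apply: ingZ; case: Lu|by apply: ingZ; case: Lj].
    apply: ler_norm_Ex; [exact: L2_dot|by apply: ingD; apply: ingZ; [case: Lu|case: Lj]|].
    by move=> p; exact: dot_le_sqn.
  move: bound; rewrite ler_norml => /andP[+ _]; rewrite split_dot.
  have := hx j; rewrite /J.
  have : e^-1 * N (fun p => (-1) *: (x_ j).1 p + alpha p) <= 8 * e.
    rewrite ler_pdivrMl// (le_trans Nj)// [leRHS]mulrCA ler_pM2l// -expr2//.
  move: (Ex mu (fun p => dot (x.1 p) ((x_ j).1 p))) (Ex mu (fun p => dot (x.1 p) _)) (N x.1) (N (x_ j).1) (e^-1 * _) hj.
  move=> a b n1 n2 y hj hy hs1 hb hs2; rewrite -(ler_pM2l e0).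
  apply: (@riesz_arith e (e_ j) s x.2 (x_ j).2 a b n1 n2 y) => //.
have ident x : S x -> x.2 = Ex mu (fun p => dot (x.1 p) (alpha p)).
  move=> Sx'; apply/eqP; rewrite eq_le half//=.
  have := half _ (S_lin (-1) Sx' S0); rewrite /= addr0 mulN1r => h; rewrite -lerN2 (le_trans h)//.
  rewrite -ExN; last exact: (L2_dot (S_L2 Sx') La).
  rewrite le_eqVlt; apply/orP; left; apply/eqP; congr Ex; apply/funext => p.
  by rewrite /dot -sumrN; apply: eq_bigr => i _; rewrite !mxE; ring.
exists alpha; split => //.
- apply: (@le_vanish _ _ _ 4) => e /andP[e0 e1]; have [j hj] := e_ex e e0.
  have [Lj] := Na j; rewrite (N_lin (-1) (Lx j) La) => Nj.
  have := S_le (Sx j); rewrite (ident _ (Sx j)); move: Nj hj.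
  move: (N _) (N _) (Ex _ _) => a b c; lra.
- move=> e e0; have [j hj] := e_ex (e / 8) (divr_gt0 e0 (ltr0n _ 8)).
  exists (x_ j); split => //; apply: (le_trans (Na j).2).
  by rewrite mulrC -ler_pdivlMr.
Unshelve. all: by end_near. Qed.

End riesz.

(** * Brownian increments of the driftless process *)

Section test_functions.
Context (R : realType) (d : nat).
Local Notation rV := 'rV[R]_d.

(* [p] plays the role of the gradient of [v]. *)
Definition c11 (K : R) (v : rV -> R) (p : rV -> rV) : Prop :=
  [/\ measurable_fun setT v, measurable_fun setT p, forall x, `|v x| <= K,
      forall x i, `|p x 0 i| <= K &
      forall x m, `|v (x + m) - v x - dot (p x) m| <= K * nrm1 m ^+ 2].

(** For an increment of size at most one the Taylor remainder is absorbed into the linear term; for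
    a larger one the bound on [v] suffices. *)
Lemma c11_lip K v p x m : 0 <= K -> c11 K v p -> `|v (x + m) - v x| <= 2 * K * nrm1 m.
Proof.
move=> K0 [_ _ bv bp h]; have n0 := nrm1_ge0 m.
have bd : `|dot (p x) m| <= K * nrm1 m by exact: dot_le_nrm1.
have [n1|n1] := leP (nrm1 m) 1.
  have e1 : nrm1 m ^+ 2 <= nrm1 m by rewrite expr2 -{3}(mulr1 (nrm1 m)) ler_wpM2l.
  have e2 : K * nrm1 m ^+ 2 <= K * nrm1 m by rewrite ler_wpM2l.
  have -> : v (x + m) - v x = (v (x + m) - v x - dot (p x) m) + dot (p x) m by rewrite subrK.
  apply: (le_trans (ler_normD _ _)); have := h x m; lra.
apply: (le_trans (ler_normB _ _)); apply: (le_trans (lerD (bv _) (bv _))).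
have : K * 1 <= K * nrm1 m by rewrite ler_wpM2l// ltW.
lra.
Qed.

Lemma c11_dist K v p x y : 0 <= K -> c11 K v p -> `|v y - v x| <= 2 * K * nrm1 (y - x).
Proof. by move=> K0 h; have := c11_lip x (y - x) K0 h; rewrite subrKC. Qed.

Lemma dot_addl (a b y : rV) : dot (a + b) y = dot a y + dot b y.
Proof. by rewrite /dot -big_split/=; apply: eq_bigr => i _; rewrite mxE mulrDl. Qed.

Lemma dot_scalel (k : R) (a y : rV) : dot (k *: a) y = k * dot a y.
Proof. by rewrite /dot mulr_sumr; apply: eq_bigr => i _; rewrite mxE mulrA. Qed.

(** In the constant, [2 K ^ 2] comes from the two Taylor remainders and [(2 K) ^ 2] from the product
    of the two increments. *)
Lemma c11_mul_arith (K a1 a2 b1 b2 q1 q2 n : R) : 0 <= K -> 0 <= n ->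
  `|a1| <= K -> `|a2| <= K -> `|b1 - a1 - q1| <= K * n ^+ 2 -> `|b2 - a2 - q2| <= K * n ^+ 2 ->
  `|b1 - a1| <= 2 * K * n -> `|b2 - a2| <= 2 * K * n ->
  `|b1 * b2 - a1 * a2 - (a1 * q2 + a2 * q1)| <= 6 * K ^+ 2 * n ^+ 2.
Proof.
move=> K0 n0 ha1 ha2 h1 h2 l1 l2.
have -> : b1 * b2 - a1 * a2 - (a1 * q2 + a2 * q1) =
  a1 * (b2 - a2 - q2) + a2 * (b1 - a1 - q1) + (b1 - a1) * (b2 - a2) by ring.
apply: (le_trans (ler_normD _ _)).
have t1 : `|a1 * (b2 - a2 - q2) + a2 * (b1 - a1 - q1)| <= K * (K * n ^+ 2) + K * (K * n ^+ 2).
  by apply: (le_trans (ler_normD _ _)); rewrite !normrM lerD// ler_pM.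
have t2 : `|(b1 - a1) * (b2 - a2)| <= (2 * K * n) * (2 * K * n) by rewrite normrM ler_pM.
have -> : 6 * K ^+ 2 * n ^+ 2 = (K * (K * n ^+ 2) + K * (K * n ^+ 2)) + (2 * K * n) * (2 * K * n) by ring.
exact: lerD.
Qed.

Lemma c11_le K K' v p : K <= K' -> c11 K v p -> c11 K' v p.
Proof.
move=> KK [mv mp bv bp h]; split => //.
- by move=> x; exact: le_trans (bv x) KK.
- by move=> x i; exact: le_trans (bp x i) KK.
- by move=> x m; rewrite (le_trans (h x m))// ler_wpM2r ?sqr_ge0.
Qed.

Lemma c11_cst (k : R) : c11 `|k| (fun=> k) (fun=> 0).
Proof.
split => //.
- by move=> x i; rewrite mxE normr0.
- move=> x m; rewrite subrr sub0r normrN /dot big1 ?normr0; [by rewrite mulr_ge0// sqr_ge0|move=> i _].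
  by rewrite mxE mul0r.
Qed.

Lemma c11_mul K1 K2 v1 p1 v2 p2 : c11 K1 v1 p1 -> c11 K2 v2 p2 ->
  exists K p, c11 K (fun x => v1 x * v2 x) p.
Proof.
move=> h1' h2'; pose K := Num.max 1 (Num.max K1 K2).
have K1' : 1 <= K by rewrite le_max lexx.
have K0 : 0 <= K by exact: le_trans K1'.
have h1 : c11 K v1 p1 by apply: (c11_le _ h1'); rewrite /K !le_max lexx orbT.
have h2 : c11 K v2 p2 by apply: (c11_le _ h2'); rewrite /K !le_max lexx !orbT.
have [mv1 mp1 bv1 bp1 q1] := h1; have [mv2 mp2 bv2 bp2 q2] := h2.
have KK : 0 <= K ^+ 2 by rewrite sqr_ge0.
exists (6 * K ^+ 2), (fun x => v1 x *: p2 x + v2 x *: p1 x); split.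
- exact: measurable_funM.
- by apply: measurable_addv; apply: measurable_scalev.
- move=> x; rewrite normrM; apply: (@le_trans _ _ (K * K)); [exact: ler_pM|rewrite -expr2; lra].
- move=> x i; rewrite !mxE; apply: (le_trans (ler_normD _ _)).
  apply: (@le_trans _ _ (K * K + K * K)); last by rewrite -expr2; lra.
  by rewrite !normrM lerD// ler_pM.
- move=> x m; rewrite dot_addl !dot_scalel.
  by apply: c11_mul_arith (K0) (nrm1_ge0 m) (bv1 x) (bv2 x) (q1 x m) (q2 x m) (c11_lip x m K0 h1) (c11_lip x m K0 h2).
Qed.

Section averaging.
Implicit Types (K : R) (v : rV -> R) (p : rV -> rV).
Variables (g : probability rV R) (s : R).
Hypotheses (s0 : 0 < s) (hg : gaussian_law g s).

(** One step of the heat semigroup, on functions and, coordinatewise, on their gradients. *)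
Definition avg (v : rV -> R) x := Ex g (fun y => v (x + y)).
Definition avgv (p : rV -> rV) x : rV := \row_i avg (fun y => p y 0 i) x.

Lemma measurable_shiftv x : measurable_fun setT (fun y : rV => x + y).
Proof. by apply: measurable_addv => //; exact: measurable_cst. Qed.

Lemma ing_avg K v x : measurable_fun setT v -> (forall x, `|v x| <= K) -> ing g (fun y => v (x + y)).
Proof.
move=> mv bv; have mf : measurable_fun setT (fun y => v (x + y)).
  exact: measurableT_comp mv (measurable_shiftv x).
exact: (@ingP_bounded _ _ _ g K _ mf).
Qed.

Lemma avg_bound K v x : measurable_fun setT v -> (forall x, `|v x| <= K) -> `|avg v x| <= K.
Proof.
move=> mv bv; rewrite -[leRHS](Ex_cst g); apply: ler_norm_Ex => //; first exact: ing_avg bv.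
by apply: (@ingP_bounded _ _ _ g `|K|) => //; exact: measurable_cst.
Qed.

Lemma measurable_avg K v : measurable_fun setT v -> (forall x, `|v x| <= K) ->
  measurable_fun setT (avg v).
Proof.
move=> mv bv.
(* Adding [K] makes the integrand nonnegative, as Tonelli's theorem requires. *)
have E x : avg v x = fine (\int[g]_y (v (x + y) + K)%:E)%E - K.
  have i1 := ing_avg x mv bv.
  have i2 : ing g (fun=> K) by apply: (@ingP_bounded _ _ _ g `|K|) => //; exact: measurable_cst.
  by rewrite (ExE (ingD i1 i2)) ExD//= Ex_cst addrK.
rewrite (_ : avg v = fun x => fine (\int[g]_y (v (x + y) + K)%:E)%E - K); last exact/funext.
apply: measurable_funB => //; apply: measurableT_comp => //.
apply: (@measurable_fun_fubini_tonelli_F _ _ rV rV R g (fun z => (v (z.1 + z.2) + K)%:E)).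
  apply/measurable_EFinP; apply: measurable_funD => //.
  apply: (measurableT_comp mv); exact: measurable_addv.
by move=> z; rewrite lee_fin; have := bv (z.1 + z.2); rewrite ler_norml => /andP[+ _]; lra.
Qed.

(** Every bound in [c11] is uniform in [x], so averaging preserves it with the same [K]. The
    semigroup may therefore be iterated over any number of cells. *)
Lemma c11_avg K v p : c11 K v p -> c11 K (avg v) (avgv p).
Proof.
move=> [mv mp bv bp h].
have mpi i : measurable_fun setT (fun x => p x 0 i) by exact: measurable_coordT.
have bpi i x : `|p x 0 i| <= K by exact: bp.
split.
- exact: measurable_avg bv.
- apply: measurable_fun_rV => // i; under eq_fun do rewrite mxE; exact: (measurable_avg (mpi i) (bpi i)).
- by move=> x; exact: avg_bound.
- by move=> x i; rewrite mxE; exact: avg_bound.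
- move=> x m.
  have i1 := ing_avg (x + m) mv bv; have i2 := ing_avg x mv bv.
  have i3 i : ing g (fun y => p (x + y) 0 i) by exact: (ing_avg x (mpi i) (bpi i)).
  have i4 : ing g (fun y => dot (p (x + y)) m).
    apply: (@ing_sum _ _ _ g _ (index_enum _) (fun (i : 'I_d) y => p (x + y) 0 i * m 0 i)) => i.
    by have := ingZ (m 0 i) (i3 i); congr ing; apply/funext => y; rewrite mulrC.
  have -> : dot (avgv p x) m = Ex g (fun y => dot (p (x + y)) m).
    rewrite (@Ex_sum _ _ _ g _ (index_enum _) (fun (i : 'I_d) y => p (x + y) 0 i * m 0 i)).
      apply: eq_bigr => i _; rewrite mxE mulrC -ExZ//; congr Ex; apply/funext => y; exact: mulrC.
    by move=> i; have := ingZ (m 0 i) (i3 i); congr ing; apply/funext => y; rewrite mulrC.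
  rewrite -ExB// -ExB//; last exact: ingB.
  rewrite -[leRHS](Ex_cst g); apply: ler_norm_Ex.
  + by apply: ingB => //; exact: ingB.
  + by apply: (@ingP_bounded _ _ _ g `|K * nrm1 m ^+ 2|) => //; exact: measurable_cst.
  + by move=> y; rewrite (addrAC x m y); exact: h.
Qed.

End averaging.

(** The second-order remainder is kept multiplied by [exp |x|], which a Gaussian increment
    integrates when [x] grows linearly. *)
Lemma expR_le_quad (x : R) : expR x <= 1 + x + x ^+ 2 * expR `|x|.
Proof.
have e0 := expR_gt0 x.
have h1 : expR x <= 1 + x * expR x.
  have := expR_ge1Dx (- x); rewrite expRN => h.
  have := ler_wpM2r (ltW e0) h; rewrite mulVf ?gt_eqF// mulrDl mul1r mulNr => h'.
  by rewrite -lerBlDr.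
have [x0|x0] := leP 0 x.
  rewrite ger0_norm//.
  have : x * (expR x - 1) <= x * (x * expR x) by rewrite ler_wpM2l// lerBlDl.
  rewrite mulrBr mulrA -expr2; lra.
rewrite ltr0_norm//.
have a1 : 0 <= x ^+ 2 by exact: sqr_ge0.
have a2 : 1 <= expR (- x) by rewrite -expR0 ler_expR oppr_ge0 ltW.
have a3 : x ^+ 2 * 1 <= x ^+ 2 * expR (- x) by rewrite ler_wpM2l.
have a4 : 1 + x <= expR x by exact: expR_ge1Dx.
have a5 : x * expR x <= x * (1 + x) by rewrite ler_wnM2l// ltW.
rewrite expr2 in a1 a3 *; lra.
Qed.

(** From [x / k <= exp (x / k)] raised to the power [k]; the constants are [4 ^ 4] and [2 ^ 2]. *)
Lemma exp_pow4 (x : R) : 0 <= x -> x ^+ 4 <= 256 * expR x /\ x ^+ 2 <= 4 * expR x.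
Proof.
move=> x0.
have E k : (0 < k)%N -> expR x = expR (x / k%:R) ^+ k.
  move=> k0; rewrite -expRM_natl; congr expR; field.
  by rewrite pnatr_eq0 -lt0n.
have F k : (0 < k)%N -> (x / k%:R) ^+ k <= expR x.
  move=> k0; rewrite (E k k0) lerXn2r ?nnegrE ?divr_ge0 ?expR_ge0//.
  by apply: (le_trans _ (expR_ge1Dx _)); rewrite lerDr.
split.
- have := F 4%N isT; rewrite exprMn exprVn -natrX ler_pdivrMr ?ltr0n//= mulrC; congr (_ <= _); by rewrite ?(natrX).
- have := F 2%N isT; rewrite exprMn exprVn -natrX ler_pdivrMr ?ltr0n//= mulrC; congr (_ <= _); by rewrite ?(natrX).
Qed.

Section one_step.

Lemma measurable_sq_nrm1 : measurable_fun setT (fun y : rV => nrm1 y ^+ 2).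
Proof. by apply: measurable_funX; exact: measurable_nrm1. Qed.

Lemma measurable_exp_nrm1 (a : R) : measurable_fun setT (fun y : rV => expR (a * nrm1 y)).
Proof. by apply: measurableT_comp => //; apply: measurable_funM => //; exact: measurable_nrm1. Qed.

Lemma ing_exp_nrm1 (g : probability rV R) (s a : R) : 0 < s -> gaussian_law g s ->
  ing g (fun y => expR (a * nrm1 y)) /\
  Ex g (fun y => expR (a * nrm1 y)) <= 2 ^+ d * expR (a ^+ 2 * s * d%:R / 2).
Proof.
move=> s0 hg; have h := gaussian_exp_nrm1 a s0 hg.
have i : ing g (fun y => expR (a * nrm1 y)).
  apply: ing_ge0; [exact: measurable_exp_nrm1|by move=> y; exact: expR_ge0|].
  exact: le_lt_trans h (ltry _).
by split => //; rewrite -lee_fin -(ExE i).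
Qed.

(** The variable is rescaled by the standard deviation, so that powers of the increment become
    powers of [s] times an exponential whose Gaussian mean does not depend on [s]. *)
Lemma nrm1_pow_le (s : R) (y : rV) : 0 < s ->
  nrm1 y ^+ 4 <= 256 * s ^+ 2 * expR ((Num.sqrt s)^-1 * nrm1 y) /\
  nrm1 y ^+ 2 <= 4 * s * expR ((Num.sqrt s)^-1 * nrm1 y).
Proof.
move=> s0; have r0 : 0 < Num.sqrt s by rewrite sqrtr_gt0.
have n0 := nrm1_ge0 y.
have rs : Num.sqrt s ^+ 2 = s by rewrite sqr_sqrtr// ltW.
have x0 : 0 <= (Num.sqrt s)^-1 * nrm1 y by rewrite mulr_ge0// invr_ge0 ltW.
have [h4 h2] := exp_pow4 x0; split.
- have -> : nrm1 y ^+ 4 = s ^+ 2 * ((Num.sqrt s)^-1 * nrm1 y) ^+ 4.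
    by rewrite -{1}rs; field; rewrite gt_eqF.
  by rewrite [leRHS]mulrAC [leLHS]mulrC ler_wpM2r ?sqr_ge0.
- have -> : nrm1 y ^+ 2 = s * ((Num.sqrt s)^-1 * nrm1 y) ^+ 2.
    by rewrite -{1}rs; field; rewrite gt_eqF.
  by rewrite [leRHS]mulrAC [leLHS]mulrC ler_wpM2r// ltW.
Qed.

(** The factor 4 is that of [exp_pow4]; the rest is the bound of [gaussian_exp_nrm1] at the rate
    [1 / sqrt s], where [s] cancels. *)
Let kappa : R := 4 * (2 ^+ d * expR (d%:R / 2)).

Let kappa_ge0 : 0 <= kappa.
Proof. by rewrite /kappa !mulr_ge0// ?expR_ge0// exprn_ge0. Qed.

Lemma gaussian_nrm1_sq (g : probability rV R) (s : R) : 0 < s -> gaussian_law g s ->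
  ing g (fun y => nrm1 y ^+ 2) /\ Ex g (fun y => nrm1 y ^+ 2) <= kappa * s.
Proof.
move=> s0 hg; have [i e] := ing_exp_nrm1 (Num.sqrt s)^-1 s0 hg.
have rs : Num.sqrt s ^+ 2 = s by rewrite sqr_sqrtr// ltW.
have i1 := ingZ (4 * s) i.
have hd (y : rV) : `|nrm1 y ^+ 2| <= 4 * s * expR ((Num.sqrt s)^-1 * nrm1 y).
  by rewrite ger0_norm ?sqr_ge0//; have [] := nrm1_pow_le y s0.
have i2 : ing g (fun y => nrm1 y ^+ 2) by apply: (ing_dom measurable_sq_nrm1 i1).
split => //; apply: (@le_trans _ _ (Ex g (fun y => 4 * s * expR ((Num.sqrt s)^-1 * nrm1 y)))).
  by apply: le_Ex => // y; have [] := nrm1_pow_le y s0.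
rewrite ExZ//; have -> : kappa * s = 4 * s * (2 ^+ d * expR (d%:R / 2)) by rewrite /kappa; ring.
rewrite ler_wpM2l ?mulr_ge0//; first exact: ltW.
move: e; rewrite exprVn rs mulVf ?gt_eqF// mul1r//.
Qed.

Variable g : probability rV R.

(** What is left of a one-step increment of [v] after subtracting its conditional mean and the
    discrete Clark-Ocone term. It is centred and of order [s] at the Gaussian scale. *)
Definition defect (v : rV -> R) (p : rV -> rV) (x y : rV) := v (x + y) - avg g v x - dot (p x) y.

Lemma defect_arith (K l L n s D ex e1 e2 : R) : 0 <= K -> 0 <= n -> 0 <= s -> `|l| <= L ->
  `|D| <= K * (n ^+ 2 + kappa * s) -> `|D| <= 2 * K + K * n ->
  n ^+ 4 <= 256 * s ^+ 2 * ex -> 1 <= ex ->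
  expR (L * (2 * K + K * n)) = e1 * e2 -> 0 <= e1 -> 0 <= e2 ->
  (l * D) ^+ 2 * expR `|l * D| <= (2 * L ^+ 2 * K ^+ 2 * (256 + kappa ^+ 2) * e1) * s ^+ 2 * (ex * e2).
Proof.
move=> K0 n0 s0 lL D1 D2 n4 ex1 E e10 e20.
have L0 : 0 <= L by exact: le_trans lL.
have ex0 : 0 <= ex by exact: le_trans ex1.
have h1 : (l * D) ^+ 2 <= 2 * L ^+ 2 * K ^+ 2 * (256 + kappa ^+ 2) * s ^+ 2 * ex.
  rewrite -real_normK ?num_real// normrM.
  have b1 : `|l| * `|D| <= L * (K * (n ^+ 2 + kappa * s)) by exact: ler_pM.
  have b2 : (`|l| * `|D|) ^+ 2 <= (L * (K * (n ^+ 2 + kappa * s))) ^+ 2.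
    by rewrite lerXn2r// nnegrE ?mulr_ge0// addr_ge0 ?sqr_ge0// mulr_ge0.
  apply: (le_trans b2).
  have -> : (L * (K * (n ^+ 2 + kappa * s))) ^+ 2 = L ^+ 2 * K ^+ 2 * (n ^+ 2 + kappa * s) ^+ 2 by ring.
  have -> : 2 * L ^+ 2 * K ^+ 2 * (256 + kappa ^+ 2) * s ^+ 2 * ex = L ^+ 2 * K ^+ 2 * (2 * ((256 + kappa ^+ 2) * s ^+ 2 * ex)) by ring.
  rewrite ler_wpM2l ?mulr_ge0 ?sqr_ge0//.
  have -> : (n ^+ 2 + kappa * s) ^+ 2 = 2 * (n ^+ 4 + kappa ^+ 2 * s ^+ 2) - (n ^+ 2 - kappa * s) ^+ 2 by ring.
  apply: (@le_trans _ _ (2 * (n ^+ 4 + kappa ^+ 2 * s ^+ 2))); first by rewrite lerBlDr lerDl sqr_ge0.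
  rewrite ler_wpM2l// mulrDl mulrDl lerD//.
  by rewrite -{1}(mulr1 (kappa ^+ 2 * s ^+ 2)) ler_wpM2l// mulr_ge0 ?sqr_ge0.
have h2 : expR `|l * D| <= e1 * e2 by rewrite -E ler_expR normrM ler_pM.
apply: (le_trans (ler_pM (sqr_ge0 _) (expR_ge0 _) h1 h2)).
by rewrite le_eqVlt; apply/orP; left; apply/eqP; ring.
Qed.

(** The first bound gives the smallness of the square, the second keeps the exponent linear in the
    increment. The conditional mean differs from [v x] only by the averaged Taylor remainder,
    because the linear term is odd. *)
Lemma defect_bounds (K s : R) v p x y : 0 <= K -> 0 < s -> gaussian_law g s -> c11 K v p ->
  [/\ `|defect v p x y| <= K * (nrm1 y ^+ 2 + kappa * s), `|defect v p x y| <= 2 * K + K * nrm1 y,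
      ing g (defect v p x) & Ex g (defect v p x) = 0].
Proof.
move=> K0 s0 hg h; have [mv mp bv bp q] := h.
have [i2 e2] := gaussian_nrm1_sq s0 hg.
have md : measurable_fun setT (dot (p x)) by exact: measurable_dot.
have idot : ing g (dot (p x)).
  have i : ing g (fun y => 2^-1 + 2^-1 * nrm1 y ^+ 2).
    by apply: ingD; [apply: (@ingP_bounded _ _ _ g `|2^-1|) => //; exact: measurable_cst|exact: ingZ].
  apply: (ing_dom md (ingZ K i)) => z.
  apply: (le_trans (dot_le_nrm1 z (bp x))); rewrite ler_wpM2l//.
  have := sqr_ge0 (nrm1 z - 1); rewrite sqrrB1; lra.
have edot : Ex g (dot (p x)) = 0.
  by apply: (gaussian_odd s0 hg idot) => z; exact: dotNr.
have iv := @ing_avg g K v x mv bv.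
have ib : ing g (fun z => v (x + z) - v x - dot (p x) z).
  by apply: ingB => //; apply: ingB => //; apply: (@ingP_bounded _ _ _ g `|v x|) => //; exact: measurable_cst.
have ic (k : R) : ing g (fun=> k) by apply: (@ingP_bounded _ _ _ g `|k|) => //; exact: measurable_cst.
have ab : `|avg g v x - v x| <= K * (kappa * s).
  have -> : avg g v x - v x = Ex g (fun z => v (x + z) - v x - dot (p x) z).
    by rewrite ExB// ?edot ?subr0 ?ExB ?Ex_cst//; apply: ingB.
  apply: (@le_trans _ _ (Ex g (fun z => K * nrm1 z ^+ 2))).
    by apply: ler_norm_Ex => //; exact: ingZ.
  by rewrite ExZ// ler_wpM2l.
split.
- have -> : defect v p x y = (v (x + y) - v x - dot (p x) y) - (avg g v x - v x) by rewrite /defect; ring.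
  by rewrite mulrDr (le_trans (ler_normB _ _))// lerD.
- rewrite /defect (le_trans (ler_normB _ _))// lerD ?dot_le_nrm1//.
  by rewrite (le_trans (ler_normB _ _))// [leRHS]mulr_natl mulr2n lerD// avg_bound.
- by apply: ingB => //; exact: ingB.
- by rewrite ExB// ?edot ?subr0 ?ExB ?Ex_cst ?subrr//; apply: ingB.
Qed.

End one_step.

(** The linear term of the exponential has mean zero and the quadratic one is of order [s ^ 2]. The
    constant must be uniform in the function, in [x] and in [s <= T], since the bound is used in
    every cell of every grid. *)
Lemma one_step_bound (K L T : R) : 0 <= K -> 0 <= L -> exists C : R, 0 <= C /\
  forall (s l : R) (g : probability rV R) v p x, 0 < s -> s <= T -> gaussian_law g s -> c11 K v p -> `|l| <= L ->
  (\int[g]_y (expR (l * defect g v p x y))%:E <= (1 + C * s ^+ 2)%:E)%E.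
Proof.
move=> K0 L0.
set kappa : R := 4 * (2 ^+ d * expR (d%:R / 2)).
pose a := L * K; pose C1 := 2 * L ^+ 2 * K ^+ 2 * (256 + kappa ^+ 2) * expR (2 * a).
have C10 : 0 <= C1.
  rewrite /C1; apply: mulr_ge0; last exact: expR_ge0.
  apply: mulr_ge0; last by apply: addr_ge0 => //; exact: sqr_ge0.
  by apply: mulr_ge0; [apply: mulr_ge0 => //|]; exact: sqr_ge0.
(* The Gaussian moment at the rate [a + 1 / sqrt s], which after multiplication of the squared rate
   by [s] is largest at [s = T]. *)
pose C2 := 2 ^+ d * expR ((a * Num.sqrt T + 1) ^+ 2 * d%:R / 2) : R.
have C20 : 0 <= C2 by rewrite /C2 mulr_ge0 ?expR_ge0 ?exprn_ge0.
have a0 : 0 <= a by rewrite mulr_ge0.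
exists (C1 * C2); split; first exact: mulr_ge0.
move=> s l g v p x s0 sT hg h lL; have [mv mp bv bp q] := h.
have r0 : 0 < Num.sqrt s by rewrite sqrtr_gt0.
have rs : Num.sqrt s ^+ 2 = s by rewrite sqr_sqrtr// ltW.
have [i e] := ing_exp_nrm1 (a + (Num.sqrt s)^-1) s0 hg.
have [_ _ iD eD] := defect_bounds x 0 K0 s0 hg h.
have mD := ing_meas iD.
pose G y := 1 + l * defect g v p x y + C1 * s ^+ 2 * expR ((a + (Num.sqrt s)^-1) * nrm1 y).
have i1 : ing g (fun=> 1 : R) by apply: (@ingP_bounded _ _ _ g `|1|) => //; exact: measurable_cst.
have i2 : ing g (fun y => 1 + l * defect g v p x y) by apply: ingD => //; exact: ingZ.
have i3 := ingZ (C1 * s ^+ 2) i.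
have iG : ing g G by exact: ingD.
apply: (@le_trans _ _ (\int[g]_y (G y)%:E)%E).
  apply: ge0_le_integral => //.
  - by apply/measurable_EFinP; apply: measurableT_comp => //; apply: measurable_funM => //; exact: mD.
  - by apply/measurable_EFinP; exact: ing_meas iG.
  - move=> y _; rewrite lee_fin (le_trans (expR_le_quad _))// /G lerD2l.
    have [D1 D2 _ _] := defect_bounds x y K0 s0 hg h.
    have [n4 _] := nrm1_pow_le y s0.
    rewrite mulrDl expRD [X in _ <= _ * X]mulrC.
    apply: (defect_arith K0 (nrm1_ge0 y) (ltW s0) lL D1 D2 n4).
    + by rewrite -expR0 ler_expR mulr_ge0 ?invr_ge0 ?nrm1_ge0// ltW.
    + by rewrite -expRD; congr expR; rewrite /a; ring.
    + exact: expR_ge0.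
    + exact: expR_ge0.
rewrite (ExE iG) lee_fin ExD// ExD//; last exact: ingZ.
rewrite ExZ// eD mulr0 addr0 Ex_cst lerD2l ExZ//.
rewrite [leRHS]mulrAC ler_wpM2l ?(mulr_ge0 C10) ?sqr_ge0//.
apply: (le_trans e); rewrite ler_wpM2l ?exprn_ge0// ler_expR ler_pM2r ?invr_gt0// ler_wpM2r//.
have -> : (a + (Num.sqrt s)^-1) ^+ 2 * s = (a * Num.sqrt s + 1) ^+ 2.
  by rewrite -{2}rs; field; rewrite gt_eqF.
rewrite lerXn2r ?nnegrE ?addr_ge0 ?mulr_ge0 ?sqrtr_ge0//.
by rewrite lerD2r ler_wpM2l// ler_wsqrtr.
Qed.

End test_functions.

(** * The drift of a law with finite entropy *)

Section entropy_drift.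
Context (R : realType) (T : R) (d : nat) (T_gt0 : 0 < T).
Local Notation Om := (path_space T d).
Local Notation FT s := (g_sigma_algebraType (@coord_events R T d s)).
Local Notation fm s := (@fmeas R T d _ _ s).
Local Notation rV := 'rV[R]_d.
Local Notation leb := (@lebesgue_measure R).
Local Notation PT :=
  (g_sigma_algebraType (predictable_rectangles T (@canonical_filtration R T d))).
Local Notation PTm P := (@PTm R T d T_gt0 P).

Lemma simpleN n (K : R) (c : nat -> Om -> rV) : simple n K c -> simple n K (fun j w => - c j w).
Proof.
move=> sc k kn; have [h1 h2] := sc k kn; split; last by move=> w i; rewrite mxE normrN.
exact: (measurable_oppv (A := FT (grid T n k))).
Qed.

Lemma simple0 : simple 0 0 (fun (_ : nat) (_ : Om) => 0 : rV).
Proof. by move=> k _; split => [|w i]; [exact: measurable_cst|rewrite mxE normr0]. Qed.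

Lemma integral_dot_proc n (c q : nat -> Om -> rV) w :
  \int[leb]_(t in `[0, T]) dot (proc n q (t, w)) (proc n c (t, w)) =
  \sum_(j < 2 ^ n) mesh T n * dot (q j w) (c j w).
Proof.
have dot0 : dot (0 : rV) 0 = 0 :> R^o by rewrite /dot big1// => i _; rewrite mxE mul0r.
under eq_Rintegral => t _ do rewrite /proc (steps_map2 T_gt0 n (fun j => q j w) (fun j => c j w) (h := @dot R d : rV -> rV -> R^o) t dot0).
rewrite (integral_steps T_gt0 n (fun j => dot (q j w) (c j w)) (ltW T_gt0)).2.
by apply: eq_bigr => j _; rewrite (tincrT T_gt0).
Qed.

Lemma L2_proc (P : probability Om R) n (K : R) (c : nat -> Om -> rV) : simple n K c ->
  L2 (PTm P) (proc n c).
Proof.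
move=> sc; split; first exact: (measurable_proc T_gt0 sc).
apply: (@ing_bounded _ _ _ (PTm P) (d%:R * K ^+ 2)); first exact: PTm_fin.
  by apply: measurable_sqnv; exact: (measurable_proc T_gt0 sc).
by move=> p; rewrite ger0_norm ?sqn_ge0//; exact: (sqn_proc_bound T_gt0 sc).
Qed.

Lemma Ex_qv (P : probability Om R) n (K : R) (c : nat -> Om -> rV) : simple n K c ->
  ing P (qv n c) /\ Ex P (qv n c) = N (PTm P) (proc n c).
Proof.
move=> sc; have [i e _] := PTm_fubini (L2_proc P sc).2; rewrite /N -e.
have E : (fun w => \int[leb]_(t in `[0, T]) sqn (proc n c (t, w))) = qv n c.
  by apply/funext => w; rewrite (qv_proc T_gt0).
by move: i; rewrite /Ex E.
Qed.

Lemma Ex_dot_proc (P : probability Om R) n (K K' : R) (c q : nat -> Om -> rV) :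
  simple n K c -> simple n K' q ->
  let f w := \sum_(j < 2 ^ n) mesh T n * dot (q j w) (c j w) in
  ing P f /\ Ex P f = Ex (PTm P) (fun p => dot (proc n q p) (proc n c p)).
Proof.
move=> sc sq f.
have [i <- _] := PTm_fubini (L2_dot (L2_proc P sq) (L2_proc P sc)).
have E : (fun w => \int[leb]_(t in `[0, T]) dot (proc n q (t, w)) (proc n c (t, w))) = f.
  by apply/funext => w; rewrite integral_dot_proc.
by move: i; rewrite /Ex E.
Qed.

Variables (P Q : probability Om R) (M : R -> Om -> rV) (H : R).
Hypothesis QM : gbm Q M.
Hypothesis PQ : (relative_entropy P Q <= H%:E)%E.

(** Under [Q] the sum of the absolute increments, multiplied by [K], has a finite exponential
    moment; the first half of [entropy_ge] transfers its integrability to [P]. *)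
Lemma ing_stoch_entropy n (K : R) (c : nat -> Om -> rV) : simple n K c -> ing P (stoch M n c).
Proof.
move=> sc; have [g hg] := mesh_law T_gt0 QM n.
pose G (k : nat) (x : Om * rV) := expR (K * nrm1 x.2).
pose kap := 2 ^+ d * expR (K ^+ 2 * mesh T n * d%:R / 2) : R.
have kap0 : 0 < kap by rewrite /kap mulr_gt0 ?exprn_gt0 ?expR_gt0.
pose h w := \sum_(j < 2 ^ n) K * nrm1 (incr M n j w).
have K0 k : (k < 2 ^ n)%N -> forall w i, `|c k w 0 i| <= K by move=> /sc[].
have hE w : expR (h w) = \prod_(k < 2 ^ n) G k (w, incr M n k w) by rewrite /h expR_sum.
have mh : measurable_fun setT h.
  apply: (measurable_sumr (index_enum _)) => j; apply: measurable_funM => //.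
  apply: measurableT_comp; first exact: measurable_nrm1.
  exact: fmeas_meas (fmeas_incr T_gt0 QM (ltn_ord j)).
have sh w : `|stoch M n c w| <= h w.
  apply: (le_trans (ler_norm_sum _ _ _)); apply: ler_sum => j _.
  by apply: dot_le_nrm1; exact: K0.
have h0 w : 0 <= h w by exact: le_trans (normr_ge0 _) (sh w).
have ih : ing P h.
  apply: ((entropy_ge PQ).1 h (kap ^+ (2 ^ n)) mh h0 (exprn_gt0 _ kap0)).
  under eq_integral => w _ do rewrite hE.
  apply: (prod_bound T_gt0 QM hg (leqnn _) (ltW kap0)).
  - move=> k kn; apply: measurableT_comp; first exact: measurable_expR.
    apply: measurable_funM; first exact: measurable_cst.
    by apply: measurableT_comp; [exact: measurable_nrm1|exact: measurable_snd].
  - by move=> k x; exact: expR_ge0.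
  - by move=> k w kn; exact: (gaussian_exp_nrm1 K (mesh_gt0 T_gt0 n) hg).
exact: (ing_dom (measurable_stoch T_gt0 QM sc) ih).
Qed.

Lemma stoch_entropy n (K : R) (c : nat -> Om -> rV) : simple n K c ->
  Ex P (stoch M n c) - 2^-1 * N (PTm P) (proc n c) <= H.
Proof.
move=> sc; have [iq eq] := Ex_qv P sc; have is_ := ing_stoch_entropy sc.
have ig : ing P (fun w => stoch M n c w - 2^-1 * qv n c w) by apply: ingB => //; exact: ingZ.
have := (entropy_ge PQ).2 _ 1 ig ltr01 (gexp_le1 T_gt0 QM sc).
by rewrite ln1 addr0 ExB// ?ExZ// ?eq//; exact: ingZ.
Qed.

Lemma entropy_drift : exists alpha : PT -> rV, [/\ L2 (PTm P) alpha, 2^-1 * N (PTm P) alpha <= H,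
  forall n (K : R) c, simple n K c ->
    Ex P (stoch M n c) = Ex (PTm P) (fun p => dot (proc n c p) (alpha p)) &
  forall e : R, 0 < e -> exists n (K : R) c, simple n K c /\ N (PTm P) (fun p => (-1) *: proc n c p + alpha p) <= e].
Proof.
(* Pairs of a process and a value are recorded because the expectation is attached to the
   representation [c]; that it depends on the process alone is a consequence of [riesz]. *)
pose S : set ((PT -> rV) * R) := [set x | exists n (K : R) c, [/\ simple n K c, x.1 = proc n c & x.2 = Ex P (stoch M n c)]].
have S_L2 x : S x -> L2 (PTm P) x.1 by move=> [n [K [c [sc -> _]]]]; exact: L2_proc sc.
have S0 : S (fun=> 0, 0).
  exists 0%N, 0, (fun _ _ => 0); split; first exact: simple0.
    by apply/funext => p; rewrite /proc /steps /= big1// => j _; rewrite scaler0.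
  rewrite /= -[LHS](Ex0 P); congr Ex; apply/funext => w; rewrite /stoch big1// => j _.
  by rewrite /dot big1// => i _; rewrite mxE mul0r.
have S_lin (a : R) x y : S x -> S y -> S (fun p => a *: x.1 p + y.1 p, a * x.2 + y.2).
  move=> [n [K [c [sc x1 x2]]]] [m [K' [c' [sc' y1 y2]]]].
  have [e [se e1 e2]] := refine_simple T_gt0 sc (leq_maxl n m).
  have [e' [se' e1' e2']] := refine_simple T_gt0 sc' (leq_maxr n m).
  exists (maxn n m), (`|a| * K + K'), (fun j w => a *: e j w + e' j w); split.
  - exact: simple_lin.
  - by apply/funext => p; rewrite proc_lin e1 e1' x1 y1.
  - have -> : stoch M (maxn n m) (fun j w => a *: e j w + e' j w) = (fun w => a * stoch M n c w + stoch M m c' w).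
      by apply/funext => w; rewrite stoch_lin e2 e2'.
    have i1 := ing_stoch_entropy sc; have i2 := ing_stoch_entropy sc'.
    by rewrite ExD ?ExZ// ?x2 ?y2//; exact: ingZ.
have S_le x : S x -> x.2 - 2^-1 * N (PTm P) x.1 <= H.
  by move=> [n [K [c [sc -> ->]]]]; exact: stoch_entropy sc.
have [alpha [h1 h2 h3 h4]] := riesz (PTm_fin T_gt0 P) S_L2 S0 S_lin S_le.
exists alpha; split => //.
- by move=> n K c sc; apply: (h3 (proc n c, Ex P (stoch M n c))); exists n, K, c.
- by move=> e /h4[x [[n [K [c [sc x1 _]]]] hx]]; exists n, K, c; rewrite -x1.
Qed.

End entropy_drift.

(** Clamping the index to [[k0, k1]] turns the windowed sum into an ordinary telescope. *)
Lemma sum_window (R : zmodType) (f : nat -> R) (k0 k1 N : nat) : (k0 <= k1)%N -> (k1 <= N)%N ->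
  \sum_(k < N) (if (k0 <= k < k1)%N then f k.+1 - f k else 0) = f k1 - f k0.
Proof.
move=> k01 k1N; pose F k := f (minn (maxn k k0) k1).
transitivity (\sum_(0 <= k < N) (F k.+1 - F k)).
  rewrite big_mkord; apply: eq_bigr => k _; rewrite /F.
  have [kk0|k0k] /= := ltnP k k0.
    have -> : maxn k.+1 k0 = k0 by lia.
    by rewrite subrr.
  have [kk1|k1k] := ltnP k k1.
    have -> : minn (maxn k.+1 k0) k1 = k.+1 by lia.
    by [].
  have -> : minn (maxn k.+1 k0) k1 = k1 by lia.
  by rewrite subrr.
rewrite telescope_sumr// /F.
have -> : minn (maxn N k0) k1 = k1 by lia.
by have -> : minn (maxn 0 k0) k1 = k0 by lia.
Qed.

(** * The exponential estimate on a grid *)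

Section levy_grid.
Context (R : realType) (T : R) (d : nat) (T_gt0 : 0 < T).
Local Notation Om := (path_space T d).
Local Notation FT s := (g_sigma_algebraType (@coord_events R T d s)).
Local Notation fm s := (@fmeas R T d _ _ s).
Local Notation rV := 'rV[R]_d.
Local Notation PT :=
  (g_sigma_algebraType (predictable_rectangles T (@canonical_filtration R T d))).
Local Notation PTm P := (@PTm R T d T_gt0 P).

Variables (P Q : probability Om R) (M : R -> Om -> rV) (H : R).
Hypothesis QM : gbm Q M.
Hypothesis PQ : (relative_entropy P Q <= H%:E)%E.
Variables (n : nat) (K : R) (c : nat -> Om -> rV).
Hypothesis sc : simple n K c.
Variables (k0 k1 : nat) (E : set Om).
Hypotheses (k01 : (k0 < k1)%N) (k1n : (k1 <= 2 ^ n)%N).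
Hypothesis FE : canonical_filtration (grid T n k0) E.
Variables (g : probability rV R).
Hypothesis hg : gaussian_law g (mesh T n).
Variables (KV : R) (v : rV -> R) (p : rV -> rV).
Hypotheses (KV0 : 0 <= KV) (hv : c11 KV v p).
Variable (l C : R).
Hypothesis C0 : 0 <= C.
Hypothesis hC : forall (l' : R) v p x, c11 KV v p -> `|l'| <= `|l| ->
  (\int[g]_y (expR (l' * defect g v p x y))%:E <= (1 + C * mesh T n ^+ 2)%:E)%E.

(** Backward heat flow: [vj j] is the expected value of [v] when [j] Gaussian increments are still
    to come, and [pj j] is its gradient in the sense of [c11]. *)
Let vj j := iter j (avg g) v.
Let pj j := iter j (avgv g) p.

Let hvj j : c11 KV (vj j) (pj j).
Proof. by elim: j => [|j ih] //; exact: c11_avg ih. Qed.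

Let drifted k w := shifted M n (fun j w => - c j w) k w.
Let u k w := drifted k w - drifted k0 w.
Let ind (k : nat) (w : Om) : R := if (k0 <= k < k1)%N then \1_E w else 0.
Let z k w := incr M n k w - mesh T n *: c k w.

Let fmeas_u k : (k0 <= k)%N -> (k <= 2 ^ n)%N -> fm (grid T n k) (u k).
Proof.
move=> k0k kn; apply: (measurable_subv (A := FT (grid T n k))).
  by apply: (fmeas_shifted T_gt0 QM (simpleN sc)).
by apply: (fmeas_shifted T_gt0 QM (simpleN sc)).
Qed.

Let u_step k w : u k.+1 w = u k w + z k w.
Proof.
rewrite /u /z /drifted /shifted /incr big_ord_recr/= scalerDr scalerN.
by apply/matrixP => i j; rewrite !mxE; ring.
Qed.

Let u0 w : u k0 w = 0. Proof. exact: subrr. Qed.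

Let ind_le1 k w : `|ind k w| <= 1.
Proof. by rewrite /ind; case: ifP => _; rewrite ?normr0// ger0_norm// indicE lern1 leq_b1. Qed.

(* The discrete Clark-Ocone integrand of [v] evaluated at the increment of
   [drifted] between the grid times [k0] and [k1]. *)
Definition levy_proc k w : rV := if (k0 <= k < k1)%N then \1_E w *: pj (k1 - k.+1) (u k w) else 0.
Local Notation q := levy_proc.

Lemma simple_levy_proc : simple n KV q.
Proof.
move=> k kn; rewrite /q; case: (boolP (k0 <= k < k1)%N) => [/andP[k0k kk1]|_]; last first.
  by split=> [|w i]; [exact: measurable_cst|rewrite mxE normr0].
have [_ mp _ bp _] := hvj (k1 - k.+1); split.
- apply: (measurable_scalev (A := FT (grid T n k))).
    by apply: fmeas_indic; apply: filtration_le FE; exact: grid_le.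
  exact: (measurableT_comp (T1 := FT (grid T n k)) mp (fmeas_u k0k (ltnW kn))).
- move=> w i; rewrite mxE normrM -[leRHS]mul1r ler_pM//.
  by rewrite ger0_norm// indicE lern1 leq_b1.
Qed.

(** The defect of one cell at the increment of [M] minus the drift [c]. Under the tilt by [c]
    contained in [G], that increment becomes a centred Gaussian again. *)
Let D k (x : Om * rV) : R := if (k0 <= k < k1)%N then
  \1_E x.1 * defect g (vj (k1 - k.+1)) (pj (k1 - k.+1)) (u k x.1) (x.2 - mesh T n *: c k x.1) else 0.
Let G k (x : Om * rV) := expR ((dot (c k x.1) x.2 - sqn (c k x.1) * mesh T n / 2) + l * D k x).

Let mG k : (k < 2 ^ n)%N -> measurable_fun setT (G k : (FT (grid T n k) * rV)%type -> R).
Proof.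
move=> kn; apply: measurableT_comp; first exact: measurable_expR.
have mck : fm (grid T n k) (c k) by case: (sc kn).
have mc : measurable_fun setT (fun x : (FT (grid T n k) * rV)%type => c k x.1).
  exact: (measurableT_comp (f := c k : FT (grid T n k) -> rV) mck measurable_fst).
apply: measurable_funD.
  apply: measurable_funB; first by apply: measurable_dotv => //; exact: measurable_snd.
  apply: measurable_funM; last exact: measurable_cst.
  by apply: measurable_funM; [exact: measurable_sqnv|exact: measurable_cst].
apply: measurable_funM; first exact: measurable_cst.
rewrite /D; case: (boolP (k0 <= k < k1)%N) => [/andP[k0k kk1]|_]; last exact: measurable_cst.
have fE : fm (grid T n k) (\1_E : Om -> R) by apply: fmeas_indic; apply: filtration_le FE; exact: grid_le.
have fu := fmeas_u k0k (ltnW kn).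
have mu : measurable_fun setT (fun x : (FT (grid T n k) * rV)%type => u k x.1).
  exact: (measurableT_comp (f := u k : FT (grid T n k) -> rV) fu measurable_fst).
have mz : measurable_fun setT (fun x : (FT (grid T n k) * rV)%type => x.2 - mesh T n *: c k x.1).
  apply: measurable_subv; first exact: measurable_snd.
  by apply: measurable_scalev => //; exact: measurable_cst.
have [mv mp bv _ _] := hvj (k1 - k.+1).
apply: measurable_funM.
  exact: (measurableT_comp (f := \1_E : FT (grid T n k) -> R) fE measurable_fst).
apply: measurable_funB.
  apply: measurable_funB.
    by apply: (measurableT_comp mv); exact: measurable_addv.
  by apply: measurableT_comp; [exact: measurable_avg bv|].
by apply: measurable_dotv => //; exact: measurableT_comp mp mu.
Qed.

(** The Cameron-Martin formula absorbs the tilt together with the drift correction, which leaves the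
    exponential moment of a plain defect with multiplier at most [|l|]. *)
Let G_bound k w : (k < 2 ^ n)%N -> (\int[g]_y (G k (w, y))%:E <= (1 + C * mesh T n ^+ 2)%:E)%E.
Proof.
move=> kn.
pose F y := (expR (l * ind k w * defect g (vj (k1 - k.+1)) (pj (k1 - k.+1)) (u k w) y))%:E.
have [_ _ id _] := defect_bounds (u k w) 0 KV0 (mesh_gt0 T_gt0 n) hg (hvj (k1 - k.+1)).
have mF : measurable_fun setT F.
  apply/measurable_EFinP; apply: measurableT_comp => //; apply: measurable_funM => //; exact: ing_meas id.
have := gaussian_shift (c k w) (mesh_gt0 T_gt0 n) hg mF (fun y => expR_ge0 _).
have -> : (\int[g]_y (G k (w, y))%:E =
  \int[g]_y ((expR (dot (c k w) y - sqn (c k w) * mesh T n / 2))%:E * F (y - mesh T n *: c k w)%R))%E.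
  apply: eq_integral => y _; rewrite /F -EFinM -expRD; congr (expR (_ + _))%:E.
  by rewrite /D /ind; case: ifP => _ /=; rewrite ?mulrA// mulr0 mul0r.
move=> ->; apply: hC => //.
by rewrite normrM -[leRHS]mulr1 ler_pM.
Qed.

Definition levy_end w := \1_E w * (v (drifted k1 w - drifted k0 w) - iter (k1 - k0) (avg g) v 0).

(** Along the grid [vj (k1 - k) (u k w)] starts at the iterated average at 0 and ends at [v] of the
    whole increment. Its steps are the defects plus the Clark-Ocone terms, and the latter split into
    a stochastic integral and a drift correction. *)
Let sum_D w : \sum_(k < 2 ^ n) D k (w, incr M n k w) =
  levy_end w - stoch M n q w + \sum_(k < 2 ^ n) mesh T n * dot (q k w) (c k w).
Proof.
pose f k := \1_E w * vj (k1 - k) (u k w).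
have -> : levy_end w = \sum_(k < 2 ^ n) (if (k0 <= k < k1)%N then f k.+1 - f k else 0).
  by rewrite (sum_window f (ltnW k01) k1n) /f subnn u0 -mulrBr.
rewrite /stoch -sumrB -big_split/=; apply: eq_bigr => k _.
rewrite /D /q; case: ifP => [/andP[k0k kk1]|_]; last first.
  by rewrite /dot !big1 ?mulr0 ?subrr ?addr0// => i _; rewrite mxE mul0r.
have e1 : (k1 - k)%N = (k1 - k.+1).+1 by lia.
rewrite /f e1 /defect/= u_step -/(z k w) !dot_scalel.
have -> : dot (pj (k1 - k.+1) (u k w)) (z k w) =
   dot (pj (k1 - k.+1) (u k w)) (incr M n k w) - mesh T n * dot (pj (k1 - k.+1) (u k w)) (c k w).
  by rewrite /z /dot mulr_sumr -sumrB; apply: eq_bigr => i _; rewrite !mxE; ring.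
by rewrite /vj /=; ring.
Qed.

Let prodG w : \prod_(k < 2 ^ n) G k (w, incr M n k w) =
  expR (l * (levy_end w - stoch M n q w + \sum_(k < 2 ^ n) mesh T n * dot (q k w) (c k w)) +
        (stoch M n c w - 2^-1 * qv n c w)).
Proof.
rewrite -sum_D /G -expR_sum big_split/= -mulr_sumr addrC; congr (expR (_ + _)).
rewrite /stoch /qv mulr_sumr -sumrB; apply: eq_bigr => j _ /=.
by rewrite [_ * mesh _ _]mulrC -[_ / 2]mulrC mulrA.
Qed.

Lemma measurable_drifted k : (k <= 2 ^ n)%N -> measurable_fun setT (drifted k).
Proof. by move=> kn; apply: fmeas_meas; exact: (fmeas_shifted T_gt0 QM (simpleN sc) (leqnn k)). Qed.

Lemma levy_end_ing : ing P levy_end.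
Proof.
have [mv _ bv _ _] := hv; have [_ _ bv' _ _] := hvj (k1 - k0).
have mE : measurable_fun setT (\1_E : Om -> R) by apply: measurable_indic; exact: filtration_measurable FE.
have m : measurable_fun setT levy_end.
  apply: measurable_funM => //; apply: measurable_funB => //; apply: (measurableT_comp mv).
  by apply: measurable_subv; apply: measurable_drifted => //; rewrite (leq_trans (ltnW k01)).
apply: (@ingP_bounded _ _ _ P (1 * (KV + KV)) _ m) => w; rewrite normrM ler_pM//.
  by rewrite ger0_norm// indicE lern1 leq_b1.
by rewrite (le_trans (ler_normB _ _))// lerD//; exact: bv'.
Qed.

(** Duality for the exponent of [prodG], whose exponential moment under [Q] is at most
    [(1 + C mesh ^ 2) ^ (2 ^ n)]. Since [2 ^ n * mesh = T], its logarithm is at most [C T mesh]. *)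
Lemma levy_grid : l * (Ex P levy_end - Ex P (stoch M n q) +
    Ex (PTm P) (fun p => dot (proc n q p) (proc n c p))) +
    (Ex P (stoch M n c) - 2^-1 * N (PTm P) (proc n c)) <= H + C * T * mesh T n.
Proof.
have sq := simple_levy_proc.
have i1 := levy_end_ing; have i2 := ing_stoch_entropy T_gt0 QM PQ sq.
have i3 := ing_stoch_entropy T_gt0 QM PQ sc.
have [i4 e4] := Ex_qv T_gt0 P sc; have [i5 e5] := Ex_dot_proc T_gt0 P sc sq.
rewrite -e4 -e5 -ExB// -ExD//; last exact: ingB.
have i6 := ingD (ingB i1 i2) i5; rewrite -ExZ//.
have i7 := ingZ 2^-1 i4; rewrite -(ExZ _ i4) -ExB//.
rewrite -ExD; [|exact: ingZ|exact: ingB].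
have kap0 : 0 <= C * mesh T n ^+ 2 by rewrite mulr_ge0// sqr_ge0.
have kap1 : 0 < 1 + C * mesh T n ^+ 2 by apply: (lt_le_trans ltr01); rewrite lerDl.
have := (entropy_ge PQ).2 _ ((1 + C * mesh T n ^+ 2) ^+ (2 ^ n)) (ingD (ingZ l i6) (ingB i3 i7)) (exprn_gt0 _ kap1).
move=> h; apply: (le_trans (h _)).
- under eq_integral => w _ do rewrite -prodG.
  apply: (prod_bound T_gt0 QM hg (leqnn _) (ltW kap1) mG _ G_bound) => k x; exact: expR_ge0.
- rewrite lerD2l lnXn// -mulr_natr.
  have h1 : ln (1 + C * mesh T n ^+ 2) <= C * mesh T n ^+ 2.
    by rewrite (le_trans (ln_le_subr1 kap1))// addrC addKr.
  rewrite (le_trans (ler_wpM2r (ler0n _ _) h1))//.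
  rewrite {1}/mesh natrX le_eqVlt; apply/orP; left; apply/eqP; rewrite /mesh; field.
  by rewrite gt_eqF// exprn_gt0.
Qed.

End levy_grid.

(** * From simple drifts to the representing drift, at dyadic times *)

Section levy_dyadic.
Context (R : realType) (T : R) (d : nat) (T_gt0 : 0 < T).
Local Notation Om := (path_space T d).
Local Notation FT s := (g_sigma_algebraType (@coord_events R T d s)).
Local Notation fm s := (@fmeas R T d _ _ s).
Local Notation rV := 'rV[R]_d.
Local Notation leb := (@lebesgue_measure R).
Local Notation PT :=
  (g_sigma_algebraType (predictable_rectangles T (@canonical_filtration R T d))).
Local Notation PTm P := (@PTm R T d T_gt0 P).

Lemma levy_arith (l x y a b N2 NA ND h C m e B KV : R) : l * (y - a + b) + ((NA - 2^-1 * (N2)) ) <= h + C * m ->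
  m <= e -> 0 <= C -> e ^+ 2 <= e -> ND <= e ^+ 2 -> 0 <= KV ->
  ND = N2 - 2 * NA + B -> 0 <= B ->
  `|x - y| <= 2 * KV * e -> `|a - b| <= KV * e ->
  l * x <= h + (C + 2^-1 + 3 * `|l| * KV) * e.
Proof.
move=> h1 h2 C0 h3 h4 KV0 h5 B0 h6 h7.
have a1 : l * (x - y) <= `|l| * (2 * KV * e).
  by apply: (le_trans (ler_norm _)); rewrite normrM ler_wpM2l.
have a2 : l * (a - b) <= `|l| * (KV * e).
  by apply: (le_trans (ler_norm _)); rewrite normrM ler_wpM2l.
have a3 : C * m <= C * e by rewrite ler_wpM2l.
lra.
Qed.

Lemma fmeas_time_integral (a : PT -> rV) (t : R) : measurable_fun setT a -> 0 <= t <= T ->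
  fm t (fun w => time_integral (fun s => a (s, w)) t).
Proof.
move=> ma /andP[t0 tT]; apply: (measurable_fun_rV (A := FT t)) => // i; under eq_fun do rewrite mxE.
have mi : measurable_fun ((`[0, T]%classic `*` [set: Om]) : set PT) (fun p => a p 0 i).
  by apply: measurable_funTS; exact: measurable_coordT.
exact: (fmeas_integral T_gt0 (lexx 0) t0 tT mi).2.
Qed.

Lemma integrable_nrm1 (f : R -> rV) : time_integrable T f ->
  leb.-integrable `[0, T] (fun t => (nrm1 (f t))%:E).
Proof.
move=> fi; have E : (fun t => (nrm1 (f t))%:E) = (fun t => \sum_i `|f t 0 i|%:E)%E by apply/funext => t; rewrite sumEFin.
have mT : measurable (`[0, T]%classic : set (measurableTypeR R)) by exact: measurable_itv.
by rewrite E; apply: integrable_sum => // i _; exact: (integrable_norm (fi i)).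
Qed.

(** Pairing with the vector of signs makes the norm of the integral a scalar integral. *)
Lemma nrm1_time_integral_cell (f : R -> rV) (a b : R) : 0 <= a -> a <= b -> b <= T -> time_integrable T f ->
  nrm1 (time_integral f b - time_integral f a) <= \int[leb]_(t in `]a, b]) nrm1 (f t).
Proof.
move=> a0 ab bT fi; set x := _ - _.
have mT : measurable (`[0, T]%classic : set (measurableTypeR R)) by exact: measurable_itv.
pose sg : rV := \row_i Num.sg (x 0 i).
have -> : nrm1 x = dot sg x by apply: eq_bigr => i _; rewrite [sg 0 i]mxE normrEsg.
rewrite -(dot_time_integral sg a0 ab bT fi).
have isub : (`]a, b]%classic : set (measurableTypeR R)) `<=` `[0, T]%classic.
  move=> t /=; rewrite !in_itv/= => /andP[h1 h2]; apply/andP; split; [exact: le_trans (ltW h1)|exact: le_trans bT].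
have idot : leb.-integrable `[0, T] (fun t => (dot sg (f t))%:E).
  have E : (fun t => (dot sg (f t))%:E) = (fun t => \sum_i (sg 0 i * f t 0 i)%:E)%E by apply/funext => t; rewrite sumEFin.
  rewrite E; apply: integrable_sum => // i _.
  have := integrableZl mT (sg 0 i) (fi i).
  by apply: eq_integrable => // t _; rewrite EFinM.
apply: le_Rintegral => //.
- exact: integrableS _ _ isub idot.
- exact: integrableS _ _ isub (integrable_nrm1 fi).
- move=> t _; apply: (le_trans (ler_norm _)); rewrite -[leRHS]mul1r; apply: dot_le_nrm1 => i.
  by rewrite mxE normr_sg; case: eqP; rewrite ?normr0 ?ler01.
Qed.

Lemma nrm1_time_integral (f : R -> rV) (a b : R) : 0 <= a -> a <= b -> b <= T -> time_integrable T f ->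
  nrm1 (time_integral f b - time_integral f a) <= \int[leb]_(t in `[0, T]) nrm1 (f t).
Proof.
move=> a0 ab bT fi; apply: (le_trans (nrm1_time_integral_cell a0 ab bT fi)).
have mT : measurable (`[0, T]%classic : set (measurableTypeR R)) by exact: measurable_itv.
have isub : (`]a, b]%classic : set (measurableTypeR R)) `<=` `[0, T]%classic.
  move=> t /=; rewrite !in_itv/= => /andP[h1 h2]; apply/andP; split; [exact: le_trans (ltW h1)|exact: le_trans bT].
have inrm := integrable_nrm1 fi.
apply: fine_le.
- apply: integrable_fin_num => //; exact: integrableS _ _ isub inrm.
- exact: integrable_fin_num.
- apply: ge0_subset_integral => //.
    by case/integrableP: inrm.
  by move=> t _; rewrite lee_fin nrm1_ge0.
Qed.

Lemma Ex_PTm_cst (P : probability Om R) (k : R) : ing (PTm P) (fun=> k) /\ Ex (PTm P) (fun=> k) = k * T.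
Proof.
split; first by apply: (@ing_bounded _ _ _ (PTm P) `|k|) => //; exact: PTm_fin.
by rewrite /Ex /Rintegral (integral_cst (PTm P) measurableT k%:E) PTm_mass.
Qed.

Lemma Ex_nrm1_L2 (P : probability Om R) (u : PT -> rV) (e : R) : 0 < e -> L2 (PTm P) u -> N (PTm P) u <= e ^+ 2 ->
  ing (PTm P) (fun p => nrm1 (u p)) /\ Ex (PTm P) (fun p => nrm1 (u p)) <= (d%:R * T + 1) * e.
Proof.
move=> e0 [mu iu] hN; have [ic ec] := Ex_PTm_cst P (d%:R * e).
have ib := ingD ic (ingZ e^-1 iu).
have hb p : nrm1 (u p) <= d%:R * e + e^-1 * sqn (u p) by rewrite [e^-1 * _]mulrC; exact: nrm1_le_sqn.
have i : ing (PTm P) (fun p => nrm1 (u p)).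
  apply: (ing_dom _ ib); first by apply: measurableT_comp => //; exact: measurable_nrm1.
  by move=> p; rewrite ger0_norm ?nrm1_ge0.
split => //; apply: (le_trans (le_Ex i ib hb)).
rewrite ExD//; last exact: ingZ.
rewrite ec ExZ//; have : e^-1 * N (PTm P) u <= e by rewrite ler_pdivrMl// -expr2.
rewrite /N; lra.
Qed.

Section avg_incr.
Variables (Q : probability Om R) (M : R -> Om -> rV).
Hypothesis QM : gbm Q M.
Variables (n : nat) (g : probability rV R).
Hypothesis hg : gaussian_law g (mesh T n).

(** Integrating out the last increment replaces [v] by its average; repeating this identifies the
    iterated average with an expectation under [Q]. *)
Lemma avg_incr (K : R) v p k j : c11 K v p -> (k + j <= 2 ^ n)%N ->
  Ex Q (fun w => v (M (grid T n (k + j)) w - M (grid T n k) w)) = iter j (avg g) v 0.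
Proof.
elim: j v p => [|j ih] v p hv kj.
  by rewrite addn0 -[RHS](Ex_cst Q); congr Ex; apply/funext => w; rewrite subrr.
rewrite addnS in kj *; rewrite iterSr -(ih _ _ (c11_avg g hv) (ltnW kj)).
have [mv _ bv _ _] := hv.
pose u w := M (grid T n (k + j)) w - M (grid T n k) w.
have mu : fm (grid T n (k + j)) u.
  have [h0 hT] := andP (grid_itv T_gt0 (ltnW kj)).
  have [k0 _] := andP (grid_itv T_gt0 (leq_trans (leq_addr j k) (ltnW kj))).
  by apply: (fmeas_diff QM) => //; apply: grid_le => //; exact: leq_addr.
pose h (x : Om * rV) := (v (u x.1 + x.2) + K)%:E.
have vK x : 0 <= v x + K by have := bv x; rewrite ler_norml => /andP[+ _]; rewrite -lerBlDr sub0r.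
have mh : measurable_fun setT (h : (FT (grid T n (k + j)) * rV)%type -> \bar R).
  apply/measurable_EFinP; apply: measurable_funD; last exact: measurable_cst.
  apply: (measurableT_comp mv); apply: measurable_addv; last exact: measurable_snd.
  exact: (measurableT_comp (f := u : FT (grid T n (k + j)) -> rV) mu measurable_fst).
have h0 x : (0 <= h x)%E by rewrite lee_fin.
have := incr_step T_gt0 QM hg kj mh h0.
have iK (m : probability Om R) : ing m (fun=> K) by apply: (@ingP_bounded _ _ _ m `|K|) => //; exact: measurable_cst.
have mu' : measurable_fun setT u by exact: fmeas_meas mu.
have mi := fmeas_meas (fmeas_incr T_gt0 QM kj).
have i1 : ing Q (fun w => v (u w + incr M n (k + j) w)).
  apply: (@ingP_bounded _ _ _ Q K) => //; apply: (measurableT_comp mv); exact: measurable_addv.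
have ma : measurable_fun setT (fun w => avg g v (u w)) by apply: (measurableT_comp (measurable_avg g mv bv)).
have i2 : ing Q (fun w => avg g v (u w)).
  by apply: (@ingP_bounded _ _ _ Q K) => // w; exact: avg_bound.
have -> : (\int[Q]_w h (w, incr M n (k + j) w) = (Ex Q (fun w => v (u w + incr M n (k + j) w)) + K)%:E)%E.
  by rewrite /h (ExE (ingD i1 (iK Q))) ExD ?Ex_cst.
have -> : (\int[Q]_w \int[g]_y h (w, y) = (Ex Q (fun w => avg g v (u w)) + K)%:E)%E.
  under eq_integral => w _.
    have j1 := @ing_avg _ _ g K v (u w) mv bv.
    have j2 : ing g (fun=> K) by apply: (@ingP_bounded _ _ _ g `|K|) => //; exact: measurable_cst.
    rewrite /h /= (ExE (ingD j1 j2)) ExD// Ex_cst; over.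
  by rewrite (ExE (ingD i2 (iK Q))) ExD ?Ex_cst.
move=> [] /addIr; rewrite /u => <-; congr Ex; apply/funext => w; congr v.
by rewrite /incr; apply/matrixP => a b; rewrite !mxE; ring.
Qed.
End avg_incr.

Variables (P Q : probability Om R) (M : R -> Om -> rV) (H : R).
Hypothesis QM : gbm Q M.
Hypothesis PQ : (relative_entropy P Q <= H%:E)%E.
Variable alpha : PT -> rV.
Hypothesis La : L2 (PTm P) alpha.
Hypothesis stoch_alpha : forall n (K : R) c, simple n K c ->
    Ex P (stoch M n c) = Ex (PTm P) (fun p => dot (proc n c p) (alpha p)).
Hypothesis alpha_app : forall e : R, 0 < e -> exists n (K : R) c,
  simple n K c /\ N (PTm P) (fun p => (-1) *: proc n c p + alpha p) <= e.

Definition driftless t w : rV := M t w - time_integral (fun s => alpha (s, w)) t.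

Lemma fmeas_driftless t : 0 <= t <= T -> fm t (driftless t).
Proof.
move=> tT; apply: (measurable_subv (A := FT t)); first exact: QM.1.
exact: fmeas_time_integral La.1 tT.
Qed.

Lemma ae_integrable_alpha : {ae P, forall w, time_integrable T (fun s => alpha (s, w))}.
Proof.
have ia i : ing (PTm P) (fun p => alpha p 0 i).
  have [ic _] := Ex_PTm_cst P 1.
  apply: (ing_dom (measurable_coordT i La.1) (ingD ic La.2)) => p.
  have h : (alpha p 0 i) ^+ 2 <= sqn (alpha p) by rewrite /sqn (bigD1 i)//= lerDl sumr_ge0// => k _; exact: sqr_ge0.
  have := sqr_ge0 (`|alpha p 0 i| - 2^-1); rewrite sqrrB real_normK ?num_real// => h'.
  have : `|alpha p 0 i| <= (2^-1) ^+ 2 + alpha p 0 i ^+ 2 by rewrite -mulr_natl in h'; lra.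
  lra.
have : {ae P, forall w i, leb.-integrable `[0, T] (fun t => (alpha (t, w) 0 i)%:E)}.
  by apply: filter_forall => i; have [_ _] := PTm_fubini (ia i).
by apply: filterS => w h i; exact: h.
Qed.

Variables (n k0 k1 : nat) (E : set Om).
Hypotheses (k01 : (k0 < k1)%N) (k1n : (k1 <= 2 ^ n)%N).
Hypothesis FE : canonical_filtration (grid T n k0) E.
Variables (KV : R) (v : rV -> R) (p : rV -> rV).
Hypotheses (KV0 : 0 <= KV) (hv : c11 KV v p).

Let vbar := Ex Q (fun w => v (M (grid T n k1) w - M (grid T n k0) w)).
Let X_ w := \1_E w * (v (driftless (grid T n k1) w - driftless (grid T n k0) w) - vbar).

Let mE : measurable_fun setT (\1_E : Om -> R).
Proof. by apply: measurable_indic; exact: filtration_measurable FE. Qed.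

Let iX : ing P X_.
Proof.
have [mv _ bv _ _] := hv.
have g0 := grid_itv T_gt0 (leq_trans (ltnW k01) k1n); have g1 := grid_itv T_gt0 k1n.
have m : measurable_fun setT X_.
  apply: measurable_funM => //; apply: measurable_funB => //; apply: (measurableT_comp mv).
  by apply: measurable_subv; apply: fmeas_meas; exact: fmeas_driftless.
apply: (@ingP_bounded _ _ _ P (1 * (KV + `|vbar|)) _ m) => w; rewrite normrM ler_pM//.
  by rewrite ger0_norm// indicE lern1 leq_b1.
by rewrite (le_trans (ler_normB _ _))// lerD.
Qed.

(** The estimate of [levy_grid] with [c] close to [alpha]. The stochastic integrals become inner
    products with [alpha], so the Clark-Ocone terms cancel up to O(e), and the entropy part
    [1/2 N alpha - 1/2 N (alpha - c)] is bounded below by [- e ^ 2 / 2]. Replacing [c] by [alpha]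
    inside [v] costs a Lipschitz constant times an L^1 distance. *)
Let X_le l : l * Ex P X_ <= H.
Proof.
have [C [C0 hC]] := one_step_bound d T KV0 (normr_ge0 l).
pose D1 := d%:R * T + 1.
have D10 : 0 <= D1 by rewrite /D1 addr_ge0// mulr_ge0// ltW.
apply: (@le_vanish _ _ _ (C * T + 2^-1 + 3 * `|l| * (KV * D1))) => e /andP[e0 e1].
have [n1 [K1 [c1 [sc1 hc1]]]] := alpha_app (exprn_gt0 2 e0).
have [m' hm'] : exists m', mesh T (n + m') <= e /\ (n1 <= n + m')%N.
  have [k hk] : exists k, mesh T k <= e.
    have /cvgrPdist_le /(_ e e0) [k _ hk] := mesh_cvg T.
    by exists k; have := hk k (leqnn k); rewrite sub0r normrN ger0_norm// ltW// mesh_gt0.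
  exists (k + n1)%N; split; last by rewrite addnA leq_addl.
  by apply: le_trans hk; apply: (mesh_le T_gt0); rewrite addnCA leq_addr.
have [hme n1m] := hm'; set m := (n + m')%N in hm' hme n1m.
have [c [sc pc _]] := refine_simple T_gt0 sc1 n1m.
have hc : N (PTm P) (fun p => (-1) *: proc m c p + alpha p) <= e ^+ 2.
  have pE : proc m c = proc n1 c1 by apply/funext.
  by rewrite pE.
have [g hg] := mesh_law T_gt0 QM m.
(* The same two times seen on the finer grid, where the mesh is small and [c] lives. *)
pose j0 := (k0 * 2 ^ m')%N; pose j1 := (k1 * 2 ^ m')%N.
have gj0 : grid T m j0 = grid T n k0 by rewrite /m /j0 grid_refine.
have gj1 : grid T m j1 = grid T n k1 by rewrite /m /j1 grid_refine.
have j01 : (j0 < j1)%N by rewrite ltn_pmul2r ?expn_gt0.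
have j1m : (j1 <= 2 ^ m)%N by rewrite /m expnD leq_pmul2r ?expn_gt0.
have FE' : canonical_filtration (grid T m j0) E by rewrite gj0.
have mT : mesh T m <= T.
  by have := mesh_le T_gt0 (leq0n m); rewrite {2}/mesh expr0 divr1.
have hC' (l' : R) (v' : rV -> R) (p' : rV -> rV) (x : rV) : c11 KV v' p' -> `|l'| <= `|l| ->
    (\int[g]_y (expR (l' * defect g v' p' x y))%:E <= (1 + C * mesh T m ^+ 2)%:E)%E.
  by move=> hv' hl; apply: hC => //; exact: mesh_gt0.
have := levy_grid T_gt0 QM PQ sc j01 j1m FE' hg KV0 hv C0 hC'.
have sq := simple_levy_proc T_gt0 QM sc j1 FE' g KV0 hv.
have iend := levy_end_ing T_gt0 P QM sc j01 j1m FE' g hv.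
set q := levy_proc _ _ _ _ _ _ _ _ in sq *.
set Y := levy_end _ _ _ _ _ _ _ _ in iend *.
rewrite (stoch_alpha sq) (stoch_alpha sc) => hmain.
have Lq := L2_proc T_gt0 P sq; have Lc := L2_proc T_gt0 P sc.
have Ld := L2_lin (-1) Lc La.
have [inr enr] := Ex_nrm1_L2 e0 Ld hc.
have hN := N_lin (-1) Lc La.
apply: (levy_arith hmain _ _ _ hc _ _ (N_ge0 (PTm P) alpha)).
- exact: hme.
- by rewrite mulr_ge0// ltW.
- by rewrite expr2 -[leRHS]mulr1 ler_wpM2l// ltW.
- by rewrite mulr_ge0.
- by rewrite hN; ring.
- have mT' : measurable (`[0, T]%classic : set (measurableTypeR R)) by exact: measurable_itv.
  have idn := PTm_fubini inr; case: idn => iG eG aG.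
  rewrite -ExB//.
  have vE : iter (j1 - j0) (avg g) v 0 = vbar.
    rewrite -(avg_incr QM hg (k := j0) hv) ?subnKC ?(ltnW j01)//.
    by rewrite /vbar gj0 gj1.
  have ae : {ae P, forall w, `|X_ w - Y w| <= 2 * KV * \int[leb]_(t in `[0, T]) nrm1 ((-1) *: proc m c (t, w) + alpha (t, w))}.
    apply: filterS ae_integrable_alpha => w aw.
    have sub2 (a b k : R) : a - k - (b - k) = a - b by ring.
    rewrite /X_ /Y /levy_end vE -mulrBr normrM sub2.
    apply: (@le_trans _ _ (1 * (2 * KV * \int[leb]_(t in `[0, T]) nrm1 ((-1) *: proc m c (t, w) + alpha (t, w))))); last by rewrite mul1r.
    apply: ler_pM => //; first by rewrite ger0_norm// indicE lern1 leq_b1.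
    apply: (le_trans (c11_dist _ _ KV0 hv)); rewrite ler_wpM2l ?mulr_ge0//.
    have cw := @time_integrable_proc _ _ _ T_gt0 m c w.
    have dw : time_integrable T (fun t => (-1) *: proc m c (t, w) + alpha (t, w)).
      move=> i; have := integrableD mT' (integrableN (cw i)) (aw i).
      by apply: eq_integrable => // t _; rewrite !mxE mulN1r EFinD.
    have [g00 g0T] := andP (grid_itv T_gt0 (leq_trans (ltnW j01) j1m)); have [g10 g1T] := andP (grid_itv T_gt0 j1m).
    have TIe j : (j <= 2 ^ m)%N -> time_integral (fun t => (-1) *: proc m c (t, w) + alpha (t, w)) (grid T m j) =
        - cumul m c (grid T m j) w + time_integral (fun t => alpha (t, w)) (grid T m j).
      move=> jm; have [a0 aT] := andP (grid_itv T_gt0 jm).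
      have isub : (`[0, grid T m j]%classic : set (measurableTypeR R)) `<=` `[0, T]%classic.
        by move=> t /=; rewrite !in_itv/= => /andP[-> /le_trans]; apply.
      rewrite -(cumulE T_gt0 m c w a0); apply/matrixP => a i; rewrite !mxE.
      have mj : measurable (`[0, grid T m j]%classic : set (measurableTypeR R)) by exact: measurable_itv.
      have i1 := integrableS mT' mj isub (cw i); have i2' := integrableS mT' mj isub (aw i).
      have E1 : \int[leb]_(t in `[0, grid T m j]) (-1 * proc m c (t, w) 0 i) = -1 * \int[leb]_(t in `[0, grid T m j]) proc m c (t, w) 0 i.
        exact: (RintegralZl (-1) mj i1).
      have I3 : leb.-integrable `[0, grid T m j] (fun t => (-1 * proc m c (t, w) 0 i)%:E).
        by have := integrableZl mj (-1) i1; apply: eq_integrable.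
      have E2 : \int[leb]_(t in `[0, grid T m j]) (-1 * proc m c (t, w) 0 i + alpha (t, w) 0 i) =
          \int[leb]_(t in `[0, grid T m j]) (-1 * proc m c (t, w) 0 i) + \int[leb]_(t in `[0, grid T m j]) alpha (t, w) 0 i.
        exact: (RintegralD mj I3 i2').
      transitivity (\int[leb]_(t in `[0, grid T m j]) (-1 * proc m c (t, w) 0 i + alpha (t, w) 0 i)).
        by apply: eq_Rintegral => t _; rewrite !mxE.
      by apply: (eq_trans E2); rewrite E1 mulN1r.
    have := nrm1_time_integral g00 (grid_le T_gt0 m (ltnW j01)) g1T dw.
    rewrite !TIe//; last exact: leq_trans (ltnW j01) j1m.
    rewrite -nrm1N; congr (nrm1 _ <= _).
    rewrite /driftless /shifted gj0 gj1 -gj0 -gj1.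
    rewrite !(cumul_grid T_gt0)//; last exact: leq_trans (ltnW j01) j1m.
    rewrite !sumrN !scalerN.
    by apply/matrixP => a i; rewrite !mxE; ring.
  have iXY := ingB iX iend.
  have i2 := ingZ (2 * KV) iG.
  apply: (@le_trans _ _ (Ex P (fun w => `|X_ w - Y w|))).
    by apply: ler_norm_Ex => //; exact: ing_norm.
  apply: (le_trans (ae_le_Ex (ing_norm iXY) i2 ae)).
  by rewrite ExZ// eG -!mulrA ler_wpM2l// ler_wpM2l.
- have -> : Ex (PTm P) (fun p => dot (proc m q p) (alpha p)) - Ex (PTm P) (fun p => dot (proc m q p) (proc m c p)) =
     Ex (PTm P) (fun p => dot (proc m q p) ((-1) *: proc m c p + alpha p)).
    rewrite -ExB; [|exact: L2_dot|exact: L2_dot].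
    by congr Ex; apply/funext => z; rewrite /dot -sumrB; apply: eq_bigr => i _; rewrite !mxE; ring.
  apply: (@le_trans _ _ (Ex (PTm P) (fun p => KV * nrm1 ((-1) *: proc m c p + alpha p)))).
    apply: ler_norm_Ex; [exact: L2_dot|exact: ingZ|move=> z].
    by apply: dot_le_nrm1 => i; exact: (proc_bound T_gt0 sq).
  by rewrite ExZ// -!mulrA ler_wpM2l.
Qed.

(* [X_le] holds for every [l], of either sign. *)
Lemma levy_dyadic : Ex P (fun w => \1_E w * v (driftless (grid T n k1) w - driftless (grid T n k0) w)) =
  Ex P (\1_E) * Ex Q (fun w => v (M (grid T n k1) w - M (grid T n k0) w)).
Proof.
have X0 : Ex P X_ = 0.
  have [//|x0] := eqVneq (Ex P X_) 0.
  have := X_le ((H + 1) / Ex P X_); rewrite divfK// gerDl ler10//.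
have iE : ing P (\1_E : Om -> R).
  by apply: (@ingP_bounded _ _ _ P 1 _ mE) => w; rewrite ger0_norm// indicE lern1 leq_b1.
have := ingZ vbar iE => i2.
transitivity (Ex P (fun w => X_ w + vbar * \1_E w)).
  by congr Ex; apply/funext => w; rewrite /X_; ring.
by rewrite ExD// X0 add0r ExZ// mulrC.
Qed.

End levy_dyadic.

(** * Smooth approximations of half-lines and orthants *)

Section ramps.
Context (R : realType).
Implicit Types x m n a : R.

(** A bounded function with Lipschitz derivative [dramp] that vanishes on the negative half-line;
    [ramp (n x)] tends to the indicator of [x > 0]. *)
Definition ramp x : R := if 0 < x then x ^+ 2 / (1 + x ^+ 2) else 0.
Definition dramp x : R := if 0 < x then 2 * x / (1 + x ^+ 2) ^+ 2 else 0.

Lemma one_sq_gt0 x : 0 < 1 + x ^+ 2. Proof. by rewrite ltr_pwDl// sqr_ge0. Qed.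

Lemma ramp_itv x : 0 <= ramp x <= 1.
Proof.
have p := one_sq_gt0 x; rewrite /ramp; case: ifP => _; last by rewrite lexx ler01.
by rewrite divr_ge0 ?sqr_ge0 ?(ltW p)//= ler_pdivrMr// mul1r lerDr.
Qed.

Lemma ramp_le_sq x : ramp x <= x ^+ 2.
Proof.
rewrite /ramp; case: ifP => _; last exact: sqr_ge0.
by rewrite ler_pdivrMr ?one_sq_gt0// mulrDr mulr1 lerDl mulr_ge0 ?sqr_ge0.
Qed.

Lemma dramp_itv x : 0 <= dramp x <= 1.
Proof.
have p := one_sq_gt0 x; rewrite /dramp; case: ifP => x0; last by rewrite lexx ler01.
apply/andP; split; first by rewrite divr_ge0 ?sqr_ge0// mulr_ge0// ltW.
rewrite ler_pdivrMr ?exprn_gt0// mul1r.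
have a1 := sqr_ge0 (x - 1); rewrite sqrrB1 in a1.
have a2 := sqr_ge0 (x ^+ 2); rewrite sqrrD expr1n mul1r.
have := sqr_ge0 x; lra.
Qed.

Lemma dramp_le x : dramp x <= 2 * `|x|.
Proof.
have p := one_sq_gt0 x; rewrite /dramp; case: ifP => x0; last by rewrite mulr_ge0.
rewrite gtr0_norm// ler_pdivrMr ?exprn_gt0// ler_peMr ?mulr_ge0 ?(ltW x0)//.
by rewrite expr_ge1 ?(ltW p)// lerDl sqr_ge0.
Qed.

Lemma ramp_taylor x m : `|ramp (x + m) - ramp x - dramp x * m| <= 4 * m ^+ 2.
Proof.
have m2 : 0 <= m ^+ 2 by exact: sqr_ge0.
have [x0|x0] := ltP 0 x; last first.
  have -> : ramp x = 0 by rewrite /ramp ltNge x0.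
  have -> : dramp x = 0 by rewrite /dramp ltNge x0.
  rewrite subr0 mul0r subr0; have /andP[r0 _] := ramp_itv (x + m); rewrite ger0_norm//.
  have [y0|y0] := ltP 0 (x + m); last by rewrite /ramp ltNge y0/= mulr_ge0.
  apply: (le_trans (ramp_le_sq _)); apply: (@le_trans _ _ (m ^+ 2)); last lra.
  by rewrite lerXn2r ?nnegrE//; lra.
have [y0|y0] := ltP 0 (x + m); last first.
  have -> : ramp (x + m) = 0 by rewrite /ramp ltNge y0.
  rewrite sub0r -opprD normrN; apply: (le_trans (ler_normD _ _)).
  have xm : x <= `|m| by rewrite ler_normr; apply/orP; right; lra.
  have e1 : `|ramp x| <= m ^+ 2.
    have /andP[r0 _] := ramp_itv x; rewrite ger0_norm// (le_trans (ramp_le_sq _))//.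
    by rewrite -[leRHS]real_normK ?num_real// lerXn2r ?nnegrE ?(ltW x0).
  have e2 : `|dramp x * m| <= 2 * m ^+ 2.
    have /andP[r0 _] := dramp_itv x; rewrite normrM ger0_norm//.
    rewrite -[m ^+ 2]real_normK ?num_real// expr2 mulrA ler_wpM2r//.
    by apply: (le_trans (dramp_le _)); rewrite (gtr0_norm x0); move: xm; lra.
  lra.
rewrite /ramp /dramp x0 y0; set y := x + m in y0 *.
pose a := 1 + x ^+ 2; pose b := 1 + y ^+ 2.
have a1 : 1 <= a by rewrite /a lerDl sqr_ge0.
have b1 : 1 <= b by rewrite /b lerDl sqr_ge0.
have a0 : 0 < a by exact: lt_le_trans a1.
have b0 : 0 < b by exact: lt_le_trans b1.
rewrite -/a -/b.
(* On the positive half-line the Taylor remainder is an explicit rational function with the factor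
   [m ^+ 2]. The cofactor is bounded by 4 because [a] and [b] are at least one and dominate [x ^+ 2]
   and [y ^+ 2]. *)
have -> : y ^+ 2 / b - x ^+ 2 / a - 2 * x / a ^+ 2 * m = m ^+ 2 * ((a - (2 * x ^+ 2 + 2 * x * y)) / (a ^+ 2 * b)).
  have hm : m = y - x by rewrite /y addrC addKr.
  have ea : x ^+ 2 = a - 1 by rewrite /a addrC addKr.
  rewrite hm /a /b; field.
  by rewrite !gt_eqF// -/b -/a.
rewrite normrM ger0_norm// mulrC ler_wpM2r//.
have ab0 : 0 < a ^+ 2 * b by rewrite mulr_gt0// exprn_gt0.
rewrite normrM [`|(a ^+ 2 * b)^-1|]gtr0_norm ?invr_gt0// ler_pdivrMr//.
have c1 : a * b <= a ^+ 2 * b by rewrite ler_pM2r// expr2 ler_peMl// ltW.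
have c2 : a <= a * b by rewrite ler_peMr// ltW.
have c3 : b <= a * b by rewrite ler_peMl// ltW.
have c4 := sqr_ge0 (x - y); rewrite sqrrB -mulr_natl in c4.
have c5 : 0 <= x * y by rewrite mulr_ge0// ltW.
have c6 := sqr_ge0 x.
rewrite ler_norml; apply/andP; split; rewrite /a /b in c1 c2 c3 *; lra.
Qed.

Lemma measurable_ramp : measurable_fun setT ramp.
Proof.
have -> : ramp = fun x => (\1_(`]0, +oo[%classic) x : R) * (x ^+ 2 / (1 + x ^+ 2)).
  apply/funext => x; rewrite /ramp indicE; case: ifP => x0.
    by rewrite mem_set ?mul1r//= in_itv/= x0.
  by rewrite memNset ?mul0r//= in_itv/= andbT x0.
apply: measurable_funM; first exact: measurable_indic.
apply: measurable_funM; first exact: measurable_funX.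
apply: measurable_inv_ge0 => [|x]; last exact: ltW (one_sq_gt0 x).
by apply: measurable_funD => //; exact: measurable_funX.
Qed.

Lemma measurable_dramp : measurable_fun setT dramp.
Proof.
have -> : dramp = fun x => (\1_(`]0, +oo[%classic) x : R) * (2 * x / (1 + x ^+ 2) ^+ 2).
  apply/funext => x; rewrite /dramp indicE; case: ifP => x0.
    by rewrite mem_set ?mul1r//= in_itv/= x0.
  by rewrite memNset ?mul0r//= in_itv/= andbT x0.
apply: measurable_funM; first exact: measurable_indic.
apply: measurable_funM; first exact: measurable_funM.
apply: measurable_inv_ge0 => [|x]; last by rewrite exprn_ge0// ltW// one_sq_gt0.
by apply: measurable_funX; apply: measurable_funD => //; exact: measurable_funX.
Qed.

Lemma ramp_cvg x : ramp (n%:R * x) @[n --> \oo] --> ((0 < x)%R%:R : R).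
Proof.
have [x0|x0] := ltP 0 x; last first.
  have -> : (fun n : nat => ramp (n%:R * x)) = fun=> 0.
    apply/funext => n; rewrite /ramp ltNge (_ : n%:R * x <= 0)//.
    by rewrite mulr_ge0_le0.
  exact: cvg_cst.
apply/cvgrPdist_le => e e0; near=> n.
have n0 : (0 < n)%N by near: n; exact: nbhs_infty_gt.
have nr : 0 < n%:R :> R by rewrite ltr0n.
rewrite /ramp mulr_gt0//=; set y := n%:R * x.
have y0 : 0 < y by rewrite mulr_gt0.
have p := one_sq_gt0 y.
have -> : 1 - y ^+ 2 / (1 + y ^+ 2) = (1 + y ^+ 2)^-1 by field; rewrite gt_eqF.
rewrite ger0_norm ?invr_ge0 ?(ltW p)//.
rewrite invf_ple ?posrE//.
have h : (e * x)^-1 <= n%:R.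
  by near: n; exact: nbhs_infty_ger.
have h2 : e^-1 <= y.
  by rewrite /y -ler_pdivrMr// -invfM.
apply: (le_trans h2); have := sqr_ge0 (y - 1); rewrite sqrrB1; lra.
Unshelve. all: by end_near. Qed.

End ramps.

Section orthants.
Context (R : realType) (d : nat).
Local Notation rV := 'rV[R]_d.
Implicit Types (s : seq ('I_d * R)).

Definition orthant s : set rV := [set y | forall x, x \in s -> x.2 < y 0 x.1].

Definition orthants : set (set rV) := [set orthant s | s in setT].

Lemma orthant_cons x s : orthant (x :: s) = [set y : rV | x.2 < y 0 x.1] `&` orthant s.
Proof.
apply/seteqP; split => y.
  by move=> h; split => [|z zs]; apply: h; rewrite inE ?eqxx// zs orbT.
by move=> [h1 h2] z; rewrite inE => /orP[/eqP ->//|/h2].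
Qed.

Lemma orthant_nil : orthant [::] = setT.
Proof. by apply/seteqP; split => y // _ x. Qed.

Lemma measurable_orthant s : measurable (orthant s).
Proof.
elim: s => [|x s ih]; first by rewrite orthant_nil.
rewrite orthant_cons; apply: measurableI => //.
rewrite (_ : mkset _ = (fun y : rV => y 0 x.1) @^-1` `]x.2, +oo[%classic).
  by rewrite -[X in measurable X]setTI; exact: measurable_coord.
by apply/seteqP; split => y /=; rewrite in_itv/= andbT.
Qed.

Lemma orthants_gen : @measurable _ rV = <<s orthants >>.
Proof.
apply/seteqP; split=> [E mE|].
  have : measurable_fun setT (id : g_sigma_algebraType orthants -> rV).
    apply: measurable_fun_rV => // i.
    apply: (measurability (@RGenOInfty.G R)); first exact: RGenOInfty.measurableE.
    move=> _ [_ [a ->] <-]; rewrite setTI; apply: sub_sigma_algebra.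
    exists [:: (i, a)] => //; apply/seteqP; split => w /=; rewrite in_itv/= andbT.
      by move=> /(_ (i, a)); apply; rewrite mem_seq1.
    by move=> aw x; rewrite mem_seq1 => /eqP ->.
  by move=> /(_ measurableT _ mE); rewrite setTI.
apply: smallest_sub; first exact: sigma_algebra_measurable.
by move=> _ [s _ <-]; exact: measurable_orthant.
Qed.

Lemma measure_orthant_unique (m1 m2 : {measure set rV -> \bar R}) :
  (m1 setT < +oo)%E -> (forall s, m1 (orthant s) = m2 (orthant s)) ->
  forall A, measurable A -> m1 A = m2 A.
Proof.
move=> m1oo m12 A mA; apply: (measure_unique orthants (fun _ => setT)) => //.
- exact: orthants_gen.
- move=> _ _ [s _ <-] [s' _ <-]; exists (s ++ s') => //.
  apply/seteqP; split => y.
    by move=> h; split => x xs; apply: h; rewrite mem_cat xs ?orbT.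
  by move=> [h1 h2] x; rewrite mem_cat => /orP[/h1|/h2].
- by move=> _; exists [::] => //; exact: orthant_nil.
- by rewrite bigcup_const.
- by move=> _ [s _ <-]; exact: m12.
Qed.

Definition orthant_ramp s (n : nat) (y : rV) : R := \prod_(x <- s) ramp (n%:R * (y 0 x.1 - x.2)).

Lemma c11_ramp (n : nat) i (a : R) : exists K p, c11 K (fun y : rV => ramp (n%:R * (y 0 i - a))) p.
Proof.
have mc : measurable_fun setT (fun y : rV => n%:R * (y 0 i - a)).
  apply: measurable_funM => //; apply: measurable_funB => //; exact: measurable_coord.
(* The three terms bound the values, the gradient and the Taylor remainder, each derivative
   contributing a factor [n]. *)
exists (1 + n%:R + 4 * n%:R ^+ 2), (fun y => (n%:R * dramp (n%:R * (y 0 i - a))) *: delta_mx 0 i); split.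
- exact: measurableT_comp (@measurable_ramp R) mc.
- apply: measurable_scalev; last exact: measurable_cst.
  by apply: measurable_funM => //; exact: measurableT_comp (@measurable_dramp R) mc.
- move=> y; have /andP[r0 r1] := ramp_itv (n%:R * (y 0 i - a)).
  rewrite ger0_norm// (le_trans r1)// -addrA lerDl addr_ge0// mulr_ge0 ?sqr_ge0//.
- move=> y j; rewrite !mxE.
  have /andP[r0 r1] := dramp_itv (n%:R * (y 0 i - a)).
  have nr : 0 <= n%:R :> R by exact: ler0n.
  have h : n%:R * dramp (n%:R * (y 0 i - a)) <= n%:R by rewrite -[leRHS]mulr1 ler_wpM2l.
  have h4 : 0 <= 4 * n%:R ^+ 2 :> R by rewrite mulr_ge0// sqr_ge0.
  have h0 : 0 <= n%:R * dramp (n%:R * (y 0 i - a)) by rewrite mulr_ge0.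
  rewrite eqxx/=; case: eqP => _; rewrite ?mulr1 ?mulr0 ?normr0 ?ger0_norm//; lra.
- move=> y m.
  have -> : dot ((n%:R * dramp (n%:R * (y 0 i - a))) *: delta_mx 0 i) m = dramp (n%:R * (y 0 i - a)) * (n%:R * m 0 i).
    rewrite dot_scalel /dot (bigD1 i)//= big1 => [|j ji]; last by rewrite mxE (negPf ji) andbF mul0r.
    by rewrite mxE !eqxx/= addr0 mul1r; ring.
  have -> : n%:R * ((y + m) 0 i - a) = n%:R * (y 0 i - a) + n%:R * m 0 i by rewrite mxE; ring.
  apply: (le_trans (ramp_taylor _ _)).
  have h1 : `|m 0 i| <= nrm1 m by rewrite /nrm1 (bigD1 i)//= lerDl sumr_ge0.
  have h2 : (m 0 i) ^+ 2 <= nrm1 m ^+ 2 by rewrite -real_normK ?num_real// lerXn2r ?nnegrE ?nrm1_ge0.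
  rewrite exprMn mulrA; apply: ler_pM => //; rewrite ?sqr_ge0 ?mulr_ge0 ?sqr_ge0//.
  by rewrite lerDr addr_ge0.
Qed.

Lemma c11_orthant_ramp s n : exists K p, c11 K (orthant_ramp s n) p.
Proof.
elim: s => [|x s [K [p h]]].
  exists `|1|, (fun=> 0); have := @c11_cst R d 1; congr c11.
  by apply/funext => y; rewrite /orthant_ramp big_nil.
have [K' [p' h']] := c11_ramp n x.1 x.2.
have [K'' [p'' h'']] := c11_mul h' h; exists K'', p''.
by move: h''; congr c11; apply/funext => y; rewrite /orthant_ramp big_cons.
Qed.

Lemma orthant_ramp_bound s n (y : rV) : `|orthant_ramp s n y| <= 1.
Proof.
rewrite /orthant_ramp; elim: s => [|x s ih]; first by rewrite big_nil normr1.
have /andP[r0 r1] := ramp_itv (n%:R * (y 0 x.1 - x.2)).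
by rewrite big_cons normrM -[leRHS]mulr1 ler_pM// ger0_norm.
Qed.

Lemma orthant_ramp_cvg s (y : rV) : orthant_ramp s n y @[n --> \oo] --> (\1_(orthant s) y : R).
Proof.
elim: s => [|x s ih].
  rewrite orthant_nil indicT; under eq_fun do rewrite /orthant_ramp big_nil; exact: cvg_cst.
rewrite orthant_cons indicI; under eq_fun do rewrite /orthant_ramp big_cons.
apply: cvgM => //; rewrite indicE.
have := @ramp_cvg R (y 0 x.1 - x.2); rewrite subr_gt0.
have [h|h] := boolP (x.2 < y 0 x.1); first by rewrite mem_set.
by rewrite memNset//; exact/negP.
Qed.

End orthants.

Lemma Ex_cvg_bounded (R : realType) (dd : measure_display) (A : measurableType dd) (P : probability A R)
    (K : R) (f : nat -> A -> R) (g : A -> R) :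
  (forall n, measurable_fun setT (f n)) -> measurable_fun setT g -> (forall n x, `|f n x| <= K) ->
  {ae P, forall x, f n x @[n --> \oo] --> g x} -> Ex P (f n) @[n --> \oo] --> Ex P g.
Proof.
move=> mf mg fK fg.
have iK : ing P (fun=> K) by apply: (@ingP_bounded _ _ _ P `|K|) => //; exact: measurable_cst.
have fi n : ing P (f n) by exact: (@ingP_bounded _ _ _ P K _ (mf n)).
have fg' : {ae P, forall x, [set: A] x -> (fun n => (f n x)%:E) @ \oo --> (g x)%:E}.
  by apply: filterS fg => x h _; apply/fine_cvgP; split; [exact: nearW|exact: h].
have bd : {ae P, forall x, forall n, [set: A] x -> (`|(f n x)%:E| <= K%:E)%E}.
  by apply: aeW => x n _; rewrite lee_fin.
have mf' n : measurable_fun setT (fun x => (f n x)%:E) by apply/measurable_EFinP.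
have mg' : measurable_fun setT (fun x => (g x)%:E) by apply/measurable_EFinP.
have [ig _ h] := dominated_convergence measurableT mf' mg' fg' iK bd.
by apply: (@fine_cvg _ _ _ _ (fun n => (\int[P]_x (f n x)%:E)%E)); rewrite -(ExE ig).
Qed.

(** * Extension to all times and all Borel sets *)

Section levy.
Context (R : realType) (T : R) (d : nat) (T_gt0 : 0 < T).
Local Notation Om := (path_space T d).
Local Notation fm s := (@fmeas R T d _ _ s).
Local Notation rV := 'rV[R]_d.
Local Notation leb := (@lebesgue_measure R).
Local Notation PT :=
  (g_sigma_algebraType (predictable_rectangles T (@canonical_filtration R T d))).
Local Notation PTm P := (@PTm R T d T_gt0 P).

Lemma within_clamp (f : R -> R) : {within `[0, T], continuous f} -> continuous (fun t => f (clamp T t)).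
Proof.
move=> /subspace_continuousP fc t.
have ct : clamp T t \in `[0, T] by rewrite in_itv/= clamp_itv.
move=> B hB; have /= hB' := fc _ ct B hB.
have {}hB' : nbhs (clamp T t) [set y | `[0, T]%classic y -> B (f y)] := hB'.
have := continuous_clamp hB'; rewrite !nbhs_simpl/=; apply: filterS => s /= hs; apply: hs.
by rewrite in_itv/= clamp_itv.
Qed.

Lemma continuous_time_integral (f : R -> rV) : time_integrable T f ->
  forall i, continuous (fun t => time_integral f (clamp T t) 0 i).
Proof.
move=> fi i.
have := within_clamp (parameterized_integral_continuous (ltW T_gt0) (fi i)).
by under [X in _ -> continuous X]eq_fun => t do rewrite mxE.
Qed.

Lemma cell_cvg (t : R) : 0 <= t -> grid T n (cell T n t) @[n --> \oo] --> t.
Proof.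
move=> t0; apply/cvgrPdist_le => e e0.
have /cvgrPdist_le /(_ e e0) := mesh_cvg T; apply: filterS => n.
rewrite sub0r normrN ger0_norm ?(ltW (mesh_gt0 T_gt0 n))// => h.
exact: le_trans (cell_dist T_gt0 n t0) h.
Qed.

Lemma cvg_addnl_seq (u : nat -> R) (l : R) m : u n @[n --> \oo] --> l -> u (m + n)%N @[n --> \oo] --> l.
Proof.
move=> /cvgrPdist_le h; apply/cvgrPdist_le => e e0; have [N _ hN] := h e e0.
by exists N => // n /= Nn; apply: hN; rewrite /= (leq_trans Nn)// leq_addl.
Qed.

(** The earlier time is rounded up, so that an event known at [s] is known at the grid time, and the
    later one is rounded down. The initial level [m] keeps the two in order. *)
Lemma dyadic_between (s t : R) : 0 <= s -> s < t -> t <= T ->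
  exists m (k0 k1 : nat -> nat), [/\ forall n, [/\ (k0 n < k1 n)%N, (k1 n <= 2 ^ (m + n))%N & s <= grid T (m + n) (k0 n)],
    grid T (m + n) (k0 n) @[n --> \oo] --> s & grid T (m + n) (k1 n) @[n --> \oo] --> t].
Proof.
move=> s0 st tT; have t0 : 0 <= t by rewrite (le_trans s0)// ltW.
have e0 : 0 < (t - s) / 4 by rewrite divr_gt0// subr_gt0.
have [m hm] : exists m, mesh T m <= (t - s) / 4.
  have /cvgrPdist_le /(_ _ e0) [k _ hk] := mesh_cvg T.
  by exists k; have := hk k (leqnn k); rewrite sub0r normrN ger0_norm// ltW// mesh_gt0.
exists m, (fun n => (cell T (m + n) s).+1), (fun n => cell T (m + n) t); split.
- move=> n; have hmn : mesh T (m + n) <= (t - s) / 4 by exact: le_trans (mesh_le T_gt0 (leq_addr n m)) hm.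
  have m0 := mesh_gt0 T_gt0 (m + n).
  have cs : s < grid T (m + n) (cell T (m + n) s).+1.
    by rewrite gridE -ltr_pdivrMr// /cell truncnS_gt.
  have cs' := cell_dist T_gt0 (m + n) s0; have ct' := cell_dist T_gt0 (m + n) t0.
  split; [|exact: cell_le|exact: ltW].
  rewrite -(ltr_nat R) -(ltr_pM2r m0) -!gridE gridS; move: cs' ct'; rewrite !ler_norml => /andP[h1 h2] /andP[h3 h4]; lra.
- under eq_fun => n do rewrite gridS.
  have h1 : grid T (m + n) (cell T (m + n) s) @[n --> \oo] --> s.
    by apply: (@cvg_addnl_seq (fun n => grid T n (cell T n s))); exact: cell_cvg.
  have h2 : mesh T (m + n) @[n --> \oo] --> (0 : R).
    by apply: (@cvg_addnl_seq (fun n => mesh T n)); exact: mesh_cvg.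
  have h3 : grid T (m + n) (cell T (m + n) s) + mesh T (m + n) @[n --> \oo] --> s + 0 by exact: cvgD h1 h2.
  by rewrite addr0 in h3.
- by apply: (@cvg_addnl_seq (fun n => grid T n (cell T n t))); exact: cell_cvg.
Qed.

Lemma c11_seq (K : R) (v : rV -> R) p (u : nat -> rV) (x : rV) : 0 <= K -> c11 K v p ->
  (forall i, u n 0 i @[n --> \oo] --> x 0 i) -> v (u n) @[n --> \oo] --> v x.
Proof.
move=> K0 hv ux.
have h0 : 2 * K * nrm1 (u n - x) @[n --> \oo] --> (0 : R).
  rewrite -[X in _ --> X](mulr0 (2 * K)); apply: cvgMr.
  have -> : (0 : R) = \sum_(i < d) 0 by rewrite big1.
  apply: cvg_sumr => i; rewrite -[X in _ --> X](normr0 R); apply: cvg_norm.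
  under eq_fun => n do rewrite !mxE.
  by rewrite -(subrr (x 0 i)); apply: cvgB => //; exact: cvg_cst.
apply/cvgrPdist_le => e e0; have /cvgrPdist_le /(_ e e0) := h0; apply: filterS => n.
rewrite sub0r normrN distrC => h; apply: (le_trans (c11_dist _ _ K0 hv)).
exact: le_trans (ler_norm _) h.
Qed.

Lemma c11_seqB (K : R) (v : rV -> R) p (u u' : nat -> rV) (x x' : rV) : 0 <= K -> c11 K v p ->
  (forall i, u n 0 i @[n --> \oo] --> x 0 i) -> (forall i, u' n 0 i @[n --> \oo] --> x' 0 i) ->
  v (u n - u' n) @[n --> \oo] --> v (x - x').
Proof.
move=> K0 hv ux ux'; apply: (c11_seq K0 hv) => i; rewrite !mxE.
by under eq_fun => n do rewrite !mxE; apply: cvgB.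
Qed.

Variables (P Q : probability Om R) (M : R -> Om -> rV) (H : R).
Hypothesis QM : gbm Q M.
Hypothesis Mc : forall w i, continuous (fun t => M (clamp T t) w 0 i).
Hypothesis PQ : (relative_entropy P Q <= H%:E)%E.

(** The dyadic identity for [c11] functions extends to all times by continuity of the paths, to
    orthants by the ramps, and to all Borel sets because orthants form a generating pi-system. *)
Lemma levy : exists alpha : PT -> rV, [/\ L2 (PTm P) alpha, 2^-1 * N (PTm P) alpha <= H &
  brownian_increments T P (@canonical_filtration R T d) (driftless M alpha)].
Proof.
have [alpha [La aH ea aa]] := entropy_drift T_gt0 QM PQ.
exists alpha; split => // s t E C s0 st tT FE mC.
have tT' : 0 <= t <= T by rewrite tT (le_trans s0 (ltW st)).
have sT' : 0 <= s <= T by rewrite s0 (le_trans (ltW st) tT).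
have mE : measurable E by exact: filtration_measurable FE.
have mY (r : R) : 0 <= r <= T -> measurable_fun setT (driftless M alpha r).
  by move=> hr; apply: fmeas_meas; exact: (fmeas_driftless QM La hr).
have mM (r : R) : 0 <= r <= T -> measurable_fun setT (M r) by move=> hr; apply: fmeas_meas; exact: QM.1.
pose DY w := driftless M alpha t w - driftless M alpha s w.
pose DM w := M t w - M s w.
have mDY : measurable_fun setT DY by apply: measurable_subv; exact: mY.
have mDM : measurable_fun setT DM by apply: measurable_subv; exact: mM.
have sub_coord (a b : rV) j : (a - b) 0 j = a 0 j - b 0 j by rewrite !mxE.
have iE w : `|\1_E w : R| <= 1 by rewrite ger0_norm// indicE lern1 leq_b1.
have mE1 : measurable_fun setT (\1_E : Om -> R) by exact: measurable_indic.
have seq_cvg (f : R -> R) (u : nat -> R) (r : R) : continuous (fun t => f (clamp T t)) -> 0 <= r <= T ->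
    (forall n, 0 <= u n <= T) -> u n @[n --> \oo] --> r -> f (u n) @[n --> \oo] --> f r.
  move=> fc hr hu ur; rewrite -(clamp_id hr).
  have -> : (fun n => f (u n)) = (fun n => (fun t => f (clamp T t)) (u n)).
    by apply/funext => n; rewrite clamp_id.
  exact: (cvg_comp _ _ ur (fc r)).
have c11_eq (K : R) v p : 0 <= K -> c11 K v p ->
    Ex P (fun w => \1_E w * v (DY w)) = Ex P (\1_E) * Ex Q (fun w => v (DM w)).
  move=> K0 hv; have [mv _ bv _ _] := hv.
  have [m [k0 [k1 [hk cs ct]]]] := dyadic_between s0 st tT.
  have g0 n : 0 <= grid T (m + n) (k0 n) <= T.
    by apply: grid_itv => //; have [h1 h2 _] := hk n; rewrite (leq_trans (ltnW h1)).
  have g1 n : 0 <= grid T (m + n) (k1 n) <= T by apply: grid_itv => //; have [] := hk n.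
  have lhs : Ex P (fun w => \1_E w * v (driftless M alpha (grid T (m + n) (k1 n)) w - driftless M alpha (grid T (m + n) (k0 n)) w))
      @[n --> \oo] --> Ex P (fun w => \1_E w * v (DY w)).
    apply: (@Ex_cvg_bounded _ _ _ P (1 * K)).
    - move=> n; apply: measurable_funM => //; apply: (measurableT_comp mv).
      by apply: measurable_subv; exact: mY.
    - by apply: measurable_funM => //; apply: (measurableT_comp mv).
    - by move=> n w; rewrite normrM ler_pM.
    - apply: filterS (ae_integrable_alpha La) => w hw.
      apply: cvgMr.
      have dE i (r : R) : driftless M alpha r w 0 i = M r w 0 i - time_integral (fun s => alpha (s, w)) r 0 i by rewrite !mxE.
      have hYc i : continuous (fun r => driftless M alpha (clamp T r) w 0 i).
        have -> : (fun r => driftless M alpha (clamp T r) w 0 i) = (fun r => M (clamp T r) w 0 i - time_integral (fun s => alpha (s, w)) (clamp T r) 0 i).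
          by apply/funext => r; exact: dE.
        by move=> r; apply: cvgB; [exact: Mc|exact: (continuous_time_integral hw)].
      have hYc' i (r : R) : 0 <= r <= T -> forall u : nat -> R, (forall n, 0 <= u n <= T) -> u n @[n --> \oo] --> r ->
          driftless M alpha (u n) w 0 i @[n --> \oo] --> driftless M alpha r w 0 i.
        by move=> hr u hu ur; apply: (seq_cvg (fun r => driftless M alpha r w 0 i)).
      by apply: (c11_seqB K0 hv) => i; exact: hYc'.
  have rhs : Ex P (\1_E) * Ex Q (fun w => v (M (grid T (m + n) (k1 n)) w - M (grid T (m + n) (k0 n)) w))
      @[n --> \oo] --> Ex P (\1_E) * Ex Q (fun w => v (DM w)).
    apply: cvgMr; apply: (@Ex_cvg_bounded _ _ _ Q K) => //.
    - by move=> n; apply: (measurableT_comp mv); apply: measurable_subv; exact: mM.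
    - exact: (measurableT_comp mv).
    - apply: aeW => w.
      have hc i (r : R) : 0 <= r <= T -> forall u : nat -> R, (forall n, 0 <= u n <= T) -> u n @[n --> \oo] --> r ->
          M (u n) w 0 i @[n --> \oo] --> M r w 0 i.
        by move=> hr u hu ur; apply: (seq_cvg (fun r => M r w 0 i)) => //; exact: Mc.
      by apply: (c11_seqB K0 hv) => i; exact: hc.
  apply: (cvg_unique _ lhs); first exact: norm_hausdorff.
  have -> : (fun n => Ex P (fun w => \1_E w * v (driftless M alpha (grid T (m + n) (k1 n)) w - driftless M alpha (grid T (m + n) (k0 n)) w))) =
    (fun n => Ex P (\1_E) * Ex Q (fun w => v (M (grid T (m + n) (k1 n)) w - M (grid T (m + n) (k0 n)) w))).
    apply/funext => n; have [h1 h2 h3] := hk n.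
    exact: (levy_dyadic QM PQ La ea aa h1 h2 (filtration_le h3 FE) K0 hv).
  exact: rhs.
have [g hg] := gauss_ex QM s0 st tT.
have DMg (B : set rV) : measurable B -> Q (DM @^-1` B) = g B.
  move=> mB; have := brownian_indep QM s0 st tT hg (@filtrationT R T d s) mB.
  by rewrite setTI prob_mass mul1e.
have orth l : P (E `&` DY @^-1` orthant l) = (P E * g (orthant l))%E.
  have mO := measurable_orthant l.
  have mDYO : measurable (DY @^-1` orthant l) by rewrite -[X in measurable X]setTI; exact: mDY.
  have mDMO : measurable (DM @^-1` orthant l) by rewrite -[X in measurable X]setTI; exact: mDM.
  have lim1 : Ex P (fun w => \1_E w * orthant_ramp l n (DY w)) @[n --> \oo] --> Ex P (fun w => \1_E w * \1_(orthant l) (DY w)).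
    apply: (@Ex_cvg_bounded _ _ _ P (1 * 1)).
    - move=> n; have [K [p [mv _ _ _ _]]] := c11_orthant_ramp l n.
      by apply: measurable_funM => //; exact: measurableT_comp mv mDY.
    - by apply: measurable_funM => //; exact: measurable_indic_comp.
    - by move=> n w; rewrite normrM ler_pM// orthant_ramp_bound.
    - by apply: aeW => w; apply: cvgMr; exact: orthant_ramp_cvg.
  have lim2 : Ex P (\1_E) * Ex Q (fun w => orthant_ramp l n (DM w)) @[n --> \oo] --> Ex P (\1_E) * Ex Q (fun w => \1_(orthant l) (DM w)).
    apply: cvgMr; apply: (@Ex_cvg_bounded _ _ _ Q 1).
    - move=> n; have [K [p [mv _ _ _ _]]] := c11_orthant_ramp l n.
      exact: measurableT_comp mv mDM.
    - exact: measurable_indic_comp.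
    - by move=> n w; exact: orthant_ramp_bound.
    - by apply: aeW => w; exact: orthant_ramp_cvg.
  have e : Ex P (fun w => \1_E w * \1_(orthant l) (DY w)) = Ex P (\1_E) * Ex Q (fun w => \1_(orthant l) (DM w)).
    apply: (cvg_unique _ lim1); first exact: norm_hausdorff.
    have -> : (fun n => Ex P (fun w => \1_E w * orthant_ramp l n (DY w))) =
       (fun n => Ex P (\1_E) * Ex Q (fun w => orthant_ramp l n (DM w))).
      apply/funext => n; have [K [p hv]] := c11_orthant_ramp l n.
      have K0 : 0 <= K by have [_ _ bv _ _] := hv; exact: le_trans (normr_ge0 _) (bv 0).
      exact: (c11_eq K _ p K0 hv).
    exact: lim2.
  have probE (m : probability Om R) (B : set Om) : measurable B -> m B = (Ex m (\1_B))%:E.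
    move=> mB; have iB : ing m (\1_B : Om -> R).
      apply: (@ingP_bounded _ _ _ m 1); first exact: measurable_indic.
      by move=> w; rewrite ger0_norm// indicE lern1 leq_b1.
    by rewrite -(ExE iB) integral_indic// setIT.
  rewrite -DMg// (probE P _ mE) (probE Q _ mDMO) (probE P _ (measurableI _ _ mE mDYO)) -EFinM; congr EFin.
  transitivity (Ex P (fun w => \1_E w * \1_(orthant l) (DY w))); last by rewrite e.
  by congr Ex; apply/funext => w; rewrite indicI.
rewrite -(hg C mC).
pose m1 : {measure set rV -> \bar R} := image_measure (mrestr P mE) mDY.
have pE : 0 <= fine (P E) by rewrite fine_ge0.
pose m2 : {measure set rV -> \bar R} := mscale (NngNum pE) g.
have mB : measurable [set y : rV | forall i, C i (y 0 i)] by exact: measurable_box.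
have m1E B : m1 B = P (E `&` DY @^-1` B) by rewrite setIC.
have m2E B : m2 B = (P E * g B)%E by rewrite -[in RHS](fineK (fin_num_measure P E mE)).
have : m1 [set y : rV | forall i, C i (y 0 i)] = m2 [set y : rV | forall i, C i (y 0 i)].
  apply: measure_orthant_unique => //.
    by rewrite m1E preimage_setT setIT (le_lt_trans (probability_le1 P mE))// ltry.
  by move=> l; rewrite m1E m2E orth.
by rewrite m1E m2E.
Qed.

End levy.

(** * Growth and moment bounds *)

Section path_sup.
Context (R : realType) (T : R) (d : nat) (T_gt0 : 0 < T).
Local Notation Om := (path_space T d).
Local Notation rV := 'rV[R]_d.

Lemma continuous_X_coord (w : Om) i : continuous (fun t => X (clamp T t) w 0 i).
Proof.
move=> t; apply: (@continuous_comp _ _ _ (fun t => X (clamp T t) w) (fun x : rV => x 0 i)).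
  exact: continuous_path.
exact: coord_continuous.
Qed.

Lemma enorm_ge0 (x : rV) : 0 <= enorm x. Proof. exact: sqrtr_ge0. Qed.

Lemma enorm_sq (x : rV) : enorm x ^+ 2 = sqn x.
Proof. by rewrite sqr_sqrtr// sumr_ge0// => i _; exact: sqr_ge0. Qed.

Lemma coord_le_enorm (x : rV) i : `|x 0 i| <= enorm x.
Proof.
rewrite -sqrtr_sqr ler_wsqrtr// (bigD1 i)//= lerDl sumr_ge0// => j _; exact: sqr_ge0.
Qed.

Lemma nrm1_le_enorm (x : rV) : nrm1 x <= d%:R * enorm x.
Proof.
apply: (@le_trans _ _ (\sum_(i < d) enorm x)); first by apply: ler_sum => i _; exact: coord_le_enorm.
by rewrite sumr_const card_ord -[X in X <= _]mulr_natl.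
Qed.

Lemma sqn_le_nrm1 (x : rV) : sqn x <= nrm1 x ^+ 2.
Proof.
have h i : `|x 0 i| <= nrm1 x by rewrite /nrm1 (bigD1 i)//= lerDl sumr_ge0.
rewrite expr2 {1}/nrm1 mulr_suml; apply: ler_sum => i _.
by rewrite -real_normK ?num_real// expr2 ler_wpM2l.
Qed.

Lemma enorm_le_nrm1 (x : rV) : enorm x <= nrm1 x.
Proof.
rewrite -(ger0_norm (nrm1_ge0 x)) -sqrtr_sqr ler_wsqrtr//.
exact: sqn_le_nrm1.
Qed.

Lemma measurable_enorm : measurable_fun setT (@enorm R d).
Proof. by apply: (measurableT_comp (continuous_measurable_fun (@sqrt_continuous R))); apply: measurable_sqnv. Qed.

Lemma seq_cvg_clamp (f : R -> R) (u : nat -> R) (r : R) : continuous (fun t => f (clamp T t)) -> 0 <= r <= T ->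
  (forall n, 0 <= u n <= T) -> u n @[n --> \oo] --> r -> f (u n) @[n --> \oo] --> f r.
Proof.
move=> fc hr hu ur; rewrite -(clamp_id hr).
have -> : (fun n => f (u n)) = (fun n => (fun t => f (clamp T t)) (u n)).
  by apply/funext => n; rewrite clamp_id.
exact: (cvg_comp _ _ ur (fc r)).
Qed.

Definition path_sup (w : Om) : \bar R := ereal_sup [set (enorm (X t w))%:E | t in `[0%R, T]].

Lemma path_sup_ge (w : Om) t : 0 <= t <= T -> ((enorm (X t w))%:E <= path_sup w)%E.
Proof. by move=> tT; apply: ereal_sup_ubound; exists t. Qed.

Let gp (j : nat) : R := if unpickle j is Some (n, k) then grid T n (minn k (2 ^ n)) else 0.

Let gp_itv j : 0 <= gp j <= T.
Proof.
rewrite /gp; case: unpickle => [[n k]|]; last by rewrite lexx ltW.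
by apply: grid_itv => //; exact: geq_minr.
Qed.

(** By continuity the supremum is reached along dyadic times, which [gp] enumerates; a countable
    supremum is measurable. *)
Lemma path_supE (w : Om) : path_sup w = esups (fun j => (enorm (X (gp j) w))%:E) 0%N.
Proof.
apply/eqP; rewrite eq_le; apply/andP; split; last first.
  by apply: ub_ereal_sup => _ [j _ <-]; exact: path_sup_ge.
apply: ub_ereal_sup => _ [t /= tT <-]; rewrite in_itv/= in tT.
have [t0 tT'] := andP tT.
set S := esups _ _.
have hS j : ((enorm (X (gp j) w))%:E <= S)%E by apply: ereal_sup_ubound; exists j.
have lim : enorm (X (grid T n (cell T n t)) w) @[n --> \oo] --> enorm (X t w).
  apply: (cvg_comp (fun n => sqn (X (grid T n (cell T n t)) w)) Num.sqrt _ (@sqrt_continuous R _)).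
  apply: cvg_sumr => i; apply: (cvg_comp _ (fun y : R => y ^+ 2) _ (@exprn_continuous R 2 _)).
  apply: (seq_cvg_clamp (f := fun t => X t w 0 i)) => //.
  - exact: continuous_X_coord.
  - by move=> n; apply: grid_itv => //; exact: cell_le.
  - exact: cell_cvg.
have hS' n : ((enorm (X (grid T n (cell T n t)) w))%:E <= S)%E.
  have := hS (pickle (n, cell T n t)); rewrite /gp pickleK (minn_idPl _)//; exact: cell_le.
move: hS'; case: S {hS} => [r|//|] h; last by have := h 0%N; rewrite leeNy_eq.
  rewrite lee_fin -(cvg_lim (@Rhausdorff R) lim); apply: limr_le; first exact: cvgP lim.
  by apply: nearW => n; rewrite -lee_fin.
by rewrite leey.
Qed.

Lemma measurable_path_sup : measurable_fun setT path_sup.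
Proof.
rewrite (_ : path_sup = fun w => esups (fun j => (enorm (X (gp j) w))%:E) 0%N); last by apply/funext => w; exact: path_supE.
apply: measurable_fun_esups => j; apply/measurable_EFinP.
exact: (measurableT_comp measurable_enorm (measurable_X _)).
Qed.

Lemma path_sup_ge0 w : (0 <= path_sup w)%E.
Proof. by apply: le_trans (path_sup_ge w (t := 0) _); rewrite ?lee_fin ?enorm_ge0// lexx ltW. Qed.

End path_sup.

Section discrete_probability.
Context (R : realType) (dd : measure_display) (A : measurableType dd).

(** A normalized series of point masses, where [c] is the inverse of the total mass. *)
Lemma discrete_probability (a : nat -> A) (p : nat -> R) (S : R) : (forall n, 0 < p n) ->
  (\sum_(0 <= n <oo) (p n)%:E <= S%:E)%E ->
  exists (P : probability A R) (c : R), 0 < c /\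
    forall f : A -> \bar R, measurable_fun setT f -> (forall x, 0 <= f x)%E ->
      (\int[P]_x f x = c%:E * \sum_(0 <= n <oo) ((p n)%:E * f (a n)))%E.
Proof.
move=> p0 pS.
pose m := mseries (fun n => mscale (NngNum (ltW (p0 n))) (dirac (a n))) 0.
have mE (f : A -> \bar R) : measurable_fun setT f -> (forall x, 0 <= f x)%E ->
    (\int[m]_x f x = \sum_(0 <= n <oo) ((p n)%:E * f (a n)))%E.
  move=> mf f0; rewrite (ge0_integral_measure_series _ measurableT)//.
  apply: eq_eseriesr => n _; rewrite ge0_integral_mscale// integral_dirac//.
  by rewrite diracT mul1e.
have mT : m setT = (\sum_(0 <= n <oo) (p n)%:E)%E.
  have := mE (fun=> 1%E) (measurable_cst _) (fun=> lee01); rewrite integral_cst// mul1e => h; apply: (eq_trans h).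
  by apply: eq_eseriesr => n _; rewrite mule1.
have mfin : (m setT < +oo)%E by rewrite mT (le_lt_trans pS)// ltry.
have mpos : (0 < m setT)%E.
  rewrite mT; apply: (@lt_le_trans _ _ (p 0%N)%:E); first by rewrite lte_fin.
  have := nneseries_lim_ge (u_ := fun n => (p n)%:E) 1%N (fun n _ _ => ltW (p0 n)).
  by move=> /(_ xpredT 0%N); rewrite big_nat1.
have ffin : 0 < fine (m setT) by rewrite fine_gt0// mpos.
exists (mnormalize m (dirac (a 0%N))), (fine (m setT))^-1; split; first by rewrite invr_gt0.
move=> f mf f0.
have c0 : 0 <= (fine (m setT))^-1 by rewrite invr_ge0 ltW.
rewrite (eq_measure_integral (mscale (NngNum c0) m)); last first.
  move=> B mB _; rewrite -[LHS]/(mnormalize m (dirac (a 0%N)) B) /mnormalize.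
  by rewrite (gt_eqF mpos) (lt_eqF mfin)/= muleC.
by rewrite ge0_integral_mscale// mE.
Qed.

End discrete_probability.

(** * Linear growth of the gradient of the potential *)

Section linear_growth.
Context (R : realType) (T : R) (d : nat) (T_gt0 : 0 < T).
Local Notation Om := (path_space T d).
Local Notation rV := 'rV[R]_d.
Variable W : rV -> R.
Hypothesis grad_int : forall P : probability Om R, in_P1 P -> forall t x i, 0 <= t <= T ->
  (marginal P t).-integrable setT (fun y => (grad W (x - y) 0 i)%:E).

Let cpath (z : rV) : Om := mkpath T (@cst_continuous _ _ z).

Let X_cpath z t : 0 <= t <= T -> X t (cpath z) = z.
Proof. by move=> tT; rewrite X_mkpath. Qed.

(** Otherwise there are points [z n] where the derivative exceeds [4 ^ n (1 + |z n|)]. Giving the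
    constant path at [- z n] a mass proportional to [2 ^ (- n - 1) / (1 + |z n|)] keeps the first
    moment finite, yet in the convolution at 0 the atom number [n] contributes at least a multiple
    of [2 ^ n]. *)
Let growth_coord i : exists C, forall z : rV, `|grad W z 0 i| <= C * (1 + nrm1 z).
Proof.
apply: contrapT => /forallNP h.
have hz (n : nat) : exists z : rV, 4 ^+ n * (1 + nrm1 z) < `|grad W z 0 i|.
  apply: contrapT => /forallNP hn; apply: (h (4 ^+ n)) => z.
  by rewrite leNgt; apply/negP; exact: hn.
have [z hz'] := boolp.choice hz.
pose q n := 1 + nrm1 (z n).
have q1 n : 1 <= q n by rewrite /q lerDl nrm1_ge0.
have q0 n : 0 < q n by exact: lt_le_trans (q1 n).
pose p n := (2 ^+ n.+1 * q n)^-1.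
have p0 n : 0 < p n by rewrite invr_gt0 mulr_gt0// exprn_gt0.
have pq n : p n * q n = 1 / 2 ^+ n.+1.
  by rewrite /p; field; rewrite !gt_eqF// exprn_gt0.
have p1 n : p n <= 1 / 2 ^+ n.+1 by rewrite -pq ler_peMr// ltW.
have geo : (\sum_(0 <= n <oo) (1 / 2 ^+ n.+1)%:E <= (1 : R)%:E)%E.
  apply: le_trans (@epsilon_trick0 R 1 xpredT ler01).
  by apply: lee_nneseries => n _; rewrite ?lee_fin ?divr_ge0 ?exprn_ge0// natrX.
have pS : (\sum_(0 <= n <oo) (p n)%:E <= (1 : R)%:E)%E.
  apply: le_trans geo; apply: lee_nneseries => n _; rewrite lee_fin; last exact: p1.
  by move=> _; exact: ltW.
have [P [c [c0 PE]]] := discrete_probability (fun n => cpath (- z n)) p0 pS.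
have t0 : 0 <= (0 : R) <= T by rewrite lexx ltW.
have P1 : in_P1 P.
  rewrite /in_P1 -[X in (X < _)%E]/(\int[P]_w path_sup w)%E PE; last 2 first.
  - exact: measurable_path_sup.
  - by move=> w; exact: path_sup_ge0.
  apply: (@le_lt_trans _ _ (c%:E * 1%:E)%E); last by rewrite mule1 ltry.
  rewrite lee_pmul2l// ?lte_fin//; apply: le_trans geo; apply: lee_nneseries => n _.
    by rewrite mule_ge0 ?lee_fin ?path_sup_ge0// ltW.
  have h1 : (path_sup (cpath (- z n)) <= (q n)%:E)%E.
    apply: ub_ereal_sup => _ [t /= tT <-]; rewrite in_itv/= in tT.
    rewrite lee_fin X_cpath// (le_trans (enorm_le_nrm1 _))// nrm1N /q lerDr//.
  apply: (@le_trans _ _ ((p n)%:E * (q n)%:E)%E); last by rewrite -EFinM lee_fin pq.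
  by rewrite lee_pmul2l ?lte_fin.
have := grad_int P1 0 i t0; set f := (fun y : rV => _) => /integrableP[mf].
have mf' : measurable_fun setT (fun y : rV => `|f y|)%E by exact: measurableT_comp.
rewrite ge0_integral_distribution//.
rewrite PE; last 2 first.
- exact: (measurableT_comp mf' (measurable_X _)).
- by move=> w; exact: abse_ge0.
apply/negP; rewrite -leNgt.
have lb (N : nat) : ((c * (N%:R / 2))%:E <= c%:E * \sum_(0 <= n <oo) ((p n)%:E * ((abse \o f) \o @X R T d 0) (cpath (- z n))))%E.
  rewrite EFinM lee_pmul2l// ?lte_fin//.
  apply: (@le_trans _ _ (\sum_(0 <= n < N.+1) ((p n)%:E * ((abse \o f) \o @X R T d 0) (cpath (- z n))))%E); last first.
    by apply: nneseries_lim_ge => n _ _; rewrite mule_ge0 ?abse_ge0// lee_fin ltW.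
  rewrite big_nat_recr//=; apply: (@le_trans _ _ ((p N)%:E * `|f (X 0 (cpath (- z N)))|)%E); last first.
    by rewrite leeDr// sume_ge0// => n _; rewrite mule_ge0 ?abse_ge0// lee_fin ltW.
  rewrite X_cpath// /f sub0r opprK abse_EFin -EFinM lee_fin.
  apply: (@le_trans _ _ (p N * (4 ^+ N * q N))); last by rewrite ler_pM2l// ltW.
  rewrite mulrCA pq exprS.
  have -> : 4 ^+ N * (1 / (2 * 2 ^+ N)) = 2 ^+ N / 2 :> R.
    have -> : 4 = 2 * 2 :> R by ring.
    by rewrite exprMn; field; rewrite gt_eqF// exprn_gt0.
  by rewrite ler_pM2r ?invr_gt0// -natrX ler_nat ltnW// ltn_expl.
move: lb; set S := (c%:E * _)%E; case: S => [r| |] lb; last 2 first.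
- by [].
- by have := lb 0%N.
exfalso; have := lb (Num.truncn (r * 2 / c)).+1; rewrite lee_fin.
have := truncnS_gt (r * 2 / c); move: (Num.truncn (r * 2 / c)).+1%:R => k hk hk'.
have h3 : r * 2 < k * c by rewrite -ltr_pdivrMr.
by move: hk'; rewrite mulrA ler_pdivrMr// [c * k]mulrC leNgt h3.
Qed.

Lemma grad_linear_growth : exists C, 0 <= C /\ forall z i, `|grad W z 0 i| <= C * (1 + nrm1 z).
Proof.
have [C hC] := boolp.choice growth_coord.
exists (\sum_i `|C i|); split; first by rewrite sumr_ge0.
move=> z i; apply: (le_trans (hC i z)); rewrite ler_wpM2r ?addr_ge0 ?nrm1_ge0//.
by rewrite (bigD1 i)//= (le_trans (ler_norm _))// lerDl sumr_ge0.
Qed.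

End linear_growth.

Section events.
Context (R : realType) (dd : measure_display) (A : measurableType dd).
Implicit Types P : probability A R.

Lemma prob_Ex P (B : set A) : measurable B ->
  ing P (\1_B : A -> R) /\ P B = (Ex P (\1_B))%:E.
Proof.
move=> mB; have iB : ing P (\1_B : A -> R).
  apply: (@ingP_bounded _ _ _ P 1); first exact: measurable_indic.
  by move=> w; rewrite ger0_norm// indicE lern1 leq_b1.
by split => //; rewrite -(ExE iB) integral_indic// setIT.
Qed.

Lemma prob_ae_eq P (E B : set A) : measurable E -> measurable B ->
  {ae P, forall w, E w <-> B w} -> P E = P B.
Proof.
move=> mE mB EB; rewrite (prob_Ex P mE).2 (prob_Ex P mB).2; congr EFin.
apply: eq_ae_Ex; [exact: measurable_indic|exact: measurable_indic|].
apply: filterS EB => w [h1 h2]; rewrite !indicE.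
by have [a|a] := pselect (E w); [rewrite !mem_set//; exact: h1|rewrite !memNset// => /h2].
Qed.

End events.

(** * Path-valued versions of processes *)

Section path_versions.
Context (R : realType) (T : R) (d : nat) (T_gt0 : 0 < T).
Local Notation Om := (path_space T d).
Local Notation FT s := (g_sigma_algebraType (@coord_events R T d s)).
Local Notation fm s := (@fmeas R T d _ _ s).
Local Notation rV := 'rV[R]_d.

Lemma continuous_rV (f : R -> rV) : (forall i, continuous (fun t => f t 0 i)) -> continuous f.
Proof.
move=> fc.
have h (s : seq 'I_d) : continuous (fun t => \sum_(i <- s) (f t 0 i *: delta_mx 0 i : rV)).
  elim: s => [|i s ih]; first by under eq_fun do rewrite big_nil; exact: cst_continuous.
  under eq_fun do rewrite big_cons; move=> t; apply: cvgD; last exact: ih.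
  by apply: cvgZr_tmp; exact: fc.
have -> : f = fun t => \sum_i (f t 0 i *: delta_mx 0 i : rV) by apply/funext => t; exact: row_sum_delta.
exact: h.
Qed.

Section law.
Variables (P : probability Om R) (M : R -> Om -> rV) (Y : {mfun Om >-> Om}).
Hypothesis PM : gbm P M.
Hypothesis PY : {ae P, forall w, forall t, 0 <= t <= T -> X t (Y w) = M t w}.

(** The pull-back by [Y] of the past up to [s] consists of events of the past up to a null set,
    because [M] is adapted while [Y] represents it only almost surely. *)
Lemma filtration_ae (s : R) (E : set Om) : s <= T -> canonical_filtration s E ->
  exists E', canonical_filtration s E' /\ {ae P, forall w, E (Y w) <-> E' w}.
Proof.
move=> sT; rewrite /canonical_filtration; move: E; apply: smallest_sub.
  split.
  - by exists set0; split; [exact: (@measurable0 _ (FT s))|apply: aeW].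
  - move=> E [E' [h1 h2]]; exists (~` E'); split; first exact: (@measurableC _ (FT s)).
    by apply: filterS h2 => w [h3 h4]; split => [[_ h] /h4//|h]; split => // /h3.
  - move=> E hE.
    have [E' hE'] := boolp.choice hE.
    exists (\bigcup_n E' n); split.
      by apply: (@bigcupT_measurable _ (FT s)) => n; case: (hE' n).
    have : {ae P, forall w n, E n (Y w) <-> E' n w} by apply: ae_foralln => n; case: (hE' n).
    by apply: filterS => w h; split => -[n _ hn]; exists n => //; exact/h.
move=> _ [r [C [/andP[r0 rs] mC ->]]]; exists (M r @^-1` C); split.
  have rT : 0 <= r <= T by rewrite r0 (le_trans rs sT).
  have := fmeas_le rs (PM.1 r rT) measurableT mC; by rewrite setTI.
by apply: filterS PY => w h; rewrite /= h// r0 (le_trans rs sT).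
Qed.

Lemma wiener_law (mu : probability rV R) : start_law mu P M -> is_wiener mu (distribution P Y).
Proof.
move=> PM0; split.
- move=> B mB; have mI : measurable_fun setT (fun x => (\1_B x)%:E : \bar R).
    by apply/measurable_EFinP; exact: measurable_indic.
  have I0 x : (0 <= (\1_B x)%:E :> \bar R)%E by rewrite lee_fin indicE ler0n.
  have hmu : (\int[mu]_x (\1_B x)%:E = mu B)%E by rewrite integral_indic// setIT.
  have mM : measurable_fun setT (M 0) by apply: fmeas_meas; apply: PM.1; rewrite lexx ltW.
  have mMB : measurable (M 0 @^-1` B) by rewrite -[X in measurable X]setTI; exact: mM.
  have hM : (\int[P]_w (\1_B (M 0%R w))%:E = P (M 0%R @^-1` B))%E.
    by rewrite -[X in P X]setIT -(integral_indic P measurableT mMB).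
  rewrite -hmu -(PM0 _ mI I0) hM.
  have mXY : measurable_fun setT (fun w => @X R T d 0 (Y w)).
    exact: (measurableT_comp (measurable_X 0) (measurable_funP Y)).
  transitivity (P ((fun w => @X R T d 0 (Y w)) @^-1` B)) => //.
  apply: prob_ae_eq => //; first by have := mXY measurableT B mB; rewrite setTI.
  by apply: filterS PY => w h; rewrite /= h// lexx ltW.
- move=> s t E C s0 st tT FE mC.
  have sT : s <= T by exact: le_trans (ltW st) tT.
  have s0T : 0 <= s <= T by rewrite s0.
  have t0T : 0 <= t <= T by rewrite tT (le_trans s0 (ltW st)).
  have [E' [FE' hE']] := filtration_ae sT FE.
  have mE := filtration_measurable FE; have mE' := filtration_measurable FE'.
  have mYE (B : set Om) : measurable B -> measurable (Y @^-1` B).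
    by move=> mB; have := measurable_funP Y measurableT B mB; rewrite setTI.
  have eE : P (Y @^-1` E) = P E' by apply: prob_ae_eq => //; exact: mYE.
  have mbox (Z : Om -> rV) : measurable_fun setT Z -> measurable [set w | forall i, C i (Z w 0 i)].
    by move=> mZ; have := mZ measurableT _ (measurable_box mC); rewrite setTI.
  have mX : measurable [set w : Om | forall i, C i ((X t w - X s w) 0 i)].
    by apply: (mbox (fun w => X t w - X s w)); apply: measurable_subv; exact: measurable_X.
  have mM : measurable [set w : Om | forall i, C i ((M t w - M s w) 0 i)].
    by apply: (mbox (fun w => M t w - M s w)); apply: measurable_subv; apply: fmeas_meas; exact: PM.1.
  transitivity (P (E' `&` [set w | forall i, C i ((M t w - M s w) 0 i)])).
    apply: (@prob_ae_eq _ _ _ P (Y @^-1` (E `&` [set w | forall i, C i ((X t w - X s w) 0 i)]))).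
    - by apply: mYE; exact: measurableI.
    - exact: measurableI.
    - apply: filterS2 PY hE' => w h1 [h2 h3]; rewrite /= !h1//.
      by split => -[a b]; split => //; [exact: h2|exact: h3].
  by rewrite (PM.2 s t E' C)// -eE.
Qed.

End law.
(** Outside the event [G] the path is replaced by zero, which makes it continuous everywhere and
    keeps the map measurable. *)
Lemma path_version (P : probability Om R) (M : R -> Om -> rV) (G : set Om) :
  (forall t, 0 <= t <= T -> measurable_fun setT (M t)) -> measurable G -> {ae P, forall w, G w} ->
  (forall w, G w -> forall i, continuous (fun t => M (clamp T t) w 0 i)) ->
  exists Y : {mfun Om >-> Om}, {ae P, forall w, forall t, 0 <= t <= T -> X t (Y w) = M t w}.
Proof.
move=> mM mG aG cM.
pose f w t : rV := (\1_G w : R) *: M (clamp T t) w.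
have fc w : continuous (f w).
  apply: continuous_rV => i; rewrite /f indicE.
  have -> : (fun t => (((w \in G)%:R : R) *: M (clamp T t) w) 0 i) = (fun t => (w \in G)%:R * M (clamp T t) w 0 i).
    by apply/funext => t; rewrite mxE.
  have [wG|wG] := boolP (w \in G); last by under eq_fun do rewrite mul0r; exact: cst_continuous.
  under eq_fun do rewrite mul1r; by apply: cM; rewrite inE in wG.
pose y w : Om := mkpath T (@fc w).
have yE w t : 0 <= t <= T -> X t (y w) = (\1_G w : R) *: M t w.
  by move=> tT; rewrite X_mkpath// /f clamp_id.
have my : measurable_fun setT y.
  apply: (measurable_path T_gt0) => // t tT.
  rewrite (_ : (fun a => X t (y a)) = fun w => (\1_G w : R) *: M t w); last by apply/funext => w; exact: yE.
  by apply: measurable_scalev; [exact: measurable_indic|exact: mM].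
pose Y' := HB.pack_for {mfun Om >-> Om} y (isMeasurableFun.Build _ _ _ _ y my).
exists Y'; apply: filterS aG => w Gw t tT.
by rewrite -[LHS]/(X t (y w)) yE// indicE mem_set// scale1r.
Qed.

End path_versions.

(** * Second moments and Gronwall's inequality *)

Section moments.
Context (R : realType) (T : R) (d : nat) (T_gt0 : 0 < T).
Local Notation Om := (path_space T d).
Local Notation fm s := (@fmeas R T d _ _ s).
Local Notation rV := 'rV[R]_d.
Local Notation leb := (@lebesgue_measure R).
Local Notation PT :=
  (g_sigma_algebraType (predictable_rectangles T (@canonical_filtration R T d))).
Local Notation PTm P := (@PTm R T d T_gt0 P).
Local Notation DT := (`[0, T]%classic `*` [set: Om]).

Lemma X_out (t : R) (w : Om) : ~~ (0 <= t <= T) -> X t w = 0.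
Proof.
move=> tT; rewrite /X; case: insubP => [u|//]; rewrite inE/= in_itv/= => h.
by rewrite h in tT.
Qed.

Lemma measurable_X_PT : measurable_fun (setT : set PT) (fun p => X p.1 p.2 : rV).
Proof.
apply: (measurable_fun_rV (A := PT)) => // i.
have h : measurable_fun (DT : set PT) (fun p => X p.1 p.2 0 i).
  apply: (predictable_continuous T_gt0 (Y := fun t w => X t w 0 i)).
    move=> t /andP[t0 tT]; apply: (measurable_coordT (A := g_sigma_algebraType (@coord_events R T d t))).
    by apply: fmeas_X; rewrite t0 lexx.
  by move=> w; exact: continuous_X_coord.
have := (measurable_restrictT _ (@measurable_DT R T d T_gt0)).1 h.
apply: eq_measurable_fun => -[t w] _ /=; rewrite patchE.
case: ifPn => //; rewrite notin_setE => hn; rewrite X_out ?mxE//; apply/negP => tT; apply: hn.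
by split => //=; rewrite in_itv.
Qed.

Lemma lebesgue_T : (leb (`[0%R, T]%classic : set (measurableTypeR R)) = T%:E)%E.
Proof. by rewrite lebesgue_measure_itv/= lte_fin T_gt0 -EFinD subr0. Qed.

(** The value at time [t] is the starting point plus a Gaussian increment of second moment at most
    [kap * T], where [kap] is the constant of [gaussian_nrm1_sq]. *)
Lemma wiener_moment (mu : probability rV R) (Q : probability Om R) : second_moment_finite mu -> is_wiener mu Q ->
  ing (PTm Q) (fun p => sqn (X p.1 p.2)).
Proof.
move=> mu2 Qw; have [QM Q0] := wiener_gbm Qw.
apply: ing_ge0 => [|p|]; [exact: measurable_sqnv measurable_X_PT|exact: sqn_ge0|].
pose m2 := (\int[mu]_x (sqn x)%:E)%E.
have m2fin : (m2 < +oo)%E.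
  by move: mu2; rewrite /second_moment_finite; under eq_integral do rewrite enorm_sq.
have m20 : (0 <= m2)%E by apply: integral_ge0 => x _; rewrite lee_fin sqn_ge0.
pose kap : R := 4 * (2 ^+ d * expR (d%:R / 2)).
have kap0 : 0 <= kap by rewrite /kap !mulr_ge0// ?expR_ge0// exprn_ge0.
have msq : measurable_fun setT (fun x : rV => (sqn x)%:E) by apply/measurable_EFinP; exact: measurable_sqnv.
have mX (t : R) : measurable_fun setT (@X R T d t) by exact: measurable_X.
have e0 : (\int[Q]_w (sqn (X 0 w))%:E = m2)%E.
  by rewrite (Q0 (fun x => (sqn x)%:E))// => x; rewrite lee_fin sqn_ge0.
have bound (t : R) : 0 < t <= T -> (\int[Q]_w (sqn (X t w))%:E <= 2%:E * m2 + (2 * (kap * T))%:E)%E.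
  move=> /andP[t0 tT]; have [g hg] := gauss_ex QM (lexx 0) t0 tT.
  rewrite subr0 in hg; have [ig eg] := gaussian_nrm1_sq t0 hg.
  have e1 : (\int[Q]_w (nrm1 (X t w - X 0 w) ^+ 2)%:E <= (kap * T)%:E)%E.
    have mh : measurable_fun setT (fun x : (g_sigma_algebraType (@coord_events R T d 0) * rV)%type => (nrm1 x.2 ^+ 2)%:E).
      apply/measurable_EFinP; apply: measurable_funX; apply: measurableT_comp; first exact: measurable_nrm1.
      exact: measurable_snd.
    have g' : gaussian_law g (t - 0) by rewrite subr0.
    have h0 (x : (g_sigma_algebraType (@coord_events R T d 0) * rV)%type) : (0 <= (nrm1 x.2 ^+ 2)%:E)%E by rewrite lee_fin sqr_ge0.
    rewrite (brownian_step QM (lexx 0) t0 tT g' mh h0)/=.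
    under eq_integral do rewrite (ExE ig).
    rewrite integral_cst// prob_mass mule1 lee_fin (le_trans eg)// ler_wpM2l//.
  apply: (@le_trans _ _ (\int[Q]_w (2%:E * (sqn (X 0 w))%:E + 2%:E * (nrm1 (X t w - X 0 w) ^+ 2)%:E))%E).
    apply: ge0_le_integral => //.
    - by move=> w _; rewrite lee_fin sqn_ge0.
    - by apply: (measurableT_comp msq).
    - apply: emeasurable_funD; apply: measurable_funeM.
        exact: (measurableT_comp msq).
      by apply/measurable_EFinP; apply: measurable_funX; apply: measurableT_comp; [exact: measurable_nrm1|exact: measurable_subv].
    - move=> w _; rewrite -!EFinM -EFinD lee_fin.
      have := sqn_sub_dot (X 0 w) (X 0 w - X t w).
      have e : X 0 w - (X 0 w - X t w) = X t w by rewrite opprB addrC subrK.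
      have h1 := sqn_le_nrm1 (X t w - X 0 w).
      rewrite e; have h2 : sqn (X 0 w - X t w) = sqn (X t w - X 0 w).
        by rewrite /sqn; apply: eq_bigr => i _; rewrite !mxE; ring.
      have h3 : 2 * dot (X 0 w - X t w) (X 0 w) >= - (sqn (X 0 w - X t w) + sqn (X 0 w)).
        have := sqn_ge0 ((1 : R) *: (X 0 w - X t w) + X 0 w); rewrite sqn_lin; lra.
      rewrite h2 in h3 *; lra.
  rewrite ge0_integralD//; last 4 first.
  - by move=> w _; rewrite mule_ge0 ?lee_fin ?sqn_ge0.
  - by apply: measurable_funeM; exact: (measurableT_comp msq).
  - by move=> w _; rewrite mule_ge0 ?lee_fin ?sqr_ge0.
  - apply: measurable_funeM; apply/measurable_EFinP; apply: measurable_funX.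
    by apply: measurableT_comp; [exact: measurable_nrm1|exact: measurable_subv].
  rewrite !ge0_integralZl//.
  - rewrite e0 leeD2l// EFinM lee_pmul2l// lte_fin//.
  - apply/measurable_EFinP; apply: measurable_funX.
    by apply: measurableT_comp; [exact: measurable_nrm1|exact: measurable_subv].
  - by move=> w _; rewrite lee_fin sqr_ge0.
  - exact: (measurableT_comp msq).
  - by move=> w _; rewrite lee_fin sqn_ge0.
pose K : \bar R := (2%:E * m2 + (2 * (kap * T))%:E)%E.
have K0 : (0 <= K)%E by rewrite adde_ge0// ?mule_ge0// lee_fin !mulr_ge0// ltW.
have Kfin : (K < +oo)%E by rewrite lte_add_pinfty ?ltry// lte_mul_pinfty.
have boundK (t : R) : 0 <= t <= T -> (\int[Q]_w (sqn (X t w))%:E <= K)%E.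
  move=> /andP[t0 tT]; have [t1|t1] := ltP 0 t; first by apply: bound; rewrite t1.
  have -> : t = 0 by apply/eqP; rewrite eq_le t1.
  rewrite e0 /K -[X in (X <= _)%E]adde0 leeD//; last by rewrite lee_fin !mulr_ge0// ltW.
  by rewrite -[X in (X <= _)%E]mul1e lee_wpmul2r// lee_fin; lra.
have mF : measurable_fun setT (fun p : PT => (sqn (X p.1 p.2))%:E).
  by apply/measurable_EFinP; exact: measurable_sqnv measurable_X_PT.
rewrite PTm_prod//; last by move=> p; rewrite lee_fin sqn_ge0.
have mG : measurable_fun setT (fun z : (measurableTypeR R * Om)%type => ((sqn (X (clamp T z.1) z.2))%:E * (timeind z)%:E)%E).
  apply: emeasurable_funM; last by apply/measurable_EFinP; exact: measurable_timeind.
  exact: (measurableT_comp mF (measurable_clampt T_gt0)).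
have G0 (z : (measurableTypeR R * Om)%type) : (0 <= ((sqn (X (clamp T z.1) z.2))%:E * (timeind z)%:E))%E.
  by rewrite mule_ge0// lee_fin ?sqn_ge0 ?timeind_ge0.
rewrite (@fubini_tonelli1 _ _ _ _ _ leb Q _ mG G0).
apply: (@le_lt_trans _ _ (\int[leb]_t (K * (\1_(`[0, T]%classic) t)%:E))%E).
  apply: ge0_le_integral => //.
  - by move=> t _; apply: integral_ge0 => w _; exact: G0.
  - exact: measurable_fun_fubini_tonelli_F.
  - by apply: measurable_funeM; apply/measurable_EFinP; exact: measurable_indic.
  - move=> t _; rewrite /fubini_F/= /timeind/=.
    under eq_integral do rewrite muleC.
    rewrite ge0_integralZl//.
    + by rewrite muleC lee_wpmul2r//; apply: boundK; exact: clamp_itv.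
    + exact: (measurableT_comp msq).
    + by move=> w _; rewrite lee_fin sqn_ge0.
rewrite ge0_integralZl//.
- have -> : (\int[leb]_t ((\1_(`[0%R, T]%classic : set (measurableTypeR R)) t)%:E : \bar R) = T%:E)%E.
    by rewrite integral_indic// setIT; exact: lebesgue_T.
  by rewrite lte_mul_pinfty// ?lee_fin ?ltry// ge0_fin_numE.
- by apply/measurable_EFinP; exact: measurable_indic.
Qed.

Section gronwall.
Local Notation mR := (measurableTypeR R).
Local Notation II f t := (\int[leb]_(s in `[0, t]) (f s : R)).
Local Notation intT f := (leb.-integrable `[0, T] (fun t => (f t)%:E)).

Let mT : measurable (`[0, T]%classic : set mR). Proof. exact: measurable_itv. Qed.

Lemma int_sub (f : R -> R) (I : set mR) : measurable I -> I `<=` `[0, T]%classic -> intT f ->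
  leb.-integrable I (fun t => (f t)%:E).
Proof. by move=> mI sI; exact: integrableS. Qed.

Lemma le_int_sub (f : R -> R) (I : set mR) : measurable I -> I `<=` `[0, T]%classic -> intT f -> (forall t, 0 <= f t) ->
  \int[leb]_(t in I) f t <= II f T.
Proof.
move=> mI sI fi f0; apply: fine_le.
- exact: (integrable_fin_num mI (int_sub mI sI fi)).
- exact: (integrable_fin_num mT fi).
- apply: ge0_subset_integral => //; first by case/integrableP: fi.
  by move=> t _; rewrite lee_fin.
Qed.

Lemma int_cst (k : R) : intT (fun=> k) /\ II (fun=> k) T = k * T.
Proof.
have f : (leb (`[0%R, T]%classic : set mR) < +oo)%E by rewrite lebesgue_T ltry.
split; last by rewrite /Rintegral (integral_cst leb mT k%:E) [X in (_ * X)%E]lebesgue_T.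
by apply: (@measurable_bounded_integrable _ _ _ leb (fun=> k)) => //; exact: bounded_cst.
Qed.

(** The variance of [f] over [[0, T]], centred at its mean [c], is nonnegative. *)
Lemma int_sq_le (f : R -> R) : intT f -> intT (fun t => f t ^+ 2) -> II f T ^+ 2 <= T * II (fun t => f t ^+ 2) T.
Proof.
move=> f1 f2; pose c := II f T / T.
have [k1 k2] := int_cst (c ^+ 2).
have i1 : leb.-integrable `[0, T] (fun t => (2 * c * f t)%:E).
  by have := integrableZl mT (2 * c) f1; apply: eq_integrable.
have i2 : leb.-integrable `[0, T] (fun t => (2 * c * f t - c ^+ 2)%:E).
  by have := integrableB mT i1 k1; apply: eq_integrable.
have : \int[leb]_(t in `[0, T]) (2 * c * f t - c ^+ 2) <= II (fun t => f t ^+ 2) T.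
  by apply: le_Rintegral => // t _; have := sqr_ge0 (f t - c); rewrite sqrrB -mulr_natl; lra.
have -> : \int[leb]_(t in `[0, T]) (2 * c * f t - c ^+ 2) = 2 * c * II f T - c ^+ 2 * T.
  rewrite -k2; transitivity (\int[leb]_(t in `[0, T]) (2 * c * f t) - II (fun=> c ^+ 2) T).
    exact: (RintegralB mT i1 k1).
  by congr (_ - _); exact: (RintegralZl (2 * c) mT f1).
have -> : 2 * c * II f T - c ^+ 2 * T = II f T ^+ 2 / T by rewrite /c; field; rewrite gt_eqF.
by rewrite ler_pdivrMr// mulrC.
Qed.

Lemma gronwall_arith (i0 i1 j a m A : R) : i1 - i0 = j -> j <= a + m -> a <= A -> m <= 2^-1 * i1 ->
  i1 <= 2 * i0 + 2 * A.
Proof. by move=> <-; lra. Qed.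

(** A discrete Gronwall inequality: when [C * mesh] is at most one half, the part of the integral
    over the current cell is absorbed, so across each cell the integral at most doubles and gains
    [2 A]. After [2 ^ n] cells this is the power of two in the statement. *)
Lemma gronwall_L1 (x a : R -> R) (C : R) n : 0 <= C -> C * mesh T n <= 2^-1 ->
  intT x -> intT a -> (forall t, 0 <= x t) -> (forall t, 0 <= a t) ->
  (forall t, 0 <= t <= T -> x t <= a t + C * II x t) ->
  II x T <= 2 ^+ (2 ^ n).+1 * II a T.
Proof.
move=> C0 Cm xi ai x0 a0 hx.
set A := II a T; have A0 : 0 <= A by apply: Rintegral_ge0 => t _; exact: a0.
have I0 t : 0 <= II x t by apply: Rintegral_ge0 => s _; exact: x0.
have sub0 (t : R) : t <= T -> (`[0, t]%classic : set mR) `<=` `[0, T]%classic.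
  by move=> tT u /=; rewrite !in_itv/= => /andP[-> us]; rewrite (le_trans us).
have m0 (t : R) : measurable (`[0, t]%classic : set mR) by exact: measurable_itv.
have i0 (t : R) : t <= T -> leb.-integrable `[0, t] (fun u => (x u)%:E).
  by move=> tT; exact: int_sub (m0 t) (sub0 t tT) xi.
have Imono (s t : R) : s <= t -> t <= T -> II x s <= II x t.
  move=> st tT; apply: fine_le.
  - exact: (integrable_fin_num (m0 s) (i0 s (le_trans st tT))).
  - exact: (integrable_fin_num (m0 t) (i0 t tT)).
  - apply: ge0_subset_integral => //.
    + by case/integrableP: (i0 t tT).
    + by move=> u _; rewrite lee_fin.
    + by move=> u /=; rewrite !in_itv/= => /andP[-> us]; rewrite (le_trans us).
have step j : (j < 2 ^ n)%N -> II x (grid T n j.+1) <= 2 * II x (grid T n j) + 2 * A.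
  move=> jn; have [g0 g1 gT] := grid_itvS T_gt0 jn.
  set J := (`]grid T n j, grid T n j.+1]%classic : set mR).
  have sJ : J `<=` `[0, T]%classic.
    move=> t; rewrite /J /= !in_itv/= => /andP[h1 h2].
    by rewrite (le_trans g0 (ltW h1))/=; exact: le_trans h2 gT.
  have mJ : measurable J by exact: measurable_itv.
  have e1 : II x (grid T n j.+1) - II x (grid T n j) = \int[leb]_(t in J) x t.
    apply: (@Rintegral_itvB _ x (BLeft 0) (BRight (grid T n j.+1)) (grid T n j)).
    - exact: i0.
    - by rewrite bnd_simp.
    - by rewrite bnd_simp ltW.
  have [k1 _] := int_cst (C * II x (grid T n j.+1)).
  have ac : intT (fun t => a t + C * II x (grid T n j.+1)).
    by have := integrableD mT ai k1; apply: eq_integrable.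
  have e2 : \int[leb]_(t in J) x t <= \int[leb]_(t in J) (a t + C * II x (grid T n j.+1)).
    apply: le_Rintegral => //; [exact: int_sub|exact: int_sub|].
    move=> t Jt; have tT : 0 <= t <= T by have := sJ _ Jt; rewrite /= in_itv.
    apply: (le_trans (hx t tT)); rewrite lerD2l ler_wpM2l//; apply: Imono => //.
    by move: Jt; rewrite /J/= in_itv/= => /andP[].
  have e3 : \int[leb]_(t in J) (a t + C * II x (grid T n j.+1)) = \int[leb]_(t in J) a t + mesh T n * (C * II x (grid T n j.+1)).
    transitivity (\int[leb]_(t in J) a t + \int[leb]_(t in J) (C * II x (grid T n j.+1))).
      exact: (RintegralD mJ (int_sub mJ sJ ai) (int_sub mJ sJ k1)).
    congr (_ + _); rewrite /Rintegral (integral_cst leb mJ (C * II x (grid T n j.+1))%:E).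
    have lJ : leb J = (mesh T n)%:E.
      by rewrite /J lebesgue_measure_itv/= lte_fin g1 -EFinD gridS addrAC subrr add0r.
    by rewrite [X in fine (_ * X)%E]lJ -EFinM/= mulrC.
  have e4 : \int[leb]_(t in J) a t <= A by exact: le_int_sub.
  have e5 : mesh T n * (C * II x (grid T n j.+1)) <= 2^-1 * II x (grid T n j.+1).
    by rewrite mulrA [mesh T n * C]mulrC ler_wpM2r.
  by rewrite e3 in e2; exact: gronwall_arith e1 e2 e4 e5.
have iter_ j : (j <= 2 ^ n)%N -> II x (grid T n j) <= (2 ^+ j.+1 - 2) * A.
  elim: j => [|j ih] jn.
    rewrite grid0 subrr mul0r set_itv1 le_eqVlt; apply/orP; left; apply/eqP.
    by rewrite /Rintegral integral_set1.
  have h1 := step j jn; have h2 := ih (ltnW jn).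
  apply: (le_trans h1); rewrite [2 ^+ j.+2]exprS; move: (2 ^+ j.+1) h2 => q h2; lra.
have := iter_ _ (leqnn _); rewrite gridT; move: (2 ^+ _) => q h; apply: (le_trans h).
by rewrite mulrBl lerBlDr lerDl mulr_ge0.
Qed.

Lemma integrable_continuous (f : R -> R) : continuous (fun t => f (clamp T t)) -> intT f.
Proof.
move=> fc; have : leb.-integrable `[0, T] (EFin \o (fun t => f (clamp T t))).
  apply: continuous_compact_integrable; first exact: segment_compact.
  exact: continuous_subspaceT.
apply: eq_integrable => // t; rewrite inE/= in_itv/= => tT; by rewrite clamp_id.
Qed.

Lemma continuous_nrm1 (f : R -> rV) : (forall i, continuous (fun t => f t 0 i)) -> continuous (fun t => nrm1 (f t)).
Proof.
move=> fc; rewrite /nrm1.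
have h (s : seq 'I_d) : continuous (fun t => \sum_(i <- s) `|f t 0 i|).
  elim: s => [|i s ih]; first by under eq_fun do rewrite big_nil; exact: cst_continuous.
  under eq_fun do rewrite big_cons; move=> t; apply: cvgD; last exact: ih.
  by apply: cvg_norm; exact: fc.
exact: h.
Qed.

Lemma continuous_sqn (f : R -> rV) : (forall i, continuous (fun t => f t 0 i)) -> continuous (fun t => sqn (f t)).
Proof.
move=> fc; rewrite /sqn.
have h (s : seq 'I_d) : continuous (fun t => \sum_(i <- s) f t 0 i ^+ 2).
  elim: s => [|i s ih]; first by under eq_fun do rewrite big_nil; exact: cst_continuous.
  under eq_fun do rewrite big_cons; move=> t; apply: cvgD; last exact: ih.
  by apply: (cvg_comp _ (fun y : R => y ^+ 2) (fc i t)); exact: exprn_continuous.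
exact: h.
Qed.

Lemma nrm1_sq_le (v : rV) : nrm1 v ^+ 2 <= 4 * d%:R * sqn v.
Proof.
have [n0|n0] := ltP 0 (nrm1 v); last first.
  have -> : nrm1 v = 0 by apply/eqP; rewrite eq_le n0 nrm1_ge0.
  by rewrite expr0n/= mulr_ge0 ?mulr_ge0// sqn_ge0.
have d0 : (0 : R) < d%:R.
  case: (posnP d) => [e|]; last by rewrite ltr0n.
  by move: n0; rewrite /nrm1 big1 ?ltxx// => i _; have := ltn_ord i; rewrite {2}e.
have e0 : 0 < nrm1 v / (2 * d%:R) by rewrite divr_gt0// mulr_gt0.
have := nrm1_le_sqn v e0; move: e0 n0; move: (nrm1 v) (sqn v) => n q e0 n0.
have -> : d%:R * (n / (2 * d%:R)) = n / 2 by field; rewrite gt_eqF.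
have -> : q / (n / (2 * d%:R)) = 2 * d%:R * q / n by field; rewrite !gt_eqF.
move=> h; have h2 : n / 2 <= 2 * d%:R * q / n by lra.
move: h2; rewrite ler_pdivlMr//; lra.
Qed.

Lemma sqrD_le (a b : R) : (a + b) ^+ 2 <= 2 * a ^+ 2 + 2 * b ^+ 2.
Proof. by rewrite -subr_ge0 (_ : _ - _ = (a - b) ^+ 2) ?sqr_ge0//; ring. Qed.

Lemma gronwall_final (C D1 T' S2 A am aa c1 xx : R) : 0 <= C -> 0 <= D1 -> 0 <= T' ->
  0 <= am -> 0 <= aa ->
  xx <= (2 + 2 * C ^+ 2 * D1 ^+ 2 * T' ^+ 2) * S2 -> S2 <= 8 * d%:R * am + 2 * T' * A ->
  A <= T' * (2 * c1 ^+ 2 * T' + 2 * aa) ->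
  xx <= (2 + 2 * C ^+ 2 * D1 ^+ 2 * T' ^+ 2) * (8 * d%:R + 4 * T' ^+ 3 * c1 ^+ 2 + 4 * T' ^+ 2) * (1 + am + aa).
Proof.
move=> C0 D0 T0 am0 aa0 h1 h2 h3; apply: (le_trans h1).
rewrite -[leRHS]mulrA ler_wpM2l//; first by rewrite addr_ge0// !mulr_ge0// sqr_ge0.
apply: (le_trans h2).
have h4 : 2 * T' * A <= 2 * T' * (T' * (2 * c1 ^+ 2 * T' + 2 * aa)) by rewrite ler_wpM2l// mulr_ge0.
have p1 : 0 <= 4 * T' ^+ 3 * c1 ^+ 2 by rewrite mulr_ge0 ?sqr_ge0// mulr_ge0// exprn_ge0.
have p2 : 0 <= 4 * T' ^+ 2 by rewrite mulr_ge0// sqr_ge0.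
have p3 : 0 <= 8 * d%:R :> R by rewrite mulr_ge0.
have e : 2 * T' * (T' * (2 * c1 ^+ 2 * T' + 2 * aa)) = 4 * T' ^+ 3 * c1 ^+ 2 + 4 * T' ^+ 2 * aa by ring.
rewrite e in h4; move: p1 p2 p3 h4.
move: (4 * T' ^+ 3 * c1 ^+ 2) (4 * T' ^+ 2) (8 * d%:R : R) (2 * T' * A) => a b c q p1 p2 p3 h4.
have q1 : 0 <= a * am by exact: mulr_ge0.
have q2 : 0 <= b * am by exact: mulr_ge0.
have q3 : 0 <= a * aa by exact: mulr_ge0.
have q4 : 0 <= c * aa by exact: mulr_ge0.
have -> : (c + a + b) * (1 + am + aa) = c + b + c * am + c * aa + a + a * am + a * aa + b * am + b * aa by ring.
lra.
Qed.

(** The constant is chosen before the path, so the pathwise bound can afterwards be integrated over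
    the law. The L^1 estimate is inserted into the pointwise inequality before squaring. *)
Lemma gronwall_path (C c1 : R) : 0 <= C -> 0 <= c1 -> exists D, 0 <= D /\
  forall (x m beta al : R -> rV),
  (forall i, continuous (fun t => x (clamp T t) 0 i)) -> (forall i, continuous (fun t => m (clamp T t) 0 i)) ->
  time_integrable T beta -> intT (fun t => nrm1 (al t)) -> intT (fun t => nrm1 (al t) ^+ 2) ->
  (forall t, 0 <= t <= T -> x t = m t + time_integral beta t) ->
  (forall t, 0 <= t <= T -> nrm1 (beta t) <= c1 + nrm1 (al t) + C * nrm1 (x t)) ->
  II (fun t => sqn (x t)) T <= D * (1 + II (fun t => sqn (m t)) T + II (fun t => nrm1 (al t) ^+ 2) T).
Proof.
move=> C0 c10.
have [n hn] : exists n, C * mesh T n <= 2^-1.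
  have e0 : 0 < 2^-1 / (C + 1) by rewrite divr_gt0// ltr_wpDl.
  have /cvgrPdist_le /(_ _ e0) [k _ hk] := mesh_cvg T.
  exists k; have := hk k (leqnn k); rewrite sub0r normrN ger0_norm; last exact: ltW (mesh_gt0 T_gt0 k).
  rewrite ler_pdivlMr ?ltr_wpDl// => h; apply: le_trans h.
  by rewrite mulrDr mulr1 mulrC lerDl ltW// mesh_gt0.
pose D1 : R := 2 ^+ (2 ^ n).+1.
have D10 : 0 <= D1 by exact: exprn_ge0.
exists ((2 + 2 * C ^+ 2 * D1 ^+ 2 * T ^+ 2) * (8 * d%:R + 4 * T ^+ 3 * c1 ^+ 2 + 4 * T ^+ 2)); split.
  rewrite mulr_ge0// !addr_ge0// ?mulr_ge0 ?sqr_ge0 ?exprn_ge0// ltW//.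
move=> x m beta al xc mc bi ai1 ai2 xE bB.
pose k t := c1 + nrm1 (al t).
have [ci ce] := int_cst c1.
have ki : intT k by have := integrableD mT ci ai1; apply: eq_integrable.
have [c2i c2e] := int_cst (2 * c1 ^+ 2).
have k2i : intT (fun t => k t ^+ 2).
  have [c3i _] := int_cst (c1 ^+ 2).
  have h := integrableD mT (integrableD mT c3i (integrableZl mT (2 * c1) ai1)) ai2.
  by move: h; apply: eq_integrable => // t _; rewrite /k sqrrD/= -!EFinM -!EFinD; congr EFin; rewrite -mulr_natl; ring.
have k0 t : 0 <= k t by rewrite addr_ge0// nrm1_ge0.
pose A := II k T; have A0 : 0 <= A by apply: Rintegral_ge0 => t _; exact: k0.
have xi : intT (fun t => nrm1 (x t)) by apply: integrable_continuous; exact: continuous_nrm1.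
have mi : intT (fun t => nrm1 (m t)) by apply: integrable_continuous; exact: continuous_nrm1.
have x2i : intT (fun t => sqn (x t)) by apply: integrable_continuous; exact: continuous_sqn.
have m2i : intT (fun t => sqn (m t)) by apply: integrable_continuous; exact: continuous_sqn.
pose a t := nrm1 (m t) + A.
have [Ai Ae] := int_cst A.
have a_i : intT a by have := integrableD mT mi Ai; apply: eq_integrable.
have a0 t : 0 <= a t by rewrite addr_ge0// nrm1_ge0.
have a2i : intT (fun t => a t ^+ 2).
  apply: integrable_continuous; have h := continuous_nrm1 mc.
  move=> t; apply: (cvg_comp _ (fun y : R => y ^+ 2) (_ : (a (clamp T s) @[s --> t] --> a (clamp T t)))); last exact: exprn_continuous.
  by apply: cvgD; [exact: h|exact: cvg_cst].
have hx t : 0 <= t <= T -> nrm1 (x t) <= a t + C * II (fun s => nrm1 (x s)) t.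
  move=> tT; have [t0 tT'] := andP tT.
  have TI0 : time_integral beta 0 = 0.
    by apply/matrixP => i j; rewrite !mxE set_itv1 /Rintegral integral_set1.
  have h1 := nrm1_time_integral_cell (lexx 0) t0 tT' bi; rewrite TI0 subr0 in h1.
  have m0t : measurable (`[0, t]%classic : set mR) by exact: measurable_itv.
  have m0t' : measurable (`]0, t]%classic : set mR) by exact: measurable_itv.
  have s0t : (`[0, t]%classic : set mR) `<=` `[0, T]%classic.
    by move=> u /=; rewrite !in_itv/= => /andP[-> us]; rewrite (le_trans us).
  have s0t' : (`]0, t]%classic : set mR) `<=` `[0, t]%classic.
    by move=> u /=; rewrite !in_itv/= => /andP[u0 ->]; rewrite ltW.
  have s0t'' : (`]0, t]%classic : set mR) `<=` `[0, T]%classic by move=> u /s0t'/s0t.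
  have bni := integrable_nrm1 bi.
  have kx : intT (fun s => k s + C * nrm1 (x s)).
    by have := integrableD mT ki (integrableZl mT C xi); apply: eq_integrable.
  have h2 : \int[leb]_(s in `]0, t]) nrm1 (beta s) <= \int[leb]_(s in `]0, t]) (k s + C * nrm1 (x s)).
    apply: le_Rintegral => //; [exact: int_sub|exact: int_sub|].
    by move=> s hs; apply: bB; have := s0t'' _ hs; rewrite /= in_itv.
  have h3 : \int[leb]_(s in `]0, t]) (k s + C * nrm1 (x s)) = \int[leb]_(s in `]0, t]) k s + C * \int[leb]_(s in `]0, t]) nrm1 (x s).
    transitivity (\int[leb]_(s in `]0, t]) k s + \int[leb]_(s in `]0, t]) (C * nrm1 (x s))).
      apply: (RintegralD m0t' (int_sub m0t' s0t'' ki)).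
      by have := integrableZl m0t' C (int_sub m0t' s0t'' xi); apply: eq_integrable.
    by congr (_ + _); exact: (RintegralZl C m0t' (int_sub m0t' s0t'' xi)).
  have h4 : \int[leb]_(s in `]0, t]) k s <= A by exact: le_int_sub.
  have h5 : \int[leb]_(s in `]0, t]) nrm1 (x s) <= II (fun s => nrm1 (x s)) t.
    apply: fine_le.
    - exact: (integrable_fin_num m0t' (int_sub m0t' s0t'' xi)).
    - exact: (integrable_fin_num m0t (int_sub m0t s0t xi)).
    - apply: ge0_subset_integral => //; first by case/integrableP: (int_sub m0t s0t xi).
      by move=> u _; rewrite lee_fin nrm1_ge0.
  have h6 : C * \int[leb]_(s in `]0, t]) nrm1 (x s) <= C * II (fun s => nrm1 (x s)) t by rewrite ler_wpM2l.
  have h7 : nrm1 (x t) <= nrm1 (m t) + nrm1 (time_integral beta t).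
    by rewrite xE// /nrm1 -big_split/=; apply: ler_sum => i _; rewrite mxE ler_normD.
  apply: (le_trans h7); rewrite /a -addrA lerD2l; apply: (le_trans h1); apply: (le_trans h2).
  by rewrite h3 lerD.
have hX := gronwall_L1 C0 hn xi a_i (fun t => nrm1_ge0 _) a0 hx.
set Xi := II (fun t => nrm1 (x t)) T in hX; rewrite -/D1 in hX.
have Xi0 : 0 <= Xi by apply: Rintegral_ge0 => t _; exact: nrm1_ge0.
set S := II a T in hX.
have S0 : 0 <= S by apply: Rintegral_ge0 => t _; exact: a0.
have S2 := int_sq_le a_i a2i; rewrite -/S in S2.
set S2' := II (fun t => a t ^+ 2) T in S2.
have xb t : 0 <= t <= T -> sqn (x t) <= 2 * a t ^+ 2 + 2 * (C * (D1 * S)) ^+ 2.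
  move=> tT; apply: (le_trans (sqn_le_nrm1 _)).
  have [t0 tT'] := andP tT.
  have m0t : measurable (`[0, t]%classic : set mR) by exact: measurable_itv.
  have s0t : (`[0, t]%classic : set mR) `<=` `[0, T]%classic.
    by move=> u /=; rewrite !in_itv/= => /andP[-> us]; rewrite (le_trans us).
  have h1 : II (fun s => nrm1 (x s)) t <= D1 * S.
    by apply: le_trans hX; apply: le_int_sub => // u; exact: nrm1_ge0.
  have h2 : nrm1 (x t) <= a t + C * (D1 * S).
    by apply: (le_trans (hx t tT)); rewrite lerD2l ler_wpM2l.
  have h3 : nrm1 (x t) ^+ 2 <= (a t + C * (D1 * S)) ^+ 2.
    by rewrite lerXn2r ?nnegrE ?nrm1_ge0// addr_ge0// !mulr_ge0.
  exact: (le_trans h3 (sqrD_le _ _)).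
have [qi qe] := int_cst (2 * (C * (D1 * S)) ^+ 2).
have a22 := integrableZl mT 2 a2i.
have xx : II (fun t => sqn (x t)) T <= (2 + 2 * C ^+ 2 * D1 ^+ 2 * T ^+ 2) * S2'.
  apply: (@le_trans _ _ (II (fun t => 2 * a t ^+ 2 + 2 * (C * (D1 * S)) ^+ 2) T)).
    apply: le_Rintegral => //.
      by have := integrableD mT a22 qi; apply: eq_integrable.
  have -> : II (fun t => 2 * a t ^+ 2 + 2 * (C * (D1 * S)) ^+ 2) T = 2 * S2' + 2 * (C * (D1 * S)) ^+ 2 * T.
    rewrite -qe; transitivity (II (fun t => 2 * a t ^+ 2) T + II (fun=> 2 * (C * (D1 * S)) ^+ 2) T).
      apply: (RintegralD mT _ qi); by move: a22; apply: eq_integrable.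
    by congr (_ + _); exact: (RintegralZl 2 mT a2i).
  rewrite [leRHS]mulrDl lerD2l.
  have -> : 2 * (C * (D1 * S)) ^+ 2 * T = 2 * C ^+ 2 * D1 ^+ 2 * T * S ^+ 2 by ring.
  have -> : 2 * C ^+ 2 * D1 ^+ 2 * T ^+ 2 * S2' = 2 * C ^+ 2 * D1 ^+ 2 * T * (T * S2') by ring.
  by rewrite ler_wpM2l// !mulr_ge0 ?sqr_ge0// ltW.
have A2 := int_sq_le ki k2i; rewrite -/A in A2.
apply: (gronwall_final (A := A ^+ 2) C0 D10 (ltW T_gt0) _ _ xx).
- by apply: Rintegral_ge0 => t _; exact: sqn_ge0.
- by apply: Rintegral_ge0 => t _; exact: sqr_ge0.
- have [q2i q2e] := int_cst (2 * A ^+ 2).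
  have m22 := integrableZl mT (8 * d%:R) m2i.
  have -> : 8 * d%:R * II (fun t => sqn (m t)) T + 2 * T * A ^+ 2 = II (fun t => 8 * d%:R * sqn (m t) + 2 * A ^+ 2) T.
    have -> : 2 * T * A ^+ 2 = 2 * A ^+ 2 * T by ring.
    rewrite -q2e; symmetry; transitivity (II (fun t => 8 * d%:R * sqn (m t)) T + II (fun=> 2 * A ^+ 2) T).
      apply: (RintegralD mT _ q2i); by move: m22; apply: eq_integrable.
    by congr (_ + _); exact: (RintegralZl (8 * d%:R) mT m2i).
  apply: le_Rintegral => //.
    by have := integrableD mT m22 q2i; apply: eq_integrable.
  move=> t _; apply: (le_trans (sqrD_le _ _)); rewrite lerD2r.
  have -> : 8 * d%:R * sqn (m t) = 2 * (4 * d%:R * sqn (m t)) by ring.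
  by rewrite ler_wpM2l// nrm1_sq_le.
- apply: (le_trans A2); rewrite ler_wpM2l ?(ltW T_gt0)//.
  have a4 := integrableZl mT 2 ai2.
  have -> : 2 * c1 ^+ 2 * T + 2 * II (fun t => nrm1 (al t) ^+ 2) T = II (fun t => 2 * c1 ^+ 2 + 2 * nrm1 (al t) ^+ 2) T.
    rewrite -c2e; symmetry; transitivity (II (fun=> 2 * c1 ^+ 2) T + II (fun t => 2 * nrm1 (al t) ^+ 2) T).
      apply: (RintegralD mT c2i); by move: a4; apply: eq_integrable.
    by congr (_ + _); exact: (RintegralZl 2 mT ai2).
  apply: le_Rintegral => //.
    by have := integrableD mT c2i a4; apply: eq_integrable.
  by move=> t _; exact: sqrD_le.
Qed.

End gronwall.

End moments.

Section path_sup_fine.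
Context (R : realType) (T : R) (d : nat) (T_gt0 : 0 < T).
Local Notation Om := (path_space T d).
Local Notation rV := 'rV[R]_d.

Lemma path_sup_fin (w : Om) : (path_sup w < +oo)%E.
Proof.
pose f t := nrm1 (X (clamp T t) w).
have fc : continuous f by apply: (@continuous_nrm1 R d (fun t => X (clamp T t) w)) => i; exact: continuous_X_coord.
have [c _ hc] := EVT_max (ltW T_gt0) (continuous_subspaceT (A := `[0, T]%classic) fc).
apply: (@le_lt_trans _ _ (f c)%:E); last exact: ltry.
apply: ub_ereal_sup => _ [t /= tT <-]; rewrite lee_fin (le_trans (enorm_le_nrm1 _))//.
have := hc t tT; rewrite /f clamp_id//; by move: tT; rewrite in_itv.
Qed.

Definition psup (w : Om) : R := fine (path_sup w).

Lemma path_supK w : (psup w)%:E = path_sup w.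
Proof. by rewrite /psup fineK// ge0_fin_numE ?path_sup_fin// path_sup_ge0. Qed.

Lemma psup_ge0 w : 0 <= psup w. Proof. by rewrite -lee_fin path_supK path_sup_ge0. Qed.

Lemma nrm1_le_psup t w : 0 <= t <= T -> nrm1 (X t w) <= d%:R * psup w.
Proof.
move=> tT; apply: (le_trans (nrm1_le_enorm _)); rewrite ler_wpM2l//.
by rewrite -lee_fin path_supK path_sup_ge.
Qed.

Lemma measurable_psup : measurable_fun setT psup.
Proof. by apply: measurableT_comp => //; exact: measurable_path_sup. Qed.

Lemma ing_psup (P : probability Om R) : in_P1 P -> ing P psup.
Proof.
move=> P1; apply: ing_ge0; [exact: measurable_psup|exact: psup_ge0|].
by under eq_integral do rewrite path_supK.
Qed.

End path_sup_fine.

Lemma Ex_cvg_dominated (R : realType) (dd : measure_display) (A : measurableType dd) (P : probability A R)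
    (h : A -> R) (f : nat -> A -> R) (g : A -> R) :
  (forall n, measurable_fun setT (f n)) -> measurable_fun setT g -> ing P h -> (forall n x, `|f n x| <= h x) ->
  (forall x, f n x @[n --> \oo] --> g x) -> Ex P (f n) @[n --> \oo] --> Ex P g.
Proof.
move=> mf mg ih fh fg.
have fi n : ing P (f n) by exact: ing_dom (mf n) ih (fh n).
have fg' : {ae P, forall x, [set: A] x -> (fun n => (f n x)%:E) @ \oo --> (g x)%:E}.
  by apply: aeW => x _; apply/fine_cvgP; split; [exact: nearW|exact: fg].
have bd : {ae P, forall x, forall n, [set: A] x -> (`|(f n x)%:E| <= (h x)%:E)%E}.
  by apply: aeW => x n _; rewrite lee_fin.
have mf' n : measurable_fun setT (fun x => (f n x)%:E) by apply/measurable_EFinP.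
have mg' : measurable_fun setT (fun x => (g x)%:E) by apply/measurable_EFinP.
have [ig _ hh] := dominated_convergence measurableT mf' mg' fg' ih bd.
by apply: (@fine_cvg _ _ _ _ (fun n => (\int[P]_x (f n x)%:E)%E)); rewrite -(ExE ig).
Qed.

(** Reduces continuity in time to sequences, for which dominated convergence is available. *)
Lemma seq_continuous (R : realType) (f : R -> R) :
  (forall t (u : nat -> R), u n @[n --> \oo] --> t -> f (u n) @[n --> \oo] --> f t) -> continuous f.
Proof.
move=> h t; apply/cvgrPdist_le => e e0; apply: contrapT => hn.
have hs (n : nat) : exists s, `|t - s| <= n.+1%:R^-1 /\ e < `|f t - f s|.
  apply: contrapT => hs; apply: hn.
  exists (n.+1%:R^-1); first by rewrite /= invr_gt0.
  move=> s /= ts; rewrite leNgt; apply/negP => es; by apply: hs; exists s; split => //; exact: ltW.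
have [u /all_and2[ut uf]] := boolp.choice hs.
have ut' : u n @[n --> \oo] --> t.
  apply/cvgrPdist_le => r r0; near=> n; apply: (le_trans (ut n)).
  by near: n; apply: filterS (near_infty_natSinv_lt (PosNum r0)) => k; exact: ltW.
have /cvgrPdist_lt /(_ e e0) [N _ hN] := h t u ut'.
by have := hN N (leqnn N); rewrite ltNge (ltW (uf N)).
Unshelve. all: by end_near. Qed.

(** * The drift of Gamma(P) *)

Section drift.
Context (R : realType) (T : R) (d : nat) (T_gt0 : 0 < T).
Local Notation Om := (path_space T d).
Local Notation FT s := (g_sigma_algebraType (@coord_events R T d s)).
Local Notation fm s := (@fmeas R T d _ _ s).
Local Notation rV := 'rV[R]_d.
Local Notation leb := (@lebesgue_measure R).
Local Notation PT :=
  (g_sigma_algebraType (predictable_rectangles T (@canonical_filtration R T d))).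
Local Notation PTm P := (@PTm R T d T_gt0 P).
Local Notation DT := (`[0, T]%classic `*` [set: Om]).
Variable W : rV -> R.
Hypothesis W_C1 : is_C1 W.
Variable C : R.
Hypothesis C0 : 0 <= C.
Hypothesis growth : forall z i, `|grad W z 0 i| <= C * (1 + nrm1 z).

Lemma continuous_grad i : continuous (fun z => grad W z 0 i).
Proof.
have -> : (fun z => grad W z 0 i) = partial i W by apply/funext => z; rewrite mxE.
exact: W_C1.2.
Qed.

Lemma measurable_grad i : measurable_fun setT (fun z => grad W z 0 i).
Proof.
apply: (measurability (@RGenOInfty.G R)); first exact: RGenOInfty.measurableE.
move=> _ [_ [a ->] <-]; rewrite setTI; apply: sub_sigma_algebra.
by apply: open_comp => [z _|]; [exact: continuous_grad|exact: interval_open].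
Qed.

Lemma measurable_grad_conv (mu : probability rV R) : measurable_fun setT (grad_conv W mu).
Proof.
apply: measurable_fun_rV => // i; under eq_fun do rewrite mxE.
have mg : measurable_fun setT (fun z : (rV * rV)%type => (grad W (z.1 - z.2) 0 i)%:E).
  apply/measurable_EFinP; apply: (measurableT_comp (measurable_grad i)).
  by apply: measurable_subv.
rewrite /Rintegral; apply: measurableT_comp => //.
under eq_fun => x do rewrite integralE.
apply: emeasurable_funB.
  have h := @measurable_fun_fubini_tonelli_F _ _ rV rV R mu ((fun z : (rV * rV)%type => (grad W (z.1 - z.2) 0 i)%:E)^\+)%E
    (measurable_funepos mg) (fun z => funepos_ge0 _ _).
  by move: h; apply: eq_measurable_fun => x _; apply: eq_integral => y _; rewrite !funeposE.
have h := @measurable_fun_fubini_tonelli_F _ _ rV rV R mu ((fun z : (rV * rV)%type => (grad W (z.1 - z.2) 0 i)%:E)^\-)%E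
  (measurable_funeneg mg) (fun z => funeneg_ge0 _ _).
by move: h; apply: eq_measurable_fun => x _; apply: eq_integral => y _; rewrite !funenegE.
Qed.

Variable P : probability Om R.
Hypothesis P1 : in_P1 P.

Let mdiff (x : rV) t i : measurable_fun setT (fun w : Om => grad W (x - X t w) 0 i).
Proof.
apply: (measurableT_comp (measurable_grad i)); apply: measurable_subv; [exact: measurable_cst|exact: measurable_X].
Qed.

Let nrm1B (x y : rV) : nrm1 (x - y) <= nrm1 x + nrm1 y.
Proof. by rewrite /nrm1 -big_split/=; apply: ler_sum => i _; rewrite !mxE ler_normB. Qed.

Let dom (x : rV) t (w : Om) i : 0 <= t <= T -> `|grad W (x - X t w) 0 i| <= C * (1 + nrm1 x) + C * d%:R * psup w.
Proof.
move=> tT; apply: (le_trans (growth _ _)); rewrite -mulrA -mulrDr ler_wpM2l// -addrA lerD2l.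
by apply: (le_trans (nrm1B _ _)); rewrite lerD2l; exact: nrm1_le_psup.
Qed.

Let ing_dominant (k : R) : ing P (fun w : Om => k + C * d%:R * psup w).
Proof.
apply: ingD; last by apply: ingZ; exact: ing_psup.
by apply: (@ingP_bounded _ _ _ P `|k|) => //; exact: measurable_cst.
Qed.

(** Expressed on path space, the convolutions at all times share one dominating function, a multiple
    of [psup] plus a constant. *)
Lemma grad_convE t x i : 0 <= t <= T -> grad_conv W (marginal P t) x 0 i = Ex P (fun w => grad W (x - X t w) 0 i).
Proof.
move=> tT; rewrite mxE /Ex /Rintegral integral_distribution//.
- apply/measurable_EFinP; apply: (measurableT_comp (measurable_grad i)).
  by apply: measurable_subv => //; exact: measurable_cst.
- exact: (ing_dom (mdiff x t i) (ing_dominant (C * (1 + nrm1 x))) (fun w => dom x w i tT)).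
Qed.

Definition drift_cst : R := d%:R * (C + C * d%:R * Ex P (@psup R T d)).

Lemma drift_cst_ge0 : 0 <= drift_cst.
Proof. by rewrite /drift_cst mulr_ge0// addr_ge0// !mulr_ge0//; apply: Ex_ge0 => w; exact: psup_ge0. Qed.

Lemma grad_conv_growth t x : 0 <= t <= T ->
  nrm1 (grad_conv W (marginal P t) x) <= drift_cst + d%:R * C * nrm1 x.
Proof.
move=> tT.
have h i : `|grad_conv W (marginal P t) x 0 i| <= C * (1 + nrm1 x) + C * d%:R * Ex P (@psup R T d).
  rewrite grad_convE// -[X in _ <= X + _](Ex_cst P) -ExZ; last exact: ing_psup.
  rewrite -ExD; last by apply: ingZ; exact: ing_psup.
    apply: ler_norm_Ex; [|exact: ing_dominant|by move=> w; exact: dom].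
    exact: (ing_dom (mdiff x t i) (ing_dominant (C * (1 + nrm1 x))) (fun w => dom x w i tT)).
  by apply: (@ingP_bounded _ _ _ P `|C * (1 + nrm1 x)|) => //; exact: measurable_cst.
apply: (le_trans (ler_sum _ (fun i _ => h i))).
rewrite sumr_const card_ord -[X in X <= _]mulr_natl /drift_cst; move: (Ex P _) => e.
by rewrite le_eqVlt; apply/orP; left; apply/eqP; ring.
Qed.

Let gc (t : R) (w : Om) : rV := grad_conv W (marginal P t) (X t w).

(** Dominated convergence: the paths and the gradient are continuous, and linear growth bounds the
    integrand by [psup], which is integrable since [P] lies in [P_1]. *)
Lemma grad_conv_continuous w i : continuous (fun t => gc (clamp T t) w 0 i).
Proof.
apply: seq_continuous => t u ut.
rewrite (_ : (fun n => gc (clamp T (u n)) w 0 i) = (fun n => Ex P (fun w' => grad W (X (clamp T (u n)) w - X (clamp T (u n)) w') 0 i))); last first.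
  by apply/funext => n; rewrite /gc grad_convE//; exact: clamp_itv.
rewrite /gc grad_convE ?clamp_itv//.
apply: (Ex_cvg_dominated (h := fun w' : Om => C * (1 + d%:R * psup w) + C * d%:R * psup w')) => //.
- move=> n w'; apply: (le_trans (dom _ _ _ (clamp_itv T_gt0 (u n)))); rewrite lerD2r ler_wpM2l// lerD2l.
  by apply: nrm1_le_psup => //; exact: clamp_itv.
- move=> w'.
  apply: (cvg_comp (fun n => X (clamp T (u n)) w - X (clamp T (u n)) w') (fun z => grad W z 0 i) _ (@continuous_grad i _)).
  apply: (cvg_comp u (fun t => X (clamp T t) w - X (clamp T t) w') ut).
  by apply: cvgB; exact: continuous_path.
Qed.

Lemma fmeas_grad_conv t : 0 <= t <= T -> fm t (gc t).
Proof.
move=> /andP[t0 tT]; apply: (measurableT_comp (T1 := FT t) (measurable_grad_conv (marginal P t))).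
by apply: fmeas_X; rewrite t0 lexx.
Qed.

(** The drift of [Gamma P], extended by zero to a total function on the predictable space. *)
Definition drift (p : PT) : rV := if (0 <= p.1 <= T)%R then - gc p.1 p.2 else 0.

Lemma driftE t w : 0 <= t <= T -> drift (t, w) = - grad_conv W (marginal P t) (X t w).
Proof. by rewrite /drift /= => ->. Qed.

Lemma measurable_drift : measurable_fun setT drift.
Proof.
apply: (measurable_fun_rV (A := PT)) => // i.
have h : measurable_fun (DT : set PT) (fun p => (- gc p.1 p.2) 0 i).
  apply: (predictable_continuous T_gt0 (Y := fun t w => (- gc t w) 0 i)).
    move=> t tT; apply: (measurable_coordT (A := FT t)); apply: (measurable_oppv (A := FT t)).
    exact: fmeas_grad_conv.
  move=> w; have -> : (fun t => (- gc (clamp T t) w) 0 i) = (fun t => - gc (clamp T t) w 0 i).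
    by apply/funext => t; rewrite mxE.
  by move=> t; apply: cvgN; exact: grad_conv_continuous.
have := (measurable_restrictT _ (@measurable_DT R T d T_gt0)).1 h.
apply: eq_measurable_fun => -[t w] _ /=; rewrite patchE /drift/=.
case: ifPn; rewrite ?inE ?notin_setE /=.
  by move=> -[/=]; rewrite in_itv/= => ->.
case: ifP => [tT hn|_ _]; last by rewrite mxE.
by exfalso; apply: hn; split => //=; rewrite in_itv.
Qed.

Lemma drift_growth t w : 0 <= t <= T -> nrm1 (drift (t, w)) <= drift_cst + d%:R * C * nrm1 (X t w).
Proof. by move=> tT; rewrite driftE// nrm1N; exact: grad_conv_growth. Qed.

Lemma L2_drift (m : probability Om R) : ing (PTm m) (fun p => sqn (X p.1 p.2)) -> L2 (PTm m) drift.
Proof.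
move=> iX; split; first exact: measurable_drift.
have [ik _] := Ex_PTm_cst T_gt0 m (2 * drift_cst ^+ 2).
apply: (ing_dom _ (ingD ik (ingZ (2 * (d%:R * C) ^+ 2 * (4 * d%:R)) iX))).
  by apply: measurable_sqnv; exact: measurable_drift.
move=> [t w]; rewrite ger0_norm ?sqn_ge0//.
have [tT|tT] := boolP (0 <= t <= T); last first.
  rewrite /drift/= (negPf tT) (_ : sqn 0 = 0); last by rewrite /sqn big1// => i _; rewrite mxE expr0n.
  apply: addr_ge0; first by apply: mulr_ge0 => //; exact: sqr_ge0.
  by apply: mulr_ge0; [apply: mulr_ge0; [apply: mulr_ge0 => //; exact: sqr_ge0|exact: mulr_ge0]|exact: sqn_ge0].
apply: (le_trans (sqn_le_nrm1 _)).
have h : nrm1 (drift (t, w)) ^+ 2 <= (drift_cst + d%:R * C * nrm1 (X t w)) ^+ 2.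
  by rewrite lerXn2r ?nnegrE ?nrm1_ge0 ?addr_ge0 ?drift_cst_ge0 ?mulr_ge0 ?nrm1_ge0// drift_growth.
apply: (le_trans h); apply: (le_trans (sqrD_le _ _)); rewrite lerD2l exprMn/= [leLHS]mulrA -[leRHS]mulrA.
by rewrite ler_wpM2l ?mulr_ge0 ?sqr_ge0//; exact: nrm1_sq_le.
Qed.

End drift.

Section second_moment.
Context (R : realType) (T : R) (d : nat) (T_gt0 : 0 < T).
Local Notation Om := (path_space T d).
Local Notation rV := 'rV[R]_d.
Local Notation leb := (@lebesgue_measure R).
Local Notation PT :=
  (g_sigma_algebraType (predictable_rectangles T (@canonical_filtration R T d))).
Local Notation PTm P := (@PTm R T d T_gt0 P).

(** Integrates the pathwise Gronwall bound: the noise has a second moment as a Wiener path, and [al]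
    is the square integrable part of the drift, the rest growing at most linearly in the path. *)
Lemma second_moment_path (muin : probability rV R) (P : probability Om R) (Y : {mfun Om >-> Om}) (beta al : PT -> rV) (C c1 : R) :
  second_moment_finite muin -> is_wiener muin (distribution P Y) -> 0 <= C -> 0 <= c1 -> L2 (PTm P) al ->
  {ae P, forall w, time_integrable T (fun t => beta (t, w)) /\
     forall t, 0 <= t <= T -> X t w = X t (Y w) + time_integral (fun s => beta (s, w)) t} ->
  (forall t w, 0 <= t <= T -> nrm1 (beta (t, w)) <= c1 + nrm1 (al (t, w)) + C * nrm1 (X t w)) ->
  ing (PTm P) (fun p => sqn (X p.1 p.2)).
Proof.
move=> mu2 Rw C0 c10 La aeX bB.
have [D [D0 hD]] := gronwall_path d T_gt0 C0 c10.
have mX := @measurable_X_PT R T d T_gt0.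
have msX : measurable_fun setT (fun p : PT => sqn (X p.1 p.2 : rV)) by exact: measurable_sqnv.
apply: ing_ge0 => // [p|]; first exact: sqn_ge0.
rewrite PTmE; [|exact/measurable_EFinP|by move=> p; rewrite lee_fin sqn_ge0].
have [ih _ _] := PTm_fubini (wiener_moment T_gt0 mu2 Rw).
set h := (fun w => _) in ih.
have ihY : ing P (fun w => h (Y w)).
  apply: ing_ge0.
  - exact: (measurableT_comp (ing_meas ih) (measurable_funP Y)).
  - by move=> w; apply: Rintegral_ge0 => t _; exact: sqn_ge0.
  - have h0 w : (0 <= (h w)%:E)%E by rewrite lee_fin; apply: Rintegral_ge0 => t _; exact: sqn_ge0.
    have mh : measurable_fun setT (fun w => (h w)%:E) by apply/measurable_EFinP; exact: ing_meas ih.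
    have := ge0_integral_distribution Y mh h0 => /= <-.
    by rewrite (ExE ih) ltry.
have La2 : ing (PTm P) (fun p => nrm1 (al p) ^+ 2).
  apply: (ing_dom _ (ingZ (4 * d%:R) La.2)).
    by apply: measurable_funX; apply: measurableT_comp; [exact: measurable_nrm1|exact: La.1].
  by move=> p; rewrite ger0_norm ?sqr_ge0//; exact: nrm1_sq_le.
have La1 : ing (PTm P) (fun p => nrm1 (al p)).
  have [i1 _] := Ex_PTm_cst T_gt0 P 1.
  apply: (ing_dom _ (ingD i1 La2)); first by apply: measurableT_comp; [exact: measurable_nrm1|exact: La.1].
  move=> p; rewrite ger0_norm ?nrm1_ge0//; have := sqr_ge0 (nrm1 (al p) - 1); have := nrm1_ge0 (al p).
  rewrite sqrrB1; lra.
have [j2 _ a2] := PTm_fubini La2; have [_ _ a1] := PTm_fubini La1.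
set k := (fun w => _) in j2.
have [i1 _] : ing P (fun=> (1 : R)) /\ True.
  by split => //; apply: (@ingP_bounded _ _ _ P `|1|) => //; exact: measurable_cst.
have iB := ingZ D (ingD (ingD i1 ihY) j2).
apply: (@le_lt_trans _ _ (\int[P]_w (D * (1 + h (Y w) + k w))%:E)%E); last by rewrite (ExE iB) ltry.
apply: ae_ge0_le_integral => //.
- by move=> w _; apply: integral_ge0 => t _; rewrite lee_fin sqn_ge0.
- apply: (measurable_time_integral_ge0 (f := fun p => (sqn (X p.1 p.2))%:E)) => //.
    by apply/measurable_EFinP; exact: (PT_meas_prod T_gt0 msX).
  by move=> p; rewrite lee_fin sqn_ge0.
- move=> w _; rewrite lee_fin mulr_ge0// addr_ge0 ?addr_ge0//; first by apply: Rintegral_ge0 => t _; exact: sqn_ge0.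
  by apply: Rintegral_ge0 => t _; exact: sqr_ge0.
- by apply/measurable_EFinP; exact: ing_meas iB.
- apply: filterS3 aeX a1 a2 => w [bi xe] b1 b2 _.
  have xc i : continuous (fun t => X (clamp T t) w 0 i) by exact: continuous_X_coord.
  have yc i : continuous (fun t => X (clamp T t) (Y w) 0 i) by exact: continuous_X_coord.
  have := hD (fun t => X t w) (fun t => X t (Y w)) (fun t => beta (t, w)) (fun t => al (t, w)) xc yc bi b1 b2 xe (fun t => bB t w).
  rewrite -lee_fin; apply: le_trans.
  have xi : leb.-integrable `[0, T] (fun t => (sqn (X t w))%:E).
    by apply: integrable_continuous => //; apply: (@continuous_sqn R d (fun t => X (clamp T t) w)).
  rewrite le_eqVlt; apply/orP; left; apply/eqP; rewrite /Rintegral fineK//.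
  have mT' : measurable (`[0, T]%classic : set (measurableTypeR R)) by exact: measurable_itv.
  exact: (integrable_fin_num mT' xi).
Qed.

End second_moment.

(** * The law [Gamma P] as a weak solution on path space *)

Section gamma.
Context (R : realType) (T : R) (d : nat) (T_gt0 : 0 < T).
Local Notation Om := (path_space T d).
Local Notation FT s := (g_sigma_algebraType (@coord_events R T d s)).
Local Notation fm s := (@fmeas R T d _ _ s).
Local Notation rV := 'rV[R]_d.
Local Notation leb := (@lebesgue_measure R).
Local Notation PT :=
  (g_sigma_algebraType (predictable_rectangles T (@canonical_filtration R T d))).
Local Notation PTm P := (@PTm R T d T_gt0 P).
Variable W : rV -> R.
Hypothesis W_C1 : is_C1 W.
Variable C : R.
Hypothesis C0 : 0 <= C.
Hypothesis growth : forall z i, `|grad W z 0 i| <= C * (1 + nrm1 z).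
Variable P : probability Om R.
Hypothesis P1 : in_P1 P.

Local Notation b := (drift W P).

Lemma time_integrable_drift w : time_integrable T (fun s => b (s, w)).
Proof.
move=> i; have gcc : continuous (fun t => grad_conv W (marginal P (clamp T t)) (X (clamp T t) w) 0 i).
  exact: (grad_conv_continuous T_gt0 W_C1 C0 growth P1).
have e : (fun t => b (clamp T t, w) 0 i) = (fun t => - grad_conv W (marginal P (clamp T t)) (X (clamp T t) w) 0 i).
  by apply/funext => t; rewrite driftE ?clamp_itv// mxE.
have bc : continuous (fun t => b (clamp T t, w) 0 i) by rewrite e => t; apply: cvgN; exact: gcc.
exact: (integrable_continuous (f := fun t => b (t, w) 0 i) bc).
Qed.

(** The driving noise recovered from the canonical path; under [Gamma P] it is the starting point
    plus the Brownian motion of the equation. *)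
Definition noise t w : rV := X t w - time_integral (fun s => b (s, w)) t.

Lemma fmeas_noise t : 0 <= t <= T -> fm t (noise t).
Proof.
move=> tT; apply: (measurable_subv (A := FT t)).
  by have /andP[t0 _] := tT; apply: fmeas_X; rewrite t0 lexx.
exact: (fmeas_time_integral T_gt0 (measurable_drift T_gt0 W_C1 C0 growth P1) tT).
Qed.

Lemma noise_continuous w i : continuous (fun t => noise (clamp T t) w 0 i).
Proof.
have -> : (fun t => noise (clamp T t) w 0 i) = (fun t => X (clamp T t) w 0 i - time_integral (fun s => b (s, w)) (clamp T t) 0 i).
  by apply/funext => t; rewrite !mxE.
move=> t; apply: cvgB; first exact: continuous_X_coord.
exact: (continuous_time_integral T_gt0 (@time_integrable_drift w)).
Qed.

Variables (muin : probability rV R) (Q : probability Om R).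
Hypothesis muin2 : second_moment_finite muin.
Hypothesis Qlaw : law_of_unique_strong_solution muin (fun t x => - grad_conv W (marginal P t) x) Q.

(** The solution [Z] is adapted to the augmented filtration, so the past of the canonical process
    pulls back into it. Independence of the increments thus passes from the space carrying the
    equation to path space. *)
Lemma noise_gbm : gbm Q noise /\ start_law muin Q noise.
Proof.
have [dd [A [P' [xi [B [Z [[hxi hB0 hB] [[Zad Zeq] _] ZQ]]]]]]] := Qlaw.
have mN (t : R) : 0 <= t <= T -> measurable_fun setT (noise t) by move=> tT; apply: fmeas_meas; exact: fmeas_noise.
have Nae : {ae P', forall w, forall t, 0 <= t <= T -> noise t (Z w) = xi w + X t (B w)}.
  apply: filterS Zeq => w [_ h] t tT; rewrite /noise h//.
  have -> : time_integral (fun s => b (s, Z w)) t = time_integral (fun s => - grad_conv W (marginal P s) (X s (Z w))) t.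
    apply/matrixP => i j; rewrite !mxE; apply: eq_Rintegral => s; rewrite inE/= in_itv/= => /andP[s0 st].
    by rewrite driftE// s0 (le_trans st)//; case/andP: tT.
  by apply/matrixP => i j; rewrite !mxE; ring.
have aug_le (r s : R) E : r <= s -> augmented_filtration P' xi B r E -> augmented_filtration P' xi B s E.
  move=> rs; rewrite /augmented_filtration; move: E; apply: smallest_sub; first exact: smallest_sigma_algebra.
  move=> E [[D [mD ->]]|[q [D [/andP[q0 qr] mD ->]]]|[mE E0]]; apply: sub_sigma_algebra.
  - by apply: Or31; exists D.
  - by apply: Or32; exists q, D; split => //; rewrite q0 (le_trans qr).
  - exact: Or33.
have augZ (s : R) E : s <= T -> canonical_filtration s E -> augmented_filtration P' xi B s (Z @^-1` E).
  move=> sT; rewrite /canonical_filtration; move: E; apply: smallest_sub.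
    split.
    - exact: (@measurable0 _ (g_sigma_algebraType _)).
    - move=> E hE; rewrite setTD preimage_setC.
      by apply: (@measurableC _ (g_sigma_algebraType _)).
    - move=> E hE; rewrite preimage_bigcup.
      by apply: (@bigcupT_measurable _ (g_sigma_algebraType _)).
  move=> _ [r [D [/andP[r0 rs] mD ->]]]; apply: (aug_le _ _ _ rs).
  by apply: Zad => //; rewrite r0 (le_trans rs).
have mZE (E : set Om) : measurable E -> measurable (Z @^-1` E).
  by move=> mE; have := measurable_funP Z measurableT E mE; rewrite setTI.
have QE (E : set Om) : measurable E -> Q E = P' (Z @^-1` E) by move=> mE; rewrite -ZQ.
split.
- split; first exact: fmeas_noise.
  move=> s t E D s0 st tT FE mD.
  have sT : s <= T by exact: le_trans (ltW st) tT.
  have s0T : 0 <= s <= T by rewrite s0.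
  have t0T : 0 <= t <= T by rewrite tT (le_trans s0 (ltW st)).
  have mE := filtration_measurable FE.
  have mNN : measurable [set w | forall i, D i ((noise t w - noise s w) 0 i)].
    have := measurable_subv (mN t t0T) (mN s s0T) measurableT (measurable_box mD); by rewrite setTI.
  rewrite (QE _ (measurableI _ _ mE mNN)) (QE _ mE).
  rewrite -(hB s t (Z @^-1` E) D s0 st tT (augZ _ _ sT FE) mD).
  apply: prob_ae_eq.
  - by apply: mZE; exact: measurableI.
  - apply: measurableI; first exact: mZE.
    have mXB (r : R) : measurable_fun setT (fun w => @X R T d r (B w)).
      exact: (measurableT_comp (measurable_X r) (measurable_funP B)).
    have := measurable_subv (mXB t) (mXB s) measurableT (measurable_box mD); by rewrite setTI.
  - apply: filterS Nae => w h; rewrite /= !h//.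
    have -> : xi w + X t (B w) - (xi w + X s (B w)) = X t (B w) - X s (B w).
      by apply/matrixP => i j; rewrite !mxE; ring.
    by [].
- move=> F mF F0.
  have t0 : 0 <= (0 : R) <= T by rewrite lexx ltW.
  have mF0 : measurable_fun setT (F \o noise 0) by exact: (measurableT_comp mF (mN 0 t0)).
  have -> : (\int[Q]_w F (noise 0 w) = \int[distribution P' Z]_w (F \o noise 0%R) w)%E.
    by apply: eq_measure_integral => E mE _; first [exact: ZQ|exact/esym/ZQ].
  rewrite ge0_integral_distribution//; last by move=> w; exact: F0.
  have -> : (\int[muin]_x F x = \int[distribution P' xi]_x F x)%E.
    by apply: eq_measure_integral => E mE _; first [exact: hxi|exact/esym/hxi].
  rewrite ge0_integral_distribution//.
  apply: ae_eq_integral.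
  - exact: measurableT.
  - exact: (measurableT_comp mF0 (measurable_funP Z)).
  - exact: (measurableT_comp mF (measurable_funP xi)).
  - apply: filterS2 Nae hB0 => w h1 h2 _; rewrite /= h1// h2 addr0//.
Qed.

(** Square integrability of the drift comes from [second_moment_path] with zero extra drift. The
    noise is continuous along every path, so its path-valued version exists without an exceptional
    set. *)
Lemma Gamma_weak_solution : weak_solution T_gt0 muin Q b.
Proof.
have [QM Q0] := noise_gbm.
have mN (t : R) : 0 <= t <= T -> measurable_fun setT (noise t) by move=> tT; apply: fmeas_meas; exact: fmeas_noise.
have [Y YM] := path_version T_gt0 (P := Q) mN measurableT (aeW _ (fun=> I)) (fun w _ => @noise_continuous w).
have Rw := wiener_law T_gt0 QM YM Q0.
have L0 : L2 (PTm Q) (fun=> 0 : rV).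
  split; first exact: measurable_cst.
  rewrite (_ : (fun=> sqn 0) = fun=> 0); first exact: ing0.
  by apply/funext => p; rewrite /sqn big1// => i _; rewrite mxE expr0n.
have aeX : {ae Q, forall w, time_integrable T (fun t => b (t, w)) /\
     forall t, 0 <= t <= T -> X t w = X t (Y w) + time_integral (fun s => b (s, w)) t}.
  apply: filterS YM => w h; split; first exact: time_integrable_drift.
  by move=> t tT; rewrite h// /noise subrK.
have iX : ing (PTm Q) (fun p => sqn (X p.1 p.2)).
  apply: (second_moment_path muin2 Rw (C := d%:R * C) (c1 := drift_cst C P) _ _ L0 aeX).
  - by rewrite mulr_ge0.
  - exact: (drift_cst_ge0 T_gt0 C0 P).
  - move=> t w tT; have := drift_growth T_gt0 W_C1 C0 growth P1 w tT.
    by rewrite (_ : nrm1 0 = 0) ?addr0// /nrm1 big1// => i _; rewrite mxE normr0.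
have [mb ib] := L2_drift W_C1 C0 growth P1 iX.
split => //; exists noise, Y; split => //.
apply: aeW => w; split; first exact: time_integrable_drift.
by move=> t tT; rewrite /noise subrK.
Qed.

End gamma.

(** * Equivalence of the problems *)

(** Projecting a competitor does not raise the cost, and every competitor of finite cost lifts
    without raising it; infima and minimizers then correspond. Infinite costs are irrelevant for
    both, as minimizers have finite cost. *)
Lemma equivalent_problems_of_le (R : realType) (A B : Type) (pr : B -> A)
    (S : set A) (c : A -> \bar R) (S' : set B) (c' : B -> \bar R) :
  (forall b, S' b -> S (pr b) /\ (c (pr b) <= c' b)%E) ->
  (forall a, S a -> (c a < +oo)%E -> exists b, [/\ pr b = a, S' b & (c' b <= c a)%E]) ->
  equivalent_problems pr S c S' c'.
Proof.
move=> h1 h2; split.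
  apply/eqP; rewrite eq_le; apply/andP; split.
    apply: le_ereal_inf_tmp => _ [b Sb <-]; have [Sa le_] := h1 b Sb.
    by apply: le_trans le_; apply: ereal_inf_lbound; exists (pr b).
  apply: le_ereal_inf_tmp => _ [a Sa <-]; have [fin|inf] := ltP (c a) +oo%E.
    have [b [_ Sb le_]] := h2 a Sa fin.
    by apply: le_trans le_; apply: ereal_inf_lbound; exists b.
  by apply: le_trans inf; exact: leey.
move=> a; split.
  move=> [Sa fin mina]; have [b [prb Sb le_]] := h2 a Sa fin; exists b; split => //; split => //.
    exact: le_lt_trans le_ fin.
  move=> b' Sb'; have [Sa' le'] := h1 b' Sb'.
  exact: le_trans le_ (le_trans (mina _ Sa') le').
move=> [b [<- [Sb fin minb]]]; have [Sa le_] := h1 b Sb; split => //; first exact: le_lt_trans le_ fin.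
move=> a' Sa'; have [fin'|inf] := ltP (c a') +oo%E; last by apply: le_trans inf; exact: leey.
have [b' [_ Sb' le']] := h2 a' Sa' fin'.
exact: le_trans le_ (le_trans (minb _ Sb') le').
Qed.

Section problem.
Context (R : realType) (T : R) (d : nat) (T_gt0 : 0 < T).
Local Notation Om := (path_space T d).
Local Notation FT s := (g_sigma_algebraType (@coord_events R T d s)).
Local Notation fm s := (@fmeas R T d _ _ s).
Local Notation rV := 'rV[R]_d.
Local Notation leb := (@lebesgue_measure R).
Local Notation PT :=
  (g_sigma_algebraType (predictable_rectangles T (@canonical_filtration R T d))).
Local Notation PTm P := (@PTm R T d T_gt0 P).
Local Notation DT := (`[0, T]%classic `*` [set: Om]).
Local Notation predictable := (predictable T (@canonical_filtration R T d)).

(** Predictability speaks of times in [[0, T]]; the extension by zero is a total function on [PT],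
    the form in which all L^2 statements are made. *)
Lemma predictable_patch (a : R -> Om -> rV) : predictable a ->
  exists L : PT -> rV, measurable_fun setT L /\ forall t w, 0 <= t <= T -> L (t, w) = a t w.
Proof.
move=> pa; exists (fun p => if (0 <= p.1 <= T)%R then a p.1 p.2 else 0); split; last by move=> t w /= ->.
apply: (measurable_fun_rV (A := PT)) => // i.
have h : measurable_fun (DT : set PT) (fun p => a p.1 p.2 0 i).
  exact: (measurableT_comp (@measurable_coord R d i) pa).
have := (measurable_restrictT _ (@measurable_DT R T d T_gt0)).1 h.
apply: eq_measurable_fun => -[t w] _ /=; rewrite patchE/=.
case: ifPn; rewrite ?inE ?notin_setE /=.
  by move=> -[/=]; rewrite in_itv/= => ->.
case: ifP => [tT hn|_ _]; last by rewrite mxE.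
by exfalso; apply: hn; split => //=; rewrite in_itv.
Qed.

Lemma measurable_predictable (L : PT -> rV) (a : R -> Om -> rV) : measurable_fun setT L ->
  (forall t w, 0 <= t <= T -> L (t, w) = a t w) -> predictable a.
Proof.
move=> mL h; have : measurable_fun (DT : set PT) L by exact: measurable_funTS.
apply: eq_measurable_fun => -[t w]; rewrite inE => -[/= tT _]; rewrite h//; by move: tT; rewrite in_itv.
Qed.

Lemma energyE (P : probability Om R) (L : PT -> rV) (a : R -> Om -> rV) : measurable_fun setT L ->
  (forall t w, 0 <= t <= T -> L (t, w) = a t w) -> energy P a = (\int[PTm P]_p (sqn (L p))%:E)%E.
Proof.
move=> mL h; rewrite PTmE; last 2 first.
- by apply/measurable_EFinP; exact: measurable_sqnv.
- by move=> p; rewrite lee_fin sqn_ge0.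
apply: eq_integral => w _; apply: eq_integral => t; rewrite inE/= in_itv/= => tT.
by rewrite h// enorm_sq.
Qed.

Lemma energy_L2 (P : probability Om R) (L : PT -> rV) (a : R -> Om -> rV) : measurable_fun setT L ->
  (forall t w, 0 <= t <= T -> L (t, w) = a t w) -> (energy P a < +oo)%E ->
  L2 (PTm P) L /\ energy P a = (N (PTm P) L)%:E.
Proof.
move=> mL h; rewrite (energyE P mL h) => fin.
have i : ing (PTm P) (fun p => sqn (L p)).
  by apply: ing_ge0 => //; [exact: measurable_sqnv|move=> p; exact: sqn_ge0].
by split => //; rewrite (ExE i).
Qed.

Lemma time_integral0 (f : R -> rV) : time_integral f 0 = 0.
Proof. by apply/matrixP => i j; rewrite !mxE set_itv1 /Rintegral integral_set1. Qed.

Lemma brownian_increments_ae (P : probability Om R) (M M' : R -> Om -> rV) :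
  (forall t, 0 <= t <= T -> measurable_fun setT (M t)) ->
  (forall t, 0 <= t <= T -> measurable_fun setT (M' t)) ->
  {ae P, forall w, forall t, 0 <= t <= T -> M t w = M' t w} ->
  brownian_increments T P (@canonical_filtration R T d) M ->
  brownian_increments T P (@canonical_filtration R T d) M'.
Proof.
move=> mM mM' MM' h s t E D s0 st tT FE mD; rewrite -(h s t E D s0 st tT FE mD).
have s0T : 0 <= s <= T by rewrite s0 (le_trans (ltW st)).
have t0T : 0 <= t <= T by rewrite tT (le_trans s0 (ltW st)).
have mE := filtration_measurable FE.
have mI (Z : R -> Om -> rV) : (forall t, 0 <= t <= T -> measurable_fun setT (Z t)) ->
    measurable (E `&` [set w | forall i, D i ((Z t w - Z s w) 0 i)]).
  move=> mZ; apply: measurableI => //.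
  have := measurable_subv (mZ t t0T) (mZ s s0T) measurableT (measurable_box mD); by rewrite setTI.
apply: prob_ae_eq; [exact: mI|exact: mI|].
by apply: filterS MM' => w e; rewrite /= !e.
Qed.

Variable W : rV -> R.
Hypothesis W_C1 : is_C1 W.
Variable C : R.
Hypothesis C0 : 0 <= C.
Hypothesis growth : forall z i, `|grad W z 0 i| <= C * (1 + nrm1 z).
Variables (muin : probability rV R) (P Q : probability Om R).
Hypothesis muin2 : second_moment_finite muin.
Hypothesis P1 : in_P1 P.
Hypothesis P0 : same_law (marginal P 0) muin.
Hypothesis Qlaw : law_of_unique_strong_solution muin (fun t x => - grad_conv W (marginal P t) x) Q.

Local Notation gc t w := (grad_conv W (marginal P t) (X t w)).
Local Notation b := (drift W P).

Let mb : measurable_fun setT b. Proof. exact: (measurable_drift T_gt0 W_C1 C0 growth P1). Qed.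
Let PX : start_law muin P (@X R T d). Proof. exact: start_law_marginal. Qed.

Lemma start_law_eq (M : R -> Om -> rV) : (forall w, M 0 w = X 0 w) -> start_law muin P M.
Proof. by move=> e F mF F0; rewrite -(PX mF F0); apply: eq_integral => w _; rewrite e. Qed.

(** The process [al] is the difference between the drifts of [P] and of [Gamma P]. Finite energy of
    [al] and linear growth of [b] yield second moments of the path under [P], hence both drifts are
    square integrable and [relative_girsanov] applies, the reference Wiener measure being the law of
    [Y]. *)
Lemma entropy_le_energy (Phi : R -> Om -> rV) : predictable Phi -> wiener_residual muin P Phi ->
  (energy P (fun t w => (Phi t w + gc t w)%R) < +oo)%E ->
  (relative_entropy P Q <= (2^-1)%:E * energy P (fun t w => (Phi t w + gc t w)%R))%E.
Proof.
move=> pPhi [Y [Yeq Rw hB]] fin.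
have [beta [mbeta be]] := predictable_patch pPhi.
pose al p := beta p - b p.
have mal : measurable_fun setT al by exact: measurable_subv.
have ale t w : 0 <= t <= T -> al (t, w) = Phi t w + gc t w.
  by move=> tT; rewrite /al be// driftE// opprK.
have [Lal ->] := energy_L2 mal ale fin.
pose M t w := X t w - time_integral (fun s => beta (s, w)) t.
have TIe w t : 0 <= t <= T -> time_integral (fun s => beta (s, w)) t = time_integral (Phi ^~ w) t.
  move=> /andP[t0 tT]; apply/matrixP => i j; rewrite !mxE; apply: eq_Rintegral => s.
  by rewrite inE/= in_itv/= => /andP[s0 st]; rewrite be// s0 (le_trans st).
have TIi w : time_integrable T (Phi ^~ w) -> time_integrable T (fun s => beta (s, w)).
  move=> h i; apply: eq_integrable (h i) => // s; rewrite inE/= in_itv/= => sT; by rewrite be.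
have fM t : 0 <= t <= T -> fm t (M t).
  move=> tT; apply: (measurable_subv (A := FT t)); last exact: (fmeas_time_integral T_gt0 mbeta tT).
  by have /andP[t0 _] := tT; apply: fmeas_X; rewrite t0 lexx.
have mM (t : R) : 0 <= t <= T -> measurable_fun setT (M t) by move=> tT; exact: fmeas_meas (fM t tT).
have YM : {ae P, forall w, forall t, 0 <= t <= T -> X t (Y w) = M t w}.
  by apply: filterS Yeq => w [_ h] t tT; rewrite h// /M TIe.
have PM : gbm P M.
  split => //; apply: brownian_increments_ae hB => //.
  by move=> t _; exact: (measurableT_comp (measurable_X t) (measurable_funP Y)).
have PM0 : start_law muin P M by apply: start_law_eq => w; rewrite /M time_integral0 subr0.
have aeX : {ae P, forall w, time_integrable T (fun t => beta (t, w)) /\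
     forall t, 0 <= t <= T -> X t w = X t (Y w) + time_integral (fun s => beta (s, w)) t}.
  by apply: filterS Yeq => w [i h]; split; [exact: TIi|move=> t tT; rewrite h// TIe// subrK].
have aeM : {ae P, forall w, time_integrable T (fun t => beta (t, w)) /\
     forall t, 0 <= t <= T -> X t w = M t w + time_integral (fun s => beta (s, w)) t}.
  by apply: filterS Yeq => w [i h]; split; [exact: TIi|move=> t tT; rewrite /M subrK].
have iX : ing (PTm P) (fun p => sqn (X p.1 p.2)).
  apply: (second_moment_path muin2 Rw (C := d%:R * C) (c1 := drift_cst C P) _ _ Lal aeX).
  - by rewrite mulr_ge0.
  - exact: (drift_cst_ge0 T_gt0 C0 P).
  - move=> t w tT; have h := drift_growth T_gt0 W_C1 C0 growth P1 w tT.
    have -> : beta (t, w) = al (t, w) + b (t, w) by rewrite /al subrK.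
    apply: (@le_trans _ _ (nrm1 (al (t, w)) + nrm1 (b (t, w)))).
      by rewrite /nrm1 -big_split/=; apply: ler_sum => i _; rewrite !mxE ler_normD.
    by rewrite addrAC addrC lerD2l.
have Lb := L2_drift W_C1 C0 growth P1 iX.
have Lbeta : L2 (PTm P) beta.
  have := L2_lin 1 Lal Lb; congr L2; apply/funext => p; by rewrite scale1r subrK.
have Pw : weak_solution T_gt0 muin P beta by split; [exists M, Y|exact: mbeta|exact: Lbeta.2].
have Qw := Gamma_weak_solution T_gt0 W_C1 C0 growth P1 muin2 Qlaw.
by rewrite -EFinM; exact: (relative_girsanov Rw Pw Qw Lb.2).
Qed.

(** The process representing the noise of [Gamma P] under [P] is the excess drift. Subtracting it
    leaves a Brownian motion for the canonical filtration, which a path-valued version turns into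
    the required residual. *)
Lemma entropy_drift_exists : (relative_entropy P Q < +oo)%E ->
  exists alpha, is_drift W muin P alpha /\ ((2^-1)%:E * energy P alpha <= relative_entropy P Q)%E.
Proof.
move=> fin.
have [H eH] : exists H : R, relative_entropy P Q = H%:E.
  move: fin; case E : (relative_entropy P Q) => [r| |]// _; first by exists r.
  (* The value minus infinity is excluded: duality with the zero function would give [0 <= -1]. *)
  have h : (relative_entropy P Q <= (-1)%:E)%E by rewrite E leNye.
  have i0 : ing P (fun=> 0) by exact: ing0.
  have := (entropy_ge h).2 (fun=> 0) 1 i0 ltr01.
  rewrite ln1 addr0 Ex0 expR0; under eq_integral do [].
  rewrite integral_cst// prob_mass mule1 lexx => /(_ isT).
  by rewrite lerNr oppr0 ler10.
have PQ : (relative_entropy P Q <= H%:E)%E by rewrite eH.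
have [QM Q0] := noise_gbm T_gt0 W_C1 C0 growth P1 Qlaw.
have Nc w i := @noise_continuous R T d T_gt0 W W_C1 C C0 growth P P1 w i.
have [al [La aH hB]] := levy T_gt0 QM Nc PQ.
pose M := driftless (noise W P) al.
have fM t : 0 <= t <= T -> fm t (M t) by move=> tT; exact: (fmeas_driftless QM La tT).
have mM (t : R) : 0 <= t <= T -> measurable_fun setT (M t) by move=> tT; exact: fmeas_meas (fM t tT).
have PM : gbm P M by [].
have PM0 : start_law muin P M.
  by apply: start_law_eq => w; rewrite /M /driftless /noise !time_integral0 !subr0.
have aei := ae_integrable_alpha La.
(* [G0] is a measurable null set containing all paths along which [al] is not integrable; off it the
   residual is continuous in time. *)
have [G0 [mG0 PG0 sG0]] := aei.
have aG : {ae P, forall w, (~` G0) w} by exists G0; split => // w /= /contrapT.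
have iG w : (~` G0) w -> time_integrable T (fun s => al (s, w)).
  by move=> nG; apply: contrapT => h; apply: nG; exact: sG0.
have cM w : (~` G0) w -> forall i, continuous (fun t => M (clamp T t) w 0 i).
  move=> /iG h i.
  have -> : (fun t => M (clamp T t) w 0 i) = (fun t => noise W P (clamp T t) w 0 i - time_integral (fun s => al (s, w)) (clamp T t) 0 i).
    by apply/funext => t; rewrite mxE [X in _ + X]mxE.
  by move=> t; apply: cvgB; [exact: Nc|exact: (continuous_time_integral T_gt0 h)].
have [Y YM] := path_version T_gt0 (P := P) mM (measurableC mG0) aG cM.
pose alpha t w := al (t, w).
have [_ eN] : L2 (PTm P) al /\ energy P alpha = (N (PTm P) al)%:E.
  apply: energy_L2 => //; first exact: La.1.
  by rewrite (energyE P La.1 (a := alpha))// (ExE La.2) ltry.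
exists alpha; split; last by rewrite eN -EFinM eH lee_fin.
split.
- exact: (measurable_predictable La.1).
- by rewrite eN ltry.
- exists Y; split.
  + apply: filterS2 YM aei => w h hi.
    have bi := time_integrable_drift T_gt0 W_C1 C0 growth P1 w.
    have mT : measurable (`[0, T]%classic : set (measurableTypeR R)) by exact: measurable_itv.
    have si : time_integrable T (fun s => - gc s w + alpha s w).
      move=> i; have := integrableD mT (bi i) (hi i).
      apply: eq_integrable => // t; rewrite inE/= in_itv/= => tT; by rewrite driftE// !mxE EFinD.
    split => // t tT; rewrite h// /M /driftless /noise -addrA -opprD; congr (_ - _).
    have [t0 tT'] := andP tT.
    have m0t : measurable (`[0, t]%classic : set (measurableTypeR R)) by exact: measurable_itv.
    have s0t : (`[0, t]%classic : set (measurableTypeR R)) `<=` `[0, T]%classic.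
      by move=> u /=; rewrite !in_itv/= => /andP[-> us]; rewrite (le_trans us).
    apply/matrixP => i j; rewrite !mxE; symmetry.
    transitivity (\int[leb]_(s in `[0, t]) (b (s, w) 0 j + al (s, w) 0 j)).
      apply: eq_Rintegral => s; rewrite inE/= in_itv/= => /andP[s0 st].
      by rewrite driftE ?mxE// s0 (le_trans st).
    exact: (RintegralD m0t (integrableS mT m0t s0t (bi j)) (integrableS mT m0t s0t (hi j))).
  + exact: (wiener_law T_gt0 PM YM PM0).
  + apply: brownian_increments_ae hB => //.
    * by move=> t _; exact: (measurableT_comp (measurable_X t) (measurable_funP Y)).
    * by apply: filterS YM => w h t tT; rewrite h.
Qed.

Lemma predictable_grad_conv (alpha : R -> Om -> rV) : predictable alpha ->
  predictable (fun t w => - gc t w + alpha t w).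
Proof.
move=> pa; have [L [mL Le]] := predictable_patch pa.
apply: (measurable_predictable (L := fun p => b p + L p)); first exact: measurable_addv.
by move=> t w tT; rewrite driftE// Le.
Qed.

End problem.

Theorem lemma1p1 (R : realType) (d : nat) (T : R) (W : 'rV[R]_d -> R)
  (muin mufin : probability 'rV[R]_d R)
  (Gamma : probability (path_space T d) R -> probability (path_space T d) R)
  (d_ge1 : (1 <= d)%N) (T_gt0 : 0 < T)
  (W_C2 : is_C2 W) (W_sym : forall z, W z = W (- z))
  (W_hess : (ereal_sup [set (quad_form (hessian W z) v)%:E
               | z in setT & v in [set v | enorm v = 1%R]] < +oo)%E)
  (muin_P2 : second_moment_finite muin) (mufin_P2 : second_moment_finite mufin)
  (muin_energy : (free_energy W muin < +oo)%E)
  (mufin_energy : (free_energy W mufin < +oo)%E)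
  (Gamma_spec : forall P, in_P1 P -> is_Gamma W muin P (Gamma P)) :
  (forall P, admissible_marginals muin mufin P ->
     (relative_entropy P (Gamma P) < +oo)%E ->
     exists alpha, is_drift W muin P alpha) /\
  equivalent_problems fst
    [set P | admissible_marginals muin mufin P]
    (fun P => relative_entropy P (Gamma P))
    [set Pa : probability (path_space T d) R * (R -> path_space T d -> 'rV[R]_d) |
       admissible_marginals muin mufin Pa.1 /\ is_drift W muin Pa.1 Pa.2]
    (fun Pa => (2^-1)%:E * energy Pa.1 Pa.2)%E /\
  equivalent_problems fst
    [set P | admissible_marginals muin mufin P]
    (fun P => relative_entropy P (Gamma P))
    [set PPhi : probability (path_space T d) R * (R -> path_space T d -> 'rV[R]_d) |
       [/\ admissible_marginals muin mufin PPhi.1,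
           predictable T (@canonical_filtration R T d) PPhi.2 &
           wiener_residual muin PPhi.1 PPhi.2]]
    (fun PPhi => (2^-1)%:E *
       energy PPhi.1 (fun t w =>
         (PPhi.2 t w + grad_conv W (marginal PPhi.1 t) (X t w))%R))%E.
Proof.
have grad_int (P : probability (path_space T d) R) : in_P1 P -> forall t x i, 0 <= t <= T ->
    (marginal P t).-integrable setT (fun y => (grad W (x - y) 0 i)%:E).
  by move=> /Gamma_spec[h _].
have [C [C0 growth]] := grad_linear_growth T_gt0 grad_int.
have W_C1 : is_C1 W := W_C2.1.
have upper P Phi : admissible_marginals muin mufin P -> predictable T (@canonical_filtration R T d) Phi ->
    wiener_residual muin P Phi ->
    (relative_entropy P (Gamma P) <= (2^-1)%:E *
       energy P (fun t w => (Phi t w + grad_conv W (marginal P t) (X t w))%R))%E.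
  move=> [P1 P0 _] pPhi rPhi; set e := energy _ _.
  (* Admissibility for the problem over [Phi] puts no bound on the energy, so the infinite case has
     to be allowed; it is trivial. *)
  have [fin|inf] := ltP e +oo%E.
    exact: (entropy_le_energy T_gt0 W_C1 C0 growth muin_P2 P1 P0 (Gamma_spec P P1).2 pPhi rPhi fin).
  have -> : e = +oo%E by apply/eqP; rewrite eq_le leey inf.
  by rewrite mulry gtr0_sg ?mul1e ?leey.
have lower P : admissible_marginals muin mufin P -> (relative_entropy P (Gamma P) < +oo)%E ->
    exists alpha, is_drift W muin P alpha /\ ((2^-1)%:E * energy P alpha <= relative_entropy P (Gamma P))%E.
  move=> [P1 P0 _] fin.
  exact: (entropy_drift_exists T_gt0 W_C1 C0 growth P1 P0 (Gamma_spec P P1).2 fin).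
(* The two control problems are exchanged by [Phi = - grad W * P + alpha], and this substitution
   leaves the energy unchanged. *)
have add_drift P (alpha : R -> path_space T d -> 'rV[R]_d) :
    energy P (fun t w => (- grad_conv W (marginal P t) (X t w) + alpha t w + grad_conv W (marginal P t) (X t w))%R) =
    energy P alpha.
  by congr energy; apply/funext => t; apply/funext => w; rewrite addrAC addNr add0r.
split; [|split].
- by move=> P adm /(lower P adm)[alpha [h _]]; exists alpha.
- apply: equivalent_problems_of_le.
    move=> [P alpha] /= [adm [pal _ ral]]; split => //.
    rewrite -add_drift; apply: upper => //.
    have [P1 _ _] := adm; exact: (predictable_grad_conv T_gt0 W_C1 C0 growth P1).
  by move=> P adm /(lower P adm)[alpha [h1 h2]]; exists (P, alpha).
- apply: equivalent_problems_of_le.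
    by move=> [P Phi] /= [adm pPhi rPhi]; split => //; exact: upper.
  move=> P adm /(lower P adm)[alpha [[pal _ ral] h2]].
  have [P1 _ _] := adm; exists (P, fun t w => - grad_conv W (marginal P t) (X t w) + alpha t w); split.
  + by [].
  + by split; [exact: adm|exact: (predictable_grad_conv T_gt0 W_C1 C0 growth P1 pal)|exact: ral].
  + by move: h2; rewrite -{1}(add_drift P alpha).
Qed.
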